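(* Let $d\ge2$ and $D=\{x\in\mathbb{R}^d:|x|<1\}$, so $\partial D=\mathbb{S}^{d-1}$. For every $\sigma>0$ there is a constant $C_2=C_2(d,\sigma)>0$ such that the following holds. Let $E>0$ and let $m>0$, $n>20(1+\sqrt{E})^2$ be integers. Let $v_{nm}$ be the potential defined in the context and $v_0\equiv0$. Assume that $E$ is not a Dirichlet eigenvalue of $-\Delta+v_{nm}$ in $D$ and is not a Dirichlet eigenvalue of $-\Delta$ in $D$. Then $$\|\hat\Phi_{nm}(E)-\hat\Phi_0(E)\|_{H^{-\sigma}(\mathbb{S}^{d-1})\to H^{\sigma}(\mathbb{S}^{d-1})}\le C_2\,(1+Q+EQ)\,2^{-n/4},$$ where $\hat\Phi_{nm}(E)$, $\hat\Phi_0(E)$ are the Dirichlet-to-Neumann maps at energy $E$ for $v_{nm}$ and $v_0$, respectively, and $$Q=\|(-\Delta+v_0-E)^{-1}\|_{L^2(D)\to L^2(D)}+\|(-\Delta+v_{nm}-E)^{-1}\|_{L^2(D)\to L^2(D)},$$ the inverses being taken with the Dirichlet boundary condition in $D$.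
   Context: Cylindrical variables on $\mathbb{R}^d$: $(r_1,\theta,x')\in\mathbb{R}_+\times\mathbb{R}/2\pi\mathbb{Z}\times\mathbb{R}^{d-2}$ with $r_1\cos\theta=x_1$, $r_1\sin\theta=x_2$, $x'=(x_3,\dots,x_d)$ (for $d=2$, $|x'|$ is read as $0$). Fix $\phi\in C^\infty(\mathbb{R}^2)$ with support in $\{y\in\mathbb{R}^2:|y|<1/3,\ y_1>1/4\}$ and $\|\phi\|_{L^\infty}=1$. For integers $m,n>0$ the complex potential $v_{nm}$ is $$v_{nm}=n^{-m}e^{in\theta}\phi(r_1,|x'|).$$ For $v\in L^\infty(D)$ and $E$ not a Dirichlet eigenvalue of $-\Delta+v$ in $D$, the Dirichlet-to-Neumann map $\hat\Phi(E)$ is defined by $\hat\Phi(E)(\psi|_{\partial D})=\frac{\partial\psi}{\partial\nu}\big|_{\partial D}$ for all sufficiently regular solutions $\psi$ of $-\Delta\psi+v\psi=E\psi$ in $\bar D$, where $\nu$ is the outward unit normal. The Sobolev spaces $H^{\sigma}(\mathbb{S}^{d-1})$, $\sigma\in\mathbb{R}$, are normed by $\bigl\|\sum_{j,p}c_{jp}f_{jp}\bigr\|_{H^\sigma}^2=\sum_{j,p}(1+j)^{2\sigma}|c_{jp}|^2$, where $\{f_{jp}: j\ge0,\ 1\le p\le p_j\}$ is an orthonormal basis of $L^2(\mathbb{S}^{d-1})$ with $f_{jp}$ a spherical harmonic of degree $j$ and $p_j$ the dimension of the space of spherical harmonics of degree $j$. The norm on the left-hand side is the operator norm of (the continuous extension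 of) the difference of the DtN maps. *)

(* Defs.v *)
From HB Require Import structures.
From mathcomp Require Import all_boot all_order all_algebra.
From mathcomp.multinomials Require Import -(notations) mpoly.
From mathcomp Require Import all_classical all_reals all_analysis.
From mathcomp.real_closed Require Import complex.
Set Implicit Arguments. Unset Strict Implicit. Unset Printing Implicit Defensive.
Import Order.TTheory GRing.Theory Num.Theory.
Import numFieldNormedType.Exports.
Local Open Scope classical_set_scope.
Local Open Scope ring_scope.

Definition matrix_display : measure_display.
Proof. exact: default_measure_display. Qed.

Definition matrix_cylinders (R : realType) (m n : nat) : set (set 'M[R]_(m, n)) :=
  [set A | exists i j, exists2 B : set R,
     measurable B & A = (fun M : 'M[R]_(m, n) => M i j) @^-1` B].

HB.instance Definition _ (R : realType) (m n : nat) :=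
  @isMeasurable.Build matrix_display 'M[R]_(m, n) <<s @matrix_cylinders R m n >>
    (@sigma_algebra0 _ setT _) (@sigma_algebraC _ _)
    (@sigma_algebra_bigcup _ setT _).

Lemma measurable_entry (R : realType) (m n : nat) (i : 'I_m) (j : 'I_n) :
  measurable_fun [set: 'M[R]_(m, n)] (fun M : 'M[R]_(m, n) => M i j : R).
Proof.
move=> _ B mB; rewrite setTI; apply: sub_sigma_algebra.
by exists i, j, B.
Qed.

Lemma measurable_matrixP (R : realType) (m n : nat) d (T : measurableType d)
    (f : T -> 'M[R]_(m, n)) :
  (forall i j, measurable_fun [set: T] (fun x => f x i j : R)) ->
  measurable_fun [set: T] f.
Proof.
move=> mf; apply: (measurability (@matrix_cylinders R m n)) => //.
move=> _ [_ [i [j [B mB ->]]] <-].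
exact: (mf i j measurableT B mB).
Qed.

Definition row_cons (R : realType) (n : nat) (p : measurableTypeR R * 'rV[R]_n) :
    'rV[R]_n.+1 :=
  row_mx (const_mx p.1 : 'rV[R]_1) p.2.

Lemma measurable_row_cons (R : realType) (n : nat) :
  measurable_fun setT (@row_cons R n).
Proof.
apply: measurable_matrixP => i j; rewrite /row_cons.
case: (@split_ordP 1 n j) => k ->.
  rewrite (_ : (fun x => _) = fst); first exact: measurable_fst.
  by apply/funext => x /=; rewrite (@row_mxEl R 1 1 n) mxE.
rewrite (_ : (fun x => _) = (fun M : 'rV[R]_n => M i k) \o snd).
  apply: measurableT_comp; last exact: measurable_snd.
  exact: measurable_entry.
by apply/funext => x /=; rewrite (@row_mxEr R 1 1 n).
Qed.

Definition lebesgue_cons (R : realType) (n : nat)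
    (mu : {sigma_finite_measure set 'rV[R]_n -> \bar R}) :
    set 'rV[R]_n.+1 -> \bar R :=
  pushforward (@lebesgue_measure R \x mu)%E (@row_cons R n).

HB.instance Definition _ (R : realType) (n : nat)
    (mu : {sigma_finite_measure set 'rV[R]_n -> \bar R}) :=
  Measure.copy (lebesgue_cons mu)
    (measure_function_pushforward__canonical__measure_function_Measure
       (lebesgue_measure \x mu)%E (@measurable_row_cons R n)).

Lemma lebesgue_cons_sigma_finite (R : realType) (n : nat)
    (mu : {sigma_finite_measure set 'rV[R]_n -> \bar R}) :
  sigma_finite setT (lebesgue_cons mu).
Proof.
pose uncons (x : 'rV[R]_n.+1) : measurableTypeR R * 'rV[R]_n :=
  (x 0 0, \row_j x 0 (rshift 1 j)).
have consK : cancel (@row_cons R n) uncons.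
  move=> [a x]; congr pair; last first.
    by apply/rowP => j; rewrite mxE /row_cons (@row_mxEr R 1 1 n).
  rewrite /row_cons (_ : 0 = lshift n (0 : 'I_1)) ?(@row_mxEl R 1 1 n) ?mxE//.
  exact/val_inj.
have muncons : measurable_fun setT uncons.
  apply/measurable_fun_pair; first exact: measurable_entry.
  apply: measurable_matrixP => i j.
  rewrite (_ : (fun x => _) = fun x : 'rV[R]_n.+1 => x 0 (rshift 1 j)).
    exact: measurable_entry.
  by apply/funext => x; rewrite mxE.
have /sigma_finiteP[F [FT ndF Ffin]] := sigma_finiteT (@lebesgue_measure R).
have /sigma_finiteP[G [GT ndG Gfin]] := sigma_finiteT mu.
exists (fun k => uncons @^-1` (F k `*` G k)).
  rewrite predeqE => x; split=> // _.
  have [k _ Fk] : (\bigcup_k F k) (uncons x).1 by rewrite -FT.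
  have [l _ Gl] : (\bigcup_k G k) (uncons x).2 by rewrite -GT.
  exists (maxn k l) => //; split.
    by move: Fk; exact/subsetPset/ndF/leq_maxl.
  by move: Gl; exact/subsetPset/ndG/leq_maxr.
move=> k; have [mF Foo] := Ffin k; have [mG Goo] := Gfin k; split.
  by rewrite -[X in measurable X]setTI; apply: muncons => //; exact: measurableX.
rewrite /lebesgue_cons /pushforward -comp_preimage.
rewrite (_ : uncons \o _ = id); last by apply/funext => p; exact: consK.
by rewrite preimage_id product_measure1E// lte_mul_pinfty// ge0_fin_numE.
Qed.

HB.instance Definition _ (R : realType) (n : nat)
    (mu : {sigma_finite_measure set 'rV[R]_n -> \bar R}) :=
  Measure_isSigmaFinite.Build _ _ _ (lebesgue_cons mu)
    (lebesgue_cons_sigma_finite mu).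

Fixpoint lebesgue_rV (R : realType) (n : nat) :
    {sigma_finite_measure set 'rV[R]_n -> \bar R} :=
  match n with
  | 0 => \d_(0 : 'rV[R]_0)
  | n'.+1 => lebesgue_cons (lebesgue_rV R n')
  end.

Section Analysis.
Context (R : realType).
Local Open Scope complex_scope.
Local Notation C := R[i].
Local Notation modulus := (@ComplexField.Normc.normc R).
Local Notation leb := (@lebesgue_rV R).

(* The library norm on 'rV[R]_d is the sup norm; this is the Euclidean one. *)
Definition enorm d (x : 'rV[R]_d) : R := Num.sqrt (\sum_(i < d) x 0 i ^+ 2).

Definition uball d : set 'rV[R]_d := [set x | enorm x < 1].

Definition usphere d : set 'rV[R]_d := [set x | enorm x = 1].

Definition cintegral d (D : set 'rV[R]_d) (f : 'rV[R]_d -> C) : C :=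
  Rintegral (leb d) D (fun x => complex.Re (f x)) +i*
  Rintegral (leb d) D (fun x => complex.Im (f x)).

Definition L2norm d (D : set 'rV[R]_d) (f : 'rV[R]_d -> C) : \bar R :=
  'N[leb d]_2%:E[(EFin \o modulus \o f) \_ D]%E.

Definition L2 d (D : set 'rV[R]_d) (f : 'rV[R]_d -> C) : Prop :=
  [/\ measurable_fun D (fun x => complex.Re (f x)),
      measurable_fun D (fun x => complex.Im (f x)) &
      (L2norm D f < +oo)%E].

(** Differential calculus for complex-valued functions on R^d *)

Fixpoint CkR d (k : nat) (f : 'rV[R]_d -> R) : Prop :=
  match k with
  | 0 => continuous f
  | k'.+1 => continuous f /\
      forall i : 'I_d,
        (forall x, derivable f x (delta_mx 0 i)) /\
        CkR k' (fun x => 'D_(delta_mx 0 i) f x)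
  end.

Definition Ck d (k : nat) (f : 'rV[R]_d -> C) : Prop :=
  CkR k (fun x => complex.Re (f x)) /\ CkR k (fun x => complex.Im (f x)).

Definition smooth d (f : 'rV[R]_d -> C) : Prop := forall k, Ck k f.

Definition partial d (i : 'I_d) (f : 'rV[R]_d -> C) (x : 'rV[R]_d) : C :=
  'D_(delta_mx 0 i) (fun y => complex.Re (f y)) x +i*
  'D_(delta_mx 0 i) (fun y => complex.Im (f y)) x.

Definition laplacian d (f : 'rV[R]_d -> C) (x : 'rV[R]_d) : C :=
  \sum_(i < d) partial i (partial i f) x.

Definition test_function d (D : set 'rV[R]_d) (eta : 'rV[R]_d -> C) : Prop :=
  smooth eta /\
  exists K : set 'rV[R]_d,
    [/\ compact K, K `<=` D & forall x, ~ K x -> eta x = 0].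

(** The Dirichlet problem in the unit ball *)

(* H^1_0 is the closure of the test functions in H^1: u is the L^2 limit of
   test functions w_k whose gradients converge in L^2. *)
Definition H10 d (u : 'rV[R]_d -> C) : Prop :=
  L2 (@uball d) u /\
  exists (w : nat -> 'rV[R]_d -> C) (g : 'I_d -> 'rV[R]_d -> C),
    [/\ forall k, test_function (@uball d) (w k),
        forall i, L2 (@uball d) (g i),
        L2norm (@uball d) (fun x => w k x - u x) @[k --> \oo] --> 0%E &
        forall i, L2norm (@uball d) (fun x => partial i (w k) x - g i x)
                    @[k --> \oo] --> 0%E].

(* - Delta u + v u - E u = f in the unit ball, in the sense of distributions *)
Definition schrodinger_eq d (v : 'rV[R]_d -> C) (E : R)
    (u f : 'rV[R]_d -> C) : Prop :=
  forall eta, test_function (@uball d) eta ->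
    cintegral (@uball d)
      (fun x => u x * (- laplacian eta x + (v x - E%:C) * eta x)) =
    cintegral (@uball d) (fun x => f x * eta x).

Definition dirichlet_eigenvalue d (v : 'rV[R]_d -> C) (E : R) : Prop :=
  exists u : 'rV[R]_d -> C,
    [/\ H10 u, L2norm (@uball d) u != 0%E & schrodinger_eq v E u (fun=> 0)].

(* Operator norm of a linear operator given by its graph T. When the domain of
   T is dense, this is also the norm of the continuous extension of T. *)
Definition opnorm (X Y : Type) (normX : X -> \bar R) (normY : Y -> \bar R)
    (T : X -> Y -> Prop) : \bar R :=
  ereal_sup [set normY y | y in
    [set y | exists2 x, T x y & (normX x <= 1)%E]].

(* Graph of (- Delta + v - E)^-1 on L^2, with the Dirichlet condition *)
Definition resolvent d (v : 'rV[R]_d -> C) (E : R)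
    (f u : 'rV[R]_d -> C) : Prop :=
  [/\ L2 (@uball d) f, H10 u & schrodinger_eq v E u f].

Definition resolvent_norm d (v : 'rV[R]_d -> C) (E : R) : \bar R :=
  opnorm (L2norm (@uball d)) (L2norm (@uball d)) (@resolvent d v E).

(* Graph of the Dirichlet-to-Neumann map. Functions on the sphere are
   represented by functions on R^d, of which only the values on the sphere
   matter. The solutions psi range over C^1 of the closed ball, i.e. over the
   restrictions of C^1 functions on R^d; for a bounded v this contains the
   solutions with smooth boundary values (which are W^{2,p} for all finite p),
   so that the domain is dense in every Sobolev space of the sphere. *)
Definition dtn d (v : 'rV[R]_d -> C) (E : R) (f g : 'rV[R]_d -> C) : Prop :=
  exists psi : 'rV[R]_d -> C,
    [/\ Ck 1 psi,
        schrodinger_eq v E psi (fun=> 0),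
        forall x, usphere x -> f x = psi x &
        forall x, usphere x ->
          g x = \sum_(i < d) (x 0 i)%:C * partial i psi x].

Definition dtn_difference d (v w : 'rV[R]_d -> C) (E : R)
    (f g : 'rV[R]_d -> C) : Prop :=
  exists g1 g2 : 'rV[R]_d -> C,
    [/\ dtn v E f g1, dtn w E f g2 &
        forall x, usphere x -> g x = g1 x - g2 x].

(** Spherical harmonics and Sobolev norms on the unit sphere *)

Definition sphere_proj d (x : 'rV[R]_d) : 'rV[R]_d := (enorm x)^-1 *: x.

(* Integral for the surface measure: in polar coordinates,
   int_{|x|<1} h(x/|x|) dx = (int_0^1 r^(d-1) dr) * int_{S^(d-1)} h. *)
Definition sphere_integral d (h : 'rV[R]_d -> C) : C :=
  d%:R * cintegral (@uball d) (h \o @sphere_proj d).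

Definition sphere_inner d (f g : 'rV[R]_d -> C) : C :=
  sphere_integral (fun x => f x * (g x)^*).

Definition spherical_harmonic d (j : nat) (f : 'rV[R]_d -> C) : Prop :=
  exists P : mpoly.mpoly d C,
    [/\ P \is mpoly.ishomog1 j mpoly.mdeg,
        \sum_(i < d) mpoly.mderiv i (mpoly.mderiv i P) = 0 &
        forall x, usphere x -> f x = mpoly.meval (fun i => (x 0 i)%:C) P].

(* (Y j k), k < p j, is a basis of the spherical harmonics of degree j, and all
   the Y j k together are an orthonormal basis of L^2 of the sphere. *)
Definition harmonic_basis d (p : nat -> nat)
    (Y : forall j, 'I_(p j) -> 'rV[R]_d -> C) : Prop :=
  [/\ forall j k, spherical_harmonic j (Y j k),
      forall j f, spherical_harmonic j f ->
        exists c : 'I_(p j) -> C,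
          forall x, usphere x -> f x = \sum_(k < p j) c k * Y j k x,
      forall j k j' k', sphere_inner (Y j k) (Y j' k') =
        ((j == j') && (k == k' :> nat))%:R &
      forall g, L2 (@uball d) (g \o @sphere_proj d) ->
        (forall j k, sphere_inner g (Y j k) = 0) ->
        L2norm (@uball d) (g \o @sphere_proj d) = 0%E].

Definition sobolev_norm d (p : nat -> nat)
    (Y : forall j, 'I_(p j) -> 'rV[R]_d -> C) (s : R)
    (f : 'rV[R]_d -> C) : \bar R :=
  ((\sum_(0 <= j <oo)
     (\sum_(k < p j)
        (1 + j%:R) `^ (2 * s) * modulus (sphere_inner f (Y j k)) ^+ 2)%:E)
   `^ 2^-1)%E.

(** The potentials *)

Definition is_profile (phi : 'rV[R]_2 -> C) : Prop :=
  [/\ smooth phi,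
      closure [set y | phi y != 0] `<=`
        [set y | enorm y < 1 / 3 /\ 1 / 4 < y 0 0] &
      'N[leb 2]_+oo[EFin \o modulus \o phi]%E = 1%E].

(* Coordinates are numbered from 0: coord x 0 and coord x 1 are x_1 and x_2. *)
Definition coord d (x : 'rV[R]_d) (k : nat) : R :=
  if insub k is Some i then x 0 i else 0.

Definition cyl_radius d (x : 'rV[R]_d) : R :=
  Num.sqrt (coord x 0 ^+ 2 + coord x 1 ^+ 2).

Definition rest_norm d (x : 'rV[R]_d) : R :=
  Num.sqrt (\sum_(i < d | (2 <= i)%N) x 0 i ^+ 2).

(* e^(i theta) = (x_1 + i x_2) / r_1; where r_1 = 0 the value is irrelevant,
   since phi vanishes there. *)
Definition exp_itheta d (x : 'rV[R]_d) : C :=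
  (coord x 0 / cyl_radius x) +i* (coord x 1 / cyl_radius x).

Definition potential d (phi : 'rV[R]_2 -> C) (m n : nat) (x : 'rV[R]_d) : C :=
  n%:R ^- m * exp_itheta x ^+ n *
  phi (\row_(k < 2) if k == 0 then cyl_radius x else rest_norm x).

End Analysis.

(* Main.v *)
(* Let psi and psi_0 solve the equations for v_nm and for 0 with the same trace.
   Their coefficients on a spherical harmonic of degree j solve radial ODEs, and
   the difference of the two solves one with source the coefficient of v_nm psi
   and value 0 at r = 1. Let M = n / 2 and q = || (- Delta - E)^-1 ||.
   - For j >= M the centrifugal term dominates E, so the ODE is coercive; since
     v_nm vanishes for r >= 1/3, the flux at r = 1 is O((2/5)^(2 j)).
   - For j < M the ODE is inverted with the resolvent of - Delta, which costs a
     factor 1 + E q; here the source itself has to be small.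
   The factor e^(i n theta) shifts the angular frequency by n. Averaging over a
   cyclic group of N rotations, N large, splits psi into frequencies K mod N.
   For M <= K <= N - M this part has no component of degree < M, so on the
   support of v_nm it is exponentially small, up to 1/50 of the part of frequency
   K + n. Iterating, all frequencies in that window are small. The shift by n
   sends every other frequency into the window, so v_nm psi is small in degrees
   < M. *)

(* The obstacle is the low degrees: there psi is controlled only through a resolvent, which makes
   nothing small, so the smallness of v_nm psi must come from e^(i n theta) alone. All estimates are
   quadratic and pass through X(psi) = int_0^1 w(r) r^(d-1) |psi(r .)|^2 dr (L^2 norm on the
   sphere), where the cut-off w is 1 for r <= 1/3 and 0 for r >= 1/2: X dominates the source, and on
   r <= 1/2 the free part of degree j >= M gains (1/4)^(j-1). The boundary data enter through two
   sums controlled by their H^(-sigma) norm: T over degrees >= M, carrying that gain, and A over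
   degrees < M. The factor 1/50 is 2 * (1/100), the 2 coming from |a + b|^2 <= 2 |a|^2 + 2 |b|^2. A
   priori X(psi) is merely finite; i iterations give 3 T + 50^(-i) X(psi), and i tends to infinity.
   A finite group replaces the circle so that the splitting into frequencies is a finite sum. The
   weights (1 + j)^(2 sigma) and the factor M^2 are paid by (5/4)^j; the squared norm is then
   O((1/2)^M), whose square root is O(2^(-n/4)). *)
From Pilot Require Import Defs.
From HB Require Import structures.
From mathcomp Require Import all_boot all_order all_algebra.
From mathcomp.multinomials Require Import -(notations) mpoly.
From mathcomp Require Import all_classical all_reals all_analysis.
From mathcomp.real_closed Require Import complex.
From mathcomp Require Import measurable_realfun ring lra zify.
From mathcomp Require cyclic separable cyclotomic.
Import Order.TTheory GRing.Theory Num.Theory.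
Import numFieldNormedType.Exports.
Set Implicit Arguments. Unset Strict Implicit. Unset Printing Implicit Defensive.
Local Open Scope classical_set_scope.
Local Open Scope ring_scope.

(** * Lebesgue measure on R^d and linear changes of variables *)

Section LebesgueRV.
Context {R : realType}.
Local Notation leb := (@lebesgue_rV R).
Local Notation mu := (@lebesgue_measure R).

Lemma measurable_affine (c b : R) :
  measurable_fun setT (fun x : measurableTypeR R => c * x + b : measurableTypeR R).
Proof.
by apply: measurable_funD => //; apply: measurable_funM.
Qed.

(** Both sides are measures in A that agree on half-open intervals, which determine Lebesgue
    measure. *)
Lemma lebesgue_measure_affine (c b : R) (A : set R) : 0 < c -> measurable A ->
  mu A = (c%:E * pushforward mu (fun x : measurableTypeR R => (c * x + b)%R : measurableTypeR R) A)%E.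
Proof.
move=> c0 mA.
pose k : {nonneg R} := NngNum (ltW c0).
pose nu := mscale k (measure_function_pushforward__canonical__measure_function_Measure mu (measurable_affine c b)).
rewrite (@lebesgue_measure_unique R nu)// => _ [[x y]] _ <-.
rewrite [RHS](_ : _ = c%:E * mu ((fun x => c * x + b)%R @^-1` `]x, y]))%E //.
rewrite (_ : _ @^-1` _ = `](x - b) / c, (y - b) / c]%classic); last first.
  by apply/seteqP; split=> z /=; rewrite !in_itv/= ltr_pdivrMr// ler_pdivlMr// ltrBlDr lerBrDr mulrC.
rewrite !lebesgue_measure_itv/= !lte_fin ltr_pM2r ?invr_gt0// ltrD2r.
case: ifPn => _; last by rewrite mule0.
rewrite -!EFinB -EFinM; congr EFin; rewrite -mulrBl mulrC divfK ?gt_eqF//; lra.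
Qed.

Lemma ge0_integral_affine (c b : R) (f : R -> \bar R) : 0 < c ->
  measurable_fun setT f -> (forall x, 0 <= f x)%E ->
  (\int[mu]_x f (c * x + b)%R = (c^-1)%:E * \int[mu]_x f x)%E.
Proof.
move=> c0 mf f0.
pose nu := measure_function_pushforward__canonical__measure_function_Measure mu (measurable_affine c b).
have -> : (\int[mu]_x f x = \int[mscale (NngNum (ltW c0)) nu]_x f x)%E.
  by apply: eq_measure_integral => A mA _; exact: lebesgue_measure_affine.
rewrite ge0_integral_mscale//= muleA -EFinM mulVf ?gt_eqF// mul1e.
by rewrite ge0_integral_pushforward//; exact: measurable_affine.
Qed.

Lemma ge0_integral_rV0 (f : 'rV[R]_0 -> \bar R) :
  measurable_fun setT f -> (forall x, 0 <= f x)%E ->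
  (\int[leb 0]_x f x = f 0%R)%E.
Proof. by move=> mf f0; rewrite integral_dirac// diracT mul1e. Qed.

Lemma ge0_integral_rVS n (f : 'rV[R]_n.+1 -> \bar R) :
  measurable_fun setT f -> (forall x, 0 <= f x)%E ->
  (\int[leb n.+1]_x f x = \int[mu]_a \int[leb n]_x f (row_cons (a, x)))%E.
Proof.
move=> mf f0.
have mrc := @measurable_row_cons R n.
transitivity (\int[(mu \x leb n)%E]_p (f \o @row_cons R n) p)%E.
  by rewrite -(@ge0_integral_pushforward _ _ _ _ _ _ mrc (mu \x leb n)%E setT f).
rewrite fubini_tonelli1; [by []|exact: (measurableT_comp mf mrc)|by move=> x; exact: f0].
Qed.

End LebesgueRV.

(* Otherwise unification unfolds the measure. *)
Opaque lebesgue_rV.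

Section LebesgueRV2.
Context {R : realType}.
Local Notation leb := (@lebesgue_rV R).
Local Notation mu := (@lebesgue_measure R).
Lemma row_cons0 n (p : measurableTypeR R * 'rV[R]_n) : row_cons p 0 0 = p.1.
Proof. by rewrite /row_cons (_ : 0 = lshift n (0 : 'I_1)) ?(@row_mxEl R 1 1 n) ?mxE//; exact/val_inj. Qed.

Lemma row_consS n (p : measurableTypeR R * 'rV[R]_n) (i : 'I_n) :
  row_cons p 0 (lift 0 i) = p.2 0 i.
Proof.
rewrite /row_cons (_ : lift 0 i = rshift 1 i) ?(@row_mxEr R 1 1 n)//; exact/val_inj.
Qed.

Lemma measurable_row_consr n (a : R) :
  measurable_fun setT (fun x : 'rV[R]_n => row_cons (a : measurableTypeR R, x)).
Proof.
apply: (measurableT_comp (@measurable_row_cons R n)).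
by apply/measurable_fun_pair => //; exact: measurable_cst.
Qed.

Lemma measurable_row_map n m (f : 'rV[R]_n -> 'rV[R]_m) :
  (forall j, measurable_fun setT (fun x => f x 0 j)) -> measurable_fun setT f.
Proof. by move=> mf; apply: measurable_matrixP => i j; rewrite ord1. Qed.

Lemma measurable_scale_rV n (t : R) :
  measurable_fun setT (fun x : 'rV[R]_n => t *: x).
Proof.
apply: measurable_row_map => j; under eq_fun do rewrite mxE.
by apply: measurable_funM => //; exact: measurable_entry.
Qed.

Lemma measurable_add_rV n (v : 'rV[R]_n) :
  measurable_fun setT (fun x : 'rV[R]_n => x + v).
Proof.
apply: measurable_row_map => j; under eq_fun do rewrite mxE.
by apply: measurable_funD => //; exact: measurable_entry.
Qed.

Lemma measurable_inner_rVS n (f : 'rV[R]_n.+1 -> \bar R) :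
  measurable_fun setT f -> (forall x, 0 <= f x)%E ->
  measurable_fun setT (fun a : measurableTypeR R => (\int[leb n]_x f (row_cons (a, x)))%E).
Proof.
move=> mf f0.
have := @measurable_fun_fubini_tonelli_F _ _ _ _ _ (leb n) (f \o @row_cons R n).
by apply; [exact: (measurableT_comp mf (@measurable_row_cons R n))|move=> x; exact: f0].
Qed.

(** Induction on the dimension: each coordinate split off by Tonelli contributes one factor 1/t. *)
Lemma ge0_integral_scale n (t : R) (f : 'rV[R]_n -> \bar R) : 0 < t ->
  measurable_fun setT f -> (forall x, 0 <= f x)%E ->
  (\int[leb n]_x f (t *: x)%R = ((t ^+ n)^-1)%:E * \int[leb n]_x f x)%E.
Proof.
move=> t0; elim: n f => [|n IH] f mf f0.
  rewrite !ge0_integral_rV0//; last exact: (measurableT_comp mf (@measurable_scale_rV _ _)).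
  by rewrite scaler0 expr0 invr1 mul1e.
rewrite ge0_integral_rVS//; last exact: (measurableT_comp mf (@measurable_scale_rV _ _)).
pose G (a : measurableTypeR R) := (\int[leb n]_x f (row_cons (a, x)))%E.
have G0 a : (0 <= G a)%E by apply: integral_ge0.
have mG : measurable_fun setT G by exact: measurable_inner_rVS.
transitivity (\int[mu]_a (((t ^+ n)^-1)%:E * G (t * a)%R))%E.
  apply: eq_integral => a _.
  rewrite -(IH (fun x => f (row_cons (t * a : measurableTypeR R, x))))//; last first.
    exact: (measurableT_comp mf (@measurable_row_consr _ _)).
  apply: eq_integral => x _; congr f; apply/rowP => i.
  case: (unliftP 0 i) => [j|] ->; first by rewrite mxE !row_consS mxE.
  by rewrite mxE !row_cons0.
have mGt : measurable_fun setT (fun a : measurableTypeR R => G (t * a)%R).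
  by apply: (measurableT_comp mG); apply: measurable_funM.
rewrite ge0_integralZl//; last by rewrite lee_fin invr_ge0 exprn_ge0// ltW.
have e0 : (\int[mu]_a G (t * a)%R = \int[mu]_a G (t * a + 0)%R)%E.
  by apply: eq_integral => a _; rewrite addr0.
rewrite e0.
rewrite (@ge0_integral_affine R t 0 G t0 mG G0) (ge0_integral_rVS mf f0) muleA -EFinM.
by rewrite exprSr invfM.
Qed.

Lemma ge0_integral_translate n (v : 'rV[R]_n) (f : 'rV[R]_n -> \bar R) :
  measurable_fun setT f -> (forall x, 0 <= f x)%E ->
  (\int[leb n]_x f (x + v)%R = \int[leb n]_x f x)%E.
Proof.
elim: n v f => [|n IH] v f mf f0.
  rewrite !ge0_integral_rV0//; last exact: (measurableT_comp mf (@measurable_add_rV _ _)).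
  by congr f; apply/rowP => -[].
rewrite (ge0_integral_rVS mf f0) (@ge0_integral_rVS _ _ (fun x => f (x + v))
  (measurableT_comp mf (measurable_add_rV v)) (fun x => f0 _)).
pose G (a : measurableTypeR R) := (\int[leb n]_x f (row_cons (a, x)))%E.
have G0 a : (0 <= G a)%E by apply: integral_ge0.
have mG : measurable_fun setT G by exact: measurable_inner_rVS.
transitivity (\int[mu]_a (G (1 * a + v 0 0)%R))%E; last first.
  by rewrite (@ge0_integral_affine R 1 (v 0 0) G)// invr1 mul1e.
apply: eq_integral => a _.
rewrite mul1r /G -(IH (\row_j v 0 (lift 0 j)) (fun x => f (row_cons (a + v 0 0 : measurableTypeR R, x))))//; last first.
  exact: (measurableT_comp mf (@measurable_row_consr _ _)).
apply: eq_integral => x _; congr f; apply/rowP => i.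
case: (unliftP 0 i) => [j|] ->; first by rewrite mxE !row_consS !mxE.
by rewrite mxE !row_cons0.
Qed.
End LebesgueRV2.

(** * Rotations of the first two coordinates preserve Lebesgue measure *)

Section PlaneRotation.
Context {R : realType}.
Local Notation leb := (@lebesgue_rV R).
Local Notation mu := (@lebesgue_measure R).
Local Notation coord := (@Pilot.Defs.coord R _).
Lemma coordE d (x : 'rV[R]_d) (i : 'I_d) : coord x i = x 0 i.
Proof. by rewrite /Pilot.Defs.coord valK. Qed.

Definition shear0 d (t : R) (x : 'rV[R]_d) : 'rV[R]_d :=
  \row_i (if i == 0 :> nat then coord x 0 + t * coord x 1 else x 0 i).

Definition shear1 d (t : R) (x : 'rV[R]_d) : 'rV[R]_d :=
  \row_i (if i == 1 :> nat then coord x 1 + t * coord x 0 else x 0 i).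

Definition rot d (c s : R) (x : 'rV[R]_d) : 'rV[R]_d :=
  \row_i (if i == 0 :> nat then c * coord x 0 - s * coord x 1
          else if i == 1 :> nat then s * coord x 0 + c * coord x 1 else x 0 i).

Lemma coord_row d (F : 'I_d -> R) (k : nat) (hk : (k < d)%N) :
  coord (\row_i F i) k = F (Ordinal hk).
Proof. by rewrite (coordE _ (Ordinal hk)) mxE. Qed.

Lemma measurable_coord d k : measurable_fun setT (fun x : 'rV[R]_d => coord x k).
Proof.
rewrite /Pilot.Defs.coord; case: insubP => [i _ _|_]; last exact: measurable_cst.
exact: measurable_entry.
Qed.

Lemma measurable_shear0 d t : measurable_fun setT (@shear0 d t).
Proof.
apply: measurable_row_map => j; under eq_fun do rewrite mxE.
case: (j == 0 :> nat); last exact: measurable_entry.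
apply: measurable_funD; first exact: measurable_coord.
by apply: measurable_funM => //; exact: measurable_coord.
Qed.

Lemma measurable_shear1 d t : measurable_fun setT (@shear1 d t).
Proof.
apply: measurable_row_map => j; under eq_fun do rewrite mxE.
case: (j == 1 :> nat); last exact: measurable_entry.
apply: measurable_funD; first exact: measurable_coord.
by apply: measurable_funM => //; exact: measurable_coord.
Qed.

(** Three shears make a rotation, the outer ones with parameter minus the tangent s / (1 + c) of the
    half-angle; the half-turn c = -1 has no such factorisation. Each shear translates one coordinate
    by an amount depending on another one, so Tonelli reduces it to translation invariance. *)
Lemma rot_shears d (hd : (2 <= d)%N) (c s : R) (x : 'rV[R]_d) :
  c ^+ 2 + s ^+ 2 = 1 -> 1 + c != 0 ->
  rot c s x = shear0 (- (s / (1 + c))) (shear1 s (shear0 (- (s / (1 + c))) x)).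
Proof.
move=> cs1 c1.
have h0 : (0 < d)%N by apply: leq_trans hd.
have sE : s * s = (1 - c) * (1 + c) by rewrite -expr2 mulrDr mulr1 mulrBl mul1r -cs1; ring.
have stE : s * (s / (1 + c)) = 1 - c by rewrite mulrA sE mulfK.
apply/rowP => i; rewrite !mxE; case: ifPn => i0.
  rewrite /shear1 (coord_row _ h0) (coord_row _ hd) /=.
  rewrite /shear0 mxE /= (coord_row _ h0) (coord_row _ hd) /=.
  rewrite -(coordE x (Ordinal hd)) /=.
  have : (s / (1 + c)) * (1 + c) = s by rewrite divfK.
  move: stE; set t := s / (1 + c); set x0 := coord x 0; set x1 := coord x 1.
  move=> stE tE; apply/eqP; rewrite -subr_eq0; apply/eqP.
  transitivity ((x0 - t * x1) * (s * t - (1 - c)) + x1 * (t * (1 + c) - s)); first by ring.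
  by rewrite stE tE !subrr !mulr0 add0r.
case: ifPn => i1.
  rewrite /shear0 (coord_row _ h0) (coord_row _ hd) /=.
  rewrite -(coordE x (Ordinal hd)) /=.
  move: stE; set t := s / (1 + c); set x0 := coord x 0; set x1 := coord x 1.
  move=> stE; transitivity (x1 + s * x0 - (s * t) * x1); last by ring.
  by rewrite stE; ring.
by [].
Qed.

Lemma measurable_rot d c s : measurable_fun setT (@rot d c s).
Proof.
apply: measurable_row_map => j; under eq_fun do rewrite mxE.
case: (j == 0 :> nat); last case: (j == 1 :> nat); last exact: measurable_entry.
  by apply: measurable_funB; apply: measurable_funM => //; exact: measurable_coord.
by apply: measurable_funD; apply: measurable_funM => //; exact: measurable_coord.
Qed.

Lemma ge0_integral_shear1 d (t : R) (f : 'rV[R]_d -> \bar R) : (2 <= d)%N ->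
  measurable_fun setT f -> (forall x, 0 <= f x)%E ->
  (\int[leb d]_x f (shear1 t x) = \int[leb d]_x f x)%E.
Proof.
case: d f => [//|d] f hd mf f0.
rewrite (ge0_integral_rVS mf f0) (@ge0_integral_rVS _ _ (fun x => f (shear1 t x))
  (measurableT_comp mf (measurable_shear1 t)) (fun x => f0 _)).
apply: eq_integral => a _.
have h0 : (0 < d)%N by [].
pose v : 'rV[R]_d := \row_j (if j == 0 :> nat then t * a else 0).
rewrite -(@ge0_integral_translate R d v (fun x => f (row_cons (a : measurableTypeR R, x))))//; last first.
  exact: (measurableT_comp mf (@measurable_row_consr _ _ _)).
apply: eq_integral => x _; congr f; apply/rowP => i; rewrite mxE.
have c0 : coord (row_cons (a : measurableTypeR R, x)) 0 = a.
  by rewrite (coordE _ (0 : 'I_d.+1)) row_cons0.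
have c1 : coord (row_cons (a : measurableTypeR R, x)) 1 = x 0 (Ordinal h0).
  by rewrite (coordE _ (lift (0 : 'I_d.+1) (Ordinal h0))) row_consS.
case: (unliftP 0 i) => [j|] ->; last by rewrite !row_cons0.
rewrite !row_consS !mxE /= /bump/= add1n eqSS; case: ifP => // /eqP j0.
  by rewrite c0 c1; congr (x 0 _ + _); exact: val_inj.
by rewrite addr0.
Qed.

(** Here the translated coordinate is the outermost one, so the first two integrations are exchanged
    before translating and exchanged back afterwards. *)
Lemma ge0_integral_shear0 d (t : R) (f : 'rV[R]_d -> \bar R) : (2 <= d)%N ->
  measurable_fun setT f -> (forall x, 0 <= f x)%E ->
  (\int[leb d]_x f (shear0 t x) = \int[leb d]_x f x)%E.
Proof.
case: d f => [//|[//|d]] f hd mf f0.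
pose rc (p : measurableTypeR R * measurableTypeR R * 'rV[R]_d) : 'rV[R]_d.+2 :=
  row_cons (p.1.1, row_cons (p.1.2, p.2)).
have mrc : measurable_fun setT rc.
  apply: (measurableT_comp (@measurable_row_cons R d.+1)).
  apply/measurable_fun_pair; first exact: (measurableT_comp measurable_fst measurable_fst).
  apply: (measurableT_comp (@measurable_row_cons R d)).
  apply/measurable_fun_pair; last exact: measurable_snd.
  exact: (measurableT_comp measurable_snd measurable_fst).
pose F (q : measurableTypeR R * measurableTypeR R) := (\int[leb d]_y f (rc (q, y)))%E.
have F0 q : (0 <= F q)%E by apply: integral_ge0.
have mF : measurable_fun setT F.
  have := @measurable_fun_fubini_tonelli_F _ _ _ _ _ (leb d) (f \o rc).
  by apply; [exact: (measurableT_comp mf mrc)|move=> x; exact: f0].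
have step g : measurable_fun setT g -> (forall x, 0 <= g x)%E ->
    (\int[leb d.+2]_x g x = \int[mu]_a \int[mu]_b \int[leb d]_y g (rc ((a, b), y)))%E.
  move=> mg g0; rewrite ge0_integral_rVS//; apply: eq_integral => a _.
  by rewrite ge0_integral_rVS//; exact: (measurableT_comp mg (@measurable_row_consr _ _ _)).
rewrite (step (f \o @shear0 d.+2 t))//; last first.
- by move=> x; exact: f0.
- exact: (measurableT_comp mf (@measurable_shear0 _ _)).
rewrite (step _ mf f0).
pose sh (q : measurableTypeR R * measurableTypeR R) : measurableTypeR R * measurableTypeR R := (q.1 + t * q.2, q.2).
have msh : measurable_fun setT sh.
  apply/measurable_fun_pair; last exact: measurable_snd.
  apply: measurable_funD; first exact: measurable_fst.
  by apply: measurable_funM => //; exact: measurable_snd.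
transitivity (\int[mu]_a \int[mu]_b (F \o sh) (a, b))%E.
  congr (integral _ _ _); apply/funext => a; congr (integral _ _ _); apply/funext => b.
  congr (integral _ _ _); apply/funext => y; congr f; apply/rowP => i.
  rewrite mxE.
  rewrite (coordE _ (0 : 'I_d.+2)) (coordE _ (lift (0 : 'I_d.+2) (0 : 'I_d.+1))).
  rewrite /rc row_cons0 row_consS row_cons0 /=.
  case: (unliftP 0 i) => [j|] ->; last by rewrite !row_cons0.
  by rewrite !row_consS.
have mFsh : measurable_fun setT (F \o sh) by exact: (measurableT_comp mF msh).
apply: (etrans (fubini_tonelli (F \o sh) mFsh (fun q => F0 _))).
transitivity (\int[mu]_b \int[mu]_a F (a, b))%E; last exact/esym/(fubini_tonelli F).
apply: eq_integral => b _.
transitivity (\int[mu]_a (fun a : measurableTypeR R => F (a, b)) (1 * a + t * b)%R)%E.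
  by apply: eq_integral => a _; rewrite mul1r.
rewrite (@ge0_integral_affine R 1 (t * b) (fun a => F (a, b)))//.
  by rewrite invr1 mul1e.
by apply: (measurableT_comp mF); apply/measurable_fun_pair => //; exact: measurable_cst.
Qed.

Lemma ge0_integral_rot d (c s : R) (f : 'rV[R]_d -> \bar R) : (2 <= d)%N ->
  c ^+ 2 + s ^+ 2 = 1 -> 1 + c != 0 ->
  measurable_fun setT f -> (forall x, 0 <= f x)%E ->
  (\int[leb d]_x f (rot c s x) = \int[leb d]_x f x)%E.
Proof.
move=> hd cs1 c1 mf f0.
under eq_integral => x _ do rewrite rot_shears//.
set t := - _.
have m1 : measurable_fun setT (fun x => f (shear0 t x)).
  exact: (measurableT_comp mf (@measurable_shear0 _ _)).
have m2 : measurable_fun setT (fun x => f (shear0 t (shear1 s x))).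
  exact: (measurableT_comp m1 (@measurable_shear1 _ _)).
rewrite (ge0_integral_shear0 t hd m2)//.
by rewrite (ge0_integral_shear1 s hd m1)// (ge0_integral_shear0 t hd mf).
Qed.
End PlaneRotation.

Section Continuity.
Context {R : realType}.
Local Notation leb := (@lebesgue_rV R).
Local Notation mu := (@lebesgue_measure R).
Local Notation coord := (@Pilot.Defs.coord R _).
Lemma ccomp (T U V : topologicalType) (f : T -> U) (g : U -> V) :
  continuous f -> continuous g -> continuous (fun x => g (f x)).
Proof. by move=> cf cg x; apply: continuous_comp; [exact: cf|exact: cg]. Qed.

Context (T : topologicalType).
Implicit Types f g : T -> R.

Lemma cC (c : R) : continuous (fun _ : T => c).
Proof. exact: cst_continuous. Qed.

Lemma cD f g : continuous f -> continuous g -> continuous (fun x => f x + g x).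
Proof. by move=> cf cg x; apply: cvgD; [exact: cf|exact: cg]. Qed.

Lemma cN f : continuous f -> continuous (fun x => - f x).
Proof. by move=> cf x; apply: cvgN; exact: cf. Qed.

Lemma cB f g : continuous f -> continuous g -> continuous (fun x => f x - g x).
Proof. by move=> cf cg; apply: cD => //; exact: cN. Qed.

Lemma cM f g : continuous f -> continuous g -> continuous (fun x => f x * g x).
Proof. by move=> cf cg x; apply: cvgM; [exact: cf|exact: cg]. Qed.

Lemma cX f n : continuous f -> continuous (fun x => f x ^+ n).
Proof. by move=> cf; exact: (ccomp cf (@exprn_continuous _ n)). Qed.

Lemma cnorm f : continuous f -> continuous (fun x => `|f x|).
Proof. by move=> cf; exact: (ccomp cf (@norm_continuous _ _)). Qed.
End Continuity.

(** * Polar coordinates and the ball *)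

Section Enorm.
Context {R : realType}.
Local Notation leb := (@lebesgue_rV R).
Local Notation mu := (@lebesgue_measure R).
Local Notation coord := (@Pilot.Defs.coord R _).
Lemma sqr_enorm d (x : 'rV[R]_d) : enorm x ^+ 2 = \sum_(i < d) x 0 i ^+ 2.
Proof. by rewrite sqr_sqrtr//; apply: sumr_ge0 => i _; exact: sqr_ge0. Qed.

Lemma enorm_ge0 d (x : 'rV[R]_d) : 0 <= enorm x.
Proof. exact: sqrtr_ge0. Qed.

Lemma enormZ d (t : R) (x : 'rV[R]_d) : enorm (t *: x) = `|t| * enorm x.
Proof.
rewrite /enorm (eq_bigr (fun i => t ^+ 2 * x 0 i ^+ 2)); last first.
  by move=> i _; rewrite mxE exprMn.
by rewrite -mulr_sumr sqrtrM ?sqr_ge0// sqrtr_sqr.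
Qed.

Lemma enorm0 d : enorm (0 : 'rV[R]_d) = 0.
Proof. by rewrite -(scale0r 0) enormZ normr0 mul0r. Qed.

Lemma le_coord_enorm d (x : 'rV[R]_d) i : `|x 0 i| <= enorm x.
Proof.
rewrite -sqrtr_sqr ler_wsqrtr// (bigD1 i)//= lerDl.
by apply: sumr_ge0 => j _; exact: sqr_ge0.
Qed.

Lemma enorm_eq0 d (x : 'rV[R]_d) : (enorm x == 0) = (x == 0).
Proof.
apply/eqP/eqP => [x0|->]; last exact: enorm0.
apply/rowP => i; rewrite mxE; apply/eqP; rewrite -normr_le0 -x0.
exact: le_coord_enorm.
Qed.

Lemma enorm_gt0 d (x : 'rV[R]_d) : (0 < enorm x) = (x != 0).
Proof. by rewrite lt_neqAle enorm_ge0 andbT eq_sym enorm_eq0. Qed.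

Lemma enorm_sphere_proj d (x : 'rV[R]_d) : x != 0 -> enorm (sphere_proj x) = 1.
Proof.
move=> x0; rewrite /sphere_proj enormZ ger0_norm ?invr_ge0 ?enorm_ge0// mulVf//.
by rewrite enorm_eq0.
Qed.

Lemma sphere_projK d (x : 'rV[R]_d) : enorm x *: sphere_proj x = x.
Proof.
have [->|x0] := eqVneq x 0; first by rewrite enorm0 scale0r.
by rewrite /sphere_proj scalerA mulfV ?scale1r// enorm_eq0.
Qed.

Lemma measurable_enorm d : measurable_fun setT (@enorm R d).
Proof.
apply: (@measurableT_comp _ _ _ _ _ _ (@Num.sqrt R)).
  by apply: continuous_measurable_fun; exact: sqrt_continuous.
apply: measurable_sum => i.
by apply: measurable_funX; exact: measurable_entry.
Qed.

Lemma continuous_sumr (T : topologicalType) (I : Type) (r : seq I) (P : pred I)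
    (f : I -> T -> R) : (forall i, P i -> continuous (f i)) ->
  continuous (fun x => \sum_(i <- r | P i) f i x).
Proof. exact/continuous_big/(@add_continuous R). Qed.

Lemma continuous_enorm d : continuous (@enorm R d).
Proof.
move=> x; apply: (@continuous_comp _ _ _ _ (@Num.sqrt R)); last exact: sqrt_continuous.
apply: continuous_sumr => i _.
move=> y; apply: (@continuous_comp _ _ _ (fun x : 'rV[R]_d => x 0 i) (fun y : R => y ^+ 2)).
  exact: coord_continuous.
exact: exprn_continuous.
Qed.

Lemma measurable_uball d : measurable (@uball R d).
Proof.
rewrite (_ : @uball R d = setT `&` (@enorm R d) @^-1` `]-oo, 1[%classic); last first.
  by rewrite setTI; apply/seteqP; split=> x; rewrite /uball/= in_itv/=.
exact: measurable_enorm.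
Qed.

Lemma measurable_boolr (dd : measure_display) (T : measurableType dd) (b : T -> bool) :
  measurable_fun setT b -> measurable_fun setT (fun x => (b x)%:R : R).
Proof.
move=> mb; rewrite (_ : (fun x => _) = fun x => if b x then 1 else 0 : R); last first.
  by apply/funext => x; case: (b x).
by apply: measurable_fun_ifT => //; exact: measurable_cst.
Qed.

End Enorm.

(** * Differentiation rules in one variable *)

Section Calc.
Context {R : realType}.
Local Notation leb := (@lebesgue_rV R).
Local Notation mu := (@lebesgue_measure R).
Local Notation coord := (@Pilot.Defs.coord R _).
Implicit Types (f g : R -> R) (x : R).

Lemma d1D f g x (a b : R) : is_derive x (1:R) f a -> is_derive x (1:R) g b ->
  is_derive x (1:R) (fun t => f t + g t) (a + b).
Proof. by move=> ? ?; exact: is_deriveD. Qed.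

Lemma d1B f g x (a b : R) : is_derive x (1:R) f a -> is_derive x (1:R) g b ->
  is_derive x (1:R) (fun t => f t - g t) (a - b).
Proof. by move=> ? ?; exact: is_deriveB. Qed.

Lemma d1N f x (a : R) : is_derive x (1:R) f a ->
  is_derive x (1:R) (fun t => - f t) (- a).
Proof. by move=> ?; exact: is_deriveN. Qed.

Lemma d1M f g x (a b : R) : is_derive x (1:R) f a -> is_derive x (1:R) g b ->
  is_derive x (1:R) (fun t => f t * g t) (a * g x + f x * b).
Proof.
move=> fa gb; have := is_deriveM fa gb.
by move=> h; apply: is_derive_eq; rewrite addrC /GRing.scale/= mulrC.
Qed.

Lemma d1X f n x (a : R) : is_derive x (1:R) f a ->
  is_derive x (1:R) (fun t => f t ^+ n) (n%:R * f x ^+ n.-1 * a).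
Proof.
move=> fa; have := is_deriveX n fa.
have -> : (f ^+ n) = (fun t => f t ^+ n) by apply/funext => t; rewrite fctE.
by [].
Qed.

Lemma d1c (c x : R) : is_derive x (1:R) (fun _ => c) 0.
Proof. exact: is_derive_cst. Qed.

Lemma d1id x : is_derive x (1:R) (fun t => t) 1.
Proof. exact: is_derive_id. Qed.

Lemma d1Xn n x : is_derive x (1:R) (fun t => t ^+ n) (n%:R * x ^+ n.-1).
Proof. by have := d1X n (d1id x); rewrite mulr1. Qed.

Lemma d1V f x (a : R) : f x != 0 -> is_derive x (1:R) f a ->
  is_derive x (1:R) (fun t => (f t)^-1) (- a / f x ^+ 2).
Proof.
move=> fx fa; have := is_deriveV fx fa.
by move=> h; apply: is_derive_eq; rewrite /GRing.scale/= mulrC mulrN mulNr.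
Qed.

Lemma d1comp f g x (a b : R) : is_derive x (1:R) g a -> is_derive (g x) (1:R) f b ->
  is_derive x (1:R) (fun t => f (g t)) (b * a).
Proof. by move=> ga fb; exact: is_derive1_comp. Qed.

Lemma d1eq f x (a b : R) : is_derive x (1:R) f a -> a = b -> is_derive x (1:R) f b.
Proof. by move=> fa <-. Qed.

Lemma d1cont f x (a : R) : is_derive x (1:R) f a -> {for x, continuous f}.
Proof. by move=> [fd _]; exact/differentiable_continuous/derivable1_diffP. Qed.

Lemma d1E f x (a : R) : is_derive x (1:R) f a -> derive1 f x = a.
Proof. by move=> fd; rewrite derive1E derive_val. Qed.

Lemma d1derivable f x (a : R) : is_derive x (1:R) f a -> derivable f x 1.
Proof. by case. Qed.

Lemma nneg_inv_measurable (dd : measure_display) (T : measurableType dd) (f : T -> R) :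
  (forall y : T, 0 <= f y) -> measurable_fun setT f ->
  measurable_fun setT (fun y : T => (f y)^-1).
Proof.
move=> f0 mf; under eq_fun do rewrite -powR_inv1//.
exact: (measurableT_comp (measurable_powR _) mf).
Qed.
End Calc.

Section Polar.
Context {R : realType}.
Local Notation leb := (@lebesgue_rV R).
Local Notation mu := (@lebesgue_measure R).
Local Notation coord := (@Pilot.Defs.coord R _).
Local Notation mR := (measurableTypeR R).

Lemma measurable_scale_pair d (dd : measure_display) (T : measurableType dd)
    (f : T -> R) (g : T -> 'rV[R]_d) :
  measurable_fun setT f -> measurable_fun setT g ->
  measurable_fun setT (fun x => f x *: g x).
Proof.
move=> mf mg; apply: measurable_matrixP => i j; rewrite ord1; under eq_fun do rewrite mxE.
apply: measurable_funM => //.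
exact: (measurableT_comp (measurable_entry _ _) mg).
Qed.

Lemma measurable_sphere_proj d : measurable_fun setT (@sphere_proj R d).
Proof.
apply: measurable_scale_pair => //.
by apply: nneg_inv_measurable; [exact: enorm_ge0|exact: measurable_enorm].
Qed.

Lemma cvg_pinfty_invr_exp (d : nat) : (0 < d)%N -> (t ^+ d)^-1 @[t --> +oo%R] --> (0 : R).
Proof.
move=> d0; apply/cvgrPdist_le => /= e e0.
exists (Num.max 1 e^-1); split; first by rewrite num_real.
move=> t; rewrite gt_max => /andP[t1 te].
have t0 : 0 < t by apply: lt_trans t1.
rewrite sub0r normrN ger0_norm ?invr_ge0 ?exprn_ge0 ?(ltW t0)//.
rewrite -[leRHS]invrK lef_pV2 ?posrE ?exprn_gt0 ?invr_gt0//.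
by rewrite (le_trans (ltW te))// -[leLHS]expr1 ler_weXn2l// ltW.
Qed.

Lemma integral_power_tail (d : nat) (a : R) : (0 < d)%N -> 0 < a ->
  (\int[mu]_(t in `[a, +oo[) ((t ^+ d.+1)^-1)%:E = ((d%:R * a ^+ d)^-1)%:E)%E.
Proof.
move=> d0 a0.
pose F (t : R) := - (d%:R^-1 * (t ^+ d)^-1).
have dn0 : d%:R != 0 :> R by rewrite pnatr_eq0 -lt0n.
have dF (t : R) : 0 < t -> is_derive t (1 : R) F ((t ^+ d.+1)^-1).
  move=> t0; have tn0 : t != 0 by rewrite gt_eqF.
  have := d1N (d1M (d1c d%:R^-1 t) (@d1V _ (fun u => u ^+ d) _ _ (expf_neq0 d tn0) (d1Xn d t))).
  move=> h; apply: d1eq h _.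
  rewrite mul0r add0r -[in LHS](prednK d0) /= -[in RHS](prednK d0) !exprS.
  have pn0 : t ^+ d.-1 != 0 by rewrite expf_neq0.
  by rewrite (prednK d0); field; rewrite tn0 pn0 dn0.
have a0' x : a <= x -> 0 < x by exact: lt_le_trans.
rewrite (@ge0_continuous_FTC2y R _ F a 0)//.
- by rewrite /F sub0e -EFinN opprK invfM.
- by move=> x /a0' x0; rewrite invr_ge0 exprn_ge0// ltW.
- apply: continuous_in_subspaceT => x; rewrite inE/= in_itv/= andbT => /a0' x0.
  apply: (@continuous_comp _ _ _ (fun t : R => t ^+ d.+1) (@GRing.inv R)).
    exact: exprn_continuous.
  by apply: inv_continuous; rewrite expf_neq0// gt_eqF.
- rewrite -oppr0 -(mulr0 d%:R^-1); apply: cvgN; apply: cvgM; first exact: cvg_cst.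
  exact: cvg_pinfty_invr_exp.
- by move=> x /ltW/a0' x0; exact: d1derivable (dF x x0).
- by apply: cvg_at_right_filter; exact: (d1cont (dF a a0)).
- by move=> x; rewrite in_itv/= andbT => /ltW/a0' x0; exact: d1E (dF x x0).
Qed.
Definition ind (b : bool) : R := b%:R.

Lemma ind_ge0 b : 0 <= ind b. Proof. by case: b. Qed.

Lemma ge0_integral_pos_scale (r : R) (g : mR -> \bar R) : 0 < r ->
  measurable_fun setT g -> (forall x, 0 <= g x)%E ->
  (\int[mu]_t g t = r%:E * \int[mu]_t g (r * t)%R)%E.
Proof.
move=> r0 mg g0.
transitivity (r%:E * \int[mu]_t g (r * t + 0)%R)%E.
  by rewrite (@ge0_integral_affine R r 0 g)// muleA -EFinM mulfV ?mul1e// gt_eqF.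
by under eq_integral => t _ do rewrite addr0.
Qed.

(** Polar coordinates with the sphere represented by the ball. For fixed y the substitution r -> |y|
    r turns the argument r y/|y| into r y ([K2]); for fixed r the scaling y = x / r turns it into x
    ([K3]). What is left is the integral of |x|^d / r^(d+1) over r > |x|, which is 1/d. *)
Lemma ge0_polar_aux d (F : 'rV[R]_d -> \bar R) : (0 < d)%N ->
  measurable_fun setT F -> (forall x, 0 <= F x)%E ->
  (\int[mu]_r \int[leb d]_y ((ind (0 < r < 1) * r ^+ d.-1 * ind (0 < enorm y < 1))%:E * F (r *: sphere_proj y)) =
   (d%:R^-1)%:E * \int[leb d]_x ((ind (0 < enorm x < 1))%:E * F x))%E.
Proof.
move=> d0 mF F0.
have dE (z : R) : z ^+ d = z * z ^+ d.-1 by rewrite -exprS prednK.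
have mfst : measurable_fun setT (fun p : mR * 'rV[R]_d => p.1 : R) by exact: measurable_fst.
have msnd : measurable_fun setT (fun p : mR * 'rV[R]_d => p.2) by exact: measurable_snd.
have men : measurable_fun setT (fun p : mR * 'rV[R]_d => enorm p.2).
  exact: (measurableT_comp (@measurable_enorm R d) msnd).
have mlt (f g : mR * 'rV[R]_d -> R) : measurable_fun setT f -> measurable_fun setT g ->
    measurable_fun setT (fun p => ind (f p < g p)).
  by move=> mf mg; apply: measurable_boolr; exact: measurable_fun_ltr.
have mind2 (f g h k : mR * 'rV[R]_d -> R) : measurable_fun setT f -> measurable_fun setT g ->
    measurable_fun setT h -> measurable_fun setT k ->
    measurable_fun setT (fun p => ind ((f p < g p) && (h p < k p))).
  move=> mf mg mh mk; rewrite (_ : (fun p => _) = fun p => ind (f p < g p) * ind (h p < k p)).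
    by apply: measurable_funM; exact: mlt.
  by apply/funext => p; rewrite /ind -natrM mulnb.
pose B0 (y : 'rV[R]_d) := ind (0 < enorm y < 1).
pose K (p : mR * 'rV[R]_d) := ((ind (0 < p.1 < 1) * p.1 ^+ d.-1 * B0 p.2)%:E * F (p.1 *: sphere_proj p.2))%E.
have mB0 : measurable_fun setT (fun p : mR * 'rV[R]_d => B0 p.2).
  by apply: mind2 => //; exact: measurable_cst.
have mI : measurable_fun setT (fun p : mR * 'rV[R]_d => ind (0 < p.1 < 1)).
  by apply: mind2 => //; exact: measurable_cst.
have mK : measurable_fun setT K.
  apply: emeasurable_funM.
    by apply/measurable_EFinP; apply: measurable_funM => //; apply: measurable_funM => //; exact: measurable_funX.
  apply: (measurableT_comp mF); apply: measurable_scale_pair => //.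
  exact: (measurableT_comp (@measurable_sphere_proj d) msnd).
have K0 p : (0 <= K p)%E.
  apply: mule_ge0 => //; rewrite lee_fin mulr_ge0 ?ind_ge0//.
  rewrite /ind; case: (boolP (0 < p.1 < 1)) => [/andP[p0 _]|_]; last by rewrite mul0r.
  by rewrite mul1r exprn_ge0// ltW.
transitivity (\int[leb d]_y \int[mu]_r K (r, y))%E; first exact: (fubini_tonelli K).
pose K2 (p : mR * 'rV[R]_d) := ((ind (0 < p.1) * ind (p.1 * enorm p.2 < 1) * enorm p.2 ^+ d * p.1 ^+ d.-1 * B0 p.2)%:E * F (p.1 *: p.2))%E.
have mK2 : measurable_fun setT K2.
  apply: emeasurable_funM.
    apply/measurable_EFinP; apply: measurable_funM => //; apply: measurable_funM; last exact: measurable_funX.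
    apply: measurable_funM; last exact: measurable_funX.
    by apply: measurable_funM; apply: mlt => //; exact: measurable_funM.
  by apply: (measurableT_comp mF); exact: measurable_scale_pair.
have K20 p : (0 <= K2 p)%E.
  apply: mule_ge0 => //; rewrite lee_fin mulr_ge0 ?ind_ge0// -mulrA -mulrA.
  rewrite /ind; case: (boolP (0 < p.1)) => [p0|_]; last by rewrite mul0r.
  by rewrite mul1r !mulr_ge0// ?exprn_ge0 ?enorm_ge0// ltW.
transitivity (\int[leb d]_y \int[mu]_r K2 (r, y))%E.
  congr (integral _ _ _); apply/funext => y.
  have [y0|y0] := eqVneq y 0.
    rewrite !integral0_eq// => r _; rewrite /K2 /K /B0 /= y0 enorm0 /ind ltxx /= mulr0 mul0e//.
  have en0 : 0 < enorm y by rewrite enorm_gt0.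
  rewrite (@ge0_integral_pos_scale (enorm y) (fun r => K (r, y)))//; last first.
    by apply: (measurableT_comp mK); apply/measurable_fun_pair => //; exact: measurable_cst.
  rewrite -ge0_integralZl//; last 2 first.
  - apply: (measurableT_comp mK); apply/measurable_fun_pair; last exact: measurable_cst.
    by apply: measurable_funM => //; exact: measurable_cst.
  - by rewrite lee_fin ltW.
  congr (integral _ _ _); apply/funext => r; rewrite /K /K2 /= muleA -EFinM.
  rewrite (mulrC (enorm y) r) -scalerA sphere_projK; congr (_%:E * _)%E.
  rewrite (pmulr_lgt0 _ en0) exprMn dE.
  rewrite /ind; case: (0 < r) => /=; last by rewrite !mul0r mulr0.
  by case: (r * enorm y < 1) => /=; ring.
transitivity (\int[mu]_r \int[leb d]_y K2 (r, y))%E; first by apply/esym; exact: (fubini_tonelli K2).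
(* The absolute value keeps the inverse power nonnegative for r < 0, where the indicator is 0
   anyway. *)
pose K3 (p : mR * 'rV[R]_d) := ((ind (enorm p.2 < p.1) * enorm p.2 ^+ d * (`|p.1| ^+ d.+1)^-1 * B0 p.2)%:E * F p.2)%E.
have mK3 : measurable_fun setT K3.
  apply: emeasurable_funM; last exact: (measurableT_comp mF).
  apply/measurable_EFinP; apply: measurable_funM => //; apply: measurable_funM; last first.
    apply: nneg_inv_measurable; first by move=> p; rewrite exprn_ge0.
    by apply: measurable_funX; exact: (measurableT_comp (@normr_measurable R setT) mfst).
  by apply: measurable_funM; [exact: mlt|exact: measurable_funX].
have K30 p : (0 <= K3 p)%E.
  apply: mule_ge0 => //; rewrite lee_fin !mulr_ge0 ?ind_ge0 ?invr_ge0 ?exprn_ge0//.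
  exact: enorm_ge0.
transitivity (\int[mu]_r \int[leb d]_y K3 (r, y))%E.
  congr (integral _ _ _); apply/funext => r.
  have [r0|r0] := leP r 0.
    rewrite !integral0_eq// => y _; rewrite /K2 /K3 /ind /=.
      by rewrite (@le_gtF _ _ r (enorm y)) ?mul0r ?mul0e// (le_trans r0)// enorm_ge0.
    by rewrite (@le_gtF _ _ r 0)// !mul0r mul0e.
  pose H (x : 'rV[R]_d) := ((ind (enorm x < 1) * (enorm x / r) ^+ d * r ^+ d.-1 * ind (0 < enorm x < r))%:E * F x)%E.
  have me : measurable_fun setT (fun x : 'rV[R]_d => enorm x) by exact: (@measurable_enorm R d).
  have mH : measurable_fun setT H.
    apply: emeasurable_funM => //; apply/measurable_EFinP; apply: measurable_funM.
      apply: measurable_funM; last exact: measurable_cst.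
      apply: measurable_funM.
        by apply: measurable_boolr; apply: measurable_fun_ltr => //; exact: measurable_cst.
      by apply: measurable_funX; apply: measurable_funM => //; exact: measurable_cst.
    apply: measurable_boolr; apply: measurable_and.
      by apply: measurable_fun_ltr => //; exact: measurable_cst.
    by apply: measurable_fun_ltr => //; exact: measurable_cst.
  have H0 x : (0 <= H x)%E.
    by apply: mule_ge0 => //; rewrite lee_fin !mulr_ge0 ?ind_ge0 ?exprn_ge0 ?mulr_ge0 ?invr_ge0 ?enorm_ge0// ltW.
  transitivity (\int[leb d]_y H (r *: y))%E.
    congr (integral _ _ _); apply/funext => y; rewrite /K2 /H /= enormZ gtr0_norm//; congr (_%:E * _)%E.
    have e2 : (r * enorm y < r) = (enorm y < 1) by rewrite -[X in _ < X]mulr1 ltr_pM2l.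
    by rewrite /B0 /ind (mulrAC r) mulfV ?gt_eqF// mul1r r0 mul1r (pmulr_rgt0 _ r0) e2.
  rewrite (@ge0_integral_scale R d r H)// -ge0_integralZl//; last first.
    by rewrite lee_fin invr_ge0 exprn_ge0// ltW.
  congr (integral _ _ _); apply/funext => x; rewrite /H /K3 /= muleA -EFinM; congr (_%:E * _)%E.
  rewrite /B0 /ind (gtr0_norm r0) exprMn exprVn exprS !dE.
  have rn0 : r != 0 by rewrite gt_eqF.
  have pn0 : r ^+ d.-1 != 0 by rewrite expf_neq0.
  case: (0 < enorm x) => /=; last by rewrite !mulr0.
  case: (enorm x < r) => /=; last by rewrite !mulr0 !mul0r.
  by case: (enorm x < 1) => /=; rewrite ?mulr0 ?mul0r ?mulr0//; field; rewrite rn0 pn0.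
transitivity (\int[leb d]_y \int[mu]_r K3 (r, y))%E; first exact: (fubini_tonelli K3).
rewrite -ge0_integralZl//; last 2 first.
- apply: emeasurable_funM => //; apply/measurable_EFinP/measurable_boolr/measurable_and.
  - by apply: measurable_fun_ltr; [exact: measurable_cst|exact: (@measurable_enorm R d)].
  - by apply: measurable_fun_ltr; [exact: (@measurable_enorm R d)|exact: measurable_cst].
- by move=> x _; apply: mule_ge0 => //; rewrite lee_fin ind_ge0.
congr (integral _ _ _); apply/funext => x.
have [x0|x0] := eqVneq x 0.
  rewrite integral0_eq; first by rewrite x0 enorm0 /ind ltxx mul0e mule0.
  by move=> r _; rewrite /K3 /B0 /ind /= x0 enorm0 ltxx /= mulr0 mul0e.
have en0 : 0 < enorm x by rewrite enorm_gt0.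
transitivity (((enorm x ^+ d * B0 x)%:E * F x) *
    \int[mu]_r (ind (enorm x < r) * (`|r| ^+ d.+1)^-1)%:E)%E.
  rewrite -ge0_integralZl//; last 3 first.
  - apply/measurable_EFinP; apply: measurable_funM.
      by apply: measurable_boolr; apply: measurable_fun_ltr => //; exact: measurable_cst.
    apply: nneg_inv_measurable; first by move=> r; rewrite exprn_ge0.
    by apply: measurable_funX; exact: (@normr_measurable R setT).
  - by move=> r _; rewrite lee_fin mulr_ge0 ?ind_ge0 ?invr_ge0 ?exprn_ge0.
  - by apply: mule_ge0 => //; rewrite lee_fin mulr_ge0 ?ind_ge0 ?exprn_ge0 ?enorm_ge0.
  congr (integral _ _ _); apply/funext => r; rewrite /K3 /= muleAC -EFinM.
  by congr (_%:E * _)%E; ring.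
rewrite (_ : (\int[mu]_r _)%E = ((d%:R * enorm x ^+ d)^-1)%:E); last first.
  rewrite -integral_power_tail//.
  rewrite -integral_itv_obnd_cbnd; last first.
    apply/measurable_EFinP; apply: (@eq_measurable_fun _ _ _ _ _ (fun t : R => (`|t| ^+ d.+1)^-1)).
      by move=> t; rewrite inE/= in_itv/= andbT => xt; rewrite gtr0_norm// (lt_trans en0).
    apply/measurable_funTS/nneg_inv_measurable; first by move=> r; rewrite exprn_ge0.
    by apply: measurable_funX; exact: (@normr_measurable R setT).
  rewrite [in RHS]integral_mkcond; congr (integral _ _ _); apply/funext => r.
  rewrite patchE mem_setE in_itv/= andbT /ind; case: ifPn => [xr|_]; last by rewrite mul0r.
  by rewrite mul1r gtr0_norm// (lt_trans en0).
rewrite muleAC -EFinM muleA -EFinM; congr (_%:E * _)%E.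
have en : enorm x ^+ d != 0 by rewrite expf_neq0// gt_eqF.
by rewrite invfM; field; rewrite en pnatr_eq0 -lt0n d0.
Qed.
End Polar.

(** * The ball has finite measure and the origin is a null set *)

Section BallIntegral.
Context {R : realType}.
Local Notation leb := (@lebesgue_rV R).
Local Notation mu := (@lebesgue_measure R).
Local Notation coord := (@Pilot.Defs.coord R _).
Local Notation ind := (@ind R).

Lemma integral_unit_cube n :
  (\int[leb n]_x ((\prod_(i < n) ind (`|x 0 i| <= 1))%R)%:E = (2 ^+ n)%:E)%E.
Proof.
have mc k (i : 'I_k) : measurable_fun setT (fun x : 'rV[R]_k => ind (`|x 0 i| <= 1)).
  apply: measurable_boolr; apply: measurable_fun_ler; last exact: measurable_cst.
  exact: (measurableT_comp (@normr_measurable R setT) (measurable_entry _ _)).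
have mp k : measurable_fun setT (fun x : 'rV[R]_k => (\prod_(i < k) ind (`|x 0 i| <= 1))%R).
  by apply: measurable_prod => i _; exact: mc.
have p0 k (x : 'rV[R]_k) : 0 <= \prod_(i < k) ind (`|x 0 i| <= 1).
  by apply: prodr_ge0 => i _; exact: ind_ge0.
elim: n => [|n IH].
  rewrite ge0_integral_rV0; first by rewrite big_ord0 expr0.
    by apply/measurable_EFinP; exact: mp.
  by move=> x; rewrite lee_fin p0.
rewrite ge0_integral_rVS; last 2 first.
- by apply/measurable_EFinP; exact: mp.
- by move=> x; rewrite lee_fin p0.
transitivity (\int[mu]_a ((ind (`|a| <= 1))%:E * (2 ^+ n)%:E))%E.
  congr (integral _ _ _); apply/funext => a.
  rewrite -IH -ge0_integralZl//; last 3 first.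
  - by apply/measurable_EFinP; exact: mp.
  - by move=> x _; rewrite lee_fin p0.
  - by rewrite lee_fin ind_ge0.
  congr (integral _ _ _); apply/funext => x; rewrite big_ord_recl row_cons0 EFinM.
  by congr (_ * (_)%:E)%E; apply: eq_bigr => i _; rewrite row_consS.
rewrite ge0_integralZr//; last 2 first.
- apply/measurable_EFinP/measurable_boolr/measurable_fun_ler; last exact: measurable_cst.
  exact: (@normr_measurable R setT).
- by move=> x _; rewrite lee_fin ind_ge0.
rewrite (_ : (\int[mu]_x _)%E = 2%:E); first by rewrite -EFinM -exprS.
transitivity (\int[mu]_(a in `[(-1)%R, 1%R]) 1)%E.
  rewrite [in RHS]integral_mkcond; congr (integral _ _ _); apply/funext => a.
  by rewrite patchE mem_setE in_itv/= ler_norml /ind; case: ifP.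
rewrite integral_cst//= mul1e lebesgue_measure_itv/= lte_fin.
by rewrite ifT ?gtrN// -EFinB opprK.
Qed.

Lemma uball_finite d : (leb d (@uball R d) < +oo)%E.
Proof.
have -> : leb d (@uball R d) = (\int[leb d]_x (\1_(@uball R d) x : R)%:E)%E.
  by rewrite integral_indic ?setIT//; exact: measurable_uball.
apply: le_lt_trans (ltry (2 ^+ d)); rewrite -integral_unit_cube.
apply: ge0_le_integral => //.
- by apply/measurable_EFinP/measurable_indic; exact: measurable_uball.
- apply/measurable_EFinP/measurable_prod => i _.
  apply: measurable_boolr; apply: measurable_fun_ler; last exact: measurable_cst.
  exact: (measurableT_comp (@normr_measurable R setT) (measurable_entry _ _)).
- move=> x _; rewrite lee_fin indicE; case: (boolP (x \in _)) => [|_]; last first.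
    by apply: prodr_ge0 => i _; exact: ind_ge0.
  rewrite inE /uball/= => x1; rewrite big1// => i _.
  by rewrite /ind (le_trans (le_coord_enorm x i))// ltW.
Qed.

Lemma measurable_rV_set0 d : measurable [set (0 : 'rV[R]_d)].
Proof.
rewrite (_ : [set 0] = setT `&` (@enorm R d) @^-1` [set 0]); last first.
  rewrite setTI; apply/seteqP; split=> x /= => [->|/eqP]; first exact: enorm0.
  by rewrite enorm_eq0 => /eqP.
exact: (@measurable_enorm R d).
Qed.

(** The origin is fixed by the dilation of ratio 2, so its finite measure is 2^(-d) times itself. *)
Lemma lebesgue_rV_set0 d : (0 < d)%N -> leb d [set 0] = 0%E.
Proof.
move=> d0.
have m0 := @measurable_rV_set0 d.
have fin : leb d [set 0] \is a fin_num.
  rewrite ge0_fin_numE//; apply: le_lt_trans (uball_finite d).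
  apply: le_measure; rewrite ?inE//; first exact: measurable_uball.
  by move=> x ->; rewrite /uball/= enorm0.
pose f (x : 'rV[R]_d) : \bar R := (\1_[set (0 : 'rV[R]_d)] x)%:E.
have i0 : (\int[leb d]_x f x = leb d [set 0%R])%E by rewrite integral_indic// setIT.
have mf : measurable_fun setT f by apply/measurable_EFinP/measurable_indic.
have f0 x : (0 <= f x)%E by rewrite lee_fin.
have := @ge0_integral_scale R d 2 f (ltr0n _ 2) mf f0.
rewrite i0 (_ : (\int[leb d]_x _)%E = leb d [set 0]); last first.
  rewrite -i0; congr (integral _ _ _); apply/funext => x; rewrite /f !indicE.
  congr ((_ : bool)%:R)%:E.
  by apply/idP/idP; rewrite !inE/= => /eqP; rewrite ?scaler_eq0 ?pnatr_eq0/= => /eqP ->; rewrite ?scaler0.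
rewrite -(fineK fin) -EFinM => -[] e; congr EFin.
apply/eqP; rewrite -(mulrI_eq0 _ (_ : GRing.lreg (1 - (2 ^+ d)^-1))).
  by rewrite mulrBl mul1r -e subrr.
apply/mulfI; rewrite subr_eq0 eq_sym invr_eq1.
by rewrite gt_eqF// exprn_egt1// ?ltr1n// -lt0n.
Qed.
End BallIntegral.

(** * Integrals of bounded functions over the ball and over the sphere *)

Section BallCalculus.
Context {R : realType}.
Local Notation leb := (@lebesgue_rV R).
Local Notation mu := (@lebesgue_measure R).
Local Notation coord := (@Pilot.Defs.coord R _).
Local Notation ind := (@ind R).

Lemma rV_norm_le d (x : 'rV[R]_d) (e : R) : 0 <= e -> (forall i, `|x 0 i| <= e) -> `|x| <= e.
Proof.
move=> e0 h; rewrite [leLHS]/Num.norm/= mx_normrE; apply/bigmax_leP; split=> // -[i j] _ /=.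
by rewrite ord1.
Qed.

(** The sigma-algebra on row vectors is generated by the coordinates, not by the topology. Rounding
    the coordinates down to the grid of mesh 1/(k+1) gives functions with countably many values on
    measurable cells, and f is their pointwise limit. *)
Lemma continuous_measurable_rV d (f : 'rV[R]_d -> R) : continuous f -> measurable_fun setT f.
Proof.
move=> cf.
pose q (k : nat) (x : 'rV[R]_d) : 'rV[int]_d := \row_i Num.floor (k.+1%:R * x 0 i).
pose g (k : nat) (z : 'rV[int]_d) : 'rV[R]_d := \row_i ((z 0 i)%:~R / k.+1%:R).
apply: (@measurable_fun_cvg _ _ _ _ (fun k x => f (g k (q k x)))); last first.
  move=> x _; apply: (@cvg_comp _ _ _ (fun k => g k (q k x)) f _ (nbhs x)); last exact: cf.
  apply/cvgrPdist_le => e e0; near=> k.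
  apply: rV_norm_le; first exact: ltW.
  move=> i; rewrite !mxE.
  have k0 : 0 < k.+1%:R :> R by rewrite ltr0n.
  have /andP[h1 h2] := floor_itv (k.+1%:R * x 0 i).
  have -> : x 0 i - (Num.floor (k.+1%:R * x 0 i))%:~R / k.+1%:R =
    (k.+1%:R * x 0 i - (Num.floor (k.+1%:R * x 0 i))%:~R) / k.+1%:R.
    by rewrite mulrBl mulrAC mulfV ?mul1r// gt_eqF.
  rewrite normrM normfV (gtr0_norm k0) ger0_norm ?subr_ge0//.
  rewrite ler_pdivrMr//; apply: (@le_trans _ _ 1).
    by rewrite lerBlDl; move: h2; rewrite intrD => /ltW.
  rewrite -ler_pdivrMr// mul1r; apply: ltW.
  by near: k; exact: (near_infty_natSinv_lt (PosNum e0)).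
move=> k _ B mB; rewrite setTI.
rewrite (_ : _ @^-1` B = \bigcup_(z : 'rV[int]_d) (if f (g k z) \in B then q k @^-1` [set z] else set0)); last first.
  apply/seteqP; split=> x /=.
    by move=> fB; exists (q k x) => //; rewrite mem_set.
  by move=> [z _]; case: ifPn => // /set_mem fB /= ->.
apply: countable_bigcupT_measurable => [|z]; first exact: countableP.
case: ifPn => // _.
rewrite (_ : _ @^-1` _ = \bigcap_(i in [set: 'I_d]) (fun x : 'rV[R]_d => x 0 i) @^-1` ((fun t => k.+1%:R * t) @^-1` `[(z 0 i)%:~R, (z 0 i + 1)%:~R[)).
  apply: fin_bigcap_measurable => // i _.
  rewrite -[X in measurable X]setTI; apply: measurable_entry => //.
  rewrite -[X in measurable X]setTI; exact: (measurable_funM (@measurable_cst _ _ _ _ _ _) (@measurable_id _ _ _)).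
apply/seteqP; split=> x /=.
  by move=> <- i _ /=; rewrite in_itv/= !mxE floor_itv.
move=> h; apply/rowP => i; rewrite mxE; apply: floor_def.
by have := h i Logic.I; rewrite /= in_itv.
Unshelve. all: by end_near. Qed.

Lemma compact_cball d (r : R) : compact [set x : 'rV[R]_d | enorm x <= r].
Proof.
apply: bounded_closed_compact.
  exists r; split; first exact: num_real.
  move=> M rM x /= xr; have M0 : 0 <= M by rewrite (le_trans _ (ltW rM))// (le_trans _ xr)// enorm_ge0.
  by apply: rV_norm_le => // i; rewrite (le_trans (le_coord_enorm _ _))// (le_trans xr)// ltW.
rewrite (_ : [set _ | _] = (@enorm R d) @^-1` [set t | t <= r])//.
by apply: closed_comp; [move=> x _; exact: continuous_enorm|exact: closed_le].
Qed.

Lemma continuous_cball_bounded d (f : 'rV[R]_d -> R) (r : R) : continuous f ->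
  exists2 M, 0 <= M & forall x, enorm x <= r -> `|f x| <= M.
Proof.
move=> cf.
have [M [_ h]] : bounded_set (f @` [set x : 'rV[R]_d | enorm x <= r]).
  apply: compact_bounded; apply: continuous_compact; last exact: compact_cball.
  exact: continuous_subspaceT.
exists (Num.max 0 (M + 1)); first by rewrite le_max lexx.
move=> x xr; apply: (h (Num.max 0 (M + 1))); last by exists x.
by rewrite lt_max ltrDl ltr01 orbT.
Qed.

(* Bounded measurable on the ball: the functions that [BI] handles. *)
Definition bm d (f : 'rV[R]_d -> R) : Prop :=
  measurable_fun setT f /\ exists M, forall x, enorm x < 1 -> `|f x| <= M.

Definition BI d (f : 'rV[R]_d -> R) : R := \int[leb d]_(x in @uball R d) f x.

Section bm_theory.
Context (d : nat).
Implicit Types f g : 'rV[R]_d -> R.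

Lemma bm_continuous f : continuous f -> bm f.
Proof.
move=> cf; split; first exact: continuous_measurable_rV.
have [M _ h] := continuous_cball_bounded 1 cf.
by exists M => x /ltW; exact: h.
Qed.

Lemma bm_cst (c : R) : bm (fun _ : 'rV[R]_d => c).
Proof. by split; [exact: measurable_cst|exists `|c|]. Qed.

Lemma bmD f g : bm f -> bm g -> bm (fun x => f x + g x).
Proof.
move=> [mf [M hM]] [mg [N hN]]; split; first exact: measurable_funD.
by exists (M + N) => x x1; rewrite (le_trans (ler_normD _ _))// lerD ?hM ?hN.
Qed.

Lemma bmM f g : bm f -> bm g -> bm (fun x => f x * g x).
Proof.
move=> [mf [M hM]] [mg [N hN]]; split; first exact: measurable_funM.
by exists (M * N) => x x1; rewrite normrM ler_pM ?hM ?hN.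
Qed.

Lemma bmZ f (c : R) : bm f -> bm (fun x => c * f x).
Proof. exact/bmM/bm_cst. Qed.

Lemma bmN f : bm f -> bm (fun x => - f x).
Proof.
by move=> bf; have := bmZ (-1) bf; under [X in bm X -> _]eq_fun do rewrite mulN1r.
Qed.

Lemma bmB f g : bm f -> bm g -> bm (fun x => f x - g x).
Proof. by move=> bf bg; apply: bmD => //; exact: bmN. Qed.

Lemma bmX f n : bm f -> bm (fun x => f x ^+ n).
Proof.
move=> bf; elim: n => [|n IH]; first exact: bm_cst.
by under eq_fun do rewrite exprS; exact: bmM.
Qed.

Lemma bm_sum (I : Type) (r : seq I) (P : pred I) (F : I -> 'rV[R]_d -> R) :
  (forall i, P i -> bm (F i)) -> bm (fun x => \sum_(i <- r | P i) F i x).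
Proof.
move=> h; elim: r => [|i r IH]; first by under eq_fun do rewrite big_nil; exact: bm_cst.
under eq_fun do rewrite big_cons.
by case: (boolP (P i)) => // Pi; apply: bmD => //; exact: h.
Qed.

Lemma bm_integrable f : bm f -> (leb d).-integrable (@uball R d) (EFin \o f).
Proof.
move=> [mf [M hM]]; apply: measurable_bounded_integrable.
- exact: measurable_uball.
- exact: uball_finite.
- exact: measurable_funTS.
- exists M; split; first exact: num_real.
  by move=> N MN x /= x1; rewrite (le_trans (hM x x1))// ltW.
Qed.

Lemma BID f g : bm f -> bm g -> BI (fun x => f x + g x) = BI f + BI g.
Proof. by move=> bf bg; rewrite /BI RintegralD//; [exact: measurable_uball|exact: bm_integrable|exact: bm_integrable]. Qed.

Lemma BIZ f c : bm f -> BI (fun x => c * f x) = c * BI f.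
Proof. by move=> bf; rewrite /BI RintegralZl//; [exact: measurable_uball|exact: bm_integrable]. Qed.

Lemma BIN f : bm f -> BI (fun x => - f x) = - BI f.
Proof.
by move=> bf; rewrite -mulN1r -BIZ//; congr BI; apply/funext => x; rewrite mulN1r.
Qed.

Lemma BIB f g : bm f -> bm g -> BI (fun x => f x - g x) = BI f - BI g.
Proof. by move=> bf bg; rewrite BID ?BIN//; exact: bmN. Qed.

Lemma BI_sum (I : Type) (r : seq I) (P : pred I) (F : I -> 'rV[R]_d -> R) :
  (forall i, P i -> bm (F i)) ->
  BI (fun x => \sum_(i <- r | P i) F i x) = \sum_(i <- r | P i) BI (F i).
Proof.
move=> h; elim: r => [|i r IH].
  rewrite big_nil /BI (_ : (fun x => _) = cst 0) ?Rintegral0//.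
    by rewrite Rintegral_cst ?mul0r//; exact: measurable_uball.
  by apply/funext => x; rewrite big_nil.
rewrite big_cons -IH; under eq_fun do rewrite big_cons.
by case: (boolP (P i)) => // Pi; rewrite BID//; [exact: h|exact: bm_sum].
Qed.

(** The origin is left out because [sphere_proj] sends it to 0, off the sphere, where functions
    given on the sphere are unspecified. *)
Lemma BI_eq f g : (0 < d)%N -> bm f -> bm g ->
  (forall x, enorm x < 1 -> x != 0 -> f x = g x) -> BI f = BI g.
Proof.
move=> d0 bf bg fg; rewrite /BI /Rintegral; congr fine; apply: ae_eq_integral.
- exact: measurable_uball.
- by apply/measurable_funTS/measurable_EFinP; case: bf.
- by apply/measurable_funTS/measurable_EFinP; case: bg.
exists [set 0]; split; first exact: measurable_rV_set0.
- exact: lebesgue_rV_set0.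
- move=> x /= h; apply: contrapT => x0; apply: h => x1; congr EFin; apply: fg => //.
  exact/eqP.
Qed.

Lemma BI_le f g : bm f -> bm g -> (forall x, enorm x < 1 -> f x <= g x) -> BI f <= BI g.
Proof. by move=> bf bg fg; apply: le_Rintegral => //; [exact: measurable_uball|exact: bm_integrable|exact: bm_integrable]. Qed.

Lemma BI_ge0 f : (forall x, enorm x < 1 -> 0 <= f x) -> 0 <= BI f.
Proof. by move=> f0; exact: Rintegral_ge0. Qed.

End bm_theory.

Section families.
Context (d : nat).
Implicit Types h : R -> 'rV[R]_d -> R.

(* Parametrized integrands that are continuous in the parameter and bounded
   locally uniformly. *)
Definition bmfam h : Prop :=
  [/\ forall r, bm (h r),
      forall y, enorm y < 1 -> continuous (h^~ y) &
      forall u : R, exists M, forall r y, `|r| <= u -> enorm y < 1 -> `|h r y| <= M].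

Lemma BI_continuous h : bmfam h -> continuous (fun r => BI (h r)).
Proof.
move=> [bh ch ubh] r.
have [M hM] := ubh (`|r| + 1).
have := @continuity_under_integral R _ _ (leb d) h (@uball R d) (@measurable_uball R d)
   (r - 1) (r + 1) _ _ (fun=> M) _ _ r.
apply => //.
- by move=> x _; exact: bm_integrable.
- by apply: aeW => y y1 x _; exact: ch.
- exact: bm_integrable (bm_cst _ _).
- move=> x; rewrite /= in_itv/= => /andP[x1 x2]; apply: aeW => y y1; apply: hM => //.
  rewrite ler_norml; have := ler_norm r; have := ler_norm (- r); rewrite normrN; lra.
- by rewrite inE/= in_itv/=; lra.
Qed.

Lemma BI_derive h h' : bmfam h -> bmfam h' ->
  (forall r y, enorm y < 1 -> is_derive r (1:R) (h^~ y) (h' r y)) ->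
  forall r, is_derive r (1:R) (fun r => BI (h r)) (BI (h' r)).
Proof.
move=> [bh ch ubh] [bh' ch' ubh'] dh r.
have [M hM] := ubh' (`|r| + 1).
have p1 s y : enorm y < 1 -> partial1of2 h s y = h' s y.
  by move=> y1; rewrite /partial1of2; exact: d1E (dh s y y1).
have Ir : (`]r - 1, r + 1[%classic : set R) r by rewrite /= in_itv/=; lra.
have HH : forall x y, `]r - 1, r + 1[%classic x -> (@uball R d) y -> `|partial1of2 h x y| <= Num.max 0 M.
  move=> x y; rewrite /= in_itv/= => /andP[x1 x2] y1; rewrite p1// le_max hM ?orbT//.
  rewrite ler_norml; have := ler_norm r; have := ler_norm (- r); rewrite normrN; lra.
have H1 : forall x, `]r - 1, r + 1[%classic x -> (leb d).-integrable (@uball R d) (EFin \o h x).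
  by move=> x _; exact: bm_integrable.
have H2 : forall x y, `]r - 1, r + 1[%classic x -> (@uball R d) y -> derivable (h^~ y) x 1.
  by move=> x y _ y1; exact: d1derivable (dh x y y1).
have H3 : (leb d).-integrable (@uball R d) (EFin \o (fun=> Num.max 0 M)) by exact: bm_integrable (bm_cst _ _).
have H4 : forall y : 'rV[R]_d, 0 <= Num.max 0 M by move=> y; rewrite le_max lexx.
have dv := @derivable_under_integral R _ _ (leb d) h (@uball R d) (@measurable_uball R d)
   r (r - 1) (r + 1) Ir H1 H2 (fun=> Num.max 0 M) H4 H3 HH.
have de := @differentiation_under_integral R _ _ (leb d) h (@uball R d) (@measurable_uball R d)
   r (r - 1) (r + 1) Ir H1 H2 (fun=> Num.max 0 M) H4 H3 HH.
apply: DeriveDef; first exact: dv.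
rewrite -derive1E; transitivity (\int[leb d]_(y in @uball R d) partial1of2 h r y); first exact: de.
by apply: eq_Rintegral => y; rewrite inE => y1; exact: p1.
Qed.
End families.

Section polar_real.
Context (d : nat) (d0 : (0 < d)%N).
Implicit Types f : 'rV[R]_d -> R.

(** Surface integral in the encoding of [sphere_integral]: the integrand is extended to the ball as
    a function of x/|x|, whose radial integral contributes 1/d. *)
Definition SI f : R := d%:R * BI (f \o @sphere_proj R d).

Lemma enorm_sphere_proj_le (x : 'rV[R]_d) : enorm (sphere_proj x) <= 1.
Proof.
have [->|x0] := eqVneq x 0; last by rewrite enorm_sphere_proj.
by rewrite /sphere_proj scaler0 enorm0.
Qed.

Lemma bm_sphere_proj f : continuous f -> bm (f \o @sphere_proj R d).
Proof.
move=> cf; split.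
  exact: (measurableT_comp (continuous_measurable_rV cf) (@measurable_sphere_proj R d)).
have [M _ hM] := continuous_cball_bounded 1 cf.
by exists M => x _; apply: hM; exact: enorm_sphere_proj_le.
Qed.

Lemma continuous_scale_rV (r : R) : continuous (fun x : 'rV[R]_d => r *: x).
Proof. exact: scaler_continuous. Qed.

Lemma continuous_scale_rVl (x : 'rV[R]_d) : continuous (fun r : R => r *: x).
Proof. exact: scalel_continuous. Qed.

Lemma bmfam_sphere f : continuous f ->
  bmfam (fun r y => f (r *: sphere_proj y)).
Proof.
move=> cf; split.
- move=> r; apply: (@bm_sphere_proj (fun x => f (r *: x))).
  exact: (ccomp (@continuous_scale_rV r) cf).
- move=> y _ r; exact: (ccomp (@continuous_scale_rVl (sphere_proj y)) cf).
- move=> u; have [M _ hM] := continuous_cball_bounded u cf.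
  exists M => r y ru _; apply: hM; rewrite enormZ; apply: le_trans ru.
  by rewrite ler_piMr// enorm_sphere_proj_le.
Qed.

Lemma SI_continuous f : continuous f -> continuous (fun r : R => SI (fun x => f (r *: x))).
Proof. by move=> cf; exact: (cM (@cC _ _ _) (BI_continuous (bmfam_sphere cf))).
Qed.

Lemma BI_EFin f : bm f -> (BI f)%:E = (\int[leb d]_(x in @uball R d) (f x)%:E)%E.
Proof.
move=> bf; rewrite /BI /Rintegral fineK//.
by apply: integrable_fin_num; [exact: measurable_uball|exact: bm_integrable].
Qed.

Lemma BI_punctured f : bm f ->
  (\int[leb d]_x ((ind (0 < enorm x < 1))%:E * (f x)%:E) = (BI f)%:E)%E.
Proof.
move=> bf; pose f1 x := ind (x != 0) * f x.
have bf1 : bm f1.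
  apply: bmM => //.
  split; last by exists 1 => x _; rewrite /ind; case: (x != 0); rewrite ?normr1 ?normr0.
  rewrite (_ : (fun x => _) = fun x : 'rV[R]_d => ind (0 < enorm x)); last first.
    by apply/funext => x; rewrite enorm_gt0.
  apply: measurable_boolr; apply: measurable_fun_ltr; first exact: measurable_cst.
  exact: (@measurable_enorm R d).
rewrite (BI_eq (f:=f) (g:=f1) d0)//; last first.
  by move=> x _ x0; rewrite /f1 x0 /ind mul1r.
rewrite BI_EFin// [in RHS]integral_mkcond; congr (integral _ _ _); apply/funext => x.
rewrite patchE -EFinM enorm_gt0 /ind /f1.
rewrite [_ \in _](_ : _ = (enorm x < 1)); last by apply/idP/idP; rewrite inE.
by case: (enorm x < 1); case: (x != 0); rewrite /= ?mul1r ?mul0r.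
Qed.

Lemma continuous_measurable_E (g : R -> R) (D : set R) : continuous g ->
  measurable_fun D (EFin \o g).
Proof.
by move=> cg; apply/measurable_EFinP/measurable_funTS; exact: continuous_measurable_fun cg.
Qed.

Lemma continuous_polar f : continuous f ->
  continuous (fun r : R => r ^+ d.-1 * SI (fun x => f (r *: x))).
Proof. by move=> cf; exact: (cM (@exprn_continuous _ _) (SI_continuous cf)). Qed.

Lemma ge0_BI_polar f : continuous f -> (forall x, 0 <= f x) ->
  ((BI f)%:E = \int[mu]_(r in `]0%R, 1%R[) (r ^+ d.-1 * SI (fun x => f (r *: x)))%:E)%E.
Proof.
move=> cf f0.
have mf : measurable_fun setT (fun x => (f x)%:E).
  by apply/measurable_EFinP; exact: continuous_measurable_rV.
have := ge0_polar_aux d0 mf (fun x => f0 x : (0%:E <= (f x)%:E)%E).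
rewrite (BI_punctured (bm_continuous cf)) => e.
have -> : (BI f)%:E = (d%:R%:E * ((d%:R)^-1%:E * (BI f)%:E))%E.
  have dn0 : d%:R != 0 :> R by rewrite pnatr_eq0 -lt0n.
  by rewrite -!EFinM mulrA mulfV// mul1r.
rewrite -e; pose B r := BI (fun y => f (r *: sphere_proj y)).
have [bB cB _] := bmfam_sphere cf.
have B0 r : 0 <= B r by apply: BI_ge0.
transitivity (d%:R%:E * \int[mu]_r (ind (0 < r < 1) * (r ^+ d.-1 * B r))%:E)%E.
  congr (_ * _)%E; congr (integral _ _ _); apply/funext => r.
  rewrite /B mulrA [RHS]EFinM -(BI_punctured (bB r)).
  have rd : 0 <= ind (0 < r < 1) * r ^+ d.-1.
    rewrite /ind; case: (boolP (0 < r < 1)) => [/andP[r0 _]|_]; last by rewrite mul0r.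
    by rewrite mul1r exprn_ge0// ltW.
  rewrite -ge0_integralZl//; last 2 first.
  - apply: emeasurable_funM; apply/measurable_EFinP; last by case: (bB r).
    apply: measurable_boolr; apply: measurable_and.
      by apply: measurable_fun_ltr; [exact: measurable_cst|exact: (@measurable_enorm R d)].
    by apply: measurable_fun_ltr; [exact: (@measurable_enorm R d)|exact: measurable_cst].
  - by move=> y _; rewrite -EFinM lee_fin mulr_ge0// ind_ge0.
  by congr (integral _ _ _); apply/funext => y; rewrite muleA -EFinM.
transitivity (d%:R%:E * \int[mu]_(r in `]0%R, 1%R[) (r ^+ d.-1 * B r)%:E)%E.
  congr (_ * _)%E; rewrite [in RHS]integral_mkcond; congr (integral _ _ _); apply/funext => r.
  by rewrite patchE mem_setE in_itv/= /ind; case: ifP => _; rewrite ?mul1r ?mul0r.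
have cB1 : continuous (fun r : R => r ^+ d.-1 * B r).
  exact: (cM (@exprn_continuous _ _) (BI_continuous (bmfam_sphere cf))).
rewrite -ge0_integralZl//; last 2 first.
- exact: continuous_measurable_E.
- by move=> r; rewrite /= in_itv/= => /andP[r0 _]; rewrite lee_fin mulr_ge0// exprn_ge0// ltW.
by apply: eq_integral => r _; rewrite -EFinM; congr EFin; rewrite /SI mulrCA.
Qed.

Lemma integrable_continuous01 (g : R -> R) : continuous g -> mu.-integrable `]0, 1[ (EFin \o g).
Proof.
move=> cg; apply: (@integrableS _ _ _ mu `[0, 1]) => //.
  exact: subset_itv_oo_cc.
apply: continuous_compact_integrable; first exact: segment_compact.
exact: continuous_subspaceT.
Qed.

Lemma BI_polar f : continuous f ->
  BI f = \int[mu]_(r in `]0, 1[) (r ^+ d.-1 * SI (fun x => f (r *: x))).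
Proof.
move=> cf.
pose f1 x : R := (`|f x| + f x) / 2; pose f2 x : R := (`|f x| - f x) / 2.
have fE x : f x = f1 x - f2 x by rewrite /f1 /f2; lra.
have cf1 : continuous f1 by exact: (cM (cD (cnorm cf) cf) (@cC _ _ _)).
have cf2 : continuous f2 by exact: (cM (cB (cnorm cf) cf) (@cC _ _ _)).
have step (g : 'rV[R]_d -> R) : continuous g -> (forall x, 0 <= g x) ->
    BI g = \int[mu]_(r in `]0, 1[) (r ^+ d.-1 * SI (fun x => g (r *: x))).
  by move=> cg g0; rewrite /Rintegral -ge0_BI_polar.
have -> : BI f = BI f1 - BI f2.
  by rewrite -BIB//; [congr BI; apply/funext|exact: bm_continuous|exact: bm_continuous].
rewrite (step f1)//; last by move=> x; rewrite /f1; have := ler_norm (- f x); rewrite normrN; lra.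
rewrite (step f2)//; last by move=> x; rewrite /f2; have := ler_norm (f x); lra.
rewrite -RintegralB//; last 2 first.
- exact/integrable_continuous01/continuous_polar.
- exact/integrable_continuous01/continuous_polar.
apply: eq_Rintegral => r _; rewrite -mulrBr; congr (_ * _); rewrite /SI -mulrBr; congr (_ * _).
have [b1 _ _] := bmfam_sphere cf1; have [b2 _ _] := bmfam_sphere cf2.
by rewrite -BIB//; [congr BI; apply/funext => x; rewrite /= fE|exact: b1|exact: b2].
Qed.

End polar_real.
End BallCalculus.

(** * The radial equation *)

Section Primitive.
Context {R : realType}.
Local Notation mu := (@lebesgue_measure R).
Implicit Types (f g F : R -> R) (a b c x y z r s t : R).

Lemma continuous_integrable_itv f (a b : R) : continuous f -> mu.-integrable `[a, b] (EFin \o f).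
Proof.
move=> cf; apply: continuous_compact_integrable; first exact: segment_compact.
exact: continuous_subspaceT.
Qed.

(* The lower bound -1 makes the primitive differentiable at 0. *)
Definition prim f (x : R) : R :=
  \int[mu]_(t in `[(-1), x]) f t - \int[mu]_(t in `[(-1), 0]) f t.

Lemma prim_derive f (x : R) : continuous f -> -1 < x -> is_derive x (1:R) (prim f) (f x).
Proof.
move=> cf x1.
have [dF eF] := @continuous_FTC1_closed R f (-1) x (x + 1) (ltr_pwDr ltr01 (lexx x))
  (continuous_integrable_itv _ _ cf) x1 (cf x).
have : is_derive x (1:R) (fun y => \int[mu]_(t in `[(-1), y]) f t) (f x).
  by apply: DeriveDef; [exact: dF|rewrite -derive1E eF].
by move=> h; have := d1B h (d1c (\int[mu]_(t in `[(-1), 0]) f t) x); rewrite subr0.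
Qed.

Lemma prim0 f : prim f 0 = 0.
Proof. by rewrite /prim subrr. Qed.

Definition II f : R := \int[mu]_(r in `]0, 1[) f r.

Lemma II_FTC f F : continuous f ->
  (forall x, 0 <= x <= 1 -> is_derive x (1:R) F (f x)) -> II f = F 1 - F 0.
Proof.
move=> cf dF.
have cF x : 0 <= x <= 1 -> {for x, continuous F} by move=> /dF; exact: d1cont.
rewrite /II /Rintegral.
rewrite integral_itv_bndo_bndc; last first.
  by apply/measurable_EFinP/measurable_funTS; exact: continuous_measurable_fun cf.
rewrite integral_itv_obnd_cbnd; last first.
  by apply/measurable_EFinP/measurable_funTS; exact: continuous_measurable_fun cf.
rewrite (@continuous_FTC2 _ f F)//; first exact: continuous_subspaceT.
- split.
  + by move=> x; rewrite in_itv/= => /andP[x0 x1]; apply: (d1derivable (dF x _)); rewrite !ltW.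
  + by apply: cvg_at_right_filter; apply: cF; rewrite lexx ler01.
  + by apply: cvg_at_left_filter; apply: cF; rewrite lexx ler01.
- by move=> x; rewrite in_itv/= => /andP[x0 x1]; apply: (d1E (dF x _)); rewrite !ltW.
Qed.

Lemma prim1 f : continuous f -> prim f 1 = II f.
Proof.
move=> cf; have dp x : 0 <= x <= 1 -> is_derive x (1:R) (prim f) (f x).
  by move=> /andP[x0 _]; apply: prim_derive => //; rewrite (lt_le_trans _ x0)// ltrN10.
by rewrite (II_FTC cf dp) prim0 subr0.
Qed.

Lemma integrable_II f : continuous f -> mu.-integrable `]0, 1[ (EFin \o f).
Proof.
move=> cf; apply: (@integrableS _ _ _ mu `[0, 1]) => //.
  exact: subset_itv_oo_cc.
exact: continuous_integrable_itv.
Qed.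

Lemma II_D f g : continuous f -> continuous g -> II (fun x => f x + g x) = II f + II g.
Proof. by move=> cf cg; rewrite /II RintegralD//; exact: integrable_II. Qed.

Lemma II_Z f c : continuous f -> II (fun x => c * f x) = c * II f.
Proof. by move=> cf; rewrite /II RintegralZl//; exact: integrable_II. Qed.

Lemma II_B f g : continuous f -> continuous g -> II (fun x => f x - g x) = II f - II g.
Proof. by move=> cf cg; rewrite /II RintegralB//; exact: integrable_II. Qed.

Lemma II_le f g : continuous f -> continuous g -> (forall x, 0 < x < 1 -> f x <= g x) -> II f <= II g.
Proof.
move=> cf cg fg; by apply: le_Rintegral => //; exact: integrable_II.
Qed.

Lemma II_ge0 f : (forall x, 0 < x < 1 -> 0 <= f x) -> 0 <= II f.
Proof. by move=> f0; apply: Rintegral_ge0 => x; rewrite /= in_itv; exact: f0. Qed.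

Lemma II_eq f g : (forall x, 0 < x < 1 -> f x = g x) -> II f = II g.
Proof. by move=> fg; apply: eq_Rintegral => x; rewrite inE/= in_itv; exact: fg. Qed.

Lemma II_cst c : II (fun=> c) = c.
Proof.
have dc x : 0 <= x <= 1 -> is_derive x (1:R) (fun x => c * x) c.
  by move=> _; have := d1M (d1c c x) (d1id x); rewrite mul0r add0r mulr1.
by rewrite (II_FTC (@cst_continuous _ _ c) dc) mulr1 mulr0 subr0.
Qed.

Lemma nondecreasing_from_derive F (f : R -> R) (a b : R) :
  {within `[a, b], continuous F} ->
  (forall x, a < x < b -> is_derive x (1:R) F (f x)) ->
  (forall x, a < x < b -> 0 <= f x) ->
  forall x y, a <= x -> x <= y -> y <= b -> F x <= F y.
Proof.
move=> cF dF f0 x y ax xy yb; apply: (@ger0_derive1_le_cc R F a b) => //.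
- by move=> z; rewrite in_itv/= => zab; exact: d1derivable (dF z zab).
- by move=> z; rewrite in_itv/= => zab; rewrite (d1E (dF z zab)) f0.
- by rewrite in_itv/= ax (le_trans xy).
- by rewrite in_itv/= yb (le_trans ax).
Qed.

End Primitive.

(** * Energy estimates for the radial equation *)

Section RadialODE.
Context {R : realType}.
Local Notation mu := (@lebesgue_measure R).
Implicit Types (x y z r s t : R).

(* [a] and [b] are the coefficients on a spherical harmonic of degree [j] of
   a function w and of Laplacian w + E w on R^(k+2): integrating the latter
   against the solid harmonic over the ball of radius r gives the equation. *)
Record radial (j k : nat) (E : R) (a a' b : R -> R) : Prop := Radial {
  rad_da : forall r, is_derive r (1:R) a (a' r);
  rad_ca' : continuous a';
  rad_cb : continuous b;
  rad_eq : forall r, 0 < r <= 1 ->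
    r ^+ (j + k).+1 * a' r - j%:R * r ^+ (j + k) * a r =
    prim (fun s => s ^+ (j + k).+1 * (b s - E * a s)) r }.

Lemma continuous_segment_bounded (f : R -> R) : continuous f ->
  exists2 M, 0 <= M & forall x, 0 <= x <= 1 -> `|f x| <= M.
Proof.
move=> cf.
have [M [_ h]] : bounded_set (f @` `[0, 1]%classic).
  apply: compact_bounded; apply: continuous_compact; last exact: segment_compact.
  exact: continuous_subspaceT.
exists (Num.max 0 (M + 1)); first by rewrite le_max lexx.
move=> x x01; apply: (h (Num.max 0 (M + 1))); last by exists x; rewrite //= in_itv.
by rewrite lt_max ltrDl ltr01 orbT.
Qed.

Lemma prim_pow_bound (f : R -> R) (n : nat) (M : R) : continuous f ->
  (forall x, 0 <= x <= 1 -> `|f x| <= M * x ^+ n) ->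
  forall r, 0 <= r <= 1 -> `|prim f r| <= M * r ^+ n.+1.
Proof.
move=> cf fM r /andP[r0 r1].
have cp : {within `[0, r], continuous (prim f)}.
  apply: continuous_in_subspaceT => x; rewrite inE/= in_itv/= => /andP[x0 _].
  by apply: d1cont; apply: prim_derive => //; rewrite (lt_le_trans _ x0)// ltrN10.
have [|c] := @MVT_segment R (prim f) f 0 r r0 _ cp.
  move=> x; rewrite in_itv/= => /andP[x0 _].
  by apply: prim_derive => //; rewrite (lt_trans _ x0)// ltrN10.
rewrite in_itv/= prim0 !subr0 => /andP[c0 cr] ->.
have M0 : 0 <= M.
  by have := fM 1; rewrite expr1n mulr1 lexx ler01 => /(_ isT); exact: le_trans.
rewrite normrM (ger0_norm r0) exprSr mulrA ler_wpM2r//.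
rewrite (le_trans (fM c _)) ?c0 ?(le_trans cr)//.
by rewrite ler_wpM2l// lerXn2r.
Qed.

Section theory.
Context (j k : nat) (E : R) (a a' b : R -> R) (rad : radial j k E a a' b).

Lemma rad_ca : continuous a.
Proof. by move=> r; exact: d1cont (rad_da rad r). Qed.

Lemma rad_flux_continuous : continuous (fun s => s ^+ (j + k).+1 * (b s - E * a s)).
Proof.
exact: (cM (@exprn_continuous _ _) (cB (rad_cb rad) (cM (@cC _ _ E) rad_ca))).
Qed.

(** Only continuity of [a'] is assumed; near r the integrated equation expresses it through
    differentiable functions, which yields the second-order radial equation. *)
Lemma rad_da' r : 0 < r < 1 ->
  is_derive r (1:R) a' (b r - E * a r - k.+1%:R * a' r / r + (j * (j + k))%:R * a r / r ^+ 2).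
Proof.
move=> /andP[r0 r1].
set N := (j + k)%N.
pose P s := prim (fun s => s ^+ N.+1 * (b s - E * a s)) s.
have rn0 : r != 0 by rewrite gt_eqF.
have rN1 : r ^+ N.+1 != 0 by rewrite expf_neq0.
have rN : r ^+ N != 0 by rewrite expf_neq0.
have dP : is_derive r (1:R) P (r ^+ N.+1 * (b r - E * a r)).
  by apply: prim_derive; [exact: rad_flux_continuous|rewrite (lt_trans _ r0)// ltrN10].
have h := d1M (d1D dP (d1M (d1M (d1c j%:R r) (d1Xn N r)) (rad_da rad r)))
  (@d1V _ (fun s => s ^+ N.+1) _ _ rN1 (d1Xn N.+1 r)).
have N1 : -1 < r by rewrite (lt_trans _ r0)// ltrN10.
apply: (@near_eq_is_derive _ _ _ (fun t => (P t + j%:R * t ^+ N * a t) / t ^+ N.+1)).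
  near=> s.
  have s01 : 0 < s <= 1.
    apply/andP; split; first by near: s; exact: lt_nbhsr.
    by apply: ltW; near: s; exact: lt_nbhsl.
  have /andP[s0 _] := s01.
  rewrite /P -(rad_eq rad s01) -/N subrK mulrAC mulfV ?mul1r//.
  by rewrite expf_neq0// gt_eqF.
apply: (d1eq h).
have r01 : 0 < r <= 1 by rewrite r0 ltW.
have := rad_eq rad r01; rewrite -/N -/(P r) => e.
have hN : N%:R * r ^+ N.-1 = N%:R * r ^+ N / r.
  by case: (N) => [|n]; rewrite ?mul0r// exprSr -mulrA mulfK.
have NE : N%:R = j%:R + k%:R :> R by rewrite natrD.
rewrite -e hN exprS natrM -!natr1 NE /=.
by field; rewrite rn0 rN.
Unshelve. all: by end_near. Qed.

(** Divided by r^(j+k), the integrated equation says j a = r a' + O(r^2), which is O(r). In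
    particular a(0) = 0. *)
Lemma rad_small0 : (0 < j)%N -> exists2 C, 0 <= C & forall r, 0 <= r <= 1 -> `|a r| <= C * r.
Proof.
move=> j0.
have [Ma' Ma'0 hMa'] := continuous_segment_bounded (rad_ca' rad).
have [M M0 hM] := continuous_segment_bounded (cB (rad_cb rad) (cM (@cC _ _ E) rad_ca)).
pose C : R := Ma' + M; have C0 : 0 <= C by rewrite addr_ge0.
have hpos r : 0 < r <= 1 -> `|a r| <= C * r.
  move=> r01; have /andP[r0 r1] := r01.
  have r01' : 0 <= r <= 1 by rewrite ltW.
  have hp : `|prim (fun s => s ^+ (j + k).+1 * (b s - E * a s)) r| <= M * r ^+ (j + k).+2.
    apply: prim_pow_bound => //; first exact: rad_flux_continuous.
    move=> x x01; have /andP[x0 x1] := x01.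
    by rewrite normrM (ger0_norm (exprn_ge0 _ x0)) mulrC ler_wpM2r ?exprn_ge0// hM.
  have h : `|j%:R * r ^+ (j + k) * a r| <= r ^+ (j + k).+1 * C.
    have -> : j%:R * r ^+ (j + k) * a r = r ^+ (j + k).+1 * a' r -
        prim (fun s => s ^+ (j + k).+1 * (b s - E * a s)) r.
      by rewrite -(rad_eq rad r01); ring.
    rewrite (le_trans (ler_normB _ _))// mulrDr lerD//.
      by rewrite normrM (ger0_norm (exprn_ge0 _ (ltW r0))) ler_wpM2l ?exprn_ge0 ?(ltW r0)// hMa'.
    by rewrite (le_trans hp)// mulrC ler_wpM2r// exprS ler_piMl// exprn_ge0// ltW.
  have rN : 0 < r ^+ (j + k) by rewrite exprn_gt0.
  have jge : 1 <= j%:R :> R by rewrite ler1n.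
  rewrite -(ler_pM2l rN); apply: (le_trans _ (_ : r ^+ (j + k).+1 * C <= _)); last first.
    by rewrite exprS le_eqVlt; apply/orP; left; apply/eqP; ring.
  apply: le_trans h; rewrite !normrM (ger0_norm (ltW rN)) normr_nat -mulrA.
  by rewrite ler_peMl// mulr_ge0// ltW.
exists C => // s /andP[]; rewrite le_eqVlt => /predU1P[<- _|s0 s1]; last by apply: hpos; rewrite s0.
(* At r = 0: the bound for positive r and the mean value theorem give |a 0| <= (C + Ma') r for all r
   in (0, 1], which fails for the r chosen below if a(0) is not 0. *)
rewrite mulr0; apply: contrapT => /negP; rewrite -ltNge => x0.
pose x : R := `|a 0|; rewrite -/x in x0.
have hD r : 0 < r <= 1 -> x <= (C + Ma') * r.
  move=> /andP[r0 r1].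
  have cp : {within `[0, r], continuous a}.
    by apply: continuous_subspaceT; exact: rad_ca.
  have [c] := @MVT_segment R a a' 0 r (ltW r0) (fun x _ => rad_da rad x) cp.
  rewrite in_itv/= => /andP[c0 cr] e.
  have -> : x = `|a r - a' c * (r - 0)| by rewrite -e /x; congr `|_|; ring.
  rewrite subr0 (le_trans (ler_normB _ _))// mulrDl lerD//; first by apply: hpos; rewrite r0.
  by rewrite normrM (gtr0_norm r0) ler_wpM2r ?(ltW r0)// hMa'// c0 (le_trans cr).
pose D : R := C + Ma'; have D0 : 0 <= D by rewrite addr_ge0.
have Dx : 0 < 2 * (D + x) by rewrite mulr_gt0// ltr_wpDl.
pose r := x / (2 * (D + x)).
have r0 : 0 < r by rewrite divr_gt0.
have rE : r * (2 * (D + x)) = x by rewrite /r divfK// gt_eqF.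
have r1 : r <= 1 by rewrite ler_pdivrMr// mul1r; nra.
have := hD r; rewrite r0 r1 => /(_ isT); rewrite -/D.
have : 0 < x * r by rewrite mulr_gt0.
nra.
Qed.

Let expN (u v : nat) : (0 < u)%N -> ((u + v) * 2 = 2 * u + v - 1 + v.+1)%N.
Proof. by clear; lia. Qed.

Section coercive.
Hypothesis j0 : (0 < j)%N.
Let J : R := j%:R - 1.
(** The excess j (j + k) - J (J + k) of the centrifugal constant of degree j over that of J = j -
    1. *)
Let V : R := 2 * j%:R + k%:R - 1.

(* r^k (r a' - J a) a: comparing with r^J, J = j - 1, instead of r^j leaves
   room to absorb the term E a. *)
Let W r := r ^+ k.+1 * a' r * a r - J * r ^+ k * a r ^+ 2.

Let W_continuous : continuous W.
Proof.
have ca := rad_ca; have ca' := rad_ca' rad.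
apply: cB; apply: cM => //; last exact: cX.
  by apply: cM => //; exact: exprn_continuous.
by apply: cM; [exact: cC|exact: exprn_continuous].
Qed.

Let W0 : W 0 = 0.
Proof.
have [C _ hC] := rad_small0 j0.
have := hC 0; rewrite lexx ler01 mulr0 normr_le0 => /(_ isT)/eqP a0.
by rewrite /W a0 exprS !mul0r (expr0n _ 2) mulr0 subr0.
Qed.

(** Completing the square with a' - J a / r, which vanishes on r^J, leaves V / r^2 - E as the
    coefficient of a^2. *)
Let W_derive r : 0 < r < 1 -> is_derive r (1:R) W
  (r ^+ k.+1 * (a r * b r + (V / r ^+ 2 - E) * a r ^+ 2 + (a' r - J * a r / r) ^+ 2)).
Proof.
move=> r01; have /andP[r0 r1] := r01.
have rn0 : r != 0 by rewrite gt_eqF.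
have h := d1B (d1M (d1M (d1Xn k.+1 r) (rad_da' r01)) (rad_da rad r))
  (d1M (d1M (d1c J r) (d1Xn k r)) (d1X 2 (rad_da rad r))).
apply: (d1eq h).
have hk : k%:R * r ^+ k.-1 = k%:R * r ^+ k / r.
  by case: (k) => [|n]; rewrite ?mul0r// exprSr -mulrA mulfK.
rewrite hk /= exprS -!natr1 natrM natrD /V /J.
by field.
Qed.

Let VE c : c <= V - E -> forall r, 0 < r < 1 -> c <= V / r ^+ 2 - E.
Proof.
move=> cV r /andP[r0 r1].
have V0 : 0 <= V.
  rewrite /V; have j1 : 1 <= j%:R :> R by rewrite ler1n.
  by have := ler0n R k; lra.
have : V <= V / r ^+ 2.
  by rewrite ler_peMr// invf_ge1 ?exprn_gt0// expr_le1// ltW.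
lra.
Qed.

Let flux c s := s ^+ k.+1 * (a s * b s + c * a s ^+ 2).

Let flux_continuous c : continuous (flux c).
Proof.
have ca := rad_ca; have cb := rad_cb rad.
apply: cM; first exact: exprn_continuous.
by apply: cD; [exact: cM|apply: cM; [exact: cC|exact: cX]].
Qed.

(** Part of the derivative of [W] is split off, so that what remains is nonnegative as soon as c <=
    V - E; monotonicity of [Phi] is the energy inequality. *)
Let Phi c r := W r - prim (flux c) r.

Let Phi_continuous c : {within `[0, 1], continuous (Phi c)}.
Proof.
apply: continuous_in_subspaceT => x; rewrite inE/= in_itv/= => /andP[x0 _].
apply: cvgB; first exact: W_continuous.
by apply: d1cont; apply: prim_derive => //; rewrite (lt_le_trans _ x0)// ltrN10.
Qed.

Let Phi_derive c r : 0 < r < 1 -> is_derive r (1:R) (Phi c)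
  (r ^+ k.+1 * ((V / r ^+ 2 - E - c) * a r ^+ 2 + (a' r - J * a r / r) ^+ 2)).
Proof.
move=> r01; have /andP[r0 r1] := r01.
have h := d1B (W_derive r01) (prim_derive (@flux_continuous c) (lt_trans (ltrN10 R) r0)).
by apply: (d1eq h); rewrite /flux; ring.
Qed.

Let Phi_derive_ge0 c r : c <= V - E -> 0 < r < 1 ->
  0 <= r ^+ k.+1 * ((V / r ^+ 2 - E - c) * a r ^+ 2 + (a' r - J * a r / r) ^+ 2).
Proof.
move=> cV r01; have /andP[r0 r1] := r01.
apply: mulr_ge0; first by rewrite exprn_ge0// ltW.
apply: addr_ge0; last exact: sqr_ge0.
by apply: mulr_ge0; [have := VE cV r01; lra|exact: sqr_ge0].
Qed.

Let Phi_mono c : c <= V - E -> forall x y, 0 <= x -> x <= y -> y <= 1 -> Phi c x <= Phi c y.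
Proof.
move=> cV; apply: (@nondecreasing_from_derive R (Phi c)
  (fun r => r ^+ k.+1 * ((V / r ^+ 2 - E - c) * a r ^+ 2 + (a' r - J * a r / r) ^+ 2)) 0 1) => //.
- exact: Phi_derive.
- by move=> x; exact: Phi_derive_ge0.
Qed.

Let Phi0 c : Phi c 0 = 0.
Proof. by rewrite /Phi W0 prim0 subrr. Qed.

Let W1 : a 1 = 0 -> W 1 = 0.
Proof. by move=> a1; rewrite /W a1 expr0n/= !mulr0 subr0. Qed.

Let wa2 : continuous (fun r => r ^+ k.+1 * a r ^+ 2).
Proof. by apply: cM; [exact: exprn_continuous|apply: cX; exact: rad_ca]. Qed.

Let wb2 : continuous (fun r => r ^+ k.+1 * b r ^+ 2).
Proof. by apply: cM; [exact: exprn_continuous|apply: cX; exact: rad_cb rad]. Qed.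

(** Young's inequality in the form a b + 10 a^2 = 5 a^2 - b^2 / 20 + (10 a + b)^2 / 20. *)
Let flux_lower : - (1 / 20 * II (fun r => r ^+ k.+1 * b r ^+ 2)) + 5 * II (fun r => r ^+ k.+1 * a r ^+ 2)
  <= II (flux 10).
Proof.
rewrite -mulNr -!II_Z// -II_D//; [|exact: (cM (@cC _ _ _) wb2)|exact: (cM (@cC _ _ _) wa2)].
apply: II_le.
- by apply: cD; apply: cM => //; exact: cC.
- exact: flux_continuous.
- move=> x /andP[x0 x1]; rewrite /flux.
  have -> : - (1 / 20) * (x ^+ k.+1 * b x ^+ 2) + 5 * (x ^+ k.+1 * a x ^+ 2) =
    x ^+ k.+1 * (- (1 / 20) * b x ^+ 2 + 5 * a x ^+ 2) by ring.
  rewrite ler_wpM2l ?exprn_ge0 ?(ltW x0)//.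
  have : 0 <= (10 * a x + b x) ^+ 2 by exact: sqr_ge0.
  nra.
Qed.

(** [Phi] increases from 0 and [W] vanishes at 1, so the integral of [flux 10] is at most 0; the
    factor 1/100 is the quotient of 1/20 by 5. *)
Lemma rad_coercive : a 1 = 0 -> 10 <= V - E ->
  II (fun r => r ^+ k.+1 * a r ^+ 2) <= 1 / 100 * II (fun r => r ^+ k.+1 * b r ^+ 2).
Proof.
move=> a1 VE10; have := Phi_mono VE10 (lexx 0) ler01 (lexx 1).
rewrite Phi0 /Phi W1// sub0r oppr_ge0 prim1; last exact: flux_continuous.
by have := flux_lower; lra.
Qed.

(** Without source the flux is nonnegative, so W >= 0, and the derivative of a^2 / r^(2 J) is a
    positive multiple of [W]. *)
Lemma rad_homogeneous r : (forall s, b s = 0) -> 10 <= V - E -> 0 <= r <= 1 ->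
  a r ^+ 2 <= r ^+ (j.-1).*2 * a 1 ^+ 2.
Proof.
move=> b0 VE10 /andP[]; rewrite le_eqVlt => /predU1P[<- _|r0 r1].
  have [C _ hC] := rad_small0 j0.
  have := hC 0; rewrite lexx ler01 mulr0 normr_le0 => /(_ isT)/eqP ->.
  by rewrite expr0n/= mulr_ge0 ?sqr_ge0// exprn_ge0.
have Wge s : 0 <= s <= 1 -> 0 <= W s.
  move=> /andP[s0 s1]; have := Phi_mono VE10 (lexx 0) s0 s1.
  rewrite Phi0 /Phi => h; apply: (le_trans h).
  rewrite lerBlDr lerDl -(prim0 (flux 10)).
  apply: (@nondecreasing_from_derive R (prim (flux 10)) (flux 10) 0 1) => //.
  - apply: continuous_in_subspaceT => x; rewrite inE/= in_itv/= => /andP[x0 _].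
    by apply: d1cont; apply: prim_derive; [exact: flux_continuous|rewrite (lt_le_trans _ x0)// ltrN10].
  - move=> x /andP[x0 _]; apply: prim_derive; first exact: flux_continuous.
    by rewrite (lt_trans _ x0)// ltrN10.
  - move=> x /andP[x0 x1]; rewrite /flux b0 mulr0 add0r mulr_ge0 ?exprn_ge0 ?(ltW x0)//.
    by rewrite mulr_ge0// sqr_ge0.
pose g s := a s ^+ 2 / s ^+ (j.-1).*2.
have dg s : 0 < s -> is_derive s (1:R) g (2 * W s / (s ^+ k.+1 * s ^+ (j.-1).*2)).
  move=> s0; have sn0 : s != 0 by rewrite gt_eqF.
  have sJ : s ^+ (j.-1).*2 != 0 by rewrite expf_neq0.
  have h := d1M (d1X 2 (rad_da rad s)) (@d1V _ (fun u => u ^+ (j.-1).*2) _ _ sJ (d1Xn (j.-1).*2 s)).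
  apply: (d1eq h).
  have hJ : (j.-1).*2%:R * s ^+ (j.-1).*2.-1 = 2 * J * s ^+ (j.-1).*2 / s.
    rewrite (_ : 2 * J = (j.-1).*2%:R); last first.
      by rewrite -mul2n natrM /J -[in LHS](prednK j0) -natr1; ring.
    by case: ((j.-1).*2) => [|n]; rewrite ?mul0r// exprSr -mulrA mulfK.
  rewrite hJ /W /= (exprS s k) expr1; have sk : s ^+ k != 0 by rewrite expf_neq0.
  move: sJ sk; move: (s ^+ (j.-1).*2) (s ^+ k) => u v u0 v0.
  by field; rewrite sn0 v0 u0.
have gr1 : g r <= g 1.
  apply: (@nondecreasing_from_derive R g (fun s => 2 * W s / (s ^+ k.+1 * s ^+ (j.-1).*2)) r 1) => //.
  - apply: continuous_in_subspaceT => x; rewrite inE/= in_itv/= => /andP[x0 _].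
    by apply: d1cont; apply: dg; exact: lt_le_trans x0.
  - by move=> x /andP[x0 _]; apply: dg; exact: lt_trans x0.
  - move=> x /andP[rx x1]; have x0 := lt_trans r0 rx.
    apply: divr_ge0; last by rewrite mulr_ge0// exprn_ge0// ltW.
    by rewrite mulr_ge0// Wge// !ltW.
have rJ : 0 < r ^+ (j.-1).*2 by rewrite exprn_gt0.
move: gr1; rewrite /g expr1n divr1 ler_pdivrMr//.
by rewrite mulrC.
Qed.

(** Beyond r = 1/3 there is no source, so [W] increases to W(1) = 0 and is <= 0 there. Hence G =
    r^(j+k) (a' - J a / r) and a have opposite signs, G^2 decreases, and a'(1)^2 = G(1)^2 <= G(c)^2
    for c in [1/3, 1]. At a suitable c < 2/5 the square in the derivative of [Phi] is bounded by the
    source, and the powers of c in G(c)^2 give the decay. *)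
Lemma rad_flux_decay : a 1 = 0 -> 10 <= V - E -> (forall r, 1 / 3 <= r -> b r = 0) ->
  a' 1 ^+ 2 <= (2 / 5) ^+ (2 * j + k - 1) * II (fun r => r ^+ k.+1 * b r ^+ 2).
Proof.
move=> a1 VE10 b0.
have VE0 : 0 <= V - E by lra.
have Wle s : 1 / 3 <= s -> s <= 1 -> W s <= 0.
  move=> s3 s1; rewrite -(W1 a1).
  apply: (@nondecreasing_from_derive R W
    (fun r => r ^+ k.+1 * (a r * b r + (V / r ^+ 2 - E) * a r ^+ 2 + (a' r - J * a r / r) ^+ 2)) (1 / 3) 1) => //.
  - exact: continuous_subspaceT.
  - by move=> x /andP[x3 x1]; apply: W_derive; rewrite x1 andbT; lra.
  - move=> x /andP[x3 x1]; have x01 : 0 < x < 1 by rewrite x1 andbT; lra.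
    have /andP[x0 _] := x01.
    rewrite b0 ?(ltW x3)// mulr0 add0r mulr_ge0 ?exprn_ge0 ?(ltW x0)//.
    by rewrite addr_ge0 ?sqr_ge0// mulr_ge0 ?sqr_ge0// VE.
pose G r := r ^+ (j + k) * a' r - J * r ^+ (j + k) * a r / r.
have dG r : 0 < r < 1 -> is_derive r (1:R) G (r ^+ (j + k) * ((V / r ^+ 2 - E) * a r + b r)).
  move=> r01; have /andP[r0 r1] := r01.
  have rn0 : r != 0 by rewrite gt_eqF.
  have h := d1B (d1M (d1Xn (j + k) r) (rad_da' r01))
    (d1M (d1M (d1M (d1c J r) (d1Xn (j + k) r)) (rad_da rad r)) (@d1V _ (fun u => u) _ _ rn0 (d1id r))).
  apply: (d1eq h).
  have hN : (j + k)%:R * r ^+ (j + k).-1 = (j + k)%:R * r ^+ (j + k) / r.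
    by case: (j + k)%N => [|n]; rewrite ?mul0r// exprSr -mulrA mulfK.
  rewrite hN /= -!natr1 natrM natrD /V /J.
  by field.
have G1 : G 1 = a' 1 by rewrite /G !expr1n a1 mulr0 mul0r subr0 mul1r.
have GW r : 0 < r -> G r * a r = r ^+ j * W r / r.
  move=> r0; have rn0 : r != 0 by rewrite gt_eqF.
  by rewrite /G /W exprD exprS; field.
have Gc r : 1 / 3 <= r -> r <= 1 -> a' 1 ^+ 2 <= G r ^+ 2.
  move=> r3 r1; rewrite -G1 -lerN2.
  apply: (@nondecreasing_from_derive R (fun r => - G r ^+ 2)
    (fun r => - (2 * G r * (r ^+ (j + k) * ((V / r ^+ 2 - E) * a r + b r)))) (1 / 3) 1) => //.
  - apply: continuous_in_subspaceT => x; rewrite inE/= in_itv/= => /andP[x3 x1].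
    have xn0 : x != 0 by rewrite gt_eqF//; lra.
    have cG : {for x, continuous G}.
      apply: cvgB; apply: cvgM; last exact: inv_continuous.
      - exact: exprn_continuous.
      - exact: (rad_ca' rad).
      - apply: cvgM; last exact: rad_ca.
        by apply: cvgM; [exact: cvg_cst|exact: exprn_continuous].
    exact: (cvgN (cvgM cG cG)).
  - move=> x /andP[x3 x1]; apply: d1N.
    have x01 : 0 < x < 1 by rewrite x1 andbT; lra.
    by apply: (d1eq (d1X 2 (dG x x01))); rewrite expr1.
  - move=> x /andP[x3 x1]; have x01 : 0 < x < 1 by rewrite x1 andbT; lra.
    have /andP[x0 _] := x01.
    have -> : - (2 * G x * (x ^+ (j + k) * ((V / x ^+ 2 - E) * a x + b x))) =
      2 * (x ^+ (j + k) * (V / x ^+ 2 - E)) * - (G x * a x) by rewrite b0 ?(ltW x3)//; ring.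
    apply: mulr_ge0; first by rewrite !mulr_ge0 ?exprn_ge0 ?(ltW x0)// VE.
    rewrite GW// oppr_ge0 -mulrA; apply: mulr_ge0_le0; first by rewrite exprn_ge0// ltW.
    by apply: mulr_le0_ge0; [apply: Wle; lra|rewrite invr_ge0 ltW].
have Phi3 : 0 <= Phi 10 (1 / 3).
  by rewrite -(Phi0 10); apply: Phi_mono => //; lra.
have Phi25 : Phi 10 (2 / 5) <= 1 / 20 * II (fun r => r ^+ k.+1 * b r ^+ 2).
  have : Phi 10 (2 / 5) <= Phi 10 1 by apply: Phi_mono => //; lra.
  rewrite {2}/Phi W1// prim1; last exact: flux_continuous.
  have := flux_lower.
  have : 0 <= II (fun r => r ^+ k.+1 * a r ^+ 2).
    by apply: II_ge0 => x /andP[x0 _]; rewrite mulr_ge0 ?sqr_ge0// exprn_ge0// ltW.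
  lra.
have m1 : (1 / 3 : R) < 2 / 5 by lra.
have m2 x : x \in `](1 / 3), (2 / 5)[ -> is_derive x (1:R) (Phi 10)
    (x ^+ k.+1 * ((V / x ^+ 2 - E - 10) * a x ^+ 2 + (a' x - J * a x / x) ^+ 2)).
  by rewrite in_itv/= => /andP[x1 x2]; apply: Phi_derive; apply/andP; split; lra.
have m3 : {within `[(1 / 3), (2 / 5)], continuous (Phi 10)}.
  apply: (continuous_subspaceW _ (@Phi_continuous 10)) => x /=; rewrite !in_itv/= => /andP[p q].
  by apply/andP; split; lra.
(* On an interval of length 1/15 the derivative of [Phi] at c is 15 times the increment, which lies
   below 1/20 of the source integral; the resulting 3/4 is rounded up to 1. *)
have [c] := MVT m1 m2 m3.
rewrite in_itv/= => /andP[c1 c2] e.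
have c0 : 0 < c by lra.
have c01 : 0 < c < 1 by lra.
have cn0 : c != 0 by rewrite gt_eqF.
have GE : (a' c - J * a c / c) ^+ 2 = G c ^+ 2 / c ^+ (j + k) ^+ 2.
  by rewrite /G; field; rewrite cn0 expf_neq0.
have lower : c ^+ k.+1 * (a' 1 ^+ 2 / c ^+ (j + k) ^+ 2) <=
    c ^+ k.+1 * ((V / c ^+ 2 - E - 10) * a c ^+ 2 + (a' c - J * a c / c) ^+ 2).
  rewrite ler_wpM2l ?exprn_ge0 ?(ltW c0)// GE.
  rewrite (le_trans (_ : _ <= G c ^+ 2 / c ^+ (j + k) ^+ 2))//.
    by rewrite ler_wpM2r ?invr_ge0 ?sqr_ge0// Gc//; lra.
  by rewrite lerDr mulr_ge0 ?sqr_ge0//; have := VE VE10 c01; lra.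
have expE : c ^+ k.+1 * (a' 1 ^+ 2 / c ^+ (j + k) ^+ 2) = a' 1 ^+ 2 / c ^+ (2 * j + k - 1).
  have -> : c ^+ (j + k) ^+ 2 = c ^+ (2 * j + k - 1) * c ^+ k.+1.
    by rewrite -exprM -exprD expN.
  by field; rewrite !expf_neq0.
have pw : (c ^+ (2 * j + k - 1)) <= (2 / 5) ^+ (2 * j + k - 1).
  by rewrite lerXn2r ?nnegrE ?(ltW c0) ?(ltW c2)//; lra.
have cp : 0 < c ^+ (2 * j + k - 1) by rewrite exprn_gt0.
have Ige : 0 <= II (fun r => r ^+ k.+1 * b r ^+ 2).
  by apply: II_ge0 => x /andP[x0 _]; rewrite mulr_ge0 ?sqr_ge0// exprn_ge0// ltW.
have : a' 1 ^+ 2 / c ^+ (2 * j + k - 1) <= II (fun r => r ^+ k.+1 * b r ^+ 2).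
  move: lower; rewrite expE; move: e Phi3 Phi25 Ige.
  set X := _ * (_ + _); set Y := a' 1 ^+ 2 / _; set Z := II _.
  by move=> e h1 h2 h3 h4; lra.
rewrite ler_pdivrMr// => h; apply: (le_trans h).
by rewrite mulrC ler_wpM2r.
Qed.

End coercive.
End theory.
End RadialODE.

(** * Polynomial approximation of radial solutions *)

Section Weierstrass.
Context {R : realType}.
Implicit Types (x c : R) (g : nat -> R).

(** De Casteljau's recursion for the Bernstein polynomial with nodal values g 0, ..., g n; it turns
    the moments into inductions on n, without binomial coefficients. *)
Fixpoint bernstein (n : nat) g : {poly R} :=
  if n is n'.+1 then 'X * bernstein n' (fun k => g k.+1) + (1 - 'X) * bernstein n' g
  else (g 0)%:P.

Lemma bernsteinS n g x : (bernstein n.+1 g).[x] =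
  x * (bernstein n (fun k => g k.+1)).[x] + (1 - x) * (bernstein n g).[x].
Proof. by rewrite /= !hornerE. Qed.

Lemma bernstein_le n g g' x : 0 <= x <= 1 -> (forall k, (k <= n)%N -> g k <= g' k) ->
  (bernstein n g).[x] <= (bernstein n g').[x].
Proof.
move=> /andP[x0 x1]; elim: n g g' => [|n IH] g g' h.
  by rewrite /= !hornerC h.
rewrite !bernsteinS lerD// ler_wpM2l ?subr_ge0//.
  by apply: IH => k kn; exact: h.
by apply: IH => k kn; apply: h; exact: leqW.
Qed.

Lemma bernstein_affine n g g' u v x :
  (bernstein n (fun k => u * g k + v * g' k)).[x] = u * (bernstein n g).[x] + v * (bernstein n g').[x].
Proof.
elim: n g g' => [|n IH] g g'; first by rewrite /= !hornerC.
by rewrite !bernsteinS !IH; ring.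
Qed.

Lemma bernstein_cst n c x : (bernstein n (fun=> c)).[x] = c.
Proof. by elim: n => [|n IH]; rewrite ?hornerC// bernsteinS IH; ring. Qed.

(** Second moment about c of the binomial law: variance plus squared bias. *)
Lemma bernstein_variance n c x :
  (bernstein n (fun k => (k%:R - c) ^+ 2)).[x] = n%:R * x * (1 - x) + (n%:R * x - c) ^+ 2.
Proof.
elim: n c => [|n IH] c; first by rewrite /= hornerC; ring.
rewrite bernsteinS IH.
rewrite (_ : (fun k : nat => (k.+1%:R - c) ^+ 2) = fun k => (k%:R - (c - 1)) ^+ 2); last first.
  by apply/funext => k; rewrite -natr1; congr (_ ^+ 2); ring.
by rewrite IH -natr1; ring.
Qed.

Lemma continuous_unif01 (f : R -> R) (e : R) : continuous f -> 0 < e ->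
  exists2 d : R, 0 < d & forall x y, 0 <= x <= 1 -> 0 <= y <= 1 -> `|x - y| < d -> `|f x - f y| < e.
Proof.
move=> cf e0; apply: contrapT => H.
have hn (n : nat) : exists xy : R * R, [/\ 0 <= xy.1 <= 1, 0 <= xy.2 <= 1,
    `|xy.1 - xy.2| < n.+1%:R^-1 & e <= `|f xy.1 - f xy.2|].
  apply: contrapT => h; apply: H; exists n.+1%:R^-1; first by rewrite invr_gt0.
  move=> x y x01 y01 xy; rewrite ltNge; apply/negP => exy.
  by apply: h; exists (x, y).
have [u hu] := choice hn.
have bu : bounded_fun (fun n => (u n).1).
  exists 1; split; first exact: num_real.
  move=> M M1 n _ /=; have [/andP[x0 x1] _ _ _] := hu n.
  by rewrite ger0_norm// (le_trans x1)// ltW.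
have [s smono cs] := bolzano_weierstrass bu.
set v := (fun n => _) in cs.
pose l := limn (v \o s).
have cl : (v \o s) n @[n --> \oo] --> l by exact: cs.
have e20 : 0 < e / 2 by rewrite divr_gt0.
have /cvgrPdist_lt /(_ _ e20) [d /= d0 hd] := cf l.
have d20 : 0 < d / 2 by rewrite divr_gt0.
move/cvgrPdist_lt : cl => /(_ _ d20) [n1 _ h1].
have [n2 _ h2] := near_infty_natSinv_lt (PosNum d20).
pose n := maxn n1 n2.
have g1 : `|l - v (s n)| < d / 2 by apply: h1; exact: leq_maxl.
have ns : (n <= s n)%N.
  have inc k : (s k < s k.+1)%N by have := smono k.+1 k; rewrite !leEnat ltnn => /negbT; rewrite -ltnNge.
  elim: n {g1} => // k IH; exact: leq_ltn_trans IH (inc k).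
have g2 : (s n).+1%:R^-1 < d / 2 by apply: h2; rewrite /= (leq_trans _ ns)// leq_maxr.
have [_ _ h3 h4] := hu (s n).
have fa : `|f l - f (u (s n)).1| < e / 2 by apply: hd; rewrite /= (lt_trans g1)// gtr_pMr// invf_lt1// ltr1n.
have fb : `|f l - f (u (s n)).2| < e / 2.
  apply: hd; rewrite /=.
  have -> : l - (u (s n)).2 = (l - v (s n)) + ((u (s n)).1 - (u (s n)).2) by rewrite /v; ring.
  by rewrite (le_lt_trans (ler_normD _ _))//; have := lt_trans h3 g2; lra.
have : `|f (u (s n)).1 - f (u (s n)).2| < e.
  have -> : f (u (s n)).1 - f (u (s n)).2 = (f l - f (u (s n)).2) - (f l - f (u (s n)).1) by ring.
  by rewrite (le_lt_trans (ler_normB _ _))//; lra.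
by rewrite ltNge h4.
Qed.

Lemma weierstrass (f : R -> R) (e : R) : continuous f -> 0 < e ->
  exists p : {poly R}, forall x, 0 <= x <= 1 -> `|f x - p.[x]| <= e.
Proof.
move=> cf e0.
have [M M0 hM] := continuous_segment_bounded cf.
have [d d0 hd] := continuous_unif01 cf (divr_gt0 e0 (ltr0n _ 2)).
(* n is so large that A n / 4, a bound for A times the variance, is at most e / 2. *)
have [n0 _ hn0] := near_infty_natSinv_lt (PosNum (divr_gt0 (mulr_gt0 e0 (exprn_gt0 2 d0))
  (ltr_wpDl (mulr_ge0 (ler0n R 4) M0) ltr01))).
have := hn0 n0 (leqnn _); set n := n0.+1 => /= hn.
have np : 0 < n%:R :> R by rewrite ltr0n.
exists (bernstein n (fun k => f (k%:R / n%:R))) => x x01; have /andP[x0 x1] := x01.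
pose g (k : nat) := f (k%:R / n%:R).
(* As in Chebyshev's inequality: where |x - k/n| >= d, the term A (k - n x)^2 is at least the
   trivial bound 2 M. *)
pose A : R := 2 * M / (d ^+ 2 * n%:R ^+ 2).
have d2 : 0 < d ^+ 2 by rewrite exprn_gt0.
have n2 : 0 < n%:R ^+ 2 :> R by rewrite exprn_gt0.
have A0 : 0 <= A by rewrite divr_ge0 ?mulr_ge0// ?ltW.
have dev k : (k <= n)%N -> `|f x - g k| <= e / 2 * 1 + A * (k%:R - n%:R * x) ^+ 2.
  move=> kn; have k01 : 0 <= (k%:R / n%:R : R) <= 1.
    by rewrite divr_ge0//= ler_pdivrMr// mul1r ler_nat.
  rewrite mulr1; have [h|h] := ltP `|x - k%:R / n%:R| d.
    by rewrite (le_trans (ltW (hd _ _ x01 k01 h)))// lerDl mulr_ge0// sqr_ge0.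
  rewrite (le_trans (ler_normB _ _))//.
  apply: (@le_trans _ _ (M + M)); first by rewrite lerD ?hM.
  have hk : (k%:R - n%:R * x) ^+ 2 = n%:R ^+ 2 * `|x - k%:R / n%:R| ^+ 2.
    by rewrite real_normK ?num_real// -exprMn mulrBr mulrCA mulfV ?gt_eqF// mulr1 -sqrrN opprB.
  have : d ^+ 2 <= `|x - k%:R / n%:R| ^+ 2 by rewrite lerXn2r ?nnegrE// ltW.
  rewrite -(ler_pM2l n2) -hk => h2.
  have : A * (n%:R ^+ 2 * d ^+ 2) <= A * (k%:R - n%:R * x) ^+ 2 by rewrite ler_wpM2l.
  rewrite /A (mulrC (n%:R ^+ 2)) divfK; last by rewrite mulf_neq0// gt_eqF.
  lra.
have var : e / 2 * 1 + A * (n%:R * x * (1 - x)) <= e.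
  have : A * (n%:R * x * (1 - x)) <= e / 2; last by lra.
  have : A * (n%:R * x * (1 - x)) <= A * (n%:R * (1 / 4)).
    rewrite ler_wpM2l// -mulrA ler_pM2l//.
    by have := sqr_ge0 (x - 1 / 2); lra.
  move/le_trans; apply.
  have -> : A * (n%:R * (1 / 4)) = M / (2 * d ^+ 2) * n%:R^-1.
    by rewrite /A; field; rewrite !gt_eqF.
  apply: (@le_trans _ _ (M / (2 * d ^+ 2) * (e * d ^+ 2 / (4 * M + 1)))).
    have dd2 : 0 <= M / (2 * d ^+ 2) by apply: divr_ge0 => //; apply: mulr_ge0 => //; exact: ltW.
    exact: (ler_wpM2l dd2 (ltW hn)).
  have M41 : 0 < 4 * M + 1 by lra.
  have -> : M / (2 * d ^+ 2) * (e * d ^+ 2 / (4 * M + 1)) = (M / (4 * M + 1)) * (e / 2).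
    by field; rewrite !gt_eqF.
  by rewrite ler_piMl ?divr_ge0 ?ltW// ltr_pdivrMr// mul1r; lra.
have bd (s : R) : `|s| = 1 -> s * (f x - (bernstein n g).[x]) <= e.
  move=> s1.
  have -> : s * (f x - (bernstein n g).[x]) =
      (bernstein n (fun k => s * (f x) * 1 + (- s) * g k)).[x].
    by rewrite (bernstein_affine n (fun=> 1) g) bernstein_cst; ring.
  apply: le_trans var.
  have -> : e / 2 * 1 + A * (n%:R * x * (1 - x)) =
     (bernstein n (fun k => e / 2 * 1 + A * (k%:R - n%:R * x) ^+ 2)).[x].
    rewrite (bernstein_affine n (fun=> 1) (fun k => (k%:R - n%:R * x) ^+ 2)) bernstein_cst bernstein_variance.
    by ring.
  apply: bernstein_le => // k kn; apply: le_trans (dev k kn).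
  have -> : s * f x * 1 + - s * g k = s * (f x - g k) by ring.
  by rewrite (le_trans (ler_norm _))// normrM s1 mul1r.
rewrite ler_norml; have := bd 1 (normr1 _); have := bd (-1).
rewrite normrN normr1 => /(_ erefl); rewrite mulN1r mul1r -/g => h1 h2.
by rewrite h2 andbT lerNl.
Qed.
End Weierstrass.

(** * Approximation of a radial solution by r^j A(r^2) together with its source *)

Section LowDegree.
Context {R : realType}.
Implicit Types (x y z r s t : R).
Local Notation mu := (@lebesgue_measure R).

Definition antideriv (q : {poly R}) : {poly R} :=
  \poly_(i < (size q).+1) (if i is i'.+1 then q`_i' / i'.+1%:R else 0).

Lemma deriv_antideriv (q : {poly R}) : deriv (antideriv q) = q.
Proof.
apply/polyP => i; rewrite coef_deriv coef_poly ltnS.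
case: ltnP => h; first by rewrite -[LHS]mulr_natr divfK// pnatr_eq0.
by rewrite mul0rn nth_default.
Qed.

(* (Laplacian + E) (A(|x|^2) H(x)) = (radial_op A)(|x|^2) H(x) for a harmonic
   homogeneous polynomial H of degree j in dimension k + 2. *)
Definition radial_op (j k : nat) (E : R) (A : {poly R}) : {poly R} :=
  (4 : R) *: ('X * A^`()^`()) + ((4 * j + 2 * k + 4)%:R : R) *: A^`() + E *: A.

Context (j k : nat) (E : R) (a a' b h : R -> R) (rad : radial j k E a a' b).
Hypotheses (ch : continuous h) (bh : forall r, 0 <= r <= 1 -> b r = r ^+ j * h r).

Let flux s := s ^+ (j + k).+1 * (b s - E * a s).

(** The left side of the integrated equation is r^(2j+k+1) times the derivative of a / r^j, so the
    flux alone controls the regularity of this quotient at 0. *)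
Let quot_derive r : 0 < r <= 1 ->
  is_derive r (1:R) (fun s => a s / s ^+ j) (prim flux r / r ^+ (j + j + k).+1).
Proof.
move=> r01; have /andP[r0 r1] := r01.
have rn0 : r != 0 by rewrite gt_eqF.
have rj : r ^+ j != 0 by rewrite expf_neq0.
apply: (d1eq (d1M (rad_da rad r) (@d1V _ (fun u => u ^+ j) _ _ rj (d1Xn j r)))).
have hj : j%:R * r ^+ j.-1 = j%:R * r ^+ j / r.
  by case: (j) => [|n]; rewrite ?mul0r// exprSr -mulrA mulfK.
rewrite -[prim flux r](rad_eq rad r01) hj.
rewrite !exprS !exprD.
have rk : r ^+ k != 0 by rewrite expf_neq0.
by field; rewrite rn0 rj rk.
Qed.

Let quot_mvt r s : 0 < r -> r <= s -> s <= 1 -> exists2 c, r <= c <= s &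
  a s / s ^+ j - a r / r ^+ j = prim flux c / c ^+ (j + j + k).+1 * (s - r).
Proof.
move=> r0 rs s1.
have cq : {within `[r, s], continuous (fun s => a s / s ^+ j)}.
  apply: continuous_in_subspaceT => x; rewrite inE/= in_itv/= => /andP[x0 x1].
  by apply: d1cont; apply: quot_derive; rewrite (le_trans x1)// (lt_le_trans r0 x0).
have [|c] := @MVT_segment R (fun s => a s / s ^+ j) (fun r => prim flux r / r ^+ (j + j + k).+1) r s rs _ cq.
  by move=> x; rewrite in_itv/= => /andP[x0 x1]; apply: quot_derive; rewrite (ltW (lt_le_trans x1 s1)) (lt_trans r0).
by rewrite in_itv/= => c01 e; exists c.
Qed.

Let flux_continuous : continuous flux.
Proof. exact: (rad_flux_continuous rad). Qed.

Let flux_bound (i : nat) C : 0 <= C -> (forall r, 0 < r <= 1 -> `|a r| <= C * r ^+ i) -> (i <= j)%N ->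
  exists2 M, 0 <= M & forall r, 0 < r <= 1 -> `|prim flux r| <= M * r ^+ ((j + k).+1 + i).+1.
Proof.
move=> C0 hC ij; have [H H0 hH] := continuous_segment_bounded ch.
pose M : R := H + `|E| * C; have M0 : 0 <= M by rewrite addr_ge0// mulr_ge0.
exists M => // r /andP[r0 r1]; apply: prim_pow_bound => //; last by rewrite r1 ltW.
move=> x x01; have /andP[x0 x1] := x01.
have [->|xn0] := eqVneq x 0.
  by rewrite /flux exprS !mul0r normr0 mulr_ge0// exprn_ge0.
have xpos : 0 < x by rewrite lt_neqAle eq_sym xn0.
rewrite /flux normrM (ger0_norm (exprn_ge0 _ x0)) exprD mulrCA ler_wpM2l ?exprn_ge0//.
rewrite mulrDl (le_trans (ler_normB _ _))// lerD//.
  rewrite bh// normrM (ger0_norm (exprn_ge0 _ x0)) mulrC ler_pM ?exprn_ge0//.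
    exact: hH.
  by rewrite ler_wiXn2l.
by rewrite normrM -mulrA ler_wpM2l// hC// xpos.
Qed.

(** Bootstrap: |a| <= C r^i bounds the flux, hence the derivative of a / r^j; the mean value theorem
    between r and 1 then gains one power of r. *)
Let growth (i : nat) : (i <= j)%N ->
  exists2 C, 0 <= C & forall r, 0 < r <= 1 -> `|a r| <= C * r ^+ i.
Proof.
elim: i => [|i IH] ij.
  have [C C0 hC] := continuous_segment_bounded (rad_ca rad).
  by exists C => // r /andP[r0 r1]; rewrite expr0 mulr1 hC// r1 ltW.
have [C C0 hC] := IH (ltnW ij).
have [M M0 hM] := flux_bound C0 hC (ltnW ij).
exists (`|a 1| + M); first by rewrite addr_ge0.
move=> r /andP[r0 r1].
have [c /andP[rc c1]] := quot_mvt r0 r1 (lexx 1).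
rewrite expr1n divr1 => e.
have c0 : 0 < c by exact: lt_le_trans rc.
have bnd : `|prim flux c / c ^+ (j + j + k).+1 * (1 - r)| <= M / r ^+ (j - i.+1).
  rewrite normrM; apply: (@le_trans _ _ (M / r ^+ (j - i.+1) * 1)); last by rewrite mulr1.
  apply: ler_pM => //; last by rewrite ger0_norm ?subr_ge0// lerBlDr lerDl ltW.
  rewrite normrM normfV (gtr0_norm (exprn_gt0 _ c0)) ler_pdivrMr ?exprn_gt0//.
  apply: (le_trans (hM c _)); first by rewrite c0.
  rewrite (_ : (j + j + k).+1 = (j - i.+1 + ((j + k).+1 + i).+1)%N); last first.
    by move: ij; clear; lia.
  rewrite [X in _ <= _ * X]exprD; set P := c ^+ ((j + k).+1 + i).+1.
  rewrite [X in _ <= X]mulrA; apply: ler_wpM2r; first by rewrite /P exprn_ge0 ?(ltW c0).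
  rewrite -mulrA ler_peMr//.
  by rewrite mulrC ler_pdivlMr ?exprn_gt0// mul1r lerXn2r ?nnegrE// ltW.
have rj : r ^+ j != 0 by rewrite expf_neq0// gt_eqF.
have -> : a r = r ^+ j * (a 1 - prim flux c / c ^+ (j + j + k).+1 * (1 - r)).
  by rewrite -e; field.
rewrite normrM (ger0_norm (exprn_ge0 _ (ltW r0))).
apply: (@le_trans _ _ (r ^+ j * (`|a 1| + M / r ^+ (j - i.+1)))).
  by rewrite ler_wpM2l ?exprn_ge0 ?(ltW r0)// (le_trans (ler_normB _ _))// lerD.
rewrite -{1}(subnK ij) exprD.
have -> : r ^+ (j - i.+1) * r ^+ i.+1 * (`|a 1| + M / r ^+ (j - i.+1)) =
    (`|a 1| * r ^+ (j - i.+1) + M) * r ^+ i.+1.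
  by field; rewrite expf_neq0// gt_eqF.
rewrite ler_wpM2r ?exprn_ge0 ?(ltW r0)// lerD2r ler_piMr//.
by rewrite exprn_ile1// ltW.
Qed.

Let quot_lipschitz : exists2 M, 0 <= M &
  forall r s, 0 < r -> r <= s -> s <= 1 -> `|a r / r ^+ j - a s / s ^+ j| <= M * (s - r).
Proof.
have [C C0 hC] := growth (leqnn j).
have [M M0 hM] := flux_bound C0 hC (leqnn j).
exists M => // r s r0 rs s1; have [c /andP[rc cs] e] := quot_mvt r0 rs s1.
have c0 : 0 < c by exact: lt_le_trans rc.
have c1 : c <= 1 by exact: le_trans s1.
rewrite distrC e normrM (ger0_norm (_ : 0 <= s - r)) ?subr_ge0// ler_wpM2r ?subr_ge0//.
rewrite normrM normfV (gtr0_norm (exprn_gt0 _ c0)) ler_pdivrMr ?exprn_gt0//.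
apply: (le_trans (hM c _)); first by rewrite c0.
rewrite (_ : ((j + k).+1 + j).+1 = (j + j + k).+2); last by clear; lia.
by rewrite ler_wpM2l// exprS ler_piMl// exprn_ge0// ltW.
Qed.

(** The function h - E a / r^j is approximated by a polynomial p in t = r^2. The equation 4 t A'' +
    (4 j + 2 k + 4) A' = p is solved exactly with A(1) = 0; then a / r^j - A(r^2) vanishes at 1 and
    satisfies the equation with a small right side, so it is small, and so is the error on b. *)
Lemma rad_poly_approx e : a 1 = 0 -> 0 < e -> exists2 A : {poly R}, A.[1] = 0 &
  forall r, 0 < r < 1 -> `|a r - r ^+ j * A.[r ^+ 2]| <= e /\
    `|b r - r ^+ j * (radial_op j k E A).[r ^+ 2]| <= e.
Proof.
move=> a1 e0.
have [M M0 hM] := quot_lipschitz.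
pose K : R := `|E| * M + 1; have K0 : 0 < K by rewrite ltr_wpDl// mulr_ge0.
pose e' := e / (2 * (1 + `|E|)).
have E1 : 0 < 1 + `|E| by rewrite ltr_pwDl.
have e'0 : 0 < e' by rewrite divr_gt0// mulr_gt0.
(* To be continuous at 0, a / r^j is frozen below r = dl; by the Lipschitz bound this changes E a /
   r^j by at most e'. *)
pose dl := Num.min 1 (e' / K).
have dl0 : 0 < dl by rewrite lt_min ltr01 divr_gt0.
have dl1 : dl <= 1 by rewrite ge_min lexx.
have dlK : K * dl <= e' by rewrite mulrC -ler_pdivlMr// ge_min lexx orbT.
pose ad r := let m := (r + dl + `|r - dl|) / 2 in a m / m ^+ j.
have mE r : (r + dl + `|r - dl|) / 2 = Num.max r dl.
  by case: (leP dl r) => hh; [rewrite ger0_norm ?subr_ge0//; lra|rewrite ltr0_norm ?subr_lt0//; lra].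
have cm : continuous (fun r => (r + dl + `|r - dl|) / 2).
  apply: cM; last exact: cC.
  apply: cD; first by apply: cD; [move=> x; exact: cvg_id|exact: cC].
  by apply: cnorm; apply: cB; [move=> x; exact: cvg_id|exact: cC].
have cad : continuous ad.
  apply: cM; first exact: (ccomp cm (rad_ca rad)).
  move=> r; apply: cvgV; first by rewrite expf_neq0// mE gt_eqF// lt_max dl0 orbT.
  exact: (cX cm).
have had r : 0 < r <= 1 -> `|ad r - a r / r ^+ j| <= M * dl.
  move=> /andP[r0 r1]; rewrite /ad mE; case: (leP dl r) => hh.
    by rewrite subrr normr0 mulr_ge0// ltW.
  rewrite distrC (le_trans (hM _ _ r0 (ltW hh) dl1))// ler_wpM2l//.
  by rewrite lerBlDr lerDl ltW.
pose f t := h (Num.sqrt t) - E * ad (Num.sqrt t).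
have cf : continuous f.
  apply: cB; first exact: (ccomp (@sqrt_continuous R) ch).
  by apply: cM; [exact: cC|exact: (ccomp (@sqrt_continuous R) cad)].
have [p hp] := weierstrass cf e'0.
have hpr r : 0 < r <= 1 -> `|h r - E * (a r / r ^+ j) - p.[r ^+ 2]| <= 2 * e'.
  move=> r01; have /andP[r0 r1] := r01.
  have r2 : 0 <= r ^+ 2 <= 1 by rewrite exprn_ge0 ?(ltW r0)// exprn_ile1// ltW.
  have := hp _ r2; rewrite /f sqrtr_sqr (gtr0_norm r0) => h1.
  have -> : h r - E * (a r / r ^+ j) - p.[r ^+ 2] =
    (h r - E * ad r - p.[r ^+ 2]) + E * (ad r - a r / r ^+ j) by ring.
  rewrite (le_trans (ler_normD _ _))// mulr_natl mulr2n lerD// normrM.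
  apply: (@le_trans _ _ (`|E| * (M * dl))); first by rewrite ler_wpM2l// had.
  apply: le_trans dlK; rewrite mulrA ler_wpM2r ?(ltW dl0)//.
  by rewrite /K lerDl.
(* q = A' solves 4 t q' + (4 j + 2 k + 4) q = p coefficient by coefficient; the divisors are
   positive. *)
pose q : {poly R} := \poly_(i < size p) (p`_i / (4 * i%:R + (4 * j + 2 * k + 4)%:R)).
have qE : (4 : R) *: ('X * deriv q) + ((4 * j + 2 * k + 4)%:R : R) *: q = p.
  apply/polyP => i; rewrite coefD !coefZ coefXM coef_deriv !coef_poly.
  have den : 4 * i%:R + (4 * j + 2 * k + 4)%:R != 0 :> R.
    by rewrite gt_eqF// ltr_wpDl ?mulr_ge0// ltr0n addn4.
  case: i den => [|i] den.
    rewrite eqxx mulr0 add0r; move: den; rewrite mulr0 add0r => den.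
    case: ltnP => hi; last by rewrite mulr0 nth_default.
    by rewrite mulrC divfK.
  rewrite /=; case: ltnP => hi; last by rewrite mul0rn !mulr0 addr0 nth_default.
  rewrite -[(_ / _) *+ _]mulr_natr.
  set u := p`_i.+1; set D := (4 * j + 2 * k + 4)%:R in den *.
  have -> : 4 * (u / (4 * i.+1%:R + D) * i.+1%:R) + D * (u / (4 * i.+1%:R + D)) =
    u / (4 * i.+1%:R + D) * (4 * i.+1%:R + D) by ring.
  by rewrite divfK.
pose A := antideriv q - (antideriv q).[1]%:P.
have A' : deriv A = q by rewrite derivB derivC subr0 deriv_antideriv.
have A1 : A.[1] = 0 by rewrite hornerD hornerN hornerC subrr.
have dpoly (P : {poly R}) t : is_derive t (1:R) (fun t => P.[t]) (deriv P).[t].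
  apply: DeriveDef; first exact: derivable_horner.
  by rewrite -derive1E -derivE.
have dA r : is_derive r (1:R) (fun r => A.[r ^+ 2]) (2 * r * q.[r ^+ 2]).
  apply: (d1eq (d1comp (d1Xn 2 r) (dpoly A (r ^+ 2)))).
  by rewrite A' /= expr1; ring.
have wq r : is_derive r (1:R) (fun r => 2 * r ^+ (j + j + k).+2 * q.[r ^+ 2]) (r ^+ (j + j + k).+1 * p.[r ^+ 2]).
  apply: (d1eq (d1M (d1M (d1c 2 r) (d1Xn (j + j + k).+2 r)) (d1comp (d1Xn 2 r) (dpoly q (r ^+ 2))))).
  have hn : (4 * j + 2 * k + 4)%:R = 2 * (j + j + k).+2%:R :> R.
    by rewrite -natrM; congr (_%:R); clear; lia.
  rewrite -qE hornerD !hornerZ hornerM hornerX hn /= expr1 (exprS r (j + j + k).+1).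
  by ring.
have difq r : 0 < r <= 1 -> `|prim flux r - 2 * r ^+ (j + j + k).+2 * q.[r ^+ 2]| <= 2 * e' * r ^+ (j + j + k).+1 * r.
  move=> /andP[r0 r1].
  have cD : {within `[0, r], continuous (fun r => prim flux r - 2 * r ^+ (j + j + k).+2 * q.[r ^+ 2])}.
    apply: continuous_in_subspaceT => x; rewrite inE/= in_itv/= => /andP[x0 _].
    apply: (d1cont (d1B (prim_derive flux_continuous _) (wq x))).
    by rewrite (lt_le_trans _ x0)// ltrN10.
  have [|c] := @MVT_segment R _ (fun x => flux x - x ^+ (j + j + k).+1 * p.[x ^+ 2]) 0 r (ltW r0) _ cD.
    move=> x; rewrite in_itv/= => /andP[x0 _].
    by apply: (d1B (prim_derive flux_continuous _) (wq x)); rewrite (lt_trans _ x0)// ltrN10.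
  rewrite in_itv/= prim0 (_ : 2 * 0 ^+ (j + j + k).+2 * _ = 0) ?subr0; last by rewrite exprS mul0r mulr0 mul0r.
  move=> /andP[c0 cr] ->.
  rewrite normrM (gtr0_norm r0) ler_wpM2r ?(ltW r0)//.
  have c1 := le_trans cr r1.
  have [->|cn0] := eqVneq c 0.
    by rewrite /flux !exprS !mul0r subr0 normr0 !mulr_ge0 ?exprn_ge0 ?(ltW e'0)// ltW.
  have cpos : 0 < c by rewrite lt_neqAle eq_sym cn0.
  have -> : flux c - c ^+ (j + j + k).+1 * p.[c ^+ 2] =
      (h c - E * (a c / c ^+ j) - p.[c ^+ 2]) * c ^+ (j + j + k).+1.
    rewrite /flux bh ?c0// !exprS !exprD.
    by field; rewrite expf_neq0.
  rewrite normrM (ger0_norm (exprn_ge0 _ c0)).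
  rewrite ler_pM ?exprn_ge0//; first by apply: hpr; rewrite cpos.
  by rewrite lerXn2r ?nnegrE// ltW.
have difa r : 0 < r <= 1 -> `|a r / r ^+ j - A.[r ^+ 2]| <= 2 * e'.
  move=> /andP[r0 r1].
  have dd x : 0 < x <= 1 -> is_derive x (1:R) (fun r => a r / r ^+ j - A.[r ^+ 2])
      ((prim flux x - 2 * x ^+ (j + j + k).+2 * q.[x ^+ 2]) / x ^+ (j + j + k).+1).
    move=> x01; have /andP[x0 x1] := x01.
    apply: (d1eq (d1B (quot_derive x01) (dA x))).
    rewrite (exprS x (j + j + k).+1).
    by field; rewrite expf_neq0// gt_eqF.
  have cD : {within `[r, 1], continuous (fun r => a r / r ^+ j - A.[r ^+ 2])}.
    apply: continuous_in_subspaceT => x; rewrite inE/= in_itv/= => /andP[x0 x1].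
    by apply: d1cont; apply: dd; rewrite x1 (lt_le_trans r0 x0).
  have [|c] := @MVT_segment R _ (fun x => (prim flux x - 2 * x ^+ (j + j + k).+2 * q.[x ^+ 2]) / x ^+ (j + j + k).+1) r 1 r1 _ cD.
    by move=> x; rewrite in_itv/= => /andP[x0 x1]; apply: dd; rewrite (ltW x1) (lt_trans r0).
  rewrite in_itv/= !expr1n a1 A1 mul0r subr0 sub0r => /andP[rc c1] ee.
  have c0 : 0 < c by exact: lt_le_trans rc.
  rewrite -normrN ee normrM (ger0_norm (_ : 0 <= 1 - r)) ?subr_ge0//.
  rewrite -[leRHS]mulr1 ler_pM ?subr_ge0//; last by rewrite lerBlDr lerDl ltW.
  rewrite normrM normfV (gtr0_norm (exprn_gt0 _ c0)) ler_pdivrMr ?exprn_gt0//.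
  rewrite (le_trans (difq c _)) ?c0// ler_piMr// mulr_ge0 ?exprn_ge0// ?(ltW c0)//.
  by rewrite mulr_ge0// ltW.
have e2 : 2 * e' * (1 + `|E|) = e by rewrite /e'; field; rewrite gt_eqF.
have e2e : 2 * e' <= e.
  rewrite -[leRHS]e2; apply: ler_peMr; first by apply: mulr_ge0 => //; exact: ltW.
  by rewrite -[leLHS]addr0 lerD2l.
exists A => // r /andP[r0 r1].
have r01 : 0 < r <= 1 by rewrite r0 ltW.
have rj : r ^+ j != 0 by rewrite expf_neq0// gt_eqF.
have rjle : `|r ^+ j| <= 1 by rewrite ger0_norm ?exprn_ge0 ?(ltW r0)// exprn_ile1// ltW.
split.
  have -> : a r - r ^+ j * A.[r ^+ 2] = (a r / r ^+ j - A.[r ^+ 2]) * r ^+ j by field.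
  rewrite normrM (le_trans (ler_piMr _ rjle))//.
  exact: le_trans (difa r r01) e2e.
have -> : b r - r ^+ j * (radial_op j k E A).[r ^+ 2] =
   ((h r - E * (a r / r ^+ j) - p.[r ^+ 2]) + E * (a r / r ^+ j - A.[r ^+ 2])) * r ^+ j.
  rewrite bh ?(ltW r0) ?(ltW r1)// /radial_op A' qE hornerD hornerZ.
  by field.
rewrite normrM (le_trans (ler_piMr _ rjle))//.
have <- : 2 * e' + `|E| * (2 * e') = e by rewrite -[RHS]e2; ring.
rewrite (le_trans (ler_normD _ _))//; apply: lerD; first exact: hpr.
by rewrite normrM; apply: ler_wpM2l => //; exact: difa.
Qed.

End LowDegree.

(** * Differential calculus on R^d *)

Section CkRCalculus.
Context {R : realType} (d : nat).
Local Notation V := 'rV[R]_d.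
Local Notation dl i := (delta_mx 0 i : V).
Implicit Types (f g : V -> R) (x v w : V).

(** A directional derivative is a one-variable derivative along a line; this carries the rules of
    one-variable calculus over to R^d. *)
Lemma line_quotient f x v :
  (fun h : R => h^-1 *: ((f \o shift x) (h *: v) - f x)) =
  (fun h : R => h^-1 *: (((fun t : R => f (t *: v + x)) \o shift (0 : R)) (h *: (1 : R)) - f (0 *: v + x))).
Proof.
by apply/funext => h; rewrite /= scale0r add0r /shift/= addr0 [h *: (1 : R)]mulr1.
Qed.

Lemma derivable_line f x v : derivable f x v = derivable (fun t : R => f (t *: v + x)) 0 1.
Proof. by rewrite /derivable line_quotient. Qed.

Lemma derive_line f x v : 'D_v f x = 'D_1 (fun t : R => f (t *: v + x)) 0.
Proof. by rewrite /derive line_quotient. Qed.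

Lemma is_derive_line f x v (l : R) : is_derive x v f l ->
  is_derive (0 : R) (1:R) (fun t => f (t *: v + x)) l.
Proof. by move=> [h1 h2]; apply: DeriveDef; rewrite -?derivable_line -?derive_line. Qed.

Lemma line_is_derive f x v (l : R) : is_derive (0 : R) (1:R) (fun t => f (t *: v + x)) l ->
  is_derive x v f l.
Proof. by move=> [h1 h2]; apply: DeriveDef; rewrite ?derivable_line ?derive_line. Qed.

Lemma is_derive_line_at f x v (t l : R) : is_derive (t *: v + x) v f l ->
  is_derive t (1:R) (fun s => f (s *: v + x)) l.
Proof.
move=> /is_derive_line h.
have h1 : is_derive t (1:R) (fun s => s - t) 1.
  by apply: d1eq (d1B (d1id t) (d1c t t)) _; rewrite subr0.
have h2 : is_derive (t - t) (1:R) (fun s => f (s *: v + (t *: v + x))) l by rewrite subrr.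
have := d1comp h1 h2; rewrite mulr1.
by congr (is_derive _ _ _ _); apply/funext => s; rewrite addrA -scalerDl subrK.
Qed.

Lemma vD f g x v (a b : R) : is_derive x v f a -> is_derive x v g b ->
  is_derive x v (fun y => f y + g y) (a + b).
Proof. by move=> /is_derive_line hf /is_derive_line hg; apply: line_is_derive; exact: (d1D hf hg). Qed.

Lemma vB f g x v (a b : R) : is_derive x v f a -> is_derive x v g b ->
  is_derive x v (fun y => f y - g y) (a - b).
Proof. by move=> /is_derive_line hf /is_derive_line hg; apply: line_is_derive; exact: (d1B hf hg). Qed.

Lemma vM f g x v (a b : R) : is_derive x v f a -> is_derive x v g b ->
  is_derive x v (fun y => f y * g y) (a * g x + f x * b).
Proof.
move=> /is_derive_line hf /is_derive_line hg; apply: line_is_derive.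
by apply: d1eq (d1M hf hg) _; rewrite scale0r add0r.
Qed.

Lemma vC (c : R) x v : is_derive x v (fun _ : V => c) 0.
Proof. by apply: line_is_derive; exact: d1c. Qed.

Lemma vcoord x i v : is_derive x v (fun y : V => y 0 i) (v 0 i).
Proof.
apply: line_is_derive; apply: (@d1eq R (fun t => (t *: v + x) 0 i) 0 (1 * v 0 i + 0 * 0 + 0)); last by ring.
under [X in is_derive _ _ X _]eq_fun do rewrite !mxE.
exact: (d1D (d1M (d1id 0) (d1c (v 0 i) 0)) (d1c (x 0 i) 0)).
Qed.

Lemma vcomp f (g : R -> R) x v (a b : R) : is_derive x v f a -> is_derive (f x) (1:R) g b ->
  is_derive x v (fun y => g (f y)) (b * a).
Proof.
move=> /is_derive_line hf hg; apply: line_is_derive; apply: (d1comp hf).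
by rewrite scale0r add0r.
Qed.

Lemma vE f x v (a : R) : is_derive x v f a -> 'D_v f x = a.
Proof. by case. Qed.

Lemma CkR_continuous k f : CkR k f -> continuous f.
Proof. by case: k => [|k] // []. Qed.

Lemma CkR_derivable k f x i : CkR k.+1 f -> is_derive x (dl i) f ('D_(dl i) f x).
Proof. by move=> [_ /(_ i)[h _]]; exact/derivableP/h. Qed.

Lemma CkR_D k f i : CkR k.+1 f -> CkR k (fun x => 'D_(dl i) f x).
Proof. by move=> [_ /(_ i)[]]. Qed.

Lemma CkRS k f (df : 'I_d -> V -> R) : continuous f ->
  (forall i x, is_derive x (dl i) f (df i x)) -> (forall i, CkR k (df i)) -> CkR k.+1 f.
Proof.
move=> cf hd ck; split=> // i; split; first by move=> x; case: (hd i x).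
rewrite (_ : (fun x => _) = df i); first exact: ck.
by apply/funext => x; exact: vE (hd i x).
Qed.

Lemma CkR_pred k f : CkR k.+1 f -> CkR k f.
Proof.
elim: k f => [|k IH] f; first by case.
by case=> cf h; split=> // i; have [h1 h2] := h i; split=> //; exact: IH.
Qed.

Lemma CkRC k (c : R) : CkR k (fun _ : V => c).
Proof.
elim: k c => [|k IH] c; first exact: cC.
refine (@CkRS k (fun _ : V => c) (fun _ _ => 0) _ _ (fun i => IH 0)); exact: cC.
Qed.

Lemma continuous_coord i : continuous (fun x : V => x 0 i).
Proof. exact: coord_continuous. Qed.

Lemma CkR_coord k i : CkR k (fun x : V => x 0 i).
Proof.
case: k => [|k]; first exact: continuous_coord.
refine (@CkRS k (fun x => x 0 i) (fun j _ => (dl j) 0 i) _ _ (fun j => CkRC k _));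
  [exact: continuous_coord|move=> j x; exact: vcoord].
Qed.

Lemma CkRD k f g : CkR k f -> CkR k g -> CkR k (fun x => f x + g x).
Proof.
elim: k f g => [|k IH] f g hf hg; first exact: cD.
apply: (@CkRS k _ (fun i x => 'D_(dl i) f x + 'D_(dl i) g x)
  (cD (CkR_continuous hf) (CkR_continuous hg))
  (fun i x => vD (CkR_derivable x i hf) (CkR_derivable x i hg))) => i.
by apply: IH; exact: CkR_D.
Qed.

Lemma CkRM k f g : CkR k f -> CkR k g -> CkR k (fun x => f x * g x).
Proof.
elim: k f g => [|k IH] f g hf hg; first exact: cM.
apply: (@CkRS k _ (fun i x => 'D_(dl i) f x * g x + f x * 'D_(dl i) g x)
  (cM (CkR_continuous hf) (CkR_continuous hg))
  (fun i x => vM (CkR_derivable x i hf) (CkR_derivable x i hg))) => i.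
by apply: CkRD; apply: IH; (exact: CkR_D || exact: CkR_pred).
Qed.

Lemma CkRZ k (c : R) f : CkR k f -> CkR k (fun x => c * f x).
Proof. exact/CkRM/CkRC. Qed.

Lemma CkRN k f : CkR k f -> CkR k (fun x => - f x).
Proof. by move=> /(CkRZ (-1)); under [X in CkR _ X -> _]eq_fun do rewrite mulN1r. Qed.

Lemma CkRB k f g : CkR k f -> CkR k g -> CkR k (fun x => f x - g x).
Proof. by move=> hf hg; apply: CkRD => //; exact: CkRN. Qed.

Lemma CkRX k n f : CkR k f -> CkR k (fun x => f x ^+ n).
Proof.
move=> hf; elim: n => [|n IH]; first exact: CkRC.
by under eq_fun do rewrite exprS; exact: CkRM.
Qed.

Lemma CkR_sum k (I : Type) (r : seq I) (P : pred I) (F : I -> V -> R) :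
  (forall i, P i -> CkR k (F i)) -> CkR k (fun x => \sum_(i <- r | P i) F i x).
Proof.
move=> h; elim: r => [|i r IH]; first by under eq_fun do rewrite big_nil; exact: CkRC.
under eq_fun do rewrite big_cons.
by case: (boolP (P i)) => // Pi; apply: CkRD => //; exact: h.
Qed.

Lemma mvt0 (f f' : R -> R) (b : R) : (forall t : R, is_derive t (1:R) f (f' t)) ->
  exists2 c, `|c| <= `|b| & f b - f 0 = f' c * b.
Proof.
move=> hf; have cf (a1 a2 : R) : {within `[a1, a2], continuous f}.
  by apply: continuous_subspaceT => t; exact: d1cont (hf t).
have [b0|b0] := leP 0 b.
  have [c] := MVT_segment b0 (fun t _ => hf t) (cf 0 b).
  by rewrite in_itv/= subr0 => /andP[c0 cb] e; exists c => //; rewrite !ger0_norm.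
have [c] := MVT_segment (ltW b0) (fun t _ => hf t) (cf b 0).
rewrite in_itv/= sub0r mulrN => /andP[bc c0] e; exists c.
  by rewrite (ler0_norm c0) (ltr0_norm b0) lerN2.
by rewrite -opprB e opprK.
Qed.

(** [CkR] only speaks of partial derivatives. The increment is telescoped along the points [z k h],
    which change one coordinate at a time; each difference is a partial derivative at a nearby
    point, and these are continuous. *)
Lemma C1_is_derive f x w : CkR 1 f ->
  is_derive x w f (\sum_i w 0 i * 'D_(dl i) f x).
Proof.
move=> cf; set l := \sum_i _.
suff H : h^-1 *: ((f \o shift x) (h *: w) - f x) @[h --> 0^'] --> l.
  by apply: DeriveDef; [apply/cvg_ex; exists l|exact/cvg_lim].
pose z (k : nat) (h : R) : V := \row_i (x 0 i + (if (i < k)%N then h * w 0 i else 0)).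
have z0 h : z 0 h = x by apply/rowP => i; rewrite !mxE addr0.
have zd h : z d h = h *: w + x by apply/rowP => i; rewrite !mxE ltn_ord addrC.
have zS h (k : 'I_d) : z k.+1 h = (h * w 0 k) *: dl k + z k h.
  apply/rowP => i; rewrite !mxE eqxx/= ltnS leq_eqVlt.
  have [->|ik] := eqVneq i k; first by rewrite eqxx ltnn mulr1 addr0 addrC.
  by rewrite mulr0 add0r -val_eqE in ik *; rewrite (negbTE ik).
have step h (k : 'I_d) : exists2 c : R, `|c| <= `|h * w 0 k| &
   f (z k.+1 h) - f (z k h) = 'D_(dl k) f (c *: dl k + z k h) * (h * w 0 k).
  have [|c hc e] := @mvt0 (fun t => f (t *: dl k + z k h)) (fun t => 'D_(dl k) f (t *: dl k + z k h)) (h * w 0 k).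
    by move=> t; exact: (is_derive_line_at (CkR_derivable _ k cf)).
  by exists c => //; rewrite zS -e scale0r add0r.
apply/cvgrPdist_le => /= e e0.
pose W : R := 1 + \sum_i `|w 0 i|.
have W0 : 0 < W by rewrite ltr_pwDl// sumr_ge0.
have e'0 : 0 < e / W by exact: divr_gt0.
have hk (k : 'I_d) : exists2 dl0 : R, 0 < dl0 & forall y, `|x - y| < dl0 -> `|'D_(dl k) f x - 'D_(dl k) f y| <= e / W.
  have cDk : continuous (fun x => 'D_(dl k) f x) by exact: CkR_continuous (CkR_D k cf).
  have /cvgrPdist_le /(_ _ e'0) := cDk x.
  by move=> /nbhs_normP[r /= r0 hr]; exists r => // y xy; exact: hr.
have [D hD] := choice (fun k => let: ex_intro2 a b c := hk k in ex_intro _ a (conj b c)).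
have [D0 D00 hD0] : exists2 D0 : R, 0 < D0 & forall k, D0 <= D k.
  exists (\big[Order.min/1]_k D k); last by move=> k; exact: bigmin_le.
  by apply: lt_bigmin => // k _; have [] := hD k.
near=> h.
have h0 : h != 0 by near: h; exact: nbhs_dnbhs_neq.
have hs : `|h| < D0 / (2 * W).
  near: h; apply: dnbhs0_lt; rewrite divr_gt0// mulr_gt0//.
have hw : `|h| * W < D0 / 2.
  by move: hs; rewrite invfM mulrA ltr_pdivlMr// .
have wW k : `|w 0 k| <= W.
  by rewrite /W (bigD1 k)//= addrCA lerDl addr_ge0// sumr_ge0.
rewrite /= /shift/= -zd -{1}(z0 h).
have tel : f (z d h) - f (z 0 h) = \sum_(k < d) (f (z k.+1 h) - f (z k h)).
  by rewrite -(big_mkord predT (fun k => f (z k.+1 h) - f (z k h))) telescope_sumr.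
rewrite tel scaler_sumr /l -sumrB.
have bound (k : 'I_d) : `|w 0 k * 'D_(dl k) f x - h^-1 *: (f (z k.+1 h) - f (z k h))| <= `|w 0 k| * (e / W).
  have [c hc ->] := step h k.
  have -> : h^-1 *: ('D_(dl k) f (c *: dl k + z k h) * (h * w 0 k)) = w 0 k * 'D_(dl k) f (c *: dl k + z k h).
    by rewrite /GRing.scale/=; field.
  rewrite -mulrBr normrM ler_wpM2l//; have [_] := hD k; apply.
  apply: lt_le_trans (hD0 k).
  have hhW : `|h| * W + `|h| * W < D0 by lra.
  apply: le_lt_trans hhW; apply: rV_norm_le; first by rewrite addr_ge0// mulr_ge0// ltW.
  move=> i; rewrite !mxE eqxx/=.
  have -> : x 0 i - (c * (i == k)%:R + (x 0 i + (if (i < k)%N then h * w 0 i else 0))) =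
     - (c * (i == k)%:R) - (if (i < k)%N then h * w 0 i else 0) by ring.
  rewrite (le_trans (ler_normB _ _))//; apply: lerD.
    rewrite normrN normrM; apply: (@le_trans _ _ (`|c| * 1)).
      by rewrite ler_wpM2l//; case: (i == k); rewrite ?normr1 ?normr0.
    by rewrite mulr1 (le_trans hc)// normrM ler_wpM2l.
  case: ifP => _; last by rewrite normr0 mulr_ge0// ltW.
  by rewrite normrM ler_wpM2l.
rewrite (le_trans (ler_norm_sum _ _ _))// (le_trans (ler_sum _ (fun k _ => bound k)))//.
rewrite -mulr_suml mulrA ler_pdivrMr// mulrC ler_wpM2l ?(ltW e0)//.
by rewrite /W lerDr.
Unshelve. all: end_near.
Qed.

Lemma C1_ray f y (r : R) : CkR 1 f ->
  is_derive r (1:R) (fun r => f (r *: y)) (\sum_i y 0 i * 'D_(dl i) f (r *: y)).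
Proof.
move=> cf; have h := is_derive_line_at (x := 0) (t := r) (v := y) (f := f).
under [X in is_derive _ _ X _]eq_fun do rewrite -[_ *: y]addr0.
by rewrite -[r *: y]addr0; exact: (h _ (C1_is_derive _ _ cf)).
Qed.

End CkRCalculus.

(** * Smooth cut-off functions *)

Section SmoothStep.
Context {R : realType}.
Implicit Types (f g : R -> R) (x t : R).

Fixpoint C1k (k : nat) f : Prop :=
  if k is k'.+1 then (forall x, derivable f x 1) /\ C1k k' (derive1 f) else continuous f.

Lemma C1kS k f f' : (forall x, is_derive x (1:R) f (f' x)) -> C1k k f' -> C1k k.+1 f.
Proof.
move=> h ck; split; first by move=> x; case: (h x).
rewrite (_ : derive1 f = f')//; apply/funext => x; exact: d1E (h x).
Qed.

Lemma C1k_d k f x : C1k k.+1 f -> is_derive x (1:R) f (derive1 f x).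
Proof. by move=> [h _]; apply: DeriveDef; [exact: h|rewrite derive1E]. Qed.

Lemma C1k_continuous k f : C1k k f -> continuous f.
Proof. by case: k => // k h x; exact: d1cont (C1k_d x h). Qed.

Lemma C1k_pred k f : C1k k.+1 f -> C1k k f.
Proof.
elim: k f => [|k IH] f; first exact: C1k_continuous.
by move=> [h1 h2]; split=> //; exact: IH.
Qed.

Lemma C1kC k (c : R) : C1k k (fun=> c).
Proof.
elim: k c => [|k IH] c; first exact: cC.
exact: (C1kS (fun x => d1c c x) (IH 0)).
Qed.

Lemma C1k_affine k (a b : R) : C1k k (fun t => a * t + b).
Proof.
case: k => [|k].
  by apply: cD; [apply: cM; [exact: cC|move=> x; exact: cvg_id]|exact: cC].
apply: (@C1kS _ _ (fun=> a)); last exact: C1kC.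
by move=> x; apply: d1eq (d1D (d1M (d1c a x) (d1id x)) (d1c b x)) _; ring.
Qed.

Lemma C1kD k f g : C1k k f -> C1k k g -> C1k k (fun x => f x + g x).
Proof.
elim: k f g => [|k IH] f g hf hg; first exact: cD.
apply: (C1kS (fun x => d1D (C1k_d x hf) (C1k_d x hg))).
by apply: IH; [case: hf|case: hg].
Qed.

Lemma C1kM k f g : C1k k f -> C1k k g -> C1k k (fun x => f x * g x).
Proof.
elim: k f g => [|k IH] f g hf hg; first exact: cM.
apply: (C1kS (fun x => d1M (C1k_d x hf) (C1k_d x hg))).
have [_ hf'] := hf; have [_ hg'] := hg.
by apply: C1kD; apply: IH => //; exact: C1k_pred.
Qed.

Lemma C1kZ k (c : R) f : C1k k f -> C1k k (fun x => c * f x).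
Proof. by move=> h; apply: C1kM => //; exact: C1kC. Qed.

Lemma C1kV k f : (forall x, f x != 0) -> C1k k f -> C1k k (fun x => (f x)^-1).
Proof.
move=> f0; elim: k f f0 => [|k IH] f f0 hf.
  by move=> x; apply: cvgV; [exact: f0|exact: hf].
apply: (C1kS (fun x => d1V (f0 x) (C1k_d x hf))).
have [_ hf'] := hf; apply: C1kM.
  by under [X in C1k _ X]eq_fun do rewrite -mulN1r; exact: C1kZ.
apply: IH; first by move=> x; rewrite expf_neq0.
by under [X in C1k _ X]eq_fun do rewrite expr2; apply: C1kM; exact: C1k_pred.
Qed.

Lemma C1k_comp k f g : C1k k f -> C1k k g -> C1k k (fun x => f (g x)).
Proof.
elim: k f g => [|k IH] f g hf hg; first exact: (ccomp hg hf).
apply: (C1kS (fun x => d1comp (C1k_d x hg) (C1k_d (g x) hf))).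
have [_ hf'] := hf; have [_ hg'] := hg.
by apply: C1kM => //; apply: IH => //; exact: C1k_pred.
Qed.

(** The powers of 1/t make the family closed under differentiation. *)
Definition flat (n : nat) t : R := if 0 < t then t^-1 ^+ n * expR (- t^-1) else 0.

Lemma flat_ge0 n t : 0 <= flat n t.
Proof. by rewrite /flat; case: ltP => // t0; rewrite mulr_ge0 ?expR_ge0// exprn_ge0// invr_ge0 ltW. Qed.

Lemma flat_gt0 n t : 0 < t -> 0 < flat n t.
Proof. by move=> t0; rewrite /flat t0 mulr_gt0 ?expR_gt0// exprn_gt0// invr_gt0. Qed.

Lemma flat_le0 n t : t <= 0 -> flat n t = 0.
Proof. by rewrite /flat ltNge => ->. Qed.

(** A quadratic bound is what differentiability at 0 requires. With N = n + 2 and u = 1 / (N t), it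
    follows from e^(1/t) = (e^u)^N >= u^N. *)
Lemma flat_bound n t : flat n t <= n.+2%:R ^+ n.+2 * t ^+ 2.
Proof.
have [t0|t0] := leP t 0; first by rewrite flat_le0// mulr_ge0 ?sqr_ge0// exprn_ge0.
rewrite /flat t0; have ti : 0 < t^-1 by rewrite invr_gt0.
have h : (t^-1 / n.+2%:R) ^+ n.+2 <= expR t^-1.
  set u := t^-1 / n.+2%:R.
  have u0 : 0 <= u by rewrite divr_ge0// ltW.
  have -> : t^-1 = n.+2%:R * u by rewrite /u mulrCA mulfV ?pnatr_eq0// mulr1.
  rewrite expRM_natl lerXn2r ?nnegrE ?expR_ge0//.
  by apply: le_trans (expR_ge1Dx _); rewrite lerDr.
rewrite expRN ler_pdivrMr ?expR_gt0//.
apply: le_trans (ler_wpM2l _ h); last by rewrite mulr_ge0 ?sqr_ge0// exprn_ge0.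
rewrite le_eqVlt; apply/orP; left; apply/eqP.
rewrite expr_div_n !exprVn !exprS; have tn : t ^+ n != 0 by rewrite expf_neq0// gt_eqF.
have N0 : n.+2%:R != 0 :> R by rewrite pnatr_eq0.
have Nn : n.+2%:R ^+ n != 0 :> R by rewrite expf_neq0.
have tn0 : t != 0 by rewrite gt_eqF.
move: tn N0 Nn tn0; move: (t ^+ n) (n.+2%:R : R) (n.+2%:R ^+ n : R) => p q r p0 q0 r0 tn0.
by rewrite expr0; field; rewrite p0 q0 r0.
Qed.

Lemma is_derive_flat n t : is_derive t (1:R) (flat n) (flat n.+2 t - n%:R * flat n.+1 t).
Proof.
have [t0|t0|->] := ltrgtP t 0.
- rewrite !flat_le0 ?(ltW t0)// mulr0 subr0.
  apply: near_eq_is_derive (d1c 0 t).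
  by near=> s; rewrite flat_le0// ltW//; near: s; exact: lt_nbhsl.
- have tn0 : t != 0 by rewrite gt_eqF.
  have dV : is_derive t (1:R) (fun s => s^-1) (- (t ^+ 2)^-1).
    by apply: d1eq (d1V tn0 (d1id t)) _; rewrite mulN1r.
  have := d1M (d1comp dV (d1Xn n t^-1)) (d1comp (d1N dV) (is_derive_expR (- t^-1))).
  move=> /d1eq h1; have {}h1 := h1 (flat n.+2 t - n%:R * flat n.+1 t) _.
  apply: near_eq_is_derive (h1 _).
    by near=> s; rewrite /flat ifT//; near: s; exact: lt_nbhsr.
  rewrite /flat t0 opprK.
  have -> : n%:R * t^-1 ^+ n.-1 = n%:R * t^-1 ^+ n * t.
    by case: (n) => [|k]; rewrite ?mul0r// exprSr -!mulrA mulVf// mulr1.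
  by rewrite !exprS; field.
- rewrite !flat_le0// mulr0 subr0.
  pose C : R := n.+2%:R ^+ n.+2; have C0 : 0 <= C by rewrite exprn_ge0.
  suff H : h^-1 *: ((flat n \o shift 0) (h *: (1:R)) - flat n 0) @[h --> (0:R)^'] --> (0 : R).
    by apply: DeriveDef; [apply/cvg_ex; exists 0|exact/cvg_lim].
  apply/cvgrPdist_le => /= e e0; near=> h.
  rewrite sub0r normrN [flat n 0]flat_le0// subr0 /shift/= addr0 [h *: (1:R)]mulr1.
  have hn0 : h != 0 by near: h; exact: nbhs_dnbhs_neq.
  rewrite normrM (ger0_norm (flat_ge0 _ _)) normfV ler_pdivrMl ?normr_gt0//.
  apply: le_trans (flat_bound n h) _; rewrite -/C -real_normK ?num_real// expr2 mulrA mulrC.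
  rewrite ler_wpM2l//.
  have hs : `|h| < e / (C + 1) by near: h; apply: dnbhs0_lt; rewrite divr_gt0// ltr_wpDl.
  move: hs; rewrite ltr_pdivlMr ?ltr_wpDl// => hs.
  by rewrite mulrC (le_trans _ (ltW hs))// ler_wpM2l// lerDl.
Unshelve. all: end_near.
Qed.

Lemma C1k_flat k n : C1k k (flat n).
Proof.
elim: k n => [|k IH] n; first by move=> x; exact: d1cont (is_derive_flat n x).
apply: (C1kS (is_derive_flat n)).
under [X in C1k _ X]eq_fun do rewrite -mulNr.
by apply: C1kD => //; exact: C1kZ.
Qed.

Lemma smooth_step (al be : R) : al < be -> exists tau : R -> R,
  [/\ forall k, C1k k tau, forall t, t <= al -> tau t = 1, forall t, be <= t -> tau t = 0,
      forall t, derive1 tau t <= 0 & forall t, 0 <= tau t <= 1].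
Proof.
move=> ab; pose A t := flat 0 (- 1 * t + be); pose B t := flat 0 (1 * t + - al).
have AB t : 0 < A t + B t.
  have [h|h] := ltP t be.
    by rewrite ltr_wpDr ?flat_ge0// flat_gt0// mulN1r addrC subr_gt0.
  by rewrite ltr_wpDl ?flat_ge0// flat_gt0// mul1r subr_gt0 (lt_le_trans ab).
have AB0 t : A t + B t != 0 by rewrite gt_eqF.
have cA k : C1k k A by apply: (@C1k_comp k (flat 0)); [exact: C1k_flat|exact: C1k_affine].
have cB k : C1k k B by apply: (@C1k_comp k (flat 0)); [exact: C1k_flat|exact: C1k_affine].
exists (fun t => A t / (A t + B t)); split.
- by move=> k; apply: C1kM => //; apply: C1kV => //; exact: C1kD.
- move=> t ta; have -> : B t = 0 by rewrite /B flat_le0// mul1r subr_le0.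
  rewrite addr0 mulfV// gt_eqF//.
  by rewrite flat_gt0// mulN1r addrC subr_gt0 (le_lt_trans ta).
- by move=> t bt; rewrite /A flat_le0 ?mul0r// mulN1r addrC subr_le0.
- move=> t.
  have dl' (a b : R) : is_derive t (1:R) (fun t => a * t + b) a.
    by apply: d1eq (d1D (d1M (d1c a t) (d1id t)) (d1c b t)) _; ring.
  have dA : is_derive t (1:R) A _ := d1comp (dl' (-1) be) (is_derive_flat 0 _).
  have dB : is_derive t (1:R) B _ := d1comp (dl' 1 (- al)) (is_derive_flat 0 _).
  have dV := @d1V R (fun t => A t + B t) t _ (AB0 t) (d1D dA dB).
  rewrite (d1E (d1M dA dV)) !mul0r !subr0 -/(A t) -/(B t).
  set a' := flat 2 _; set b' := flat 2 _.
  have -> : a' * -1 / (A t + B t) + A t * (- (a' * -1 + b' * 1) / (A t + B t) ^+ 2) =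
     - ((a' * B t + b' * A t) / (A t + B t) ^+ 2) by field.
  by rewrite oppr_le0 divr_ge0 ?sqr_ge0// addr_ge0// mulr_ge0// flat_ge0.
- move=> t; have A0 : 0 <= A t := flat_ge0 _ _; have B0 : 0 <= B t := flat_ge0 _ _.
  by rewrite divr_ge0 ?(ltW (AB t))//= ler_pdivrMr// mul1r lerDl.
Qed.

Lemma CkR_comp d k (tau : R -> R) (f : 'rV[R]_d -> R) : C1k k tau -> CkR k f ->
  CkR k (fun y : 'rV[R]_d => tau (f y)).
Proof.
elim: k tau f => [|k IH] tau f ht hf; first exact: (ccomp hf ht).
apply: (CkRS (ccomp (CkR_continuous hf) (C1k_continuous ht))
   (fun i y => vcomp (CkR_derivable y i hf) (C1k_d (f y) ht))) => i.
have [_ ht'] := ht; apply: CkRM; last exact: CkR_D.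
by apply: IH => //; exact: CkR_pred.
Qed.

End SmoothStep.

Section SphereIntegral.
Context {R : realType} (d : nat) (d0 : (0 < d)%N).
Local Notation V := 'rV[R]_d.
Implicit Types f g : V -> R.

Lemma SI_eq f g : continuous f -> continuous g ->
  (forall x, enorm x = 1 -> f x = g x) -> SI f = SI g.
Proof.
move=> cf cg fg; congr (_ * _); apply: BI_eq => //; [exact: bm_sphere_proj|exact: bm_sphere_proj|].
by move=> x _ x0; apply: fg; exact: enorm_sphere_proj.
Qed.

Lemma SID f g : continuous f -> continuous g -> SI (fun x => f x + g x) = SI f + SI g.
Proof.
by move=> cf cg; rewrite /SI -mulrDr -BID//; exact: bm_sphere_proj.
Qed.

Lemma SIZ f c : continuous f -> SI (fun x => c * f x) = c * SI f.
Proof.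
by move=> cf; rewrite /SI mulrCA -(BIZ c (bm_sphere_proj cf)).
Qed.

Lemma bmfamM (h : R -> V -> R) g : bmfam h -> continuous g ->
  bmfam (fun r y => h r y * g (sphere_proj y)).
Proof.
move=> [h1 h2 h3] cg; have bg := bm_sphere_proj cg; split.
- by move=> r; apply: bmM => //; exact: h1.
- by move=> y y1; apply: (cM (h2 y y1)); exact: cC.
- move=> u; have [M hM] := h3 u; have [_ [N hN]] := bg.
  exists (M * N) => r y ru y1; rewrite normrM ler_pM//; [exact: hM|exact: hN].
Qed.

Lemma bmfam_sum (I : finType) (h : I -> R -> V -> R) : (forall i, bmfam (h i)) ->
  bmfam (fun r y => \sum_i h i r y).
Proof.
move=> hh; split.
- by move=> r; apply: bm_sum => i _; have [h1 _ _] := hh i.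
- by move=> y y1; apply: continuous_sumr => i _; have [_ h2 _] := hh i; exact: h2.
- move=> u; have [M hM] := choice (fun i => let: And3 _ _ c := hh i in c u).
  exists (\sum_i M i) => r y ru y1; rewrite (le_trans (ler_norm_sum _ _ _))//.
  by apply: ler_sum => i _; exact: hM.
Qed.

End SphereIntegral.

(** * Solid harmonics multiplied by radial functions *)

Section SolidHarmonics.
Context {R : realType} (d : nat).
Local Notation V := 'rV[R]_d.
Local Notation dl i := (delta_mx 0 i : V).
Implicit Types (f : V -> R) (x : V).

Definition lapR f x : R := \sum_(i < d) 'D_(dl i) (fun y => 'D_(dl i) f y) x.

(** Radial functions are written in |x|^2, which unlike [enorm] is smooth at the origin. *)
Definition nsq x : R := \sum_(i < d) x 0 i ^+ 2.

Lemma nsqE x : nsq x = enorm x ^+ 2. Proof. by rewrite sqr_enorm. Qed.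

Lemma CkR_nsq k : CkR k nsq.
Proof. by apply: CkR_sum => i _; apply: CkRX; exact: CkR_coord. Qed.

Lemma is_derive_nsq x i : is_derive x (dl i) nsq (2 * x 0 i).
Proof.
apply: line_is_derive.
have -> : (fun t => nsq (t *: dl i + x)) = (fun t : R => nsq x + (2 * x 0 i * t + t ^+ 2)).
  apply/funext => t; rewrite /nsq (bigD1 i)//= [in RHS](bigD1 i)//= !mxE !eqxx/= mulr1.
  rewrite (eq_bigr (fun j => x 0 j ^+ 2)); last first.
    by move=> j ji; rewrite !mxE eqxx/= (negbTE ji) mulr0 add0r.
  by ring.
apply: d1eq (d1D (d1c _ 0) (d1D (d1M (d1c _ 0) (d1id 0)) (d1Xn 2 0))) _.
by rewrite /= expr1; ring.
Qed.

Record solid (j : nat) (H : V -> R) : Prop := Solid {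
  solid_smooth : forall k, CkR k H;
  solid_homog : forall t x, H (t *: x) = t ^+ j * H x;
  solid_harm : forall x, lapR H x = 0 }.

Section theory.
Context (j : nat) (H : V -> R) (sH : solid j H).

Lemma solid_euler x : \sum_i x 0 i * 'D_(dl i) H x = j%:R * H x.
Proof.
have h1 := C1_ray x 1 (solid_smooth sH 1).
have h2 : is_derive (1:R) (1:R) (fun r => H (r *: x)) (j%:R * H x).
  rewrite (_ : (fun r => _) = fun r : R => r ^+ j * H x); last by apply/funext => r; exact: solid_homog.
  by apply: d1eq (d1M (d1Xn j 1) (d1c (H x) 1)) _; rewrite expr1n mulr1 mulr0 addr0.
by rewrite -(d1E h2) (d1E h1) scale1r.
Qed.

Context (tau : R -> R) (st : forall k, C1k k tau).
Let tau' := derive1 tau.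
Let tau'' := derive1 tau'.

Lemma CkR_radial_solid k : CkR k (fun x => tau (nsq x) * H x).
Proof. exact: (CkRM (CkR_comp (st k) (CkR_nsq k)) (solid_smooth sH k)). Qed.

Let dt x i : is_derive x (dl i) (fun x => tau (nsq x)) (tau' (nsq x) * (2 * x 0 i)).
Proof. exact: vcomp (is_derive_nsq x i) (C1k_d (nsq x) (st 1)). Qed.

Let dt' x i : is_derive x (dl i) (fun x => tau' (nsq x)) (tau'' (nsq x) * (2 * x 0 i)).
Proof. have st' : C1k 1 tau' by have [] := st 2.
exact: vcomp (is_derive_nsq x i) (C1k_d (nsq x) st'). Qed.

Lemma is_derive_radial_solid x i : is_derive x (dl i) (fun x => tau (nsq x) * H x)
  (tau' (nsq x) * (2 * x 0 i) * H x + tau (nsq x) * 'D_(dl i) H x).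
Proof. exact: vM (dt x i) (CkR_derivable x i (solid_smooth sH 1)). Qed.

(** Euler's identity turns the cross terms into 4 j tau' H, and the term with the Laplacian of H
    vanishes. *)
Lemma lap_radial_solid x : lapR (fun x => tau (nsq x) * H x) x =
  (4 * nsq x * tau'' (nsq x) + (4 * j + 2 * d)%:R * tau' (nsq x)) * H x.
Proof.
have dH i y := CkR_derivable y i (solid_smooth sH 1).
have ddH i y := CkR_derivable y i (CkR_D i (solid_smooth sH 2)).
have D1 i : (fun y => 'D_(dl i) (fun x => tau (nsq x) * H x) y) =
   (fun x => tau' (nsq x) * (2 * x 0 i) * H x + tau (nsq x) * 'D_(dl i) H x).
  by apply/funext => y; exact: vE (is_derive_radial_solid y i).
have D2 i : 'D_(dl i) (fun y => 'D_(dl i) (fun x => tau (nsq x) * H x) y) x =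
   4 * tau'' (nsq x) * H x * x 0 i ^+ 2 + 2 * tau' (nsq x) * H x +
   4 * tau' (nsq x) * (x 0 i * 'D_(dl i) H x) + tau (nsq x) * 'D_(dl i) ('D_(dl i) H) x.
  rewrite D1.
  have e2 : is_derive x (dl i) (fun x : V => 2 * x 0 i) 2.
    have := vM (vC 2 x (dl i)) (vcoord x i (dl i)).
    by rewrite mul0r add0r mxE !eqxx mulr1.
  rewrite (vE (vD (vM (vM (dt' x i) e2) (dH i x)) (vM (dt x i) (ddH i x)))).
  by ring.
rewrite /lapR (eq_bigr _ (fun i _ => D2 i)) !big_split/= -!mulr_sumr solid_euler.
have -> : \sum_(i < d) 'D_(dl i) ('D_(dl i) H) x = 0 by exact: (solid_harm sH).
rewrite -/(nsq x) sumr_const card_ord natrD !natrM -[_ *+ d]mulr_natr.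
by ring.
Qed.
End theory.
End SolidHarmonics.

(** * From the weak equation to the radial equation *)

Section WeakToRadial.
Context {R : realType}.
Implicit Types (r s t : R).

Lemma derive1_locally_cst (f : R -> R) (c t : R) : (\near t, f t = c) -> derive1 f t = 0.
Proof.
move=> h; apply: d1E; apply: near_eq_is_derive (d1c c t).
by near=> s; rewrite (_ : f s = c)//; near: s.
Unshelve. all: end_near.
Qed.

(** If D(r0) > 0, take a step whose descent lies where D >= D(r0) / 2: since - 2 r tau'(r^2) is
    nonnegative of integral 1, the tested integral would be at most - D(r0) / 2. *)
Lemma step_test_pos (D : R -> R) : continuous D ->
  (forall al be (tau : R -> R), 0 < al -> al < be -> be < 1 ->
     (forall k, C1k k tau) -> (forall t, t <= al -> tau t = 1) ->
     (forall t, be <= t -> tau t = 0) -> (forall t, derive1 tau t <= 0) ->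
     II (fun r => 2 * r * derive1 tau (r ^+ 2) * D r) = 0) ->
  forall r, 0 < r < 1 -> D r <= 0.
Proof.
move=> cD h r0 /andP[r00 r01]; rewrite leNgt; apply/negP => D0.
have D20 : 0 < D r0 / 2 by exact: divr_gt0.
have cDr : continuous D by [].
have /cvgrPdist_lt /(_ _ D20) /nbhs_normP [e /= e0 he] := cDr r0.
pose a1 := Num.max (r0 / 2) (r0 - e / 2); pose b1 := Num.min ((1 + r0) / 2) (r0 + e / 2).
have a1r : a1 < r0 by rewrite /a1 gt_max; apply/andP; split; lra.
have rb1 : r0 < b1 by rewrite /b1 lt_min; apply/andP; split; lra.
have a10 : 0 < a1 by rewrite /a1 lt_max divr_gt0.
have b11 : b1 < 1 by rewrite /b1 gt_min; apply/orP; left; lra.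
have b10 : 0 < b1 by exact: lt_trans rb1.
have Dge r : a1 <= r <= b1 -> D r0 / 2 <= D r.
  rewrite /a1 /b1 ge_max le_min => /andP[/andP[_ h1] /andP[_ h2]].
  have : `|r0 - r| < e by rewrite ltr_norml; apply/andP; split; lra.
  by move=> /he; rewrite /= ltr_norml => /andP[_]; lra.
have ab : a1 ^+ 2 < b1 ^+ 2 by rewrite ltrXn2r ?(ltW a10) ?(ltW b10)// (lt_trans a1r).
have b21 : b1 ^+ 2 < 1 by rewrite exprn_ilt1 ?(ltW b10).
have [tau [st t1 t2 td _]] := smooth_step ab.
have H := h _ _ _ (exprn_gt0 2 a10) ab b21 st t1 t2 td.
have ct : continuous (derive1 tau) by have [_ ?] := st 1.
have cth : continuous (fun r => 2 * r * derive1 tau (r ^+ 2)).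
  by apply: cM; [apply: cM; [exact: cC|move=> x; exact: cvg_id]|exact: (ccomp (@exprn_continuous _ 2) ct)].
have I1 : II (fun r => 2 * r * derive1 tau (r ^+ 2)) = - 1.
  have dtau r : is_derive r (1:R) (fun r => tau (r ^+ 2)) (2 * r * derive1 tau (r ^+ 2)).
    by apply: d1eq (d1comp (d1Xn 2 r) (C1k_d (r ^+ 2) (st 1))) _; rewrite /= expr1 mulrC.
  rewrite (II_FTC cth (fun r _ => dtau r)) expr1n t2 ?(ltW b21)// t1 ?sub0r//.
  by rewrite expr0n/= exprn_ge0// ltW.
have : II (fun r => 2 * r * derive1 tau (r ^+ 2) * D r) <=
       II (fun r => D r0 / 2 * (2 * r * derive1 tau (r ^+ 2))).
  apply: II_le; [exact: (cM cth cD)|exact: (cM (@cC _ _ _) cth)|].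
  move=> r /andP[r0' r1']; rewrite [leRHS]mulrC.
  have [hr|hr] := boolP (a1 <= r <= b1).
    apply: ler_wnM2l; last exact: Dge.
    by rewrite mulr_ge0_le0// mulr_ge0// ltW.
  rewrite (_ : derive1 tau (r ^+ 2) = 0) ?mulr0 ?mul0r//.
  move: hr; rewrite negb_and -!ltNge => /orP[hr|hr].
    apply: (@derive1_locally_cst _ 1); near=> s; apply: t1; apply: ltW; near: s.
    by apply: lt_nbhsl; rewrite ltrXn2r ?(ltW r0') ?(ltW a10).
  apply: (@derive1_locally_cst _ 0); near=> s; apply: t2; apply: ltW; near: s.
  by apply: lt_nbhsr; rewrite ltrXn2r ?(ltW r0') ?(ltW b10).
rewrite H II_Z// I1; lra.
Unshelve. all: end_near.
Qed.

Lemma step_test (D : R -> R) : continuous D ->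
  (forall al be (tau : R -> R), 0 < al -> al < be -> be < 1 ->
     (forall k, C1k k tau) -> (forall t, t <= al -> tau t = 1) ->
     (forall t, be <= t -> tau t = 0) -> (forall t, derive1 tau t <= 0) ->
     II (fun r => 2 * r * derive1 tau (r ^+ 2) * D r) = 0) ->
  forall r, 0 < r <= 1 -> D r = 0.
Proof.
move=> cD h; have D01 r : 0 < r < 1 -> D r = 0.
  move=> r01; apply/eqP; rewrite eq_le (step_test_pos cD h r01)/= -oppr_le0.
  apply: (step_test_pos (D := fun r => - D r)) => //; first exact: cN.
  move=> al be tau h1 h2 h3 h4 h5 h6 h7.
  transitivity (II (fun r => (- 1) * (2 * r * derive1 tau (r ^+ 2) * D r))).
    by congr II; apply/funext => s; ring.
  rewrite II_Z ?(h al be) ?mulr0//; apply: cM => //; apply: cM.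
    by apply: cM; [exact: cC|move=> x; exact: cvg_id].
  apply: (ccomp (@exprn_continuous _ 2)); by have [_ ?] := h4 1.
move=> r /andP[r0]; rewrite le_eqVlt => /predU1P[->|r1]; last by rewrite D01// r0.
apply: contrapT => /eqP D1.
have D10 : 0 < `|D 1| by rewrite normr_gt0.
have cDr : continuous D by [].
have /cvgrPdist_lt /(_ _ D10) /nbhs_normP [e /= e0 he] := cDr 1.
have := he (Num.max (1 / 2) (1 - e / 2)).
rewrite /ball_/= => hh; have : `|1 - Num.max (1 / 2) (1 - e / 2)| < e.
  rewrite ger0_norm ?subr_ge0 ?ge_max; last by apply/andP; split; lra.
  by rewrite ltrBlDr -ltrBlDl lt_max; apply/orP; right; lra.
move=> /hh; rewrite [D (Num.max _ _)]D01 ?subr0 ?ltxx//.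
by rewrite lt_max gt_max; apply/andP; split; [apply/orP; left; lra|apply/andP; split; lra].
Qed.

Section weak.
Context (k : nat).
Let d := k.+2.
Local Notation V := 'rV[R]_k.+2.
Local Notation dl i := (delta_mx 0 i : V).
Let d0 : (0 < d)%N. Proof. by []. Qed.

Definition real_test (eta : V -> R) : Prop :=
  (forall n, CkR n eta) /\ exists2 rho : R, rho < 1 & forall x : V, rho <= enorm x -> eta x = 0.

Definition weak_eq (w B : V -> R) (E : R) : Prop := forall eta, real_test eta ->
  BI (fun x : V => w x * (lapR eta x + E * eta x)) = BI (fun x : V => B x * eta x).

Context (w B H : V -> R) (E : R) (j : nat).
Hypotheses (cw : CkR 1 w) (cBB : continuous B) (wE : weak_eq w B E) (sH : solid j H).

Let cw0 : continuous w. Proof. exact: CkR_continuous cw. Qed.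
Let cH : continuous H. Proof. exact: CkR_continuous (solid_smooth sH 0). Qed.

Definition sph_coef (f : V -> R) r : R := SI (fun y : V => f (r *: y) * H y).

Definition sph_coef_deriv (f : V -> R) r : R :=
  SI (fun y : V => (\sum_i y 0 i * 'D_(dl i) f (r *: y)) * H y).

Let bmfam_coef (f : V -> R) : continuous f ->
  bmfam (fun r (y : V) => f (r *: sphere_proj y) * H (sphere_proj y)).
Proof. by move=> cf; apply: bmfamM => //; exact: bmfam_sphere. Qed.

Let bmfam_coef' : bmfam (fun r (y : V) =>
  (\sum_i sphere_proj y 0 i * 'D_(dl i) w (r *: sphere_proj y)) * H (sphere_proj y)).
Proof.
apply: bmfamM => //; apply: bmfam_sum => i.
have cwi : continuous (fun x => 'D_(dl i) w x) by exact: CkR_continuous (CkR_D i cw).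
have := bmfamM (bmfam_sphere cwi) (@continuous_coord _ _ i).
by under [X in bmfam X -> _]eq_fun do under eq_fun do rewrite mulrC.
Qed.

Lemma sph_coef_continuous (f : V -> R) : continuous f -> continuous (sph_coef f).
Proof. by move=> cf; apply: cM; [exact: cC|exact: BI_continuous (bmfam_coef cf)]. Qed.

Lemma sph_coef_deriv_continuous : continuous (sph_coef_deriv w).
Proof. by apply: cM; [exact: cC|exact: BI_continuous bmfam_coef']. Qed.

Lemma sph_coef_derive r : is_derive r (1:R) (sph_coef w) (sph_coef_deriv w r).
Proof.
apply: d1eq (d1M (d1c (d%:R) r) (BI_derive (bmfam_coef cw0) bmfam_coef' _ r)) _; last first.
  by rewrite mul0r add0r.
move=> s y _; have h := d1M (C1_ray (sphere_proj y) s cw) (d1c (H (sphere_proj y)) s).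
by apply: d1eq h _; rewrite mulr0 addr0.
Qed.

Lemma BI_radial (f : V -> R) (g : R -> R) : continuous f -> continuous g ->
  BI (fun x : V => f x * (g (nsq x) * H x)) = II (fun r => r ^+ (j + k).+1 * sph_coef f r * g (r ^+ 2)).
Proof.
move=> cf cg.
have cn : continuous (@nsq R k.+2) by exact: CkR_continuous (@CkR_nsq _ _ 0).
have cF : continuous (fun x : V => f x * (g (nsq x) * H x)).
  by apply: cM => //; apply: cM => //; exact: (ccomp cn cg).
rewrite BI_polar//; apply: II_eq => r /andP[r0 r1].
rewrite -/d.
have e : SI (fun x : V => f (r *: x) * (g (nsq (r *: x)) * H (r *: x))) =
  SI (fun x : V => (r ^+ j * g (r ^+ 2)) * (f (r *: x) * H x)).
  apply: SI_eq => //.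
  - exact: (ccomp (@continuous_scale_rV _ _ r) cF).
  - apply: (cM (@cC _ _ _)); apply: cM => //; exact: (ccomp (@continuous_scale_rV _ _ r) cf).
  - move=> x x1; rewrite nsqE enormZ x1 mulr1 (solid_homog sH) real_normK ?num_real//; ring.
rewrite e SIZ; last by apply: cM => //; exact: (ccomp (@continuous_scale_rV _ _ r) cf).
by rewrite -/(sph_coef f r) /= -addnS exprD; ring.
Qed.

Let flux s := s ^+ (j + k).+1 * (sph_coef B s - E * sph_coef w s).

Let flux_continuous : continuous flux.
Proof.
apply: cM; first exact: exprn_continuous.
apply: (@cB _ _); first exact: sph_coef_continuous.
by apply: cM; [exact: cC|exact: sph_coef_continuous].
Qed.

(** Testing with tau(|x|^2) H(x) and polar coordinates give an identity on (0, 1). Adding 2 r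
    tau'(r^2) (G - P) to its integrand makes it the exact derivative of [Psi], so this term
    integrates to 0 for every step tau, and [step_test] gives G = P. Only first derivatives of w
    occur. *)
Lemma radial_of_weak : radial j k E (sph_coef w) (sph_coef_deriv w) (sph_coef B).
Proof.
have ca := sph_coef_continuous cw0; have ca' := sph_coef_deriv_continuous.
have cb := sph_coef_continuous cBB.
split; [exact: sph_coef_derive|exact: ca'|exact: cb|].
pose a := sph_coef w; pose a' := sph_coef_deriv w; pose b := sph_coef B.
pose G r := r ^+ (j + k).+1 * a' r - j%:R * r ^+ (j + k) * a r.
pose P r := prim flux r.
(* [prim] is known to be differentiable only above -1; the absolute value makes the function
   continuous on the whole line, as [step_test] requires. *)
suff H0 : forall r, 0 < r <= 1 -> G r - P `|r| = 0.
  move=> r r01; have /andP[r0 _] := r01; apply/eqP; rewrite -subr_eq0.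
  by have := H0 r r01; rewrite (gtr0_norm r0) => ->.
have cP : continuous (fun r => P `|r|).
  move=> r; apply: (continuous_comp (@norm_continuous _ _ r)).
  by apply: d1cont; apply: prim_derive => //; rewrite (lt_le_trans (ltrN10 R)).
have cX' (n : nat) : continuous (fun r : R => r ^+ n) by exact: exprn_continuous.
have cG : continuous G.
  by apply: (@cB _ _); apply: cM => //; apply: cM => //; exact: cC.
apply: step_test; first exact: (@cB _ _).
move=> al be tau al0 ab be1 st t1 t2 td.
pose tau' := derive1 tau; pose tau'' := derive1 tau'.
have st' n : C1k n tau' by have [] := st n.+1.
have st'' n : C1k n tau'' by have [] := st' n.+1.
have ct : continuous tau := C1k_continuous (st 0).
have ct' : continuous tau' := C1k_continuous (st' 0).
have ct'' : continuous tau'' := C1k_continuous (st'' 0).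
have csq (g : R -> R) : continuous g -> continuous (fun r => g (r ^+ 2)).
  by move=> cg; exact: (ccomp (cX' 2) cg).
have tst : real_test (fun x : V => tau (nsq x) * H x).
  split; first by move=> n; exact: (CkR_radial_solid sH st n).
  exists (Num.sqrt be); first by rewrite -(sqrtr1 R) ltr_sqrt.
  move=> x hx; rewrite t2 ?mul0r// nsqE -(sqr_sqrtr (_ : 0 <= be)); last first.
    by rewrite ltW// (lt_trans al0).
  by rewrite lerXn2r ?nnegrE ?sqrtr_ge0 ?enorm_ge0.
have h1 := wE tst.
pose N : R := (4 * j + 2 * d)%:R.
pose q t := 4 * t * tau'' t + N * tau' t + E * tau t.
have cq : continuous q.
  apply: cD; last by apply: cM => //; exact: cC.
  apply: cD; last by apply: cM => //; exact: cC.
  by apply: cM => //; apply: cM; [exact: cC|move=> x; exact: cvg_id].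
have lhs : BI (fun x : V => w x * (lapR (fun x => tau (nsq x) * H x) x + E * (tau (nsq x) * H x))) =
   II (fun r => r ^+ (j + k).+1 * a r * q (r ^+ 2)).
  rewrite -(BI_radial cw0 cq); congr BI; apply/funext => x.
  rewrite (lap_radial_solid sH st) /q -/tau' -/tau'' -[(4 * j + 2 * k.+2)%:R]/N.
  by generalize N (tau'' (nsq x)) (tau' (nsq x)) => N' x2 x1; ring.
rewrite lhs (BI_radial cBB ct) -/b in h1.
(* [Psi] vanishes at both ends: at 1 because tau is 0 from be < 1 on, at 0 because of the power of r
   and P(0) = 0. *)
pose Psi r := 2 * r ^+ (j + d) * tau' (r ^+ 2) * a r - tau (r ^+ 2) * P r.
have Nn : N = 2 * (j + d)%:R + 2 * j%:R by rewrite /N !natrD !natrM; ring.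
have dsq (g : R -> R) r : C1k 1 g -> is_derive r (1:R) (fun r => g (r ^+ 2)) (2 * r * derive1 g (r ^+ 2)).
  by move=> sg; apply: d1eq (d1comp (d1Xn 2 r) (C1k_d (r ^+ 2) sg)) _; rewrite /= expr1 mulrC.
have dPsi r : 0 <= r <= 1 -> is_derive r (1:R) Psi
  ((r ^+ (j + k).+1 * a r * q (r ^+ 2) - r ^+ (j + k).+1 * b r * tau (r ^+ 2)) +
   2 * r * tau' (r ^+ 2) * (G r - P `|r|)).
  move=> /andP[r0 r1]; have rN1 : -1 < r by rewrite (lt_le_trans (ltrN10 R)).
  have hp := prim_derive flux_continuous rN1.
  have h := d1B (d1M (d1M (d1M (d1c 2 r) (d1Xn (j + d) r)) (dsq _ r (st' 1))) (sph_coef_derive r))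
    (d1M (dsq _ r (st 1)) hp).
  apply: d1eq h _.
  rewrite -/a -/a' -/(P r) -/tau' -/tau'' (ger0_norm r0) /G /q Nn /flux -/a -/b.
  have -> : (j + d).-1 = (j + k).+1 by rewrite /d !addnS.
  have -> : r ^+ (j + d) = r ^+ 2 * r ^+ (j + k) by rewrite -exprD /d; congr (_ ^+ _); lia.
  rewrite (exprS r (j + k)).
  generalize ((j + d)%:R : R) (j%:R : R) (r ^+ (j + k)) (tau'' (r ^+ 2) : R) (tau' (r ^+ 2) : R) (tau (r ^+ 2))
    (a r) (a' r) (b r) (P r) => u1 u2 u3 u4 u5 u6 u7 u8 u9 u10.
  by ring.
have cA : continuous (fun r => r ^+ (j + k).+1 * a r * q (r ^+ 2)).
  by apply: cM; [exact: cM|exact: csq].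
have cB1 : continuous (fun r => r ^+ (j + k).+1 * b r * tau (r ^+ 2)).
  by apply: cM; [exact: cM|exact: csq].
have cD1 : continuous (fun r => 2 * r * tau' (r ^+ 2) * (G r - P `|r|)).
  apply: cM; last exact: (@cB _ _).
  by apply: cM; [apply: cM; [exact: cC|move=> x; exact: cvg_id]|exact: csq].
have := II_FTC (cD (@cB _ _ _ _ cA cB1) cD1) dPsi.
rewrite II_D//; last exact: (@cB _ _).
rewrite II_B// h1 subrr add0r /Psi !expr1n [tau 1]t2 ?ltW// (_ : tau' 1 = 0); last first.
  apply: (@derive1_locally_cst _ 0); near=> s; apply: t2; apply: ltW; near: s.
  exact: lt_nbhsr.
rewrite [P 0]prim0 /d addnS exprS !(mul0r, mulr0) !subr0.
by move=> ->.
Unshelve. all: end_near.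
Qed.
End weak.
End WeakToRadial.

(** * The resolvent on smooth functions *)

Section ComplexL2.
Context {R : realType}.
Local Notation leb := (@lebesgue_rV R).
Local Notation C := R[i].
Local Notation Re := (@complex.Re R).
Local Notation Im := (@complex.Im R).
Local Notation modulus := (@ComplexField.Normc.normc R).

Definition normsq (z : C) : R := Re z ^+ 2 + Im z ^+ 2.

Lemma normsq_ge0 z : 0 <= normsq z. Proof. by rewrite addr_ge0// sqr_ge0. Qed.

Lemma modulusE z : modulus z = Num.sqrt (normsq z). Proof. by case: z. Qed.

Lemma ReDE (x y : C) : Re (x + y) = Re x + Re y. Proof. by case: x; case: y. Qed.
Lemma ImDE (x y : C) : Im (x + y) = Im x + Im y. Proof. by case: x; case: y. Qed.
Lemma ReNE (x : C) : Re (- x) = - Re x. Proof. by case: x. Qed.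
Lemma ImNE (x : C) : Im (- x) = - Im x. Proof. by case: x. Qed.
Lemma ReME (x y : C) : Re (x * y) = Re x * Re y - Im x * Im y. Proof. by case: x; case: y. Qed.
Lemma ImME (x y : C) : Im (x * y) = Re x * Im y + Im x * Re y. Proof. by case: x; case: y. Qed.
Lemma ReJ (x : C) : Re (x^*)%R = Re x. Proof. by case: x. Qed.
Lemma ImJ (x : C) : Im (x^*)%R = - Im x. Proof. by case: x. Qed.

Lemma Re_sum (I : Type) (r : seq I) (P : pred I) (F : I -> C) :
  Re (\sum_(i <- r | P i) F i) = \sum_(i <- r | P i) Re (F i).
Proof. by elim/big_rec2 : _ => // i a b _ <-; rewrite ReDE. Qed.

Lemma Im_sum (I : Type) (r : seq I) (P : pred I) (F : I -> C) :
  Im (\sum_(i <- r | P i) F i) = \sum_(i <- r | P i) Im (F i).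
Proof. by elim/big_rec2 : _ => // i a b _ <-; rewrite ImDE. Qed.

Lemma complexP (x y : C) : Re x = Re y -> Im x = Im y -> x = y.
Proof. by case: x; case: y => a b c e /= -> ->. Qed.

Definition cxE := (ReDE, ImDE, ReNE, ImNE, ReME, ImME, ReJ, ImJ).

Lemma normsqM (x y : C) : normsq (x * y) = normsq x * normsq y.
Proof. by rewrite /normsq !cxE; ring. Qed.

Lemma normsqD_le (x y : C) : normsq (x + y) <= 2 * normsq x + 2 * normsq y.
Proof.
rewrite /normsq !cxE; have := sqr_ge0 (Re x - Re y); have := sqr_ge0 (Im x - Im y); nra.
Qed.

Lemma L2normE d (D : set 'rV[R]_d) (f : 'rV[R]_d -> C) :
  L2norm D f = ((\int[leb d]_(x in D) (normsq (f x))%:E) `^ 2^-1)%E.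
Proof.
rewrite /L2norm unlock; congr (_ `^ _)%E.
rewrite [in RHS]integral_mkcond; congr (integral _ _ _); apply/funext => x.
rewrite /= !patchE; case: ifPn => _.
  rewrite /= modulusE ger0_norm ?sqrtr_ge0// powR_mulrn ?sqrtr_ge0//.
  by rewrite sqr_sqrtr// normsq_ge0.
by rewrite /= normr0 powR0// pnatr_eq0.
Qed.

Lemma L2norm_bm d (f : 'rV[R]_d -> C) : bm (fun x => normsq (f x)) ->
  L2norm (@uball R d) f = (Num.sqrt (BI (fun x => normsq (f x))))%:E.
Proof.
move=> bf; rewrite L2normE -BI_EFin// poweR_EFin powR12_sqrt//.
by apply: BI_ge0 => x _; exact: normsq_ge0.
Qed.

Lemma L2_bm d (f : 'rV[R]_d -> C) : bm (fun x => Re (f x)) -> bm (fun x => Im (f x)) ->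
  L2 (@uball R d) f.
Proof.
move=> bR bI; split; [exact: measurable_funTS (proj1 bR)|exact: measurable_funTS (proj1 bI)|].
by rewrite L2norm_bm ?ltry//; apply: bmD; exact: bmX.
Qed.

Lemma BI0 d : BI (fun _ : 'rV[R]_d => 0 : R) = 0.
Proof. by rewrite /BI Rintegral_cst ?mul0r//; exact: measurable_uball. Qed.

Lemma cvg_BI d (f : nat -> 'rV[R]_d -> R) (g : 'rV[R]_d -> R) M :
  (forall k, bm (f k)) -> bm g -> (forall k x, enorm x < 1 -> `|f k x| <= M) ->
  (forall x, enorm x < 1 -> f k x @[k --> \oo] --> g x) ->
  BI (f k) @[k --> \oo] --> BI g.
Proof.
move=> bf bg fM fg.
have mball := @measurable_uball R d.
have mf k : measurable_fun (@uball R d) (EFin \o f k).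
  by apply/measurable_EFinP/measurable_funTS; case: (bf k).
have mg : measurable_fun (@uball R d) (EFin \o g).
  by apply/measurable_EFinP/measurable_funTS; case: bg.
have h1 : {ae leb d, forall x, @uball R d x -> (EFin \o f k) x @[k --> \oo] --> (EFin \o g) x}.
  by apply: aeW => x x1; apply/fine_cvgP; split; [near=> k|exact: fg].
have h2 : {ae leb d, forall x n, @uball R d x -> (`|(EFin \o f n) x| <= (EFin \o (fun=> M)) x)%E}.
  by apply: aeW => x n x1; rewrite /= lee_fin fM.
have [_ _] := @dominated_convergence _ _ R (leb d) (@uball R d) mball (fun k => EFin \o f k) (EFin \o g)
  (EFin \o (fun=> M)) mf mg h1 (bm_integrable (bm_cst d M)) h2.
have e (h : 'rV[R]_d -> R) : bm h -> (\int[leb d]_(x in @uball R d) (EFin \o h) x)%E = (BI h)%:E.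
  by move=> bh; rewrite BI_EFin.
rewrite e// (_ : (fun k => _) = (fun k => (BI (f k))%:E)); last by apply/funext => k; rewrite /= e.
by move=> /fine_cvgP[_].
Unshelve. all: end_near.
Qed.

Lemma cvg_L2norm0 d (f : nat -> 'rV[R]_d -> C) M :
  (forall k, bm (fun x => Re (f k x))) -> (forall k, bm (fun x => Im (f k x))) ->
  (forall k x, enorm x < 1 -> normsq (f k x) <= M) ->
  (forall x, enorm x < 1 -> \forall k \near \oo, f k x = 0) ->
  L2norm (@uball R d) (f k) @[k --> \oo] --> 0%E.
Proof.
move=> bR bI fM f0.
have bn k : bm (fun x => normsq (f k x)) by apply: bmD; exact: bmX.
rewrite (_ : (fun k => L2norm _ _) = (fun k => (Num.sqrt (BI (fun x => normsq (f k x))))%:E)); last first.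
  by apply/funext => k; rewrite L2norm_bm.
apply: cvg_EFin; first by near=> k.
have := @cvg_BI d (fun k x => normsq (f k x)) (fun=> 0) M bn (bm_cst d 0).
rewrite BI0.
move=> h.
have : BI (fun x => normsq (f k x)) @[k --> \oo] --> (0:R).
  apply: h => [k x x1|x x1].
    by rewrite ger0_norm ?normsq_ge0// fM.
  apply: cvg_near_cst; apply: filterS (f0 x x1) => k ->.
  by rewrite /normsq /= expr0n/= addr0.
by move=> /(continuous_cvg _ (@sqrt_continuous R 0)); rewrite sqrtr0.
Unshelve. all: end_near.
Qed.
End ComplexL2.

(** * Green's formula for test functions *)

Section Green.
Context {R : realType} (d : nat).
Local Notation leb := (@lebesgue_rV R).
Local Notation V := 'rV[R]_d.
Local Notation dl i := (delta_mx 0 i : V).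
Implicit Types (f g G s eta : V -> R) (x : V).

Lemma enorm_shift i (t : R) x : enorm (t *: dl i + x) <= enorm x + `|t|.
Proof.
rewrite -(@ler_pXn2r _ 2)// ?nnegrE ?addr_ge0 ?enorm_ge0//.
rewrite sqrrD !sqr_enorm (bigD1 i)//= [in leRHS](bigD1 i)//= !mxE !eqxx/= mulr1.
rewrite (eq_bigr (fun j => x 0 j ^+ 2)); last first.
  by move=> j ji; rewrite !mxE eqxx/= (negbTE ji) mulr0 add0r.
have h : t * x 0 i <= `|t| * enorm x.
  by rewrite (le_trans (ler_norm _))// normrM ler_wpM2l// le_coord_enorm.
have : `|t| ^+ 2 = t ^+ 2 by rewrite real_normK ?num_real.
rewrite -mulr_natr; move: h; nra.
Qed.

Let BI_whole G : continuous G -> (forall x, 0 <= G x) -> (forall x, 1 <= enorm x -> G x = 0) ->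
  ((BI G)%:E = \int[leb d]_x (G x)%:E)%E.
Proof.
move=> cG G0 Gout; rewrite BI_EFin; last exact: bm_continuous.
rewrite [LHS]integral_mkcond; congr (integral _ _ _); apply/funext => x.
by rewrite patchE; case: ifPn => //; rewrite notin_setE => /negP; rewrite -leNgt => /Gout ->.
Qed.

Lemma continuous_addl (w : 'rV[R]_d) : continuous (fun x : 'rV[R]_d => w + x).
Proof.
move=> x; have FF : Filter (nbhs x) by exact: nbhs_filter.
have h1 : (fun _ : 'rV[R]_d => w) y @[y --> x] --> w by exact: cvg_cst.
have h2 : y @[y --> x] --> x by exact: cvg_id.
have := cvgD h1 h2; exact.
Qed.

Lemma continuous_shift i (t : R) : continuous (fun x : 'rV[R]_d => t *: dl i + x).
Proof. exact: (@continuous_addl (t *: dl i)). Qed.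

Lemma continuous_line i (x : 'rV[R]_d) : continuous (fun t : R => t *: dl i + x).
Proof.
under eq_fun do rewrite addrC.
exact: (ccomp (@continuous_scale_rVl _ _ (dl i)) (@continuous_addl x)).
Qed.

Let BI_translate_ge0 G (rho : R) i (t : R) : continuous G -> (forall x, 0 <= G x) ->
  (forall x, rho <= enorm x -> G x = 0) -> `|t| < 1 - rho ->
  BI (fun x => G (t *: dl i + x)) = BI G.
Proof.
move=> cG G0 Gout t1; apply: EFin_inj.
have r1 : rho <= 1 by rewrite -subr_ge0 (le_trans _ (ltW t1)).
rewrite !BI_whole//; last 3 first.
- by move=> x x1; apply: Gout; exact: le_trans x1.
- exact: (ccomp (@continuous_shift i t) cG).
- move=> x x1; apply: Gout.
  have := enorm_shift i (- t) (t *: dl i + x).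
  by rewrite scaleNr addKr normrN => h; move: t1 x1 h; clear; lra.
rewrite -[RHS](@ge0_integral_translate R d (t *: dl i)).
- by congr (integral _ _ _); apply/funext => x; rewrite addrC.
- by apply/measurable_EFinP; exact: continuous_measurable_rV.
- by move=> x; rewrite lee_fin.
Qed.

Lemma BI_translate G (rho : R) i (t : R) : continuous G ->
  (forall x, rho <= enorm x -> G x = 0) -> `|t| < 1 - rho ->
  BI (fun x => G (t *: dl i + x)) = BI G.
Proof.
move=> cG Gout t1.
pose f1 x : R := (`|G x| + G x) / 2; pose f2 x : R := (`|G x| - G x) / 2.
have fE x : G x = f1 x - f2 x by rewrite /f1 /f2; lra.
have cf1 : continuous f1 by exact: (cM (cD (cnorm cG) cG) (@cC _ _ _)).
have cf2 : continuous f2 by exact: (cM (@cB _ _ _ _ (cnorm cG) cG) (@cC _ _ _)).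
have b1 : bm (fun x => f1 (t *: dl i + x)) by apply: bm_continuous; exact: (ccomp (@continuous_shift i t) cf1).
have b2 : bm (fun x => f2 (t *: dl i + x)) by apply: bm_continuous; exact: (ccomp (@continuous_shift i t) cf2).
transitivity (BI (fun x => f1 (t *: dl i + x)) - BI (fun x => f2 (t *: dl i + x))).
  by rewrite -BIB//; congr BI; apply/funext => x; rewrite fE.
transitivity (BI f1 - BI f2); last first.
  by rewrite -BIB; [congr BI; apply/funext => x; rewrite fE|exact: bm_continuous|exact: bm_continuous].
have p1 x : 0 <= f1 x by rewrite /f1; have := ler_norm (- G x); rewrite normrN; lra.
have p2 x : 0 <= f2 x by rewrite /f2; have := ler_norm (G x); lra.
have o1 x : rho <= enorm x -> f1 x = 0 by rewrite /f1 => /Gout ->; rewrite normr0 addr0 mul0r.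
have o2 x : rho <= enorm x -> f2 x = 0 by rewrite /f2 => /Gout ->; rewrite normr0 subr0 mul0r.
by rewrite (BI_translate_ge0 i cf1 p1 o1 t1) (BI_translate_ge0 i cf2 p2 o2 t1).
Qed.

Lemma bmfam_shift f i : continuous f -> bmfam (fun t y => f (t *: dl i + y)).
Proof.
move=> cf; split.
- by move=> r; apply: bm_continuous; exact: (ccomp (@continuous_shift i r) cf).
- by move=> y _; exact: (ccomp (@continuous_line i y) cf).
- move=> u; have [M _ hM] := continuous_cball_bounded (1 + u) cf.
  exists M => r y ru y1; apply: hM; apply: (le_trans (enorm_shift _ _ _)).
  by rewrite lerD// ltW.
Qed.

(** For small t translating G along a coordinate keeps its support in the ball, so the integral does
    not depend on t; its derivative at t = 0 is the integral of the partial derivative. This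
    replaces the divergence theorem. *)
Lemma BI_partial0 G (rho : R) i : CkR 1 G -> rho < 1 ->
  (forall x, rho <= enorm x -> G x = 0) -> BI (fun x => 'D_(dl i) G x) = 0.
Proof.
move=> cG r1 Gout.
have cDG : continuous (fun x => 'D_(dl i) G x) by exact: CkR_continuous (CkR_D i cG).
have h := BI_derive (bmfam_shift i (CkR_continuous cG)) (bmfam_shift i cDG).
have {}h := h (fun r y _ => is_derive_line_at (CkR_derivable (r *: dl i + y) i cG)) 0.
transitivity (BI (fun y => 'D_(dl i) G (0 *: dl i + y))).
  by congr BI; apply/funext => y; rewrite scale0r add0r.
have r1' : 0 < 1 - rho by rewrite subr_gt0.
rewrite -(d1E h); apply: (@derive1_locally_cst _ _ (BI G)).
apply: filterS (@nbhs0_lt R R _ r1') => t t1.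
by apply: (@BI_translate G rho) => //; exact: CkR_continuous cG.
Qed.

Lemma partial_out eta (rho : R) i x : (forall x, rho <= enorm x -> eta x = 0) ->
  rho < enorm x -> 'D_(dl i) eta x = 0.
Proof.
move=> eout xr; rewrite derive_line -derive1E; apply: (@derive1_locally_cst _ _ 0).
have c1 : continuous (fun t : R => enorm (t *: dl i + x)).
  exact: (ccomp (@continuous_line i x) (@continuous_enorm _ _)).
have c0 : enorm (t *: dl i + x) @[t --> (0:R)] --> enorm (0 *: dl i + x) by exact: c1.
have xr' : rho < enorm (0 *: dl i + x) by rewrite scale0r add0r.
by apply: filterS (cvgr_gt _ c0 rho xr') => t /ltW; exact: eout.
Qed.

Lemma BI_green s eta (rho : R) i : CkR 2 s -> CkR 2 eta -> rho < 1 ->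
  (forall x, rho <= enorm x -> eta x = 0) ->
  BI (fun x => s x * 'D_(dl i) (fun y => 'D_(dl i) eta y) x) =
  BI (fun x => 'D_(dl i) (fun y => 'D_(dl i) s y) x * eta x).
Proof.
move=> cs ce r1 eout.
have cs1 := CkR_pred cs; have ce1 := CkR_pred ce.
pose G x := s x * 'D_(dl i) eta x - 'D_(dl i) s x * eta x.
have cG : CkR 1 G.
  exact: (CkRB (CkRM cs1 (CkR_D i ce)) (CkRM (CkR_D i cs) ce1)).
have dG x : 'D_(dl i) G x = s x * 'D_(dl i) (fun y => 'D_(dl i) eta y) x -
     'D_(dl i) (fun y => 'D_(dl i) s y) x * eta x.
  have h1 := vM (CkR_derivable x i cs1) (CkR_derivable x i (CkR_D i ce)).
  have h2 := vM (CkR_derivable x i (CkR_D i cs)) (CkR_derivable x i ce1).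
  have alg (u w q : R) : u + w - (q + u) = w - q by ring.
  by rewrite (vE (vB h1 h2)) alg.
(* The derivative of eta is only known to vanish where |x| > rho, hence a larger radius. *)
have := @BI_partial0 G ((1 + rho) / 2) i cG.
have -> : BI (fun x => 'D_(dl i) G x) = BI (fun x => s x * 'D_(dl i) (fun y => 'D_(dl i) eta y) x) -
   BI (fun x => 'D_(dl i) (fun y => 'D_(dl i) s y) x * eta x).
  rewrite -BIB; first by congr BI; apply/funext => x; rewrite dG.
    apply: bm_continuous; apply: cM; first exact: CkR_continuous cs.
    exact: CkR_continuous (CkR_D i (CkR_D i ce)).
  apply: bm_continuous; apply: cM; last exact: CkR_continuous ce.
  exact: CkR_continuous (CkR_D i (CkR_D i cs)).
move=> h; apply/eqP; rewrite -subr_eq0; apply/eqP; apply: h; first by lra.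
move=> x xr; have x1 : rho < enorm x by lra.
by rewrite /G (partial_out _ eout x1) (eout x (ltW x1)) !mulr0 subrr.
Qed.

Lemma BI_green_lap s eta : CkR 2 s -> CkR 2 eta ->
  (exists2 rho : R, rho < 1 & forall x, rho <= enorm x -> eta x = 0) ->
  BI (fun x => s x * lapR eta x) = BI (fun x => lapR s x * eta x).
Proof.
move=> cs ce [rho r1 eout].
have b1 i : bm (fun x => s x * 'D_(dl i) (fun y => 'D_(dl i) eta y) x).
  apply: bm_continuous; apply: cM; first exact: CkR_continuous cs.
  exact: CkR_continuous (CkR_D i (CkR_D i ce)).
have b2 i : bm (fun x => 'D_(dl i) (fun y => 'D_(dl i) s y) x * eta x).
  apply: bm_continuous; apply: cM; last exact: CkR_continuous ce.
  exact: CkR_continuous (CkR_D i (CkR_D i cs)).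
under eq_fun do rewrite /lapR mulr_sumr.
under [in RHS]eq_fun do rewrite /lapR mulr_suml.
rewrite !BI_sum//; apply: eq_bigr => i _; exact: BI_green eout.
Qed.
End Green.

(** * Distributional equations, membership in H^1_0 and the resolvent bound *)

Section Resolvent.
Context {R : realType} (k : nat).
Local Notation d := k.+2.
Local Notation leb := (@lebesgue_rV R).
Local Notation V := 'rV[R]_k.+2.
Local Notation C := R[i].
Local Notation Re := (@complex.Re R).
Local Notation Im := (@complex.Im R).
Local Notation dl i := (delta_mx 0 i : V).

Definition cplx (f : V -> R) : V -> C := fun x => (f x)%:C%C.

Lemma real_test_of (eta : V -> C) : test_function (@uball R d) eta ->
  real_test (fun x => Re (eta x)) /\ real_test (fun x => Im (eta x)).
Proof.
move=> [se [K [cK KB Kout]]].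
have [rho r1 rout] : exists2 rho : R, rho < 1 & forall x : V, rho <= enorm x -> ~ K x.
  have [K0|/set0P [x0 Kx0]] := eqVneq K set0.
    by exists 0 => // x _; rewrite K0.
  have cE : {within K, continuous (@enorm R d)} by apply: continuous_subspaceT; exact: continuous_enorm.
  have [c Kc hc] := compact_EVT_max (ex_intro _ x0 Kx0) cK cE.
  have c1 : enorm c < 1 by apply: KB; rewrite -inE.
  exists ((1 + enorm c) / 2); first by lra.
  move=> x hx Kx; have := hc x; rewrite inE => /(_ Kx); lra.
split; split=> [n|]; try by have [] := se n.
- by exists rho => // x /rout /Kout ->.
- by exists rho => // x /rout /Kout ->.
Qed.

Lemma cplx_test (eta : V -> R) : real_test eta -> test_function (@uball R d) (cplx eta).
Proof.
move=> [se [rho r1 eout]]; split; first by move=> n; split; [exact: se|exact: CkRC].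
exists [set x | enorm x <= rho]; split; first exact: compact_cball.
- by move=> x /= /le_lt_trans; exact.
- by move=> x /negP; rewrite -ltNge /cplx => /ltW/eout ->.
Qed.

Lemma partial_cplx (f : V -> R) i x : partial i (cplx f) x = ('D_(dl i) f x)%:C%C.
Proof.
by rewrite /partial /cplx /=; congr (_ +i* _)%C; exact: vE (vC 0 x _).
Qed.

Lemma Re_laplacian (f : V -> C) x : Re (laplacian f x) = lapR (fun y => Re (f y)) x.
Proof. by rewrite /laplacian Re_sum. Qed.

Lemma Im_laplacian (f : V -> C) x : Im (laplacian f x) = lapR (fun y => Im (f y)) x.
Proof. by rewrite /laplacian Im_sum. Qed.

Lemma lapR_continuous (f : V -> R) : CkR 2 f -> continuous (lapR f).
Proof.
move=> cf; apply: continuous_sumr => i _; exact: CkR_continuous (CkR_D i (CkR_D i cf)).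
Qed.

Lemma weak_eq_of (v psi : V -> C) (E : R) : Ck 1 psi ->
  continuous (fun x => Re (v x * psi x)) -> continuous (fun x => Im (v x * psi x)) ->
  schrodinger_eq v E psi (fun=> 0) ->
  weak_eq (fun x => Re (psi x)) (fun x => Re (v x * psi x)) E /\
  weak_eq (fun x => Im (psi x)) (fun x => Im (v x * psi x)) E.
Proof.
move=> [cR cI] cFR cFI H.
have key (f F : V -> R) (eta : V -> R) : CkR 1 f -> continuous F -> real_test eta ->
    BI (fun x => F x * eta x - f x * (lapR eta x + E * eta x)) = 0 ->
    BI (fun x => f x * (lapR eta x + E * eta x)) = BI (fun x => F x * eta x).
  move=> cf cF [se _]; rewrite BIB; first by move=> /eqP; rewrite subr_eq0 => /eqP ->.
    by apply: bm_continuous; apply: cM => //; exact: CkR_continuous (se 0).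
  apply: bm_continuous; apply: cM; first exact: CkR_continuous cf.
  apply: cD; first exact: lapR_continuous (se 2).
  by apply: cM; [exact: cC|exact: CkR_continuous (se 0)].
split=> eta te; apply: key => //; have := H _ (cplx_test te).
- move=> /(congr1 Re); rewrite /cintegral /= -!/(BI _).
  rewrite [X in _ = X -> _](_ : _ = 0); last first.
    by rewrite -[RHS](@BI0 R d); congr BI; apply/funext => x; rewrite !mul0r ?subr0 ?addr0.
  move=> <-; congr BI; apply/funext => x.
  rewrite !cxE Re_laplacian Im_laplacian /cplx /= [lapR (fun=> 0) x]big1; last first.
    move=> i _; have -> : 'D_(dl i) (fun=> 0 : R) = (fun=> 0) by apply/funext => y; exact: vE (vC 0 y _).
    exact: vE (vC 0 x _).
  by ring.
- move=> /(congr1 Im); rewrite /cintegral /= -!/(BI _).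
  rewrite [X in _ = X -> _](_ : _ = 0); last first.
    by rewrite -[RHS](@BI0 R d); congr BI; apply/funext => x; rewrite !mul0r ?subr0 ?addr0.
  move=> <-; congr BI; apply/funext => x.
  rewrite !cxE Re_laplacian Im_laplacian /cplx /= [lapR (fun=> 0) x]big1; last first.
    move=> i _; have -> : 'D_(dl i) (fun=> 0 : R) = (fun=> 0) by apply/funext => y; exact: vE (vC 0 y _).
    exact: vE (vC 0 x _).
  by ring.
Qed.

Lemma schrodinger_classical (s : V -> R) (E : R) : (forall n, CkR n s) ->
  schrodinger_eq (fun=> 0) E (cplx s) (cplx (fun x => - (lapR s x + E * s x))).
Proof.
move=> ss eta te; have [teR teI] := real_test_of te.
have key (e : V -> R) : real_test e ->
    BI (fun x => s x * (- lapR e x - E * e x)) = BI (fun x => - (lapR s x + E * s x) * e x).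
  move=> [se oe]; have cs := CkR_continuous (ss 0); have ce := CkR_continuous (se 0).
  have b1 : bm (fun x => s x * lapR e x).
    by apply: bm_continuous; apply: cM => //; exact: lapR_continuous (se 2).
  have b2 : bm (fun x => lapR s x * e x).
    by apply: bm_continuous; apply: cM => //; exact: lapR_continuous (ss 2).
  have b3 : bm (fun x => E * (s x * e x)).
    by apply: bm_continuous; apply: cM; [exact: cC|exact: cM].
  transitivity (- BI (fun x => s x * lapR e x) - BI (fun x => E * (s x * e x))).
    rewrite -BIN// -BIB//; last exact: bmN.
    by congr BI; apply/funext => x; ring.
  rewrite (BI_green_lap (ss 2) (se 2) oe) -BIN// -BIB//; last exact: bmN.
  by congr BI; apply/funext => x; ring.
rewrite /cintegral -!/(BI _); apply: complexP => /=.
  transitivity (BI (fun x => s x * (- lapR (fun y => Re (eta y)) x - E * Re (eta x)))).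
    congr BI; apply/funext => x; rewrite !cxE Re_laplacian Im_laplacian /=.
    move: (lapR (fun y => Re (eta y)) x) (lapR (fun y => Im (eta y)) x) (Re (eta x)) (Im (eta x)) (s x).
    by move=> u1 u2 u3 u4 u5; ring.
  by rewrite key//; congr BI; apply/funext => x; rewrite !cxE /=; ring.
transitivity (BI (fun x => s x * (- lapR (fun y => Im (eta y)) x - E * Im (eta x)))).
  congr BI; apply/funext => x; rewrite !cxE Re_laplacian Im_laplacian /=.
    move: (lapR (fun y => Re (eta y)) x) (lapR (fun y => Im (eta y)) x) (Re (eta x)) (Im (eta x)) (s x).
    by move=> u1 u2 u3 u4 u5; ring.
by rewrite key//; congr BI; apply/funext => x; rewrite !cxE /=; ring.
Qed.

(* Cutting off where |x|^2 > 1 - 1/K costs a gradient of size K, compensated by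
   s = O(1/K) there. *)
Lemma H10_cplx (s : V -> R) (M : R) : (forall n, CkR n s) ->
  (forall x, enorm x < 1 -> `|s x| <= M * (1 - nsq x)) -> H10 (cplx s).
Proof.
move=> ss sM; have cs := CkR_continuous (ss 0).
have cDs i : continuous (fun x => 'D_(dl i) s x) by exact: CkR_continuous (CkR_D i (ss 1)).
have [tau [st t1 t0 td t01]] := smooth_step (ltrN10 R).
have ct' : continuous (derive1 tau) by have [] := st 1.
have [T T0 hT] : exists2 T, 0 <= T & forall t, `|derive1 tau t| <= T.
  have ct2 : continuous (fun x : R => derive1 tau (x - 1)).
    by apply: (ccomp _ ct'); apply: cB; [move=> x; exact: cvg_id|exact: cC].
  have [T T0 hT] := continuous_segment_bounded ct2.
  exists T => // t; have [h1|h1] := ltP t (- 1).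
    rewrite (@derive1_locally_cst _ _ 1) ?normr0//; near=> u; apply: t1; apply: ltW; near: u.
    exact: lt_nbhsl.
  have [h2|h2] := ltP 0 t.
    rewrite (@derive1_locally_cst _ _ 0) ?normr0//; near=> u; apply: t0; apply: ltW; near: u.
    exact: lt_nbhsr.
  have := hT (t + 1); rewrite addrK; apply; apply/andP; split; lra.
pose c (K : nat) (x : V) : R := tau (K%:R * (nsq x - 1) + 1).
pose c' (K : nat) (x : V) : R := K%:R * derive1 tau (K%:R * (nsq x - 1) + 1).
have lin (K : nat) n : CkR n (fun x : V => K%:R * (nsq x - 1) + 1 : R).
  apply: CkRD; last exact: CkRC.
  by apply: CkRM; [exact: CkRC|apply: CkRB; [exact: CkR_nsq|exact: CkRC]].
have sc K n : CkR n (c K) by exact: (CkR_comp (st n) (lin K n)).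
have dc K i x : is_derive x (dl i) (c K) (c' K x * (2 * x 0 i)).
  have h : is_derive x (dl i) (fun x : V => K%:R * (nsq x - 1) + 1 : R) (K%:R * (2 * x 0 i)).
    have := vD (vM (vC K%:R x (dl i)) (vB (is_derive_nsq x i) (vC 1 x (dl i)))) (vC 1 x (dl i)).
    by rewrite mul0r add0r subr0 addr0.
  have -> : c' K x * (2 * x 0 i) = derive1 tau (K%:R * (nsq x - 1) + 1) * (K%:R * (2 * x 0 i)).
    by rewrite [RHS]mulrCA mulrA.
  exact: vcomp h (C1k_d (K%:R * (nsq x - 1) + 1) (st 1)).
have c01 K x : 0 <= c K x <= 1 by exact: t01.
have nsq1 (x : V) : enorm x < 1 -> nsq x < 1 by move=> x1; rewrite nsqE exprn_ilt1 ?enorm_ge0.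
have near1 (x : V) : enorm x < 1 -> \forall K \near \oo, K%:R * (nsq x - 1) + 1 < -1.
  move=> /nsq1 x1; have x10 : 0 < 1 - nsq x by rewrite subr_gt0.
  near=> K; have : 2 / (1 - nsq x) < K%:R.
    near: K; exact: nbhs_infty_gtr.
  by rewrite ltr_pdivrMr//; lra.
have c1 x : enorm x < 1 -> \forall K \near \oo, c K x = 1 /\ c' K x = 0.
  move=> x1; have [N _ hN] := near1 x x1; exists N => // K /hN hK; split; first by rewrite /c t1// ltW.
  rewrite /c' (@derive1_locally_cst _ _ 1) ?mulr0//; near=> u; apply: t1; apply: ltW; near: u.
  exact: lt_nbhsl.
have c's K x : enorm x < 1 -> `|c' K x * s x| <= T * (2 * `|M|).
  move=> x1; rewrite /c'; set u := K%:R * (nsq x - 1) + 1.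
  have [u1|u1] := ltP u (- 1).
    rewrite (@derive1_locally_cst _ _ 1) ?mulr0 ?mul0r ?normr0 ?mulr_ge0//.
    near=> z; apply: t1; apply: ltW; near: z; exact: lt_nbhsl.
  have h : K%:R * (1 - nsq x) <= 2 by rewrite /u in u1; lra.
  have n0 : 0 <= 1 - nsq x by rewrite subr_ge0 ltW// nsq1.
  rewrite !normrM (ger0_norm (ler0n R K)) [K%:R * _]mulrC -mulrA.
  apply: ler_pM => //.
  apply: (@le_trans _ _ (K%:R * (`|M| * (1 - nsq x)))).
    by rewrite ler_wpM2l// (le_trans (sM x x1))// ler_wpM2r// ler_norm.
  by rewrite mulrCA [2 * _]mulrC ler_wpM2l.
pose w K (x : V) : R := c K x * s x.
have sw K n : CkR n (w K) by exact: (CkRM (sc K n) (ss n)).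
have dw K i x : 'D_(dl i) (w K) x = c' K x * (2 * x 0 i) * s x + c K x * 'D_(dl i) s x.
  exact: vE (vM (dc K i x) (CkR_derivable x i (ss 1))).
have bmRe (f : V -> R) : continuous f -> bm (fun x => Re (cplx f x)) by exact: bm_continuous.
have bmIm (f : V -> R) : bm (fun x => Im (cplx f x)) by exact: bm_cst.
have L2c (f : V -> R) : continuous f -> L2 (@uball R d) (cplx f).
  by move=> cf; apply: L2_bm; [exact: bmRe|exact: bmIm].
have [M0 _ hM0] := continuous_cball_bounded 1 cs.
split; first exact: L2c.
exists (fun K => cplx (w K.+1)), (fun i => cplx (fun x => 'D_(dl i) s x)); split.
- move=> K; apply: cplx_test; split; first exact: sw.
  have Kp : 0 < K.+1%:R :> R by rewrite ltr0n.
  have K1 : 0 <= 1 - K.+1%:R^-1 :> R by rewrite subr_ge0 invf_le1// ler1n.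
  exists (Num.sqrt (1 - K.+1%:R^-1)).
    by rewrite -[ltRHS]sqrtr1 ltr_sqrt// ltrBlDr ltrDl invr_gt0.
  move=> x hx; have : 1 - K.+1%:R^-1 <= nsq x.
    by rewrite nsqE -(sqr_sqrtr K1) lerXn2r ?nnegrE ?sqrtr_ge0 ?enorm_ge0.
  move=> h; rewrite /w /c t0 ?mul0r//.
  have : K.+1%:R * (1 - K.+1%:R^-1) <= K.+1%:R * nsq x by rewrite ler_wpM2l// ltW.
  by rewrite mulrBr mulfV ?gt_eqF// mulr1; lra.
- by move=> i; exact: L2c.
- apply: (@cvg_L2norm0 _ _ _ (M0 ^+ 2)).
  + move=> K; rewrite (_ : (fun x => _) = (fun x => w K.+1 x - s x)).
      by apply: bm_continuous; apply: cB => //; exact: CkR_continuous (sw K.+1 0).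
    by apply/funext => x; rewrite !cxE.
  + move=> K; rewrite (_ : (fun x => _) = (fun=> 0)); first exact: bm_cst.
    by apply/funext => x; rewrite !cxE /= subr0.
  + move=> K x x1; rewrite /normsq !cxE /= subr0 expr0n/= addr0 /w.
    have -> : (c K.+1 x * s x - s x) ^+ 2 = (1 - c K.+1 x) ^+ 2 * (s x) ^+ 2 by ring.
    have /andP[h0 h1] := c01 K.+1 x; have h2 := hM0 x (ltW x1).
    have h3 : (s x) ^+ 2 <= M0 ^+ 2 by rewrite -(real_normK (num_real (s x))) lerXn2r ?nnegrE// (le_trans _ h2).
    have : (1 - c K.+1 x) ^+ 2 <= 1 by rewrite exprn_ile1; lra.
    by move=> h4; rewrite -[leRHS]mul1r ler_pM ?sqr_ge0.
  + move=> x x1; have [N _ hN] := c1 x x1; exists N => // K NK.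
    have [e _] := hN K.+1 (leqW NK); rewrite /w /cplx e mul1r subrr//.
- move=> i; have [M1 M10 hM1] := continuous_cball_bounded 1 (cDs i).
  apply: (@cvg_L2norm0 _ _ _ ((2 * (T * (2 * `|M|)) + M1) ^+ 2)).
  + move=> K; rewrite (_ : (fun x => _) = (fun x => 'D_(dl i) (w K.+1) x - 'D_(dl i) s x)).
      by apply: bm_continuous; apply: cB => //; exact: CkR_continuous (CkR_D i (sw K.+1 1)).
    by apply/funext => x; rewrite partial_cplx !cxE.
  + move=> K; rewrite (_ : (fun x => _) = (fun=> 0)); first exact: bm_cst.
    by apply/funext => x; rewrite partial_cplx !cxE /= subr0.
  + move=> K x x1; rewrite partial_cplx /normsq !cxE /= subr0 expr0n/= addr0 dw.
    have -> : c' K.+1 x * (2 * x 0 i) * s x + c K.+1 x * 'D_(dl i) s x - 'D_(dl i) s x =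
       2 * x 0 i * (c' K.+1 x * s x) - (1 - c K.+1 x) * 'D_(dl i) s x by ring.
    have /andP[h0 h1] := c01 K.+1 x; have h2 := hM1 x (ltW x1).
    have TM : 0 <= T * (2 * `|M|) by rewrite !mulr_ge0.
    rewrite -[X in X <= _]real_normK ?num_real// lerXn2r ?nnegrE ?addr_ge0 ?mulr_ge0//.
    rewrite (le_trans (ler_normB _ _))// lerD//.
      rewrite normrM ler_pM// ?c's// normrM (ger0_norm (ler0n R 2)) ger_pMr//.
      by rewrite (le_trans (le_coord_enorm _ _))// ltW.
    rewrite normrM -[leRHS]mul1r ler_pM// ger0_norm; lra.
  + move=> x x1; have [N _ hN] := c1 x x1; exists N => // K NK.
    have [e e'] := hN K.+1 (leqW NK); rewrite partial_cplx dw e e' !mul0r add0r mul1r subrr//.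
Unshelve. all: end_near.
Qed.

(** [opnorm] is a supremum over data of norm at most 1, so s is rescaled by t before being tested.
    If its datum has norm 0, every t is admissible, which forces s to have norm 0 as well. *)
Lemma resolvent_le (s : V -> R) (E q M : R) : (forall n, CkR n s) ->
  (forall x, enorm x < 1 -> `|s x| <= M * (1 - nsq x)) ->
  (resolvent_norm (fun _ : V => 0%R : C) E <= q%:E)%E ->
  BI (fun x => s x ^+ 2) <= q ^+ 2 * BI (fun x => (lapR s x + E * s x) ^+ 2).
Proof.
move=> ss sM hq; pose f (x : V) : R := - (lapR s x + E * s x).
have cs := CkR_continuous (ss 0).
have cf : continuous f.
  by apply: cN; apply: cD; [exact: lapR_continuous (ss 2)|apply: cM => //; exact: cC].
have nE (g : V -> R) : continuous g ->
    L2norm (@uball R d) (cplx g) = (Num.sqrt (BI (fun x => g x ^+ 2)))%:E.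
  move=> cg; have e : (fun x => normsq (cplx g x)) = (fun x => g x ^+ 2).
    by apply/funext => x; rewrite /normsq /= expr0n/= addr0.
  by rewrite L2norm_bm e//; apply: bmX; exact: bm_continuous.
have BIsq (g : V -> R) : 0 <= BI (fun x => g x ^+ 2) by apply: BI_ge0 => x _; exact: sqr_ge0.
have key (t : R) : 0 < t -> t * Num.sqrt (BI (fun x => f x ^+ 2)) <= 1 ->
    t * Num.sqrt (BI (fun x => s x ^+ 2)) <= q.
  move=> t0 h.
  pose ts (x : V) : R := t * s x.
  have sts n : CkR n ts by exact: CkRZ.
  have scl (g : V -> R) : continuous g -> BI (fun x => (t * g x) ^+ 2) = t ^+ 2 * BI (fun x => g x ^+ 2).
    move=> cg; rewrite -BIZ; last by apply: bmX; exact: bm_continuous.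
    by congr BI; apply/funext => x; rewrite exprMn.
  have lapts x : lapR ts x = t * lapR s x.
    have D1 i y : 'D_(dl i) ts y = t * 'D_(dl i) s y.
      by rewrite (vE (vM (vC t y (dl i)) (CkR_derivable y i (ss 1)))) mul0r add0r.
    rewrite /lapR mulr_sumr; apply: eq_bigr => i _.
    rewrite (_ : 'D_(dl i) ts = (fun y => t * 'D_(dl i) s y)); last exact/funext.
    by rewrite (vE (vM (vC t x (dl i)) (CkR_derivable x i (CkR_D i (ss 2))))) mul0r add0r.
  have ef : (fun x => - (lapR ts x + E * ts x)) = (fun x => t * f x).
    by apply/funext => x; rewrite lapts /ts /f; ring.
  have res : resolvent (fun _ : V => 0 : C) E (cplx (fun x => t * f x)) (cplx ts).
    split.
    - by apply: L2_bm; [apply: bm_continuous; apply: cM => //; exact: cC|exact: bm_cst].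
    - apply: (@H10_cplx ts (t * M)) => // x x1.
      by rewrite /ts normrM gtr0_norm// -mulrA ler_wpM2l ?(ltW t0)// sM.
    - by rewrite -ef; exact: schrodinger_classical.
  have : (L2norm (@uball R d) (cplx ts) <= q%:E)%E.
    apply: le_trans hq; apply: ereal_sup_ubound; exists (cplx ts) => //=.
    exists (cplx (fun x => t * f x)) => //.
    rewrite nE; last by apply: cM => //; exact: cC.
    by rewrite scl// sqrtrM ?sqr_ge0// sqrtr_sqr gtr0_norm// lee_fin.
  rewrite nE; last by apply: cM => //; exact: cC.
  by rewrite scl// sqrtrM ?sqr_ge0// sqrtr_sqr gtr0_norm// lee_fin.
have fe : BI (fun x => (lapR s x + E * s x) ^+ 2) = BI (fun x => f x ^+ 2).
  by congr BI; apply/funext => x; rewrite /f sqrrN.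
rewrite fe; set A := BI (fun x => s x ^+ 2); set B := BI (fun x => f x ^+ 2).
have A0 : 0 <= A := BIsq _; have B0 : 0 <= B := BIsq _.
rewrite -(sqr_sqrtr A0) -[B](sqr_sqrtr B0) -exprMn.
have q0 : 0 <= q.
  have [b0|b0] := eqVneq (Num.sqrt B) 0.
    by apply: le_trans (key 1 ltr01 _); rewrite ?mul1r ?sqrtr_ge0// -/B b0.
  have bp : 0 < Num.sqrt B by rewrite lt_neqAle eq_sym b0 sqrtr_ge0.
  apply: le_trans (key (Num.sqrt B)^-1 _ _); rewrite ?invr_gt0//.
  by rewrite -/B mulVf.
rewrite lerXn2r ?nnegrE ?mulr_ge0 ?sqrtr_ge0//.
have [b0|b0] := eqVneq (Num.sqrt B) 0; last first.
  have bp : 0 < Num.sqrt B by rewrite lt_neqAle eq_sym b0 sqrtr_ge0.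
  have := key (Num.sqrt B)^-1; rewrite invr_gt0 -/B mulVf// lexx => /(_ bp isT).
  by rewrite ler_pdivrMl// mulrC.
rewrite b0 mulr0 leNgt; apply/negP => a0.
have := key ((q + 1) / Num.sqrt A); rewrite -/B b0 mulr0 ler01 divfK ?gt_eqF//.
by rewrite divr_gt0 ?ltr_wpDl// => /(_ isT isT); lra.
Qed.
End Resolvent.

(** * Spherical harmonics, rotations and frequencies *)

Section HarmonicPolynomials.
Context {R : realType} (d : nat).
Local Notation C := R[i].
Local Notation Re := (@complex.Re R).
Local Notation Im := (@complex.Im R).
Local Notation V := 'rV[R]_d.
Local Notation dl i := (delta_mx 0 i : V).
Local Notation P := (mpoly d C).
Local Notation Xv i := (mpolyX C (mnm1 i) : P).

Lemma mpoly_gen_ind (Q : P -> Prop) : (forall c : C, Q (mpolyC d c)) -> (forall i, Q (Xv i)) ->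
  (forall p q, Q p -> Q q -> Q (p + q)) -> (forall p q, Q p -> Q q -> Q (p * q)) -> forall p, Q p.
Proof.
move=> QC QX QD QM p; rewrite (mpolyE p); elim/big_ind : _ => //.
  by rewrite -(mpolyC0 d C); exact: QC.
move=> m _; rewrite -mul_mpolyC; apply: (QM) => //; rewrite mpolyXE_id.
elim/big_ind : _ => //; first by rewrite -(mpolyC1 d C); exact: QC.
move=> i _; elim: (m i) => [|n IH]; first by rewrite expr0 -(mpolyC1 d C); exact: QC.
by rewrite exprS; exact: QM.
Qed.

Definition ev (p : P) (x : V) : C := meval (fun i => (x 0 i)%:C%C) p.

Lemma evD p q x : ev (p + q) x = ev p x + ev q x. Proof. exact: mevalD. Qed.
Lemma evM p q x : ev (p * q) x = ev p x * ev q x. Proof. exact: mevalM. Qed.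
Lemma evZ c p x : ev (c *: p) x = c * ev p x. Proof. exact: mevalZ. Qed.
Lemma evC c x : ev (mpolyC d c) x = c. Proof. exact: mevalC. Qed.
Lemma evX i x : ev (Xv i) x = (x 0 i)%:C%C. Proof. exact: mevalXU. Qed.
Lemma ev0 x : ev 0 x = 0. Proof. exact: meval0. Qed.

Lemma ev_sum (I : Type) (r : seq I) (F : I -> P) x :
  ev (\sum_(i <- r) F i) x = \sum_(i <- r) ev (F i) x.
Proof. by elim/big_rec2 : _ => [|i a b _ <-]; [exact: ev0|exact: evD]. Qed.

Lemma mderivXU i l : mderiv i (Xv l) = mpolyC d (l == i)%:R.
Proof.
rewrite mderivX mnm1E; case: eqVneq => [->|_]; last by rewrite scale0r mpolyC0.
rewrite scale1r (_ : mnm_sub _ _ = mnm0) ?mpolyX0 ?mpolyC1//.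
by apply/mnmP => k; rewrite mnmBE mnm0E subnn.
Qed.

Lemma ev_derive p i x :
  is_derive x (dl i) (fun y => Re (ev p y)) (Re (ev (mderiv i p) x)) /\
  is_derive x (dl i) (fun y => Im (ev p y)) (Im (ev (mderiv i p) x)).
Proof.
elim/mpoly_gen_ind : p => [c|l|p q [p1 p2] [q1 q2]|p q [p1 p2] [q1 q2]].
- rewrite mderivC ev0; split.
    by under [X in is_derive _ _ X _]eq_fun do rewrite evC; exact: vC.
  by under [X in is_derive _ _ X _]eq_fun do rewrite evC; exact: vC.
- rewrite mderivXU evC; split.
    under [X in is_derive _ _ X _]eq_fun do rewrite evX.
    have := vcoord x l (dl i); rewrite mxE eqxx/=.
    by case: (l == i).
  under [X in is_derive _ _ X _]eq_fun do rewrite evX.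
  by case: (l == i); exact: vC.
- rewrite mderivD evD !cxE; split.
    by under [X in is_derive _ _ X _]eq_fun do rewrite evD ReDE; exact: vD.
  by under [X in is_derive _ _ X _]eq_fun do rewrite evD ImDE; exact: vD.
- rewrite mderivM evD !evM !cxE; split.
    under [X in is_derive _ _ X _]eq_fun do rewrite evM ReME.
    have := vB (vM p1 q1) (vM p2 q2); congr (is_derive _ _ _ _).
    by rewrite opprD addrACA.
  under [X in is_derive _ _ X _]eq_fun do rewrite evM ImME.
  have := vD (vM p1 q2) (vM p2 q1); by congr (is_derive _ _ _ _); rewrite addrACA.
Qed.

Lemma CkR_ev k p : CkR k (fun x => Re (ev p x)) /\ CkR k (fun x => Im (ev p x)).
Proof.
elim: k p => [|k IH] p; last first.
  have c0 := IH p; split.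
    apply: (CkRS (CkR_continuous c0.1) (fun i x => (ev_derive p i x).1)) => i.
    by have [] := IH (mderiv i p).
  apply: (CkRS (CkR_continuous c0.2) (fun i x => (ev_derive p i x).2)) => i.
  by have [] := IH (mderiv i p).
elim/mpoly_gen_ind : p => [c|l|p q [p1 p2] [q1 q2]|p q [p1 p2] [q1 q2]]; split.
- rewrite (_ : (fun x => _) = fun x => Re c); first exact: CkRC.
  by apply/funext => x; rewrite evC.
- rewrite (_ : (fun x => _) = fun x => Im c); first exact: CkRC.
  by apply/funext => x; rewrite evC.
- rewrite (_ : (fun x => _) = fun x : V => x 0 l); first exact: CkR_coord.
  by apply/funext => x; rewrite evX.
- rewrite (_ : (fun x => _) = fun _ : V => 0 : R); first exact: CkRC.
  by apply/funext => x; rewrite evX.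
- rewrite (_ : (fun x => _) = fun x => Re (ev p x) + Re (ev q x)); first exact: CkRD p1 q1.
  by apply/funext => x; rewrite evD ReDE.
- rewrite (_ : (fun x => _) = fun x => Im (ev p x) + Im (ev q x)); first exact: CkRD p2 q2.
  by apply/funext => x; rewrite evD ImDE.
- rewrite (_ : (fun x => _) = fun x => Re (ev p x) * Re (ev q x) - Im (ev p x) * Im (ev q x)); first exact: CkRB (CkRM p1 q1) (CkRM p2 q2).
  by apply/funext => x; rewrite evM ReME.
- rewrite (_ : (fun x => _) = fun x => Re (ev p x) * Im (ev q x) + Im (ev p x) * Re (ev q x)); first exact: CkRD (CkRM p1 q2) (CkRM p2 q1).
  by apply/funext => x; rewrite evM ImME.
Qed.

Definition harm (j : nat) (p : P) : Prop :=
  p \is ishomog1 j mdeg /\ \sum_(i < d) mderiv i (mderiv i p) = 0.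

Lemma ev_homog j p (t : R) x : p \is ishomog1 j mdeg -> ev p (t *: x) = (t ^+ j)%:C%C * ev p x.
Proof.
move=> /dhomogP hp; rewrite /ev !mevalE mulr_sumr; apply: eq_big_seq => m /hp /= mj.
rewrite mulrCA; congr (_ * _).
rewrite -mj mdegE rmorphXn/= -prodrXr -big_split/=; apply: eq_bigr => i _.
by rewrite mxE rmorphM/= exprMn.
Qed.

Lemma harm_solid j p : harm j p -> solid j (fun x => Re (ev p x)) /\ solid j (fun x => Im (ev p x)).
Proof.
move=> [hp dp]; split; split.
- by move=> k; have [] := CkR_ev k p.
- by move=> t x; rewrite (ev_homog _ _ hp) ReME /= mul0r subr0.
- move=> x; rewrite /lapR.
  transitivity (Re (ev (\sum_(i < d) mderiv i (mderiv i p)) x)); last by rewrite dp ev0.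
  rewrite ev_sum Re_sum; apply: eq_bigr => i _.
  have e : (fun y => 'D_(dl i) (fun x => Re (ev p x)) y) = (fun y => Re (ev (mderiv i p) y)).
    by apply/funext => y; exact: vE (ev_derive p i y).1.
  rewrite e.
  exact: vE (ev_derive _ i x).1.
- by move=> k; have [] := CkR_ev k p.
- by move=> t x; rewrite (ev_homog _ _ hp) ImME /= mul0r addr0.
- move=> x; rewrite /lapR.
  transitivity (Im (ev (\sum_(i < d) mderiv i (mderiv i p)) x)); last by rewrite dp ev0.
  rewrite ev_sum Im_sum; apply: eq_bigr => i _.
  have e : (fun y => 'D_(dl i) (fun x => Im (ev p x)) y) = (fun y => Im (ev (mderiv i p) y)).
    by apply/funext => y; exact: vE (ev_derive p i y).2.
  rewrite e.
  exact: vE (ev_derive _ i x).2.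
Qed.

Lemma harmD j p q : harm j p -> harm j q -> harm j (p + q).
Proof.
move=> [p1 p2] [q1 q2]; split; first exact: rpredD.
by under eq_bigr do rewrite !mderivD; rewrite big_split/= p2 q2 addr0.
Qed.

Lemma harmZ j c p : harm j p -> harm j (c *: p).
Proof.
move=> [p1 p2]; split; first exact: rpredZ.
by under eq_bigr do rewrite !mderivZ; rewrite -scaler_sumr p2 scaler0.
Qed.

Lemma harm0 j : harm j 0.
Proof. by split; [exact: rpred0|rewrite big1// => i _; rewrite !mderiv0]. Qed.

Lemma harm_sum j (I : Type) (r : seq I) (F : I -> P) :
  (forall i, harm j (F i)) -> harm j (\sum_(i <- r) F i).
Proof.
move=> h; elim: r => [|i r IH]; first by rewrite big_nil; exact: harm0.
by rewrite big_cons; apply: (harmD (h i) IH).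
Qed.

Section linear_change.
Context (M : 'M[R]_d) (MM : M^T *m M = 1%:M).

Definition lin_tuple : d.-tuple P := [tuple \sum_i (M i l)%:C%C *: Xv i | l < d].
Local Notation cmp := (comp_mpoly lin_tuple).

Lemma ev_comp p x : ev (cmp p) x = ev p (x *m M).
Proof.
rewrite /ev comp_mpoly_meval; apply: meval_eq => l.
rewrite tnth_mktuple -/(ev _ x) ev_sum mxE rmorph_sum; apply: eq_bigr => i _.
by rewrite evZ evX rmorphM/= mulrC.
Qed.

Lemma mderiv_comp p i : mderiv i (cmp p) = \sum_l (M i l)%:C%C *: cmp (mderiv l p).
Proof.
have cD a b : cmp (a + b) = cmp a + cmp b by exact: comp_mpolyD.
have mD l a b : mderiv l (a + b) = mderiv l a + mderiv l b :> P by exact: mderivD.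
have cM' a b : cmp (a * b) = cmp a * cmp b by exact: (comp_mpoly_is_multiplicative _).1.
elim/mpoly_gen_ind : p => [c|l|p q hp hq|p q hp hq].
- by rewrite comp_mpolyC mderivC big1// => l _; rewrite mderivC comp_mpoly0 scaler0.
- rewrite comp_mpolyXU (nth_map l) ?size_enum_ord ?ltn_ord// nth_ord_enum.
  rewrite raddf_sum/= (bigD1 i)//= big1 => [|l' l'i]; last first.
    by rewrite mderivZ mderivXU (negbTE l'i) mpolyC0 scaler0.
  rewrite (bigD1 l)//= big1 => [|l' l'l]; last first.
    by rewrite mderivXU eq_sym (negbTE l'l) mpolyC0 comp_mpoly0 scaler0.
  by rewrite mderivZ !mderivXU !eqxx comp_mpolyC.
- move: hp hq; move: (comp_mpoly lin_tuple) cD cM' (@mderiv d C) mD => cm cD _ md mD hp hq.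
  rewrite cD mD hp hq; transitivity (\sum_l ((M i l)%:C%C *: cm (md l p) + (M i l)%:C%C *: cm (md l q))).
    by rewrite big_split.
  by apply: eq_bigr => l _; rewrite mD cD scalerDr.
- have mM l a b : mderiv l (a * b) = mderiv l a * b + a * mderiv l b :> P by exact: mderivM.
  move: hp hq; move: (comp_mpoly lin_tuple) cD cM' (@mderiv d C) mD mM => cm cD cM' md mD mM hp hq.
  rewrite cM' mM hp hq mulr_suml mulr_sumr.
  transitivity (\sum_l ((M i l)%:C%C *: cm (md l p) * cm q + cm p * ((M i l)%:C%C *: cm (md l q)))).
    by rewrite big_split.
  by apply: eq_bigr => l _; rewrite mM cD !cM' scalerDr scalerAl scalerAr.
Qed.

Let lin_homog l : tnth lin_tuple l \is ishomog1 1 mdeg.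
Proof.
rewrite tnth_mktuple; apply: rpred_sum => i _; apply: rpredZ.
by rewrite dhomogX /= mdeg1 eqxx.
Qed.

Let prod_homog (m : 'I_d -> nat) (s : seq 'I_d) :
  \prod_(i <- s) tnth lin_tuple i ^+ m i \is ishomog1 (\sum_(i <- s) m i)%N mdeg.
Proof.
elim: s => [|i s IH]; first by rewrite !big_nil; exact: dhomog1.
rewrite !big_cons; apply: dhomogM => //.
by have := dhomogMn (m i) (lin_homog i); rewrite mul1n.
Qed.

(** The second derivatives of p(x M) are those of p contracted with M^T M = 1, so the Laplacian
    commutes with the substitution. *)
Lemma harm_comp j p : harm j p -> harm j (cmp p).
Proof.
move=> [hp dp]; split.
  rewrite comp_mpolyEX big_seq; apply: rpred_sum => m mp; apply: rpredZ.
  have hm : \sum_(i <- index_enum 'I_d) m i = j :> nat.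
    by rewrite -mdegE; have /dhomogP hp' := hp; exact: hp'.
  by rewrite comp_mpolyX -hm; exact: prod_homog.
transitivity (\sum_i \sum_l \sum_l' ((M i l)%:C%C * (M i l')%:C%C) *: cmp (mderiv l' (mderiv l p))).
  apply: eq_bigr => i _; rewrite mderiv_comp raddf_sum/=; apply: eq_bigr => l _.
  by rewrite mderivZ mderiv_comp scaler_sumr; apply: eq_bigr => l' _; rewrite scalerA.
rewrite exchange_big/=.
transitivity (\sum_l \sum_l' ((l == l')%:R : C) *: cmp (mderiv l' (mderiv l p))).
  apply: eq_bigr => l _; rewrite exchange_big/=; apply: eq_bigr => l' _.
  rewrite -scaler_suml; congr (_ *: _).
  have := congr1 (fun A : 'M[R]_d => A l l') MM; rewrite !mxE => h.
  transitivity ((\sum_i M i l * M i l')%:C%C : C).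
    by rewrite rmorph_sum; apply: eq_bigr => i _; rewrite rmorphM.
  have -> : \sum_i M i l * M i l' = (l == l')%:R.
    by rewrite -h; apply: eq_bigr => i _; rewrite mxE.
  by rewrite rmorph_nat.
transitivity (\sum_l cmp (mderiv l (mderiv l p))).
  apply: eq_bigr => l _; rewrite (bigD1 l)//= eqxx scale1r big1 ?addr0// => l' l'l.
  by rewrite eq_sym (negbTE l'l) scale0r.
by rewrite -raddf_sum/= dp comp_mpoly0.
Qed.
End linear_change.
End HarmonicPolynomials.

(** * Hermitian inner product on the sphere and Bessel's inequality *)

Section SphereInner.
Context {R : realType} (k : nat).
Local Notation d := k.+2.
Local Notation leb := (@lebesgue_rV R).
Local Notation V := 'rV[R]_k.+2.
Local Notation C := R[i].
Local Notation Re := (@complex.Re R).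
Local Notation Im := (@complex.Im R).
Local Notation dl i := (delta_mx 0 i : V).
Implicit Types (f g : V -> C) (x : V).
Let d0 : (0 < k.+2)%N. Proof. by []. Qed.

Definition cc f : Prop := continuous (fun x => Re (f x)) /\ continuous (fun x => Im (f x)).

Lemma ccD f g : cc f -> cc g -> cc (fun x => f x + g x).
Proof.
move=> [f1 f2] [g1 g2]; split.
  by under [X in continuous X]eq_fun do rewrite ReDE; exact: cD.
by under [X in continuous X]eq_fun do rewrite ImDE; exact: cD.
Qed.

Lemma ccM f g : cc f -> cc g -> cc (fun x => f x * g x).
Proof.
move=> [f1 f2] [g1 g2]; split.
  by under [X in continuous X]eq_fun do rewrite ReME; apply: cB; exact: cM.
by under [X in continuous X]eq_fun do rewrite ImME; apply: cD; exact: cM.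
Qed.

Lemma ccC (c : C) : cc (fun=> c).
Proof. by split; exact: cC. Qed.

Lemma ccZ c f : cc f -> cc (fun x => c * f x).
Proof. exact/ccM/ccC. Qed.

Lemma ccJ f : cc f -> cc (fun x => (f x)^*).
Proof.
move=> [f1 f2]; split.
  by under [X in continuous X]eq_fun do rewrite ReJ.
by under [X in continuous X]eq_fun do rewrite ImJ; exact: cN.
Qed.

Lemma cc_sum (I : Type) (r : seq I) (F : I -> V -> C) :
  (forall i, cc (F i)) -> cc (fun x => \sum_(i <- r) F i x).
Proof.
move=> h; elim: r => [|i r IH].
  by under [X in cc X]eq_fun do rewrite big_nil; exact: ccC.
by under [X in cc X]eq_fun do rewrite big_cons; exact: ccD.
Qed.

Lemma cc_comp f (h : V -> V) : continuous h -> cc f -> cc (fun x => f (h x)).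
Proof. by move=> ch [f1 f2]; split; [exact: (ccomp ch f1)|exact: (ccomp ch f2)]. Qed.

Lemma cc_normsq f : cc f -> continuous (fun x => normsq (f x)).
Proof. by move=> [f1 f2]; apply: cD; exact: cX. Qed.

Lemma cc_ev p : cc (@ev R d p).
Proof. by have [h1 h2] := CkR_ev 0 p. Qed.

Definition cS f : C := (SI (fun x => Re (f x)) +i* SI (fun x => Im (f x)))%C.

Lemma cSD f g : cc f -> cc g -> cS (fun x => f x + g x) = cS f + cS g.
Proof.
move=> [f1 f2] [g1 g2]; apply: complexP; rewrite ?ReDE ?ImDE /=.
  by rewrite -SID//; congr SI; apply/funext => x; rewrite ReDE.
by rewrite -SID//; congr SI; apply/funext => x; rewrite ImDE.
Qed.

Lemma cSZ c f : cc f -> cS (fun x => c * f x) = c * cS f.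
Proof.
move=> [f1 f2].
have b r (g : V -> R) : continuous g -> continuous (fun x => r * g x) by move=> cg; apply: cM => //; exact: cC.
apply: complexP; rewrite ?ReME ?ImME /=.
  rewrite -mulNr -!(SIZ _ f1) -!(SIZ _ f2) -SID//; try exact: b.
  by congr SI; apply/funext => x; rewrite ReME mulNr.
rewrite -!(SIZ _ f1) -!(SIZ _ f2) -SID//; try exact: b.
by congr SI; apply/funext => x; rewrite ImME.
Qed.

Lemma cS_sum (I : Type) (r : seq I) (F : I -> V -> C) :
  (forall i, cc (F i)) -> cS (fun x => \sum_(i <- r) F i x) = \sum_(i <- r) cS (F i).
Proof.
move=> h; elim: r => [|i r IH].
  rewrite big_nil; under [X in cS X]eq_fun do rewrite big_nil.
  by have := cSZ 0 (ccC 0); under [X in cS X = _ -> _]eq_fun do rewrite mul0r; rewrite mul0r.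
rewrite big_cons -IH -cSD//; last exact: cc_sum.
by congr cS; apply/funext => x; rewrite big_cons.
Qed.

Lemma cSJ f : cc f -> cS (fun x => (f x)^*) = (cS f)^*.
Proof.
move=> [f1 f2]; apply: complexP; rewrite ?ReJ ?ImJ /=.
  by congr SI; apply/funext => x; rewrite ReJ.
rewrite -mulN1r -SIZ//; congr SI; apply/funext => x; by rewrite ImJ mulN1r.
Qed.

Lemma cS_eq f g : cc f -> cc g -> (forall x, enorm x = 1 -> f x = g x) -> cS f = cS g.
Proof.
move=> [f1 f2] [g1 g2] fg; apply: complexP => /=; apply: SI_eq => // x /fg -> //.
Qed.

Definition cip f g : C := cS (fun x => f x * (g x)^*).

Lemma cip_cc f g : cc f -> cc g -> cc (fun x => f x * (g x)^*).
Proof. by move=> cf cg; apply: ccM => //; exact: ccJ. Qed.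

Lemma cipJ f g : cc f -> cc g -> cip g f = (cip f g)^*.
Proof.
move=> cf cg; rewrite /cip -cSJ; last exact: cip_cc.
by congr cS; apply/funext => x; rewrite rmorphM/= conjCK mulrC.
Qed.

Lemma cipDl f1 f2 g : cc f1 -> cc f2 -> cc g -> cip (fun x => f1 x + f2 x) g = cip f1 g + cip f2 g.
Proof.
move=> c1 c2 cg; rewrite /cip -cSD; [|exact: cip_cc|exact: cip_cc].
by congr cS; apply/funext => x; rewrite mulrDl.
Qed.

Lemma cipZl c f g : cc f -> cc g -> cip (fun x => c * f x) g = c * cip f g.
Proof.
move=> cf cg; rewrite /cip -cSZ; last exact: cip_cc.
by congr cS; apply/funext => x; rewrite mulrA.
Qed.

Lemma cip_suml (I : Type) (r : seq I) (F : I -> V -> C) g :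
  (forall i, cc (F i)) -> cc g -> cip (fun x => \sum_(i <- r) F i x) g = \sum_(i <- r) cip (F i) g.
Proof.
move=> h cg; rewrite /cip -cS_sum; last by move=> i; exact: cip_cc.
by congr cS; apply/funext => x; rewrite mulr_suml.
Qed.

Lemma cip_sumr (I : Type) (r : seq I) (F : I -> V -> C) f (c : I -> C) :
  (forall i, cc (F i)) -> cc f ->
  cip f (fun x => \sum_(i <- r) c i * F i x) = \sum_(i <- r) (c i)^* * cip f (F i).
Proof.
move=> h cf; have cs : cc (fun x => \sum_(i <- r) c i * F i x) by apply: cc_sum => i; exact: ccZ.
rewrite cipJ// cip_suml//; last by move=> i; exact: ccZ.
by rewrite rmorph_sum; apply: eq_bigr => i _; rewrite cipZl// rmorphM/= -cipJ.
Qed.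

Lemma cip_eq f f' g g' : cc f -> cc f' -> cc g -> cc g' ->
  (forall x, enorm x = 1 -> f x = f' x) -> (forall x, enorm x = 1 -> g x = g' x) -> cip f g = cip f' g'.
Proof.
move=> cf cf' cg cg' ef eg; apply: cS_eq; [exact: cip_cc|exact: cip_cc|].
by move=> x x1; rewrite ef// eg.
Qed.

Definition Sq f : R := SI (fun x => normsq (f x)).

Lemma Sq_ge0 f : 0 <= Sq f.
Proof. by rewrite mulr_ge0// BI_ge0// => x _; exact: normsq_ge0. Qed.

Lemma mulJ (z : C) : z * z^* = (normsq z)%:C%C.
Proof. by apply: complexP; rewrite !cxE /normsq /=; ring. Qed.

Lemma cip_self f : cc f -> cip f f = (Sq f)%:C%C.
Proof.
move=> cf; rewrite /cip; under [X in cS X]eq_fun do rewrite mulJ.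
apply: complexP => //=; rewrite -[RHS](mul0r (SI (fun _ : V => 0 : R))) -SIZ; last exact: cC.
by congr SI; apply/funext => x; rewrite mul0r.
Qed.

Section bessel.
Context (I : eqType) (r : seq I) (e : I -> V -> C).
Hypotheses (ur : uniq r) (ce : forall i, cc (e i)).
Hypothesis oe : forall i j, i \in r -> j \in r -> cip (e i) (e j) = (i == j)%:R.

Definition proj_on f x : C := \sum_(i <- r) cip f (e i) * e i x.

Lemma cc_proj_on f : cc (proj_on f).
Proof. by apply: cc_sum => i; exact: ccZ. Qed.

Lemma cip_proj_on f i : cc f -> i \in r -> cip (proj_on f) (e i) = cip f (e i).
Proof.
move=> cf ir; rewrite /proj_on cip_suml//; last by move=> j; exact: ccZ.
rewrite (bigD1_seq i)//= big_seq_cond big1 => [|j /andP[jr ji]].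
  by rewrite addr0 cipZl// oe// eqxx mulr1.
by rewrite cipZl// oe// (negbTE ji) mulr0.
Qed.

Lemma Sq_proj_on f : Sq (proj_on f) = \sum_(i <- r) normsq (cip f (e i)).
Proof.
have cp := cc_proj_on f.
suff h : (Sq (proj_on f))%:C%C = ((\sum_(i <- r) normsq (cip f (e i)))%:C)%C :> C.
  by have := congr1 Re h.
rewrite -cip_self// [X in cip _ X](_ : _ = fun x => \sum_(i <- r) cip f (e i) * e i x)//.
rewrite cip_sumr// rmorph_sum/= big_seq [RHS]big_seq; apply: eq_bigr => i ir.
rewrite /proj_on cip_suml//; last by move=> j; exact: ccZ.
rewrite (bigD1_seq i)//= big_seq_cond big1 => [|j /andP[jr ji]].
  by rewrite addr0 cipZl// oe// eqxx mulr1 mulrC mulJ.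
by rewrite cipZl// oe// (negbTE ji) mulr0.
Qed.

Lemma Sq_sub_proj f : cc f ->
  Sq (fun x => f x - proj_on f x) = Sq f - \sum_(i <- r) normsq (cip f (e i)).
Proof.
move=> cf; have cp := cc_proj_on f.
have cN' : cc (fun x => - 1 * proj_on f x) by exact: ccZ.
have cross : cip f (proj_on f) = ((\sum_(i <- r) normsq (cip f (e i)))%:C)%C.
  rewrite [X in cip _ X](_ : _ = fun x => \sum_(i <- r) cip f (e i) * e i x)//.
  by rewrite cip_sumr// rmorph_sum/=; apply: eq_bigr => i _; rewrite mulrC mulJ.
have e1 : (fun x => f x - proj_on f x) = (fun x => f x + - 1 * proj_on f x).
  by apply/funext => x; rewrite mulN1r.
have cfp : cc (fun x => f x + - 1 * proj_on f x) by exact: ccD.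
suff h : (Sq (fun x => f x - proj_on f x))%:C%C =
   ((Sq f)%:C%C - ((\sum_(i <- r) normsq (cip f (e i)))%:C)%C : C).
  by have := congr1 Re h; rewrite ReDE ReNE.
rewrite e1 -cip_self// cipDl// cipZl// (cipJ cfp cf) (cipJ cfp cp).
rewrite !cipDl// !cipZl// cip_self// cip_self// Sq_proj_on (cipJ cf cp) cross.
by apply: complexP; rewrite !cxE /=; ring.
Qed.

Lemma bessel f : cc f -> \sum_(i <- r) normsq (cip f (e i)) <= Sq f.
Proof. by move=> cf; rewrite -subr_ge0 -Sq_sub_proj// Sq_ge0. Qed.
End bessel.
End SphereInner.
Lemma continuous_rowP (R : realType) (T : topologicalType) n (f : T -> 'rV[R]_n) :
  (forall j, continuous (fun x => f x 0 j)) -> continuous f.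
Proof.
move=> cf x A [P Pn PA].
have : \forall y \near x, forall j, P 0 j (f y 0 j).
  by apply: filter_forall => j; exact: (cf j x _ (Pn 0 j)).
by apply: filterS => y h; apply: PA => i j; rewrite (ord1 i); exact: h.
Qed.

(** * Action of a plane rotation on functions, and averages over its powers *)

Section Rotations.
Context {R : realType} (k : nat).
Local Notation d := k.+2.
Local Notation leb := (@lebesgue_rV R).
Local Notation V := 'rV[R]_k.+2.
Local Notation C := R[i].
Local Notation Re := (@complex.Re R).
Local Notation Im := (@complex.Im R).
Local Notation coord := (@Pilot.Defs.coord R _).
Implicit Types (f g : V -> C) (x y : V).
Let d0 : (0 < k.+2)%N. Proof. by []. Qed.

Definition rotM (c s : R) : 'M[R]_k.+2 := \matrix_(i, j)
  (if j == 0 :> nat then c * (i == 0 :> nat)%:R - s * (i == 1 :> nat)%:R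
   else if j == 1 :> nat then s * (i == 0 :> nat)%:R + c * (i == 1 :> nat)%:R else (i == j)%:R).

Lemma coord0 x : coord x 0 = x 0 ord0.
Proof. exact: (coordE x ord0). Qed.

Let i1 : 'I_k.+2 := lift ord0 ord0.

Lemma coord1 x : coord x 1 = x 0 i1.
Proof. exact: (coordE x i1). Qed.

Let pick (n : nat) (l : 'I_k.+2) (a : R) x : n = l :> nat ->
  \sum_i x 0 i * (a * (i == n :> nat)%:R) = a * x 0 l.
Proof.
move=> ->; rewrite (bigD1 l)//= eqxx mulr1 mulrC big1 ?addr0// => i il.
by rewrite val_eqE (negbTE il) !mulr0.
Qed.

Lemma rotE (c s : R) x : rot c s x = x *m rotM c s.
Proof.
apply/rowP => j; rewrite !mxE coord0 coord1.
have p0 a : \sum_i x 0 i * (a * (i == 0 :> nat)%:R) = a * x 0 ord0 by exact: pick.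
have p1 a : \sum_i x 0 i * (a * (i == 1 :> nat)%:R) = a * x 0 i1 by exact: pick.
under [RHS]eq_bigr do rewrite mxE.
case: ifP => _.
  by under [RHS]eq_bigr do rewrite mulrBr; rewrite sumrB p0 p1.
case: ifP => _.
  by under [RHS]eq_bigr do rewrite mulrDr; rewrite big_split/= p0 p1.
rewrite (bigD1 j)//= eqxx mulr1 big1 ?addr0// => i ij.
by rewrite (negbTE ij) mulr0.
Qed.

Lemma rotM_tr (c s : R) : rotM c (- s) = (rotM c s)^T.
Proof.
apply/matrixP => i j; rewrite !mxE; case: i j => [[|[|i]] hi] [[|[|j]] hj] //=;
  rewrite -?val_eqE/= ?(mulr1, mulr0, subr0, addr0, add0r, sub0r, oppr0, opprK)//.
by rewrite eq_sym.
Qed.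

Section fixed.
Context (c s : R).
Hypotheses (cs1 : c ^+ 2 + s ^+ 2 = 1) (c1 : 1 + c != 0).
Local Notation rho := (rot c s).
Local Notation rho' := (rot c (- s)).

Lemma rotK : cancel (rho : V -> V) rho'.
Proof.
move=> x; apply/rowP => j; rewrite !mxE !coord0 !coord1 !mxE /= !coord0 !coord1.
case: ifP => [/eqP j0|j0].
  have -> : j = ord0 by exact/val_inj.
  transitivity ((c ^+ 2 + s ^+ 2) * x 0 ord0); last by rewrite cs1 mul1r.
  by ring.
case: ifP => [/eqP j1|j1]; last by rewrite j0 ?j1.
have -> : j = i1 by exact/val_inj.
transitivity ((c ^+ 2 + s ^+ 2) * x 0 i1); last by rewrite cs1 mul1r.
by ring.
Qed.

Lemma rotZ (t : R) x : rho (t *: x) = t *: rho x.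
Proof. by rewrite !rotE scalemxAl. Qed.

Lemma enorm_rot x : enorm (rho x) = enorm x.
Proof.
congr Num.sqrt; rewrite !big_ord_recl !mxE /= !coord0 !coord1 -/i1 !addrA; congr (_ + _).
  transitivity ((c ^+ 2 + s ^+ 2) * (x 0 ord0 ^+ 2 + x 0 i1 ^+ 2)); last by rewrite cs1 mul1r.
  by ring.
by apply: eq_bigr => i _; rewrite !mxE.
Qed.

Lemma continuous_rot : continuous (rho : V -> V).
Proof.
apply: continuous_rowP => j; under [X in continuous X]eq_fun do rewrite mxE coord0 coord1.
case: (j == 0 :> nat); last case: (j == 1 :> nat); last exact: continuous_coord.
  by apply: cB; apply: cM; (exact: cC || exact: continuous_coord).
by apply: cD; apply: cM; (exact: cC || exact: continuous_coord).
Qed.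

Lemma rot_sphere_proj x : sphere_proj (rho x) = rho (sphere_proj x).
Proof. by rewrite /sphere_proj enorm_rot rotZ. Qed.

Lemma BI_rot (f : V -> R) : bm f -> BI (fun x => f (rho x)) = BI f.
Proof.
have main (g : V -> R) : bm g -> (forall x, 0 <= g x) -> BI (fun x => g (rho x)) = BI g.
  move=> bg g0; have bgr : bm (fun x => g (rho x)).
    case: bg => mg [M hM]; split; first exact: (measurableT_comp mg (@measurable_rot R d c s)).
    by exists M => x x1; apply: hM; rewrite enorm_rot.
  have e (h : V -> R) : bm h -> (BI h)%:E = (\int[leb d]_x (ind (enorm x < 1) * h x)%:E)%E.
    move=> bh; rewrite BI_EFin// [LHS]integral_mkcond; congr (integral _ _ _); apply/funext => x.
    rewrite patchE /ind; case: ifPn; first by rewrite inE /uball/= => ->; rewrite mul1r.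
    by rewrite notin_setE /uball/= => /negP/negbTE ->; rewrite mul0r.
  apply: EFin_inj; rewrite !e//.
  pose F x : \bar R := (ind (enorm x < 1) * g x)%:E.
  have mF : measurable_fun setT F.
    apply/measurable_EFinP; apply: measurable_funM; last by case: bg.
    apply: measurable_boolr; apply: measurable_fun_ltr; [exact: measurable_enorm|exact: measurable_cst].
  have F0 x : (0 <= F x)%E by rewrite lee_fin mulr_ge0// ind_ge0.
  rewrite -(@ge0_integral_rot R d c s F isT cs1 c1 mF F0).
  by congr (integral _ _ _); apply/funext => x; rewrite /F enorm_rot.
move=> bf; have [mf [M hM]] := bf.
have bn : bm (fun x => `|f x|).
  split; first exact: measurableT_comp.
  by exists M => x x1; rewrite normr_id hM.
have bp : bm (fun x => 2^-1 * (`|f x| + f x)) by apply: bmZ; exact: bmD.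
have bm' : bm (fun x => 2^-1 * (`|f x| - f x)) by apply: bmZ; exact: bmB.
have fE x : f x = 2^-1 * (`|f x| + f x) - 2^-1 * (`|f x| - f x) by lra.
have bc (g : V -> R) : bm g -> bm (fun x => g (rho x)).
  move=> [mg [N hN]]; split; first exact: (measurableT_comp mg (@measurable_rot R d c s)).
  by exists N => x x1; apply: hN; rewrite enorm_rot.
transitivity (BI (fun x => 2^-1 * (`|f (rho x)| + f (rho x))) - BI (fun x => 2^-1 * (`|f (rho x)| - f (rho x)))).
  rewrite -BIB; [|exact: (bc _ bp)|exact: (bc _ bm')].
  by congr BI; apply/funext => x; rewrite -fE.
rewrite (main _ bp) ?(main _ bm') -?BIB//.
- by congr BI; apply/funext => x; rewrite -fE.
- by move=> x; rewrite mulr_ge0// subr_ge0 ler_norm.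
- by move=> x; rewrite mulr_ge0//; have := ler_norm (- f x); rewrite normrN; lra.
Qed.

Lemma SI_rot (f : V -> R) : continuous f -> SI (fun x => f (rho x)) = SI f.
Proof.
move=> cf; rewrite /SI -(BI_rot (bm_sphere_proj cf)); congr (_ * BI _); apply/funext => x.
by rewrite /= rot_sphere_proj.
Qed.

Lemma cc_rot f : cc f -> cc (fun x => f (rho x)).
Proof. exact: (cc_comp continuous_rot). Qed.

Lemma cS_rot f : cc f -> cS (fun x => f (rho x)) = cS f.
Proof. by move=> [f1 f2]; apply: complexP; rewrite /= (SI_rot f1, SI_rot f2). Qed.

Lemma Sq_rot f : cc f -> Sq (fun x => f (rho x)) = Sq f.
Proof. by move=> /cc_normsq cf; exact: (SI_rot cf). Qed.

Lemma iter_rotZ a (t : R) x : iter a rho (t *: x) = t *: iter a rho x.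
Proof. by elim: a => //= a ->; rewrite rotZ. Qed.

Lemma cc_iter_rot a f : cc f -> cc (fun x => f (iter a rho x)).
Proof. by move=> cf; elim: a => // a IH; under [X in cc X]eq_fun do rewrite iterSr; exact: cc_rot IH. Qed.

Lemma cS_iter_rot a f : cc f -> cS (fun x => f (iter a rho x)) = cS f.
Proof.
move=> cf; elim: a => // a <-; rewrite -(cS_rot (cc_iter_rot a cf)).
by congr cS; apply/funext => x; rewrite iterSr.
Qed.

Lemma Sq_iter_rot a f : cc f -> Sq (fun x => f (iter a rho x)) = Sq f.
Proof.
move=> cf; elim: a => // a <-; rewrite -(Sq_rot (cc_iter_rot a cf)).
by congr Sq; apply/funext => x; rewrite iterSr.
Qed.

(* The average of f against a character of the cyclic group generated by rho *)
Definition av (N : nat) (w : C) f x : C := N%:R^-1 * \sum_(0 <= a < N) w ^+ a * f (iter a rho x).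

Lemma cc_av N w f : cc f -> cc (av N w f).
Proof. by move=> cf; apply: ccZ; apply: cc_sum => a; apply: ccZ; exact: cc_iter_rot. Qed.

(** Cauchy-Schwarz, by induction: the step expands |S - N z_N|^2 >= 0. *)
Lemma normsq_sum_le (N : nat) (z : nat -> C) :
  normsq (\sum_(0 <= a < N) z a) <= N%:R * \sum_(0 <= a < N) normsq (z a).
Proof.
elim: N => [|N IH]; first by rewrite !big_geq// mul0r /normsq /= expr0n addr0.
rewrite !big_nat_recr//=; set S := \sum_(0 <= a < N) z a in IH *; set T := \sum_(0 <= a < N) normsq _ in IH *.
have T0 : 0 <= T by apply: sumr_ge0 => a _; exact: normsq_ge0.
have [N0|N0] := posnP N.
  move: IH; rewrite /S /T N0 !big_geq// => _; rewrite !add0r mul1r//.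
have Np : 0 < N%:R :> R by rewrite ltr0n.
have h : N%:R * normsq (S + z N) <= (N%:R + 1) * (normsq S + N%:R * normsq (z N)).
  have : 0 <= normsq (S - N%:R%:C%C * z N) by exact: normsq_ge0.
  rewrite /normsq !cxE /=; move: (N%:R : R) => n; nra.
rewrite -natr1 -(ler_pM2l Np) (le_trans h)// mulrCA ler_wpM2l ?addr_ge0//.
by move: IH; clear; move: (normsq S) (normsq (z N)) T (N%:R : R) => u v t n; lra.
Qed.

Lemma normsqV (n : nat) : normsq (n%:R^-1 : C) = n%:R^-1 ^+ 2.
Proof.
have -> : n%:R^-1 = (n%:R^-1 : R)%:C%C :> C by rewrite fmorphV/= rmorph_nat.
by rewrite /normsq /= expr0n/= addr0.
Qed.

Lemma Sq_av_le N w f : (0 < N)%N -> normsq w = 1 -> cc f -> Sq (av N w f) <= Sq f.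
Proof.
move=> N0 w1 cf; have Np : 0 < N%:R :> R by rewrite ltr0n.
have cfa a : continuous (fun x => normsq (f (iter a rho x))) by apply: cc_normsq; exact: cc_iter_rot.
have h x : normsq (av N w f x) <= N%:R^-1 * \sum_(0 <= a < N) normsq (f (iter a rho x)).
  rewrite normsqM normsqV expr2 -mulrA ler_wpM2l ?invr_ge0 ?(ltW Np)//.
  rewrite ler_pdivrMl// (le_trans (normsq_sum_le _ _))//.
  have -> : \sum_(0 <= a < N) normsq (w ^+ a * f (iter a rho x)) = \sum_(0 <= a < N) normsq (f (iter a rho x)).
    apply: eq_bigr => a _; rewrite normsqM (_ : normsq (w ^+ a) = 1) ?mul1r//.
    by elim: a => [|a IH]; rewrite ?expr0 /normsq /= ?expr1n ?expr0n ?addr0// -/(normsq _) exprS normsqM IH w1 mul1r.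
  by [].
have cs : continuous (fun x : V => N%:R^-1 * \sum_(0 <= a < N) normsq (f (iter a rho x)) : R).
  by apply: cM; [exact: cC|apply: continuous_sumr => a _; exact: cfa].
apply: (@le_trans _ _ (SI (fun x => N%:R^-1 * \sum_(0 <= a < N) normsq (f (iter a rho x))))).
  rewrite ler_wpM2l//; apply: BI_le; [exact/bm_sphere_proj/cc_normsq/cc_av|exact: bm_sphere_proj|].
  by move=> x _; exact: h.
rewrite SIZ; last by apply: continuous_sumr => a _; exact: cfa.
have -> : SI (fun x => \sum_(0 <= a < N) normsq (f (iter a rho x))) = \sum_(0 <= a < N) Sq f.
  rewrite /SI BI_sum; last by move=> a _; exact: (bm_sphere_proj (cfa a)).
  by rewrite mulr_sumr; apply: eq_bigr => a _; rewrite -(Sq_iter_rot a cf).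
by rewrite sumr_const_nat subn0 -(mulr_natl (Sq f) N) mulKf// gt_eqF.
Qed.
End fixed.
End Rotations.

(** * Averages over a cyclic group: adjoint, inversion and spectrum of harmonics *)

Section Averages.
Context {R : realType} (k : nat).
Local Notation d := k.+2.
Local Notation V := 'rV[R]_k.+2.
Local Notation C := R[i].
Local Notation Re := (@complex.Re R).
Local Notation Im := (@complex.Im R).
Local Notation P := (mpoly k.+2 C).
Implicit Types (f g : V -> C) (x y : V).

Lemma geom_root0 (N : nat) (q : C) : q ^+ N = 1 -> q != 1 -> \sum_(0 <= a < N) q ^+ a = 0.
Proof.
move=> qN q1; have := subrX1 q N; rewrite qN subrr => /esym/eqP.
by rewrite mulf_eq0 subr_eq0 (negbTE q1)/= big_mkord => /eqP.
Qed.

Section adjoint.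
Context (c s : R).
Hypotheses (cs1 : c ^+ 2 + s ^+ 2 = 1) (c1 : 1 + c != 0).

Let cs1' : c ^+ 2 + (- s) ^+ 2 = 1. Proof. by rewrite sqrrN. Qed.

Lemma iter_rotK a x : iter a (rot c (- s)) (iter a (rot c s) x) = x.
Proof. by elim: a x => //= a IH x; rewrite -[LHS]iterS iterSr (rotK cs1) IH. Qed.

(** Rotation invariance of the sphere integral moves each power of the rotation to g as its
    inverse. *)
Lemma cip_av N w f g : cc f -> cc g -> cip (av c s N w f) g = cip f (av c (- s) N (w^*) g).
Proof.
move=> cf cg; rewrite /av.
have cfa a : cc (fun x => f (iter a (rot c s) x)) by exact: cc_iter_rot.
have cga a : cc (fun x => g (iter a (rot c (- s)) x)) by exact: cc_iter_rot.
rewrite cipZl//; last by apply: cc_sum => a; exact: ccZ.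
rewrite cip_suml//; last by move=> a; exact: ccZ.
transitivity (N%:R^-1 * \sum_(0 <= a < N) w ^+ a * cip f (fun x => g (iter a (rot c (- s)) x))).
  congr (_ * _); apply: eq_bigr => a _; rewrite cipZl//; congr (_ * _).
  rewrite /cip -[RHS](cS_iter_rot cs1 c1 a); last exact: cip_cc.
  by congr cS; apply/funext => x; rewrite iter_rotK.
have cs2 : cc (fun x => \sum_(0 <= a < N) w^* ^+ a * g (iter a (rot c (- s)) x)).
  by apply: cc_sum => a; exact: ccZ.
rewrite (cipJ _ cf)//; last exact: ccZ.
rewrite cipZl// rmorphM/= -(cipJ cs2 cf) cip_sumr// fmorphV/= rmorph_nat; congr (_ * _).
by apply: eq_bigr => a _; rewrite rmorphXn/= conjCK.
Qed.

Lemma avM N w e v f : (forall x, v (rot c s x) = e * v x) ->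
  av c s N w (fun x => v x * f x) = fun x => v x * av c s N (w * e) f x.
Proof.
move=> hv; apply/funext => x; rewrite /av mulrCA; congr (_ * _); rewrite mulr_sumr.
apply: eq_bigr => a _; have -> : v (iter a (rot c s) x) = e ^+ a * v x.
  by elim: a => [|a IH]; rewrite ?expr0 ?mul1r// iterS hv IH mulrA -exprS.
by rewrite exprMn; ring.
Qed.

Lemma av_scale N w f (t : R) x : av c s N w (fun x => f (t *: x)) x = av c s N w f (t *: x).
Proof. by rewrite /av; congr (_ * _); apply: eq_bigr => a _; rewrite iter_rotZ. Qed.

(** Discrete Fourier inversion: summing over K leaves only the term a = 0. *)
Lemma av_spectral N w f x : (0 < N)%N -> N.-primitive_root w ->
  f x = \sum_(0 <= K < N) av c s N (w ^+ K) f x.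
Proof.
move=> N0 pw.
have Nn : N%:R != 0 :> C by rewrite pnatr_eq0 -lt0n.
rewrite /av -mulr_sumr exchange_big/= big_ltn// [X in _ + X]big1_seq ?addr0 => [|a].
  by under eq_bigr do rewrite expr0 mul1r; rewrite sumr_const_nat subn0 -(mulr_natl (f x) N) mulKf.
rewrite mem_index_iota => /andP[_ /andP[a0 aN]].
rewrite -mulr_suml; under eq_bigr do rewrite exprAC.
by rewrite geom_root0 ?mul0r// -?(prim_order_dvd pw) ?gtnNdvd// exprAC (prim_expr_order pw) expr1n.
Qed.

End adjoint.

Section weights.
Context (om : C).
Hypothesis om1 : normsq om = 1.
Local Notation rho := (rot (Re om) (Im om)).

(** f is a finite sum of eigenfunctions of the rotation with eigenvalues om^(l - j), where l - j
    runs from -j to j; the shift by j keeps the exponents natural numbers. *)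
Definition wt (j : nat) f : Prop := exists (I : finType) (G : I -> V -> C) (l : I -> nat),
  [/\ forall i, (l i <= j.*2)%N, forall i x, om ^+ j * G i (rho x) = om ^+ l i * G i x &
      forall x, f x = \sum_i G i x].

Lemma wt_eq j f g : (forall x, f x = g x) -> wt j f -> wt j g.
Proof. by move=> fg [I [G [l [h1 h2 h3]]]]; exists I, G, l; split=> // x; rewrite -fg. Qed.

Lemma wtC (c : C) : wt 0 (fun=> c).
Proof.
exists unit, (fun _ _ => c), (fun=> 0%N); split=> // x.
by rewrite (eq_bigr (fun=> c))// sumr_const card_unit mulr1n.
Qed.

Lemma wtD j f g : wt j f -> wt j g -> wt j (fun x => f x + g x).
Proof.
move=> [I [G [l [h1 h2 h3]]]] [I' [G' [l' [h1' h2' h3']]]].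
exists (I + I')%type, (fun u => match u with inl i => G i | inr i => G' i end),
  (fun u => match u with inl i => l i | inr i => l' i end).
by split=> [[]|[]|x] //; rewrite big_sumType/= h3 h3'.
Qed.

Lemma wt0 j : wt j (fun=> 0).
Proof.
exists void, (fun _ _ => 0), (fun=> 0%N); split=> [[]|[]|x].
by rewrite big1.
Qed.

Lemma wtM i j f g : wt i f -> wt j g -> wt (i + j) (fun x => f x * g x).
Proof.
move=> [I [G [l [h1 h2 h3]]]] [I' [G' [l' [h1' h2' h3']]]].
exists (I * I')%type, (fun u x => G u.1 x * G' u.2 x), (fun u => (l u.1 + l' u.2)%N).
split=> [u|u x|x].
- by rewrite doubleD leq_add.
- by rewrite !exprD mulrACA h2 h2' mulrACA.
- rewrite h3 h3' mulr_suml -(pair_bigA _ (fun i j => G i x * G' j x))/=.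
  by apply: eq_bigr => a _; rewrite mulr_sumr.
Qed.

Lemma wtX j f n : wt j f -> wt (j * n) (fun x => f x ^+ n).
Proof.
move=> h; elim: n => [|n IH]; first by rewrite muln0; exact: wtC.
rewrite mulnS; apply: (wt_eq (f := fun x => f x * f x ^+ n)); last exact: wtM.
by move=> x; rewrite exprS.
Qed.

Lemma wt_prod (I : Type) (r : seq I) (F : I -> V -> C) (j : I -> nat) :
  (forall i, wt (j i) (F i)) -> wt (\sum_(i <- r) j i)%N (fun x => \prod_(i <- r) F i x).
Proof.
move=> h; elim: r => [|i r IH].
  by rewrite big_nil; apply: (wt_eq (f := fun=> 1)); [move=> x; rewrite big_nil|exact: wtC].
rewrite big_cons; apply: (wt_eq (f := fun x => F i x * \prod_(i <- r) F i x)); last exact: wtM.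
by move=> x; rewrite big_cons.
Qed.

Lemma wt_sum j (I : eqType) (r : seq I) (F : I -> V -> C) :
  (forall i, i \in r -> wt j (F i)) -> wt j (fun x => \sum_(i <- r) F i x).
Proof.
elim: r => [|i r IH] h.
  by apply: (wt_eq (f := fun=> 0)); [move=> x; rewrite big_nil|exact: wt0].
apply: (wt_eq (f := fun x => F i x + \sum_(i <- r) F i x)); first by move=> x; rewrite big_cons.
apply: wtD; first by apply: h; rewrite mem_head.
by apply: IH => a ar; apply: h; rewrite inE ar orbT.
Qed.

Let cis : Re om ^+ 2 + Im om ^+ 2 = 1. Proof. exact: om1. Qed.

(** The first two coordinates are combinations of x_1 + i x_2 and x_1 - i x_2, with eigenvalues om
    and om^(-1); the others are invariant, which is l = j = 1. *)
Lemma wt_coord (l : 'I_k.+2) : wt 1 (fun x => (x 0 l)%:C%C).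
Proof.
have [l0|l0] := eqVneq (l : nat) 0%N; last have [l1|l1] := eqVneq (l : nat) 1%N.
- have -> : l = ord0 by exact/val_inj.
  exists bool, (fun b x => ((x 0 ord0 / 2) +i* (if b then x 0 (lift ord0 ord0) / 2 else - (x 0 (lift ord0 ord0) / 2)))%C),
    (fun b => if b then 2 else 0); split=> [[]|[] x|x] //; last first.
    rewrite big_bool/=; apply: complexP; rewrite !cxE /=; lra.
  + rewrite expr0 mul1r expr1; apply: complexP; rewrite !cxE /= !mxE /= !coord0 !coord1.
      transitivity ((Re om ^+ 2 + Im om ^+ 2) * (x 0 ord0 / 2)); last by rewrite cis mul1r.
      by ring.
    transitivity (- ((Re om ^+ 2 + Im om ^+ 2) * (x 0 (lift ord0 ord0) / 2))); last by rewrite cis mul1r.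
    by ring.
  + rewrite expr2 expr1 -mulrA; congr (_ * _); apply: complexP; rewrite !cxE /= !mxE /= !coord0 !coord1; ring.
- have -> : l = lift ord0 ord0 by exact/val_inj.
  exists bool, (fun b x => ((x 0 (lift ord0 ord0) / 2) +i* (if b then - (x 0 ord0 / 2) else x 0 ord0 / 2))%C),
    (fun b => if b then 2 else 0); split=> [[]|[] x|x] //; last first.
    rewrite big_bool/=; apply: complexP; rewrite !cxE /=; lra.
  + rewrite expr0 mul1r expr1; apply: complexP; rewrite !cxE /= !mxE /= !coord0 !coord1.
      transitivity ((Re om ^+ 2 + Im om ^+ 2) * (x 0 (lift ord0 ord0) / 2)); last by rewrite cis mul1r.
      by ring.
    transitivity ((Re om ^+ 2 + Im om ^+ 2) * (x 0 ord0 / 2)); last by rewrite cis mul1r.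
    by ring.
  + rewrite expr2 expr1 -mulrA; congr (_ * _); apply: complexP; rewrite !cxE /= !mxE /= !coord0 !coord1; ring.
- exists unit, (fun _ x => (x 0 l)%:C%C), (fun=> 1%N); split=> // [_ x|x].
    by rewrite mxE (negbTE l0) (negbTE l1).
  by rewrite (eq_bigr (fun=> (x 0 l)%:C%C))// sumr_const card_unit mulr1n.
Qed.

Lemma wt_ev j (p : P) : p \is ishomog1 j mdeg -> wt j (ev p).
Proof.
move=> /dhomogP hp; apply: (wt_eq (f := fun x => \sum_(m <- msupp p) mcoeff m p * \prod_i (x 0 i)%:C%C ^+ m i)).
  by move=> x; rewrite /ev mevalE.
apply: wt_sum => m mp; rewrite -(hp m mp) /= mdegE -[X in wt X]add0n; apply: wtM; first exact: wtC.
apply: wt_prod => i; rewrite -[X in wt X]mul1n; apply: wtX; exact: wt_coord.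
Qed.

Lemma wt_iter j (G : V -> C) l a x : (forall x, om ^+ j * G (rho x) = om ^+ l * G x) ->
  G (iter a rho x) = (om ^- j * om ^+ l) ^+ a * G x.
Proof.
move=> h; have o0 : om != 0.
  by apply/negP => /eqP o0; move: om1; rewrite o0 /normsq /= expr0n/= addr0 => /eqP; rewrite eq_sym oner_eq0.
elim: a => [|a IH]; first by rewrite expr0 mul1r.
rewrite iterS exprS -mulrA -IH -mulrA -h mulKf// expf_neq0//.
Qed.

(** On an eigenfunction the average is a geometric sum of ratio om^(K - j + l). Since 0 <= l <= 2 j,
    this exponent lies strictly between 0 and N, so the sum vanishes. *)
Lemma av_wt0 N K j f : N.-primitive_root om -> wt j f -> (j < K)%N -> (K + j < N)%N ->
  forall x, av (Re om) (Im om) N (om ^+ K) f x = 0.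
Proof.
move=> po [I [G [l [h1 h2 h3]]]] jK KN x.
have o0 : om != 0.
  by apply/negP => /eqP o0; move: om1; rewrite o0 /normsq /= expr0n/= addr0 => /eqP; rewrite eq_sym oner_eq0.
rewrite /av (_ : \sum_(0 <= a < N) _ = 0) ?mulr0//.
under eq_bigr do rewrite h3 mulr_sumr; rewrite exchange_big/= big1// => i _.
under eq_bigr do rewrite (wt_iter _ _ (h2 i)) mulrA -exprMn.
rewrite -mulr_suml geom_root0 ?mul0r//.
  rewrite !exprMn exprVn -!exprM ![(_ * N)%N]mulnC !exprM (prim_expr_order po) !expr1n invr1 !mulr1//.
have -> : om ^+ K * (om ^- j * om ^+ l i) = om ^+ (K - j + l i).
  by rewrite exprD mulrA -{1}(subnK (ltnW jK)) exprD mulfK// expf_neq0.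
rewrite -(prim_order_dvd po) gtnNdvd//; first by rewrite addn_gt0 subn_gt0 jK.
have := h1 i; move: jK KN; clear; lia.
Qed.
End weights.

Lemma prim_root_exists n : (0 < n)%N -> exists z : C, n.-primitive_root z.
Proof.
pose p : {poly C} := 'X^n - 1; have [r Dp] := closed_field_poly_normal p.
move=> n_gt0; rewrite (monicP _) ?monicXnsubC // scale1r in Dp.
have rn1 : all n.-unity_root r by apply/allP=> z; rewrite -root_prod_XsubC -Dp.
have sz_r : (n < (size r).+1)%N by rewrite -(size_prod_XsubC r id) -Dp size_XnsubC.
have [|z] := hasP (cyclic.has_prim_root n_gt0 rn1 _ sz_r); last by exists z.
by rewrite -separable.separable_prod_XsubC -Dp cyclotomic.separable_Xn_sub_1 // pnatr_eq0 -lt0n.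
Qed.

(** N > 2 excludes w = -1, the half-turn that does not factor into shears. *)
Lemma prim_root_unit N (w : C) : (2 < N)%N -> N.-primitive_root w -> normsq w = 1 /\ 1 + Re w != 0.
Proof.
move=> N2 pw; have w1 : normsq w = 1.
  have h : normsq w ^+ N = 1.
    have hX n : normsq (w ^+ n) = normsq w ^+ n.
      by elim: n => [|n IH]; rewrite ?exprS ?normsqM ?IH// /normsq /= expr1n expr0n addr0.
    by rewrite -hX (prim_expr_order pw) /normsq /= expr1n expr0n addr0.
  apply/eqP; rewrite -(@pexpr_eq1 _ _ N) ?normsq_ge0 ?h//; exact: ltnW (ltnW N2).
split=> //; apply/negP => /eqP c1.
have cE : Re w = -1 by lra.
have sE : Im w = 0.
  by move: w1; rewrite /normsq cE sqrrN expr1n => /eqP; rewrite -subr_eq0 addrAC subrr add0r sqrf_eq0 => /eqP.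
have w2 : w ^+ 2 = 1.
  by rewrite (_ : w = -1) ?sqrrN ?expr1n//; apply: complexP; rewrite ?cE ?sE /= ?oppr0.
by have := prim_order_dvd pw 2; rewrite w2 eqxx gtnNdvd.
Qed.
End Averages.

(** * Parseval's identity *)

Section RieszFischer.
Context {R : realType} (d : nat).
Local Notation leb := (@lebesgue_rV R).
Local Notation V := 'rV[R]_d.
Implicit Types (u : nat -> V -> R) (x : V).
Local Notation ball := (@uball R d).
Let mball : measurable ball. Proof. exact: measurable_uball. Qed.

(** A real value defined for every sequence and equal to the limit when there is one; pointwise
    limits that exist only almost everywhere thus become measurable functions on the whole space. *)
Definition rlimsup (s : nat -> R) : R := fine (limn_esup (fun m => (s m)%:E)).

Lemma rlimsup_cvg (s : nat -> R) (l : R) : s m @[m --> \oo] --> l -> rlimsup s = l.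
Proof.
move=> sl; have h : (s m)%:E @[m --> \oo] --> l%:E by apply/fine_cvgP; split; [near=> m|exact: sl].
by rewrite /rlimsup (cvg_limn_einf_sup h).2.
Unshelve. all: end_near.
Qed.

Lemma limn_einf_le (a : nat -> \bar R) (B : \bar R) : (forall l, (a l <= B)%E) -> (limn_einf a <= B)%E.
Proof.
move=> aB; apply: le_trans (limn_einf_sup a) _; rewrite limn_esup_lim.
apply: lime_le; first exact: is_cvg_esups.
by apply: nearW => n; apply: ge_ereal_sup => _ [l /= _ <-].
Qed.

Lemma measurable_rlimsup u : (forall m, measurable_fun setT (u m)) ->
  measurable_fun setT (fun x => rlimsup (u^~ x)).
Proof.
move=> mu; apply: measurableT_comp; first exact: fine_measurable.
by apply: (measurable_fun_limn_esup (f := fun m x => (u m x)%:E)) => m; exact/measurable_EFinP.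
Qed.

Lemma series_abs_cvg (s : nat -> R) (B : R) :
  (forall n, \sum_(0 <= m < n) `|s m.+1 - s m| <= B) -> cvgn s.
Proof.
move=> h; have hc : cvgn (series (fun m => s m.+1 - s m)).
  apply: normed_cvg; apply: nondecreasing_is_cvgn.
    move=> n m nm; have e : \sum_(0 <= k < m) `|s k.+1 - s k| =
       \sum_(0 <= k < n) `|s k.+1 - s k| + \sum_(n <= k < m) `|s k.+1 - s k| by rewrite -big_cat_nat.
    by rewrite -[leRHS]/(\sum_(0 <= k < m) `|s k.+1 - s k|) e lerDl sumr_ge0.
  by exists B => _ [n _ <-]; exact: h.
have : cvgn (fun n => s 0%N + series (fun m => s m.+1 - s m) n).
  apply: is_cvgD; [exact: is_cvg_cst|exact: hc].
rewrite (_ : (fun n => _) = s)//; apply/funext => n.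
by rewrite /series/= telescope_sumr// addrC subrK.
Qed.

Section cauchy.
Context (u : nat -> V -> R) (c : R).
Hypotheses (bu : forall m, bm (u m)) (c0 : 0 <= c)
  (hu : forall m l, (m <= l)%N -> BI (fun x => (u l x - u m x) ^+ 2) <= c / 4 ^+ m).

Let D m x : R := `|u m.+1 x - u m x|.
Let bD m : bm (D m).
Proof.
have [mf [M hM]] := bmB (bu m.+1) (bu m); split; first exact: measurableT_comp.
by exists M => x x1; rewrite normr_id hM.
Qed.

Let vol : R := BI (fun _ : V => 1 : R).

(** Integrate |z| <= 2^m z^2 + 2^(-m), the squares being O(4^(-m)) by [hu]. The increments are thus
    summable in L^1, which gives convergence almost everywhere. *)
Let BI_D m : BI (D m) <= (c + vol) / 2 ^+ m.
Proof.
have t0 : 0 < 2 ^+ m :> R by rewrite exprn_gt0.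
have b1 : bm (fun x => 2 ^+ m * (u m.+1 x - u m x) ^+ 2) by apply: bmZ; apply: bmX; exact: bmB.
have b2 : bm (fun _ : V => (2 ^+ m)^-1 * 1 : R) by exact: bm_cst.
apply: (@le_trans _ _ (BI (fun x => 2 ^+ m * (u m.+1 x - u m x) ^+ 2 + (2 ^+ m)^-1 * 1))).
  apply: BI_le => //; first exact: bmD.
  move=> x _; rewrite /D; set z := u m.+1 x - u m x; rewrite -(real_normK (num_real z)).
  move: `|z| => y; rewrite -(ler_pM2l t0) mulr1 mulrDr mulfV ?gt_eqF//.
  have := sqr_ge0 (2 ^+ m * y - 1); have := sqr_ge0 (2 ^+ m * y); move: (2 ^+ m) => t; nra.
rewrite BID// !BIZ//; [|exact: bm_cst|by apply: bmX; exact: bmB].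
rewrite mulrDl -/vol [_ * vol]mulrC lerD2r.
have := hu (leqnSn m); rewrite -(ler_pM2l t0) => /le_trans; apply.
rewrite (_ : 4 ^+ m = 2 ^+ m * 2 ^+ m :> R); last by rewrite -exprMn -natrM.
rewrite le_eqVlt; apply/orP; left; apply/eqP.
by have t0' := lt0r_neq0 t0; move: (2 ^+ m) t0' => t tn0; field.
Qed.

Let vol0 : 0 <= vol. Proof. by apply: BI_ge0 => x _. Qed.

Let ae_cvg : {ae leb d, forall x, ball x -> cvgn (u^~ x)}.
Proof.
pose h x := (\sum_(0 <= m <oo) (D m x)%:E)%E.
have mD m : measurable_fun ball (fun x => (D m x)%:E).
  by apply/measurable_EFinP/measurable_funTS; case: (bD m).
have D0 m x : (0 <= (D m x)%:E)%E by rewrite lee_fin; exact: normr_ge0.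
have mh : measurable_fun ball h by apply: ge0_emeasurable_sum.
have h0 x : (0 <= h x)%E by apply: nneseries_ge0.
have Ih : (\int[leb d]_(x in ball) h x < +oo)%E.
  rewrite /h integral_nneseries//.
  apply: (@le_lt_trans _ _ ((2 * (c + vol))%:E)); last exact: ltry.
  apply: lime_le; first by apply: is_cvg_nneseries => n _ _; apply: integral_ge0.
  apply: nearW => n.
  have -> : (\sum_(0 <= m < n) \int[leb d]_(x in ball) (D m x)%:E)%E = (\sum_(0 <= m < n) BI (D m))%:E.
    by rewrite -sumEFin; apply: eq_bigr => m _; rewrite BI_EFin.
  rewrite lee_fin; apply: (@le_trans _ _ (\sum_(0 <= m < n) (c + vol) * 2^-1 ^+ m)).
    by apply: ler_sum => m _; rewrite exprVn; exact: BI_D.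
  have := @geometric_le_lim R n (c + vol) 2^-1 (addr_ge0 c0 vol0).
  rewrite invr_gt0 ltr0n gtr0_norm ?invr_gt0// invf_lt1// ltr1n => /(_ isT isT).
  by rewrite /series/= => /le_trans; apply; rewrite le_eqVlt; apply/orP; left; apply/eqP; field.
have ih : (leb d).-integrable ball h.
  by apply/integrableP; split=> //; under eq_integral do rewrite gee0_abs//.
apply: filterS (integrable_ae mball ih) => x hx /hx hfin.
apply: (@series_abs_cvg _ (fine (h x))) => n.
rewrite -lee_fin fineK// -sumEFin; exact: nneseries_lim_ge.
Qed.

(** Fatou's lemma applied to (u_(l+m) - u_m)^2 as l tends to infinity with m fixed. *)
Lemma riesz_fischer m :
  (\int[leb d]_(x in ball) ((rlimsup (u^~ x) - u m x) ^+ 2)%:E <= (c / 4 ^+ m)%:E)%E.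
Proof.
pose F l x := ((u (l + m)%N x - u m x) ^+ 2)%:E.
have mF l : measurable_fun ball (F l).
  apply/measurable_EFinP/measurable_funTS; have [] : bm (fun x => (u (l + m)%N x - u m x) ^+ 2) => //.
  by apply: bmX; exact: bmB.
have F0 l x : ball x -> (0 <= F l x)%E by rewrite lee_fin sqr_ge0.
have := fatou (leb d) mball mF F0 => fat.
apply: (@le_trans _ _ (\int[leb d]_(x in ball) limn_einf (F^~ x))%E).
  have mU : measurable_fun setT (fun x => rlimsup (u^~ x)) by apply: measurable_rlimsup => i; case: (bu i).
  apply: ae_ge0_le_integral => //.
  - by move=> x _; rewrite lee_fin sqr_ge0.
  - apply/measurable_EFinP/measurable_funTS/measurable_funX/measurable_funB => //; by case: (bu m).
  - move=> x x1; rewrite limn_einf_lim; apply: lime_ge; first exact: is_cvg_einfs.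
    by apply: nearW => n; apply: le_ereal_inf_tmp => _ [l /= _ <-]; exact: F0.
  - rewrite (_ : (fun x => _) = fun x => (- limn_esup (fun l => - F l x))%E); last first.
      by [].
    apply: measurableT_comp => //; apply: (measurable_fun_limn_esup (f := fun l x => (- F l x)%E)) => l.
    by apply: measurableT_comp.
  - apply: filterS ae_cvg => x hx /hx /cvg_ex[/= y uy].
    rewrite (rlimsup_cvg uy).
    have h : F l x @[l --> \oo] --> ((y - u m x) ^+ 2)%:E.
      apply/fine_cvgP; split; first by near=> l.
      have h1 : u (l + m)%N x @[l --> \oo] --> y by have := uy; rewrite -(cvg_shiftn m).
      have h2 : u (l + m)%N x - u m x @[l --> \oo] --> y - u m x by apply: cvgB => //; exact: cvg_cst.
      exact: (cvgM h2 h2).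
    by rewrite (cvg_limn_einf_sup h).1.
apply: le_trans fat _; apply: limn_einf_le => l; rewrite -BI_EFin ?lee_fin; first exact: (hu (leq_addl l m)).
by apply: bmX; exact: bmB.
Unshelve. all: end_near.
Qed.
End cauchy.
End RieszFischer.

(** * Parseval's identity from completeness of an orthonormal system *)

Section Parseval.
Context {R : realType} (k : nat).
Local Notation d := k.+2.
Local Notation leb := (@lebesgue_rV R).
Local Notation V := 'rV[R]_k.+2.
Local Notation C := R[i].
Local Notation Re := (@complex.Re R).
Local Notation Im := (@complex.Im R).
Local Notation proj := (@sphere_proj R k.+2).
Local Notation ball := (@uball R k.+2).
Implicit Types (f g : V -> C) (x y : V).
Let mball : measurable ball. Proof. exact: measurable_uball. Qed.

Lemma le0_of_pow (a c : R) (m0 : nat) : 0 <= c -> (forall m, (m0 <= m)%N -> a <= c / 2 ^+ m) -> a <= 0.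
Proof.
move=> c0 h; rewrite leNgt; apply/negP => a0.
have c1 : 0 < c + 1 by rewrite ltr_wpDl.
have [n0 _ hn] := near_infty_natSinv_lt (PosNum (divr_gt0 a0 c1)).
pose m := maxn m0 n0; have := hn m (leq_maxr _ _); rewrite /= => h1.
have h2 := h m (leq_maxl _ _).
have h3 : c / 2 ^+ m <= c * m.+1%:R^-1.
  by rewrite ler_wpM2l// lef_pV2 ?posrE ?exprn_gt0 ?ltr0n// -natrX ler_nat ltn_expl.
have h4 : (c + 1) * m.+1%:R^-1 < a by rewrite mulrC -ltr_pdivlMr.
have h5 : 0 < m.+1%:R^-1 :> R by rewrite invr_gt0 ltr0n.
have h6 : a < a; last by rewrite ltxx in h6.
apply: le_lt_trans h4; apply: (le_trans h2); apply: (le_trans h3).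
by rewrite mulrDl lerDl mul1r ltW.
Qed.

Lemma Rintegral_eq0_approx (H : V -> R) (c : R) (m0 : nat) : measurable_fun setT H -> 0 <= c ->
  (forall m, (m0 <= m)%N -> exists H1 : V -> R, [/\ bm H1, BI H1 = 0 &
     (\int[leb d]_(x in ball) `|H x - H1 x|%:E <= (c / 2 ^+ m)%:E)%E]) ->
  \int[leb d]_(x in ball) H x = 0.
Proof.
move=> mH c0 h; apply/eqP; rewrite -normr_le0; apply: (le0_of_pow (m0 := m0) c0) => m mm.
have [H1 [b1 e1 I1]] := h m mm.
have mD : measurable_fun ball (EFin \o (fun x => H x - H1 x)).
  by apply/measurable_EFinP/measurable_funTS/measurable_funB => //; case: b1.
have iD : (leb d).-integrable ball (EFin \o (fun x => H x - H1 x)).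
  by apply/integrableP; split=> //; apply: le_lt_trans I1 (ltry _).
have -> : \int[leb d]_(x in ball) H x = BI H1 + \int[leb d]_(x in ball) (H x - H1 x).
  rewrite -RintegralD//; last exact: bm_integrable.
  by congr (fine (integral _ _ _)); apply/funext => x; rewrite addrC subrK.
rewrite e1 add0r (le_trans (le_normr_Rintegral _ iD))//.
rewrite -lee_fin /Rintegral fineK//.
by apply: integrable_fin_num => //; exact: (integrable_norm iD).
Qed.

Section basis.
Context (T : eqType) (lev : nat -> seq T) (e : T -> V -> C).
Hypotheses (ul : forall J, uniq (lev J)) (nl : forall J J', (J <= J')%N -> {subset lev J <= lev J'})
  (cl : forall u, exists J, u \in lev J) (ce : forall u, cc (e u))
  (oe : forall u v, cip (e u) (e v) = (u == v)%:R)
  (complete : forall g, L2 ball (g \o proj) -> (forall u, sphere_inner g (e u) = 0) ->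
     L2norm ball (g \o proj) = 0%E).

Definition partial_sum f (J : nat) : R := \sum_(u <- lev J) normsq (cip f (e u)).

Context (f : V -> C) (cf : cc f).
Let S := partial_sum f.
Let pf J := proj_on (lev J) e f.

Let cpf J : cc (pf J). Proof. exact: cc_proj_on. Qed.

Let oe' J : forall i j, i \in lev J -> j \in lev J -> cip (e i) (e j) = (i == j)%:R.
Proof. by move=> i j _ _. Qed.

Let Sq_dist J J' : (J <= J')%N -> Sq (fun x => pf J' x - pf J x) = S J' - S J.
Proof.
move=> JJ'; have e1 u : u \in lev J -> cip (pf J') (e u) = cip f (e u).
  by move=> uJ; apply: (cip_proj_on (ul J') ce (oe' (J := J'))) => //; exact: nl uJ.
have := Sq_sub_proj (ul J) ce (oe' (J := J)) (cpf J').
rewrite (Sq_proj_on (ul J') ce (oe' (J := J'))) -/(S J').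
rewrite (_ : \sum_(i <- lev J) normsq (cip (pf J') (e i)) = S J); last first.
  by rewrite /S /partial_sum big_seq [RHS]big_seq; apply: eq_bigr => u /e1 ->.
move=> <-; congr Sq; apply/funext => x; congr (_ - _).
by rewrite /pf /proj_on big_seq [RHS]big_seq; apply: eq_bigr => u /e1 ->.
Qed.

Let S_homo : {homo S : n m / (n <= m)%N >-> n <= m}.
Proof. by move=> n m nm; rewrite -subr_ge0 -Sq_dist// Sq_ge0. Qed.

Let S_le J : S J <= Sq f.
Proof. exact: (bessel (ul J) ce (oe' (J := J)) cf). Qed.

Let S_cvg : cvgn S.
Proof. by apply: nondecreasing_is_cvgn => //; exists (Sq f) => _ [J _ <-]. Qed.

Let L := limn S.

Let S_leL J : S J <= L.
Proof. exact: (nondecreasing_cvgn_le S_homo S_cvg). Qed.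

Let pick_level (m : nat) : exists J, (m <= J)%N /\ L - (4 ^+ m)^-1 <= S J.
Proof.
have e0 : 0 < (4 ^+ m)^-1 :> R by rewrite invr_gt0 exprn_gt0.
have cS' : S J @[J --> \oo] --> L by exact: S_cvg.
have /cvgrPdist_le /(_ _ e0) [N _ hN] := cS'.
exists (maxn m N); rewrite leq_maxl; split=> //.
by have := hN (maxn m N) (leq_maxr _ _); rewrite /= ler_norml => /andP[_]; lra.
Qed.

(** Completeness speaks of functions orthogonal to the system, so the limit of the projections has
    to be realised as a function G. A sufficiently fast subsequence converges by [riesz_fischer]; f
    - G is square integrable and orthogonal to every e u, hence null, so the projections converge to
    f. *)
Lemma parseval : S J @[J --> \oo] --> Sq f.
Proof.
suff <- : L = Sq f by exact: S_cvg.
apply/eqP; rewrite eq_le; apply/andP; split.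
  by apply: limr_le; [exact: S_cvg|apply: nearW => J; exact: S_le].
have [Jm hJ] := choice pick_level.
pose F m := pf (Jm m).
have cF m : cc (F m) by exact: cpf.
have dist m l : (m <= l)%N -> Sq (fun x => F l x - F m x) <= 1 / 4 ^+ m.
  move=> ml; have [_ h1] := hJ m; have [_ h2] := hJ l.
  have h3 : (4 ^+ l)^-1 <= (4 ^+ m)^-1 :> R by rewrite lef_pV2 ?posrE ?exprn_gt0// ler_eXn2l// ltr1n.
  have h4 := S_leL (Jm m); have h5 := S_leL (Jm l).
  (* The chosen levels need not be monotone in m; either order gives the bound, because both partial
     sums are within 4^(-m) of L. *)
  have [h|h] := leqP (Jm m) (Jm l).
    have e2 : Sq (fun x => F l x - F m x) = S (Jm l) - S (Jm m) := Sq_dist h.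
    by rewrite e2 div1r; lra.
  have e1 : Sq (fun x => F l x - F m x) = Sq (fun x => F m x - F l x).
    by congr SI; apply/funext => x; rewrite /normsq !cxE -sqrrN opprB; congr (_ + _); rewrite -sqrrN opprB.
  have e2 : Sq (fun x => F m x - F l x) = S (Jm m) - S (Jm l) := Sq_dist (ltnW h).
  by rewrite e1 e2 div1r; lra.
pose u m x := Re (F m (proj x)); pose w m x := Im (F m (proj x)).
have bu m : bm (u m) by apply: (bm_sphere_proj (f := fun x => Re (F m x))); case: (cF m).
have bw m : bm (w m) by apply: (bm_sphere_proj (f := fun x => Im (F m x))); case: (cF m).
have dge1 : 1 <= d%:R :> R by rewrite ler1n.
have BIle m l : (m <= l)%N -> BI (fun x => (u l x - u m x) ^+ 2 + (w l x - w m x) ^+ 2) <= 1 / 4 ^+ m.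
  move=> ml; apply: le_trans (dist m l ml).
  have -> : BI (fun x => (u l x - u m x) ^+ 2 + (w l x - w m x) ^+ 2) =
     BI ((fun x => normsq (F l x - F m x)) \o proj).
    by congr BI; apply/funext => x; rewrite /= /normsq !cxE.
  rewrite /Sq /SI ler_peMl//; apply: BI_ge0 => x _; exact: normsq_ge0.
have b2 (v : nat -> V -> R) m l : (forall m, bm (v m)) -> bm (fun x => (v l x - v m x) ^+ 2).
  by move=> bv; apply: bmX; exact: bmB.
have hu m l : (m <= l)%N -> BI (fun x => (u l x - u m x) ^+ 2) <= 1 / 4 ^+ m.
  move=> ml; apply: le_trans (BIle m l ml); apply: BI_le; [exact: b2|by apply: bmD; exact: b2|].
  by move=> x _; rewrite lerDl sqr_ge0.
have hw m l : (m <= l)%N -> BI (fun x => (w l x - w m x) ^+ 2) <= 1 / 4 ^+ m.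
  move=> ml; apply: le_trans (BIle m l ml); apply: BI_le; [exact: b2|by apply: bmD; exact: b2|].
  by move=> x _; rewrite lerDr sqr_ge0.
pose G x : C := (rlimsup (fun m => Re (F m x)) +i* rlimsup (fun m => Im (F m x)))%C.
have mGR : measurable_fun setT (fun x => Re (G (proj x))).
  by apply: (measurable_rlimsup (u := u)) => m; case: (bu m).
have mGI : measurable_fun setT (fun x => Im (G (proj x))).
  by apply: (measurable_rlimsup (u := w)) => m; case: (bw m).
have mN (h : V -> C) : measurable_fun setT (fun x => Re (h x)) -> measurable_fun setT (fun x => Im (h x)) ->
    measurable_fun ball (fun x => (normsq (h x))%:E).
  by move=> h1 h2; apply/measurable_EFinP/measurable_funTS/measurable_funD; exact: measurable_funX.
have mF m : measurable_fun setT (fun x => Re (F m (proj x))) /\ measurable_fun setT (fun x => Im (F m (proj x))).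
  by split; [case: (bu m)|case: (bw m)].
have nE (h : V -> C) x : (0 <= (normsq (h x))%:E)%E by rewrite lee_fin normsq_ge0.
have GF m : (\int[leb d]_(x in ball) (normsq (G (proj x) - F m (proj x)))%:E <= (2 / 4 ^+ m)%:E)%E.
  have h1 := @riesz_fischer R d u 1 bu ler01 hu m; have h2 := @riesz_fischer R d w 1 bw ler01 hw m.
  have -> : (2 / 4 ^+ m : R) = 1 / 4 ^+ m + 1 / 4 ^+ m by lra.
  rewrite EFinD; apply: le_trans (leeD h1 h2); rewrite -ge0_integralD//.
  - rewrite le_eqVlt; apply/orP; left; apply/eqP; congr (integral _ _ _); apply/funext => x.
    by rewrite -EFinD /normsq !cxE.
  - by move=> x _; rewrite lee_fin sqr_ge0.
  - by apply/measurable_EFinP/measurable_funTS/measurable_funX/measurable_funB; [exact: mGR|case: (mF m)].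
  - by move=> x _; rewrite lee_fin sqr_ge0.
  - by apply/measurable_EFinP/measurable_funTS/measurable_funX/measurable_funB; [exact: mGI|case: (mF m)].
pose r x := f x - G x.
have bf1 : bm (fun x => Re (f (proj x))) by apply: (bm_sphere_proj (f := fun x => Re (f x))); case: cf.
have bf2 : bm (fun x => Im (f (proj x))) by apply: (bm_sphere_proj (f := fun x => Im (f x))); case: cf.
have mrR : measurable_fun setT (fun x => Re (r (proj x))).
  under [X in measurable_fun _ X]eq_fun do rewrite ReDE ReNE.
  by apply: measurable_funB => //; case: bf1.
have mrI : measurable_fun setT (fun x => Im (r (proj x))).
  under [X in measurable_fun _ X]eq_fun do rewrite ImDE ImNE.
  by apply: measurable_funB => //; case: bf2.
have cfF m : cc (fun x => f x - F m x).
  have -> : (fun x => f x - F m x) = (fun x => f x + - 1 * F m x) by apply/funext => x; rewrite mulN1r.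
  by apply: ccD => //; exact: ccZ.
have bfF m : bm (fun x => normsq (f (proj x) - F m (proj x))).
  exact: (bm_sphere_proj (cc_normsq (cfF m))).
have tri (a b : V -> C) : measurable_fun ball (fun x => (normsq (a x))%:E) ->
    measurable_fun ball (fun x => (normsq (b x))%:E) ->
    measurable_fun ball (fun x => (normsq (a x + b x))%:E) ->
    (\int[leb d]_(x in ball) (normsq (a x + b x))%:E <=
     2%:E * \int[leb d]_(x in ball) (normsq (a x))%:E + 2%:E * \int[leb d]_(x in ball) (normsq (b x))%:E)%E.
  move=> ma mb mab; rewrite -!ge0_integralZl//.
  rewrite -ge0_integralD//; [|by move=> x _; rewrite mule_ge0|exact: measurable_funeM|by move=> x _; rewrite mule_ge0|exact: measurable_funeM].
  apply: ge0_le_integral => //.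
  - by move=> x _; rewrite lee_fin normsq_ge0.
  - by apply: emeasurable_funD; exact: measurable_funeM.
  - by move=> x _; rewrite -!EFinM -EFinD lee_fin; exact: normsqD_le.
have mfF m : measurable_fun ball (fun x => (normsq (f (proj x) - F m (proj x)))%:E).
  by apply/measurable_EFinP/measurable_funTS; case: (bfF m).
have mGF m : measurable_fun ball (fun x => (normsq (G (proj x) - F m (proj x)))%:E).
  apply: mN; under [X in measurable_fun _ X]eq_fun do rewrite !cxE.
    by apply: measurable_funB => //; case: (mF m).
  by apply: measurable_funB => //; case: (mF m).
have mFG m : measurable_fun ball (fun x => (normsq (F m (proj x) - G (proj x)))%:E).
  apply: mN; under [X in measurable_fun _ X]eq_fun do rewrite !cxE.
    by apply: measurable_funB => //; case: (mF m).
  by apply: measurable_funB => //; case: (mF m).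
have mr : measurable_fun ball (fun x => (normsq (r (proj x)))%:E) by apply: mN.
have FG m : (\int[leb d]_(x in ball) (normsq (F m (proj x) - G (proj x)))%:E <= (2 / 4 ^+ m)%:E)%E.
  apply: le_trans (GF m); rewrite le_eqVlt; apply/orP; left; apply/eqP; congr (integral _ _ _); apply/funext => x.
  by congr EFin; rewrite /normsq !cxE; ring.
have L2r : L2 ball (r \o proj).
  split; [exact: measurable_funTS mrR|exact: measurable_funTS mrI|].
  rewrite L2normE poweR_lty//.
  apply: (@le_lt_trans _ _ (2%:E * (BI (fun x => normsq (f (proj x) - F 0%N (proj x))))%:E + 2%:E * (2 / 4 ^+ 0)%:E)%E); last first.
    by rewrite -!EFinM -EFinD ltry.
  have mr' : measurable_fun ball (fun x => (normsq (f (proj x) - F 0%N (proj x) + (F 0%N (proj x) - G (proj x))))%:E).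
    by under [X in measurable_fun _ X]eq_fun do rewrite addrA subrK.
  have := tri _ _ (mfF 0%N) (mFG 0%N) mr'.
  under [X in (X <= _)%E -> _]eq_integral do rewrite addrA subrK.
  move=> /le_trans; apply; rewrite -(BI_EFin (bfF 0%N)); apply: leeD => //.
  by apply: lee_wpmul2l => //; exact: FG.
have orth v : sphere_inner r (e v) = 0.
  have [J0 vJ0] := cl v.
  have cev := ce v.
  have be : bm (fun x => normsq (e v (proj x))) by apply: (bm_sphere_proj (cc_normsq cev)).
  pose c : R := 2 + BI (fun x => normsq (e v (proj x))).
  have c0 : 0 <= c by rewrite addr_ge0// BI_ge0// => x _; exact: normsq_ge0.
  have me1 : bm (fun x => Re (e v (proj x))) by apply: (bm_sphere_proj (f := fun x => Re (e v x))); case: cev.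
  have me2 : bm (fun x => Im (e v (proj x))) by apply: (bm_sphere_proj (f := fun x => Im (e v x))); case: cev.
  have fF0 m : (J0 <= m)%N -> cip (fun x => f x - F m x) (e v) = 0.
    move=> J0m; have vJ : v \in lev (Jm m) by apply: nl vJ0; apply: leq_trans J0m _; case: (hJ m).
    have -> : (fun x => f x - F m x) = (fun x => f x + - 1 * F m x) by apply/funext => x; rewrite mulN1r.
    rewrite cipDl//; last exact: ccZ.
    by rewrite cipZl// (cip_proj_on (ul _) ce (oe' (J := Jm m)))// mulN1r subrr.
  have cH1 m := cip_cc (cfF m) cev.
  (* p will be the real or the imaginary part. Pointwise |A B| <= 2^m |A|^2 + 2^(-m) |B|^2 with A =
     F m - G and B = e v, and the integral of |A|^2 is at most 2 / 4^m. *)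
  have est m (p : C -> R) : (forall z, `|p z| ^+ 2 <= normsq z) -> (forall a b, p (a - b) = p a - p b) ->
      measurable_fun setT (fun x => p (r (proj x) * (e v (proj x))^*)) ->
      measurable_fun setT (fun x => p ((f (proj x) - F m (proj x)) * (e v (proj x))^*)) ->
      (\int[leb d]_(x in ball) `|p (r (proj x) * (e v (proj x))^*) -
          p ((f (proj x) - F m (proj x)) * (e v (proj x))^*)|%:E <= (c / 2 ^+ m)%:E)%E.
    move=> hp pB m1 m2.
    have t0 : 0 < 2 ^+ m :> R by rewrite exprn_gt0.
    apply: (@le_trans _ _ (\int[leb d]_(x in ball) ((2 ^+ m)%:E * (normsq (F m (proj x) - G (proj x)))%:E +
        ((2 ^+ m)^-1)%:E * (normsq (e v (proj x)))%:E))%E).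
      apply: ge0_le_integral => //.
      - apply/measurable_EFinP/measurable_funTS; apply: measurableT_comp => //; exact: measurable_funB.
      - apply: emeasurable_funD; apply: measurable_funeM => //.
        by apply/measurable_EFinP/measurable_funTS; case: be.
      - move=> x _; rewrite -!EFinM -EFinD lee_fin -pB -mulrBl.
        have -> : r (proj x) - (f (proj x) - F m (proj x)) = F m (proj x) - G (proj x) by rewrite /r; ring.
        set A := _ - _; set B := e v _; have := hp (A * B^*); rewrite normsqM.
        have -> : normsq B^* = normsq B by rewrite /normsq !cxE sqrrN.
        have a0 := normsq_ge0 A; have b0 := normsq_ge0 B.
        move: (normsq A) (normsq B) (`|p _|) a0 b0 (normr_ge0 (p (A * B^*))) => a b q a0 b0 q0 hq.
        rewrite -(ler_pM2l t0) mulrDr (mulrA _ _^-1) mulfV ?gt_eqF// mul1r.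
        have h1 : 0 <= 2 ^+ m * (2 ^+ m * a) + b by rewrite addr_ge0// !mulr_ge0// ltW.
        rewrite -(@ler_pXn2r _ 2)// ?nnegrE ?mulr_ge0 ?(ltW t0)//.
        move: (2 ^+ m) t0 {h1} => t t0.
        have : (t * q) ^+ 2 <= t ^+ 2 * (a * b) by rewrite exprMn ler_wpM2l ?sqr_ge0.
        move=> /le_trans; apply.
        have -> : (t * (t * a) + b) ^+ 2 = (t * (t * a) - b) ^+ 2 + 4 * (t ^+ 2 * (a * b)) by ring.
        have h0 : 0 <= t ^+ 2 * (a * b) by rewrite mulr_ge0 ?sqr_ge0// mulr_ge0.
        by have := sqr_ge0 (t * (t * a) - b); lra.
    have meb : measurable_fun ball (fun x => (normsq (e v (proj x)))%:E).
      by apply/measurable_EFinP/measurable_funTS; case: be.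
    have ti : 0 <= (2 ^+ m)^-1 :> R by rewrite invr_ge0 ltW.
    have n1 x : ball x -> (0 <= (2 ^+ m)%:E * (normsq (F m (proj x) - G (proj x)))%:E)%E.
      by move=> _; rewrite -EFinM lee_fin mulr_ge0 ?normsq_ge0// ltW.
    have n2 x : ball x -> (0 <= ((2 ^+ m)^-1)%:E * (normsq (e v (proj x)))%:E)%E.
      by move=> _; rewrite -EFinM lee_fin mulr_ge0 ?normsq_ge0.
    have q1 : measurable_fun ball (fun x => (2 ^+ m)%:E * (normsq (F m (proj x) - G (proj x)))%:E)%E by exact: measurable_funeM.
    have q2 : measurable_fun ball (fun x => ((2 ^+ m)^-1)%:E * (normsq (e v (proj x)))%:E)%E by exact: measurable_funeM.
    have n3 x : ball x -> (0 <= (normsq (F m (proj x) - G (proj x)))%:E)%E by rewrite lee_fin normsq_ge0.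
    have n4 x : ball x -> (0 <= (normsq (e v (proj x)))%:E)%E by rewrite lee_fin normsq_ge0.
    have tm : (0 <= (2 ^+ m)%:E :> \bar R)%E by rewrite lee_fin ltW.
    have tn : (0 <= ((2 ^+ m)^-1)%:E :> \bar R)%E by rewrite lee_fin.
    have z1 : (\int[leb d]_(x in ball) ((2 ^+ m)%:E * (normsq (F m (proj x) - G (proj x)))%:E) =
        (2 ^+ m)%:E * \int[leb d]_(x in ball) (normsq (F m (proj x) - G (proj x)))%:E)%E.
      by apply: ge0_integralZl.
    have z2 : (\int[leb d]_(x in ball) (((2 ^+ m)^-1)%:E * (normsq (e v (proj x)))%:E) =
        ((2 ^+ m)^-1)%:E * \int[leb d]_(x in ball) (normsq (e v (proj x)))%:E)%E.
      by apply: ge0_integralZl.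
    rewrite ge0_integralD// z1 z2 -(BI_EFin be).
    apply: (@le_trans _ _ ((2 ^+ m)%:E * (2 / 4 ^+ m)%:E + ((2 ^+ m)^-1)%:E * (BI (fun x => normsq (e v (proj x))))%:E)%E).
      by apply: leeD => //; apply: lee_wpmul2l; rewrite ?lee_fin ?(ltW t0)//; exact: FG.
    rewrite -!EFinM -EFinD lee_fin /c.
    rewrite (_ : 4 ^+ m = 2 ^+ m * 2 ^+ m :> R); last by rewrite -exprMn -natrM.
    rewrite le_eqVlt; apply/orP; left; apply/eqP; have tn0 := lt0r_neq0 t0.
    by move: (BI _) (2 ^+ m) tn0 => b t tn0; field.
  have mReH : measurable_fun setT (fun x => Re (r (proj x) * (e v (proj x))^*)).
    under [X in measurable_fun _ X]eq_fun do rewrite ReME ReJ ImJ.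
    by apply: measurable_funB; apply: measurable_funM => //; [case: me1|apply: measurableT_comp => //; case: me2].
  have mImH : measurable_fun setT (fun x => Im (r (proj x) * (e v (proj x))^*)).
    under [X in measurable_fun _ X]eq_fun do rewrite ImME ReJ ImJ.
    by apply: measurable_funD; apply: measurable_funM => //; [apply: measurableT_comp => //; case: me2|case: me1].
  have bRe m : bm (fun x => Re ((f (proj x) - F m (proj x)) * (e v (proj x))^*)).
    by apply: (bm_sphere_proj (f := fun x => Re ((f x - F m x) * (e v x)^*))); case: (cH1 m).
  have bIm m : bm (fun x => Im ((f (proj x) - F m (proj x)) * (e v (proj x))^*)).
    by apply: (bm_sphere_proj (f := fun x => Im ((f x - F m x) * (e v x)^*))); case: (cH1 m).
  rewrite /sphere_inner /sphere_integral /cintegral.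
  rewrite (_ : Rintegral _ _ _ = 0); last first.
    apply: (Rintegral_eq0_approx (m0 := J0) mReH c0) => m J0m.
    exists (fun x => Re ((f (proj x) - F m (proj x)) * (e v (proj x))^*)); split.
    - exact: bRe.
    - have := congr1 Re (fF0 m J0m); rewrite /cip /cS /= /SI => /eqP.
      by rewrite mulf_eq0 pnatr_eq0/= => /eqP.
    - apply: est => //; last by case: (bRe m).
        by move=> z; rewrite real_normK ?num_real// lerDl sqr_ge0.
      by move=> a b; rewrite ReDE ReNE.
  rewrite (_ : Rintegral _ _ _ = 0); last first.
    apply: (Rintegral_eq0_approx (m0 := J0) mImH c0) => m J0m.
    exists (fun x => Im ((f (proj x) - F m (proj x)) * (e v (proj x))^*)); split.
    - exact: bIm.
    - have := congr1 Im (fF0 m J0m); rewrite /cip /cS /= /SI => /eqP.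
      by rewrite mulf_eq0 pnatr_eq0/= => /eqP.
    - apply: est => //; last by case: (bIm m).
        by move=> z; rewrite real_normK ?num_real// lerDr sqr_ge0.
      by move=> a b; rewrite ImDE ImNE.
  by rewrite mulr0.
have I0 : (\int[leb d]_(x in ball) (normsq (r (proj x)))%:E = 0)%E.
  have := complete L2r orth; rewrite L2normE; apply: poweR_eq0_eq0.
  by apply: integral_ge0.
rewrite -subr_le0; apply: (@le0_of_pow _ (4 * d%:R) 0); first by rewrite mulr_ge0.
move=> m _; have t4 : 0 < 4 ^+ m :> R by rewrite exprn_gt0.
apply: (@le_trans _ _ (Sq f - S (Jm m))); first by rewrite lerD2l lerN2 S_leL.
rewrite -(Sq_sub_proj (ul _) ce (oe' (J := Jm m)) cf).
have eqr : (fun x => (normsq (r (proj x) + (G (proj x) - F m (proj x))))%:E) =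
    (fun x => (normsq (f (proj x) - F m (proj x)))%:E).
  by apply/funext => x; congr (EFin (normsq _)); rewrite /r; ring.
have mf' : measurable_fun ball (fun x => (normsq (r (proj x) + (G (proj x) - F m (proj x))))%:E).
  by rewrite eqr; exact: mfF.
have := tri _ _ mr (mGF m) mf'; rewrite eqr.
rewrite -(BI_EFin (bfF m)) I0 mule0 add0e => hle.
have : ((BI (fun x => normsq (f (proj x) - F m (proj x))))%:E <= 2%:E * (2 / 4 ^+ m)%:E)%E.
  by apply: le_trans hle _; apply: lee_wpmul2l => //; exact: GF.
rewrite -EFinM lee_fin => hb.
have -> : Sq (fun x => f x - proj_on (lev (Jm m)) e f x) = d%:R * BI (fun x => normsq (f (proj x) - F m (proj x))) by [].
apply: (@le_trans _ _ (d%:R * (2 * (2 / 4 ^+ m)))); first by rewrite ler_wpM2l.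
have -> : d%:R * (2 * (2 / 4 ^+ m)) = 4 * d%:R / 4 ^+ m :> R by ring.
rewrite ler_wpM2l ?mulr_ge0// lef_pV2 ?posrE ?exprn_gt0//.
by rewrite lerXn2r ?nnegrE// ler_nat.
Qed.
End basis.
End Parseval.

(** * Estimates of spherical coefficients *)

Section RadialEstimates.
Context {R : realType}.
Local Notation mu := (@lebesgue_measure R).
Implicit Types f g : R -> R.

Lemma prim_lin f g (c x : R) : continuous f -> continuous g ->
  prim (fun s => f s + c * g s) x = prim f x + c * prim g x.
Proof.
move=> cf cg; have key (a b : R) : \int[mu]_(t in `[a, b]) (f t + c * g t) =
    \int[mu]_(t in `[a, b]) f t + c * \int[mu]_(t in `[a, b]) g t.
  rewrite RintegralD//; [|exact: continuous_integrable_itv|].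
    by rewrite RintegralZl//; exact: continuous_integrable_itv.
  have cg' : continuous (fun t => c * g t) by apply: cM => //; exact: cC.
  exact: (continuous_integrable_itv _ _ cg').
by rewrite /prim !key; ring.
Qed.

Lemma radial_lin j k (E c : R) (a1 a1' b1 a2 a2' b2 : R -> R) :
  radial j k E a1 a1' b1 -> radial j k E a2 a2' b2 ->
  radial j k E (fun r => a1 r + c * a2 r) (fun r => a1' r + c * a2' r) (fun r => b1 r + c * b2 r).
Proof.
move=> r1 r2; split.
- move=> r; apply: (d1eq (d1D (rad_da r1 r) (d1M (d1c c r) (rad_da r2 r)))).
  by rewrite mul0r add0r.
- by apply: cD; [exact: rad_ca' r1|apply: cM; [exact: cC|exact: rad_ca' r2]].
- by apply: cD; [exact: rad_cb r1|apply: cM; [exact: cC|exact: rad_cb r2]].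
- move=> r r01; have e1 := rad_eq r1 r01; have e2 := rad_eq r2 r01.
  rewrite (_ : (fun s => s ^+ (j + k).+1 * _) =
    (fun s => s ^+ (j + k).+1 * (b1 s - E * a1 s) + c * (s ^+ (j + k).+1 * (b2 s - E * a2 s)))).
    rewrite prim_lin; [|exact: rad_flux_continuous r1|exact: rad_flux_continuous r2].
    by rewrite -e1 -e2; move: (r ^+ _) (r ^+ _) => u v; ring.
  by apply/funext => s; move: (s ^+ _) => u; ring.
Qed.

Lemma radial_pow j k (E : R) :
  radial j k E (fun r => r ^+ j) (fun r => j%:R * r ^+ j.-1) (fun r => E * r ^+ j).
Proof.
have cXn n : continuous (fun r : R => r ^+ n) by exact: exprn_continuous.
split.
- by move=> r; exact: d1Xn.
- by apply: cM => //; exact: cC.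
- by apply: cM => //; exact: cC.
- move=> r _; rewrite (_ : (fun s => _) = (fun _ => 0)); last first.
    by apply/funext => s; rewrite subrr mulr0.
  rewrite /prim /Rintegral !integral0 subrr; case: j => [|j]; first by rewrite !mul0r mulr0 subrr.
  by rewrite /= addSn !exprS; ring.
Qed.

(** Expand the integral of w (f - t)^2 >= 0 with t the integral of w f; the total mass of w is at
    most 1. *)
Lemma II_Jensen (w f : R -> R) : continuous w -> continuous f -> (forall r, 0 < r < 1 -> 0 <= w r <= 1) ->
  II (fun r => w r * f r) ^+ 2 <= II (fun r => w r * f r ^+ 2).
Proof.
move=> cw cf w01; set t := II _.
have cf2 : continuous (fun r => f r ^+ 2) by exact: cX.
have h : 0 <= II (fun r => w r * (f r - t) ^+ 2).
  by apply: II_ge0 => r /w01/andP[w0 _]; rewrite mulr_ge0 ?sqr_ge0.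
have w1 : II w <= 1.
  by rewrite -[leRHS](@II_cst R); apply: II_le => //; [exact: cC|move=> r /w01/andP[]].
move: h; rewrite (_ : (fun r => _) = (fun r => w r * f r ^+ 2 + ((- (2 * t)) * (w r * f r) + t ^+ 2 * w r))); last first.
  by apply/funext => r; ring.
have c1 : continuous (fun r => w r * f r) by exact: cM.
have c2 : continuous (fun r => t ^+ 2 * w r) by apply: cM => //; exact: cC.
have c3 : continuous (fun r => (- (2 * t)) * (w r * f r)) by apply: cM => //; exact: cC.
have c4 : continuous (fun r => w r * f r ^+ 2) by exact: cM.
rewrite (II_D c4 (cD c3 c2)) (II_D c3 c2) (II_Z _ c1) (II_Z _ cw) -/t => h.
have : t ^+ 2 * II w <= t ^+ 2 by rewrite ler_piMr ?sqr_ge0.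
by move: h; rewrite expr2; move: (II _) (II w) => u v; lra.
Qed.

Lemma horner_derive (A : {poly R}) t : is_derive t (1:R) (fun x => A.[x]) A^`().[t].
Proof.
elim/poly_ind: A => [|p c IH].
  rewrite deriv0 (_ : (fun x => _) = (fun=> 0)); last by apply/funext => x; rewrite horner0.
  by rewrite horner0; exact: d1c.
rewrite (_ : (fun x => _) = (fun x => p.[x] * x + c)); last first.
  by apply/funext => x; rewrite hornerMXaddC.
apply: (d1eq (d1D (d1M IH (d1id t)) (d1c c t))).
by rewrite derivMXaddC hornerD hornerMX; ring.
Qed.

Lemma C1k_horner n (A : {poly R}) : C1k n (fun t => A.[t]).
Proof.
elim: n A => [|n IH] A; last exact: (C1kS (horner_derive A) (IH A^`())).
by move=> t; exact: (d1cont (horner_derive A t)).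
Qed.

Lemma derive1_horner (A : {poly R}) : derive1 (fun t => A.[t]) = (fun t => A^`().[t]).
Proof. by apply/funext => t; exact: (d1E (horner_derive A t)). Qed.
End RadialEstimates.

(** * The resolvent bound for a single radial solution *)

Section LowDegreeEstimate.
Context {R : realType} (k : nat).
Local Notation V := 'rV[R]_k.+2.
Local Notation C := R[i].
Context (j : nat) (H : V -> R) (sH : solid j H).

Let cH : continuous H. Proof. exact: CkR_continuous (solid_smooth sH 0). Qed.
Let cn : continuous (@nsq R k.+2). Proof. exact: CkR_continuous (@CkR_nsq _ _ 0). Qed.

Let BI_sq_radial (g : R -> R) : continuous g -> BI (fun x : V => (g (nsq x) * H x) ^+ 2) =
  SI (fun x => H x ^+ 2) * II (fun r => r ^+ k.+1 * (r ^+ j * g (r ^+ 2)) ^+ 2).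
Proof.
move=> cg; have cF : continuous (fun x : V => (g (nsq x) * H x) ^+ 2).
  by apply: cX; apply: cM => //; exact: (ccomp cn cg).
have cg2 : continuous (fun r : R => g (r ^+ 2)) by apply: (ccomp _ cg); exact: exprn_continuous.
rewrite BI_polar// -II_Z; last first.
  by apply: cM; [exact: exprn_continuous|apply: cX; apply: cM => //; exact: exprn_continuous].
apply: II_eq => r /andP[r0 r1].
have e : SI (fun x : V => (g (nsq (r *: x)) * H (r *: x)) ^+ 2) =
  SI (fun x : V => ((r ^+ j * g (r ^+ 2)) ^+ 2) * H x ^+ 2).
  apply: SI_eq => //.
  - exact: (ccomp (@continuous_scale_rV _ _ r) cF).
  - by apply: (cM (@cC _ _ _)); exact: cX.
  - by move=> x x1; rewrite nsqE enormZ x1 mulr1 (solid_homog sH) real_normK ?num_real//; ring.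
rewrite e SIZ//=; [|exact: cX].
by rewrite mulrA mulrC.
Qed.

(** The resolvent bound is applied to A(|x|^2) H(x). The root of A at 1 makes it O(1 - |x|^2), hence
    an element of H^1_0, and the common factor [SI] of H^2 cancels. *)
Let poly_estimate (E q : R) (A : {poly R}) : 0 < SI (fun x => H x ^+ 2) -> A.[1] = 0 ->
  (resolvent_norm (fun _ : V => 0%R : C) E <= q%:E)%E ->
  II (fun r => r ^+ k.+1 * (r ^+ j * A.[r ^+ 2]) ^+ 2) <=
  q ^+ 2 * II (fun r => r ^+ k.+1 * (r ^+ j * (radial_op j k E A).[r ^+ 2]) ^+ 2).
Proof.
move=> S0 A1 hq; pose s (x : V) := A.[nsq x] * H x.
have st n : C1k n (fun t => A.[t]) := C1k_horner n A.
have ss n : CkR n s := CkR_radial_solid sH st n.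
have chorn (p : {poly R}) : continuous (fun t => p.[t]) := C1k_continuous (C1k_horner 0 p).
have /factor_theorem[q' Aq] : root A 1 by apply/eqP.
have [M M0 hM] : exists2 M, 0 <= M & forall x : V, enorm x <= 1 -> `|q'.[nsq x] * H x| <= M.
  have c0 : continuous (fun x : V => q'.[nsq x] * H x) by apply: cM => //; exact: (ccomp cn (chorn q')).
  have [M hM] := continuous_cball_bounded 1 c0.
  by exists M => //; apply: le_trans (hM 0 _); rewrite ?enorm0.
have sM (x : V) : enorm x < 1 -> `|s x| <= M * (1 - nsq x).
  move=> x1; rewrite /s Aq hornerM hornerXsubC mulrAC normrM.
  apply: ler_pM => //; first exact: hM (ltW x1).
  have : nsq x <= 1 by rewrite nsqE expr_le1 ?enorm_ge0 ?ltW.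
  by move=> h; rewrite ler0_norm ?opprB ?subr_le0.
have := resolvent_le ss sM hq.
rewrite (_ : (fun x => (lapR s x + E * s x) ^+ 2) =
  (fun x => ((radial_op j k E A).[nsq x] * H x) ^+ 2)); last first.
  apply/funext => x; rewrite (lap_radial_solid sH st x) !derive1_horner /radial_op /s.
  rewrite !hornerD !hornerZ hornerM hornerX; congr (_ ^+ 2).
  have -> : ((4 * j + 2 * k + 4)%:R : R) = (4 * j + 2 * k.+2)%:R by congr (_%:R); lia.
  by move: (_%:R) => N; ring.
rewrite (BI_sq_radial (chorn A)) (BI_sq_radial (chorn (radial_op j k E A))) mulrCA.
by rewrite ler_pM2l.
Qed.

Context (E q : R) (a a' b h : R -> R) (rad : radial j k E a a' b).
Hypotheses (ch : continuous h) (bh : forall r, 0 <= r <= 1 -> b r = r ^+ j * h r) (a1 : a 1 = 0).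
Hypotheses (S0 : 0 < SI (fun x => H x ^+ 2))
  (hq : (resolvent_norm (fun _ : V => 0%R : C) E <= q%:E)%E).

(** [resolvent_le] needs smooth functions, which a need not provide: the bound is taken on the
    approximants of [rad_poly_approx] with error 2^(-m), and m tends to infinity. *)
Lemma low_estimate : II (fun r => r ^+ k.+1 * a r ^+ 2) <= q ^+ 2 * II (fun r => r ^+ k.+1 * b r ^+ 2).
Proof.
have ca := rad_ca rad; have cb := rad_cb rad.
have cXn n : continuous (fun r : R => r ^+ n) by exact: exprn_continuous.
have [Ma Ma0 hMa] := continuous_segment_bounded ca.
have [Mb Mb0 hMb] := continuous_segment_bounded cb.
rewrite -subr_le0; apply: (@le0_of_pow R _ (2 * Ma + q ^+ 2 * (2 * Mb + 1)) 0%N) => [|m _].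
  by apply: addr_ge0; [exact: mulr_ge0|apply: mulr_ge0; [exact: sqr_ge0|apply: addr_ge0 => //; exact: mulr_ge0]].
pose e : R := (2 ^+ m)^-1; have e0 : 0 < e by rewrite invr_gt0 exprn_gt0.
have e1 : e <= 1 by rewrite invf_le1 ?exprn_gt0// exprn_ege1// ler1n.
have [A A1 hA] := rad_poly_approx rad ch bh a1 e0.
have chp (p : {poly R}) : continuous (fun r : R => r ^+ k.+1 * (r ^+ j * p.[r ^+ 2]) ^+ 2).
  apply: cM => //; apply: cX; apply: cM => //; apply: (ccomp (cXn 2%N)).
  exact: C1k_continuous (C1k_horner 0 p).
have cw (f : R -> R) : continuous f -> continuous (fun r : R => r ^+ k.+1 * f r ^+ 2).
  by move=> cf; apply: cM => //; exact: cX.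
have w01 (r : R) : 0 < r < 1 -> 0 <= r ^+ k.+1 <= 1.
  by move=> /andP[r0 r1]; rewrite exprn_ge0 ?exprn_ile1 ?ltW.
have hp := poly_estimate S0 A1 hq.
have up : II (fun r => r ^+ k.+1 * a r ^+ 2) - 2 * Ma * e <= II (fun r => r ^+ k.+1 * (r ^+ j * A.[r ^+ 2]) ^+ 2).
  rewrite lerBlDr -[X in _ + X](@II_cst R) -II_D//; last exact: cC.
  apply: II_le => //; [exact: cw|apply: cD => //; exact: cC|move=> r r01].
  have [+ _] := hA r r01; have /andP[w0 w1] := w01 r r01.
  have r1 : 0 <= r <= 1 by case/andP: r01 => h1 h2; rewrite (ltW h1) (ltW h2).
  have := hMa r r1.
  move: (r ^+ k.+1) w0 w1 (r ^+ j * A.[r ^+ 2]) (a r) => w w0 w1 al x.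
  rewrite !ler_norml => /andP[x1 x2] /andP[y1 y2].
  have h1 : 0 <= (Ma - x) * (e + (x - al)) by apply: mulr_ge0; lra.
  have h2 : 0 <= (Ma + x) * (e - (x - al)) by apply: mulr_ge0; lra.
  have h3 := sqr_ge0 (x - al).
  have : x ^+ 2 <= al ^+ 2 + 2 * Ma * e by nra.
  by move=> /(ler_wpM2l w0) hh; apply: (le_trans hh); rewrite mulrDr lerD2l ler_piMl ?mulr_ge0// ltW.
have dn : II (fun r => r ^+ k.+1 * (r ^+ j * (radial_op j k E A).[r ^+ 2]) ^+ 2) <=
    II (fun r => r ^+ k.+1 * b r ^+ 2) + (2 * Mb + 1) * e.
  rewrite -[X in _ + X](@II_cst R) -II_D//; [|exact: cw|exact: cC].
  apply: II_le => //; [apply: cD; [exact: cw|exact: cC]|move=> r r01].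
  have [_ +] := hA r r01; have /andP[w0 w1] := w01 r r01.
  have r1 : 0 <= r <= 1 by case/andP: r01 => h1 h2; rewrite (ltW h1) (ltW h2).
  have := hMb r r1.
  move: (r ^+ k.+1) w0 w1 (r ^+ j * _) (b r) => w w0 w1 al x.
  rewrite !ler_norml => /andP[x1 x2] /andP[y1 y2].
  have : al ^+ 2 <= x ^+ 2 + (2 * Mb + 1) * e by nra.
  move=> /(ler_wpM2l w0) hh; apply: (le_trans hh); rewrite mulrDr lerD2l ler_piMl//.
  by apply: mulr_ge0; [apply: addr_ge0 => //; exact: mulr_ge0|exact: ltW].
have := ler_wpM2l (sqr_ge0 q) dn; rewrite -/e; move: hp up; rewrite mulrDr mulrDl.
move: (II _) (q ^+ 2 * II _) (II _) (II _) => x1 x2 x3 x4; move: (q ^+ 2) => Q; nra.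
Qed.

(** Since a(1) = 0, the integrated equation at r = 1 gives a'(1) as the integral of r^(j+k+1) (b - E
    a); Jensen bounds its square, and [low_estimate] the part in a. *)
Lemma low_flux : a' 1 ^+ 2 <= 2 * (1 + E ^+ 2 * q ^+ 2) * II (fun r => r ^+ k.+1 * b r ^+ 2).
Proof.
have ca := rad_ca rad; have cb := rad_cb rad.
have cXn n : continuous (fun r : R => r ^+ n) by exact: exprn_continuous.
have := rad_eq rad (r := 1); rewrite ltr01 lexx !expr1n a1 mulr0 subr0 mul1r => /(_ isT) ->.
rewrite prim1; last exact: rad_flux_continuous rad.
rewrite (_ : (fun s => _) = (fun s => s ^+ k.+1 * (s ^+ j * (b s - E * a s)))); last first.
  by apply/funext => s; rewrite -addnS addnC exprD mulrA.
have cf : continuous (fun s => b s - E * a s) by apply: cB => //; apply: cM => //; exact: cC.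
have cg : continuous (fun s : R => s ^+ j * (b s - E * a s)) by exact: cM.
have w01 n (r : R) : 0 < r < 1 -> 0 <= r ^+ n <= 1.
  by move=> /andP[r0 r1]; rewrite exprn_ge0 ?exprn_ile1 ?ltW.
apply: (le_trans (II_Jensen (cXn k.+1) cg (w01 k.+1))).
have cw (f : R -> R) : continuous f -> continuous (fun r : R => r ^+ k.+1 * f r ^+ 2).
  by move=> cff; apply: cM => //; exact: cX.
apply: (@le_trans _ _ (2 * II (fun r => r ^+ k.+1 * b r ^+ 2) + (2 * E ^+ 2) * II (fun r => r ^+ k.+1 * a r ^+ 2))).
  have c1 := cw _ cb; have c2 := cw _ ca.
  rewrite -(II_Z 2 c1) -(II_Z (2 * E ^+ 2) c2) -II_D; [|by apply: cM => //; exact: cC..].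
  apply: II_le; [exact: cw|by apply: cD; apply: cM => //; exact: cC|move=> r r01].
  have /andP[w0 w1] := w01 k.+1 r r01; have /andP[z0 z1] := w01 j r r01.
  rewrite exprMn; move: (r ^+ k.+1) w0 (r ^+ j) z0 z1 (a r) (b r) => w w0 z z0 z1 x y.
  have z2 : z ^+ 2 <= 1 by rewrite expr_le1.
  have : z ^+ 2 * (y - E * x) ^+ 2 <= 2 * y ^+ 2 + 2 * E ^+ 2 * x ^+ 2.
    apply: (@le_trans _ _ ((y - E * x) ^+ 2)); first by rewrite ler_piMl ?sqr_ge0.
    have := sqr_ge0 (y + E * x); nra.
  by move=> /(ler_wpM2l w0) hh; apply: (le_trans hh); rewrite le_eqVlt; apply/orP; left; apply/eqP; ring.
have E2 : 0 <= 2 * E ^+ 2 by rewrite mulr_ge0 ?sqr_ge0.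
have := ler_wpM2l E2 low_estimate.
by move: (II _) (II _) (E ^+ 2) (q ^+ 2) => x y e2 q2; lra.
Qed.
End LowDegreeEstimate.

(** * Complex coefficients on a spherical harmonic *)

Section ComplexRadial.
Context {R : realType} (k : nat).
Local Notation V := 'rV[R]_k.+2.
Local Notation C := R[i].
Local Notation Re := (@complex.Re R).
Local Notation Im := (@complex.Im R).
Local Notation dl i := (delta_mx 0 i : V).
Implicit Types (c b : R -> C) (r : R).

Definition cradial (j : nat) (E : R) c (c' : R -> C) b : Prop :=
  radial j k E (fun r => Re (c r)) (fun r => Re (c' r)) (fun r => Re (b r)) /\
  radial j k E (fun r => Im (c r)) (fun r => Im (c' r)) (fun r => Im (b r)).

Definition rcc b : Prop := continuous (fun r => Re (b r)) /\ continuous (fun r => Im (b r)).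

Definition nsqI b : R := II (fun r => r ^+ k.+1 * normsq (b r)).

Lemma rcc_normsq b : rcc b -> continuous (fun r => normsq (b r)).
Proof. by move=> [cR cI]; apply: cD; exact: cX. Qed.

Lemma rcc_weight b : rcc b -> continuous (fun r => r ^+ k.+1 * normsq (b r)).
Proof. by move=> cb; apply: cM; [exact: exprn_continuous|exact: rcc_normsq]. Qed.

Lemma nsqIE b : rcc b ->
  nsqI b = II (fun r => r ^+ k.+1 * Re (b r) ^+ 2) + II (fun r => r ^+ k.+1 * Im (b r) ^+ 2).
Proof.
move=> [cR cI]; have cw (f : R -> R) : continuous f -> continuous (fun r : R => r ^+ k.+1 * f r ^+ 2).
  by move=> cf; apply: cM; [exact: exprn_continuous|exact: cX].
rewrite -(II_D (cw _ cR) (cw _ cI)); congr II.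
by apply/funext => r; rewrite -mulrDr.
Qed.

Lemma nsqI_ge0 b : 0 <= nsqI b.
Proof. by apply: II_ge0 => r /andP[r0 _]; rewrite mulr_ge0 ?normsq_ge0 ?exprn_ge0 ?ltW. Qed.

Section theory.
Context (j : nat) (E : R) (c c' b : R -> C) (rad : cradial j E c c' b).

Lemma cradial_cc : rcc c.
Proof. by split; [exact: rad_ca (proj1 rad)|exact: rad_ca (proj2 rad)]. Qed.

Lemma cradial_cb : rcc b.
Proof. by split; [exact: rad_cb (proj1 rad)|exact: rad_cb (proj2 rad)]. Qed.

Section high.
Hypotheses (j0 : (0 < j)%N) (VE : 10 <= 2 * j%:R + k%:R - 1 - E).

Lemma cradial_coercive : c 1 = 0 -> nsqI c <= 1 / 100 * nsqI b.
Proof.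
move=> c1; rewrite !nsqIE ?mulrDr; [|exact: cradial_cb|exact: cradial_cc].
by apply: lerD; [apply: (rad_coercive (proj1 rad))|apply: (rad_coercive (proj2 rad))] => //;
  rewrite c1.
Qed.

Lemma cradial_homogeneous r : (forall s, b s = 0) -> 0 <= r <= 1 ->
  normsq (c r) <= r ^+ (j.-1).*2 * normsq (c 1).
Proof.
move=> b0 r01; rewrite /normsq mulrDr.
by apply: lerD; [apply: (rad_homogeneous (proj1 rad))|apply: (rad_homogeneous (proj2 rad))] => //
  s; rewrite b0.
Qed.

Lemma cradial_flux_decay : c 1 = 0 -> (forall r, 1 / 3 <= r -> b r = 0) ->
  normsq (c' 1) <= (2 / 5) ^+ (2 * j + k - 1) * nsqI b.
Proof.
move=> c1 b0; rewrite nsqIE ?mulrDr; last exact: cradial_cb.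
by apply: lerD; [apply: (rad_flux_decay (proj1 rad))|apply: (rad_flux_decay (proj2 rad))] => //;
  rewrite ?c1// => r /b0 ->.
Qed.
End high.

Section low.
Context (H : V -> R) (q : R).
Hypotheses (sH : solid j H) (S0 : 0 < SI (fun x => H x ^+ 2))
  (hq : (resolvent_norm (fun _ : V => 0%R : C) E <= q%:E)%E).

(* The denominator max(r, 1/8) avoids the division by 0 at the origin. *)
Lemma divide_power (f : R -> R) : continuous f -> (forall r, 0 <= r -> r < 1 / 4 -> f r = 0) ->
  exists2 h : R -> R, continuous h & forall r, 0 <= r <= 1 -> f r = r ^+ j * h r.
Proof.
move=> cf f0; pose m (r : R) : R := (r + 1 / 8 + `|r - 1 / 8|) / 2.
have m0 (r : R) : m r != 0.
  rewrite gt_eqF// /m; have := ler_norm (- (r - 1 / 8)); rewrite normrN; lra.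
have cm : continuous m.
  have c1 : continuous (fun r : R => r) by move=> x.
  have cc (a : R) : continuous (fun _ : R => a) by exact: cC.
  apply: cM => //; apply: cD; first exact: cD.
  by apply: cnorm; exact: cB.
exists (fun r => f r * (m r ^+ j)^-1).
  apply: cM => // r; have cmj : continuous (fun r => m r ^+ j) by exact: cX.
  by apply: cvgV; [rewrite expf_neq0|exact: cmj].
move=> r /andP[r0 r1]; case: (ltrP r (1 / 4)) => h; first by rewrite f0// mul0r mulr0.
have -> : m r = r by rewrite /m ger0_norm; lra.
by rewrite mulrC divfK// expf_neq0// gt_eqF//; lra.
Qed.

Lemma cradial_low : c 1 = 0 -> (forall r, 0 <= r -> r < 1 / 4 -> b r = 0) ->
  nsqI c <= q ^+ 2 * nsqI b /\ normsq (c' 1) <= 2 * (1 + E ^+ 2 * q ^+ 2) * nsqI b.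
Proof.
move=> c1 b0; have [cR cI] := cradial_cb; have [rR rI] := rad.
have [hR chR ehR] : exists2 h : R -> R, continuous h & forall r, 0 <= r <= 1 -> Re (b r) = r ^+ j * h r.
  by apply: divide_power => // r r0 r4; rewrite b0.
have [hI chI ehI] : exists2 h : R -> R, continuous h & forall r, 0 <= r <= 1 -> Im (b r) = r ^+ j * h r.
  by apply: divide_power => // r r0 r4; rewrite b0.
have cR1 : Re (c 1) = 0 by rewrite c1.
have cI1 : Im (c 1) = 0 by rewrite c1.
rewrite !nsqIE; [|exact: cradial_cb|exact: cradial_cc]; rewrite !mulrDr; split; apply: lerD.
- exact: (low_estimate sH rR chR ehR cR1 S0 hq).
- exact: (low_estimate sH rI chI ehI cI1 S0 hq).
- by have := low_flux sH rR chR ehR cR1 S0 hq; rewrite mulrDr mulr1.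
- by have := low_flux sH rI chI ehI cI1 S0 hq; rewrite mulrDr mulr1.
Qed.

(** Subtracting a(1) r^j creates the boundary value 0 at the price of the source - a(1) E r^j, to
    which [low_estimate] applies. *)
Let homogeneous_low_real (a a' f : R -> R) : radial j k E a a' f -> (forall r, f r = 0) ->
  II (fun r => r ^+ k.+1 * a r ^+ 2) <= 2 * (1 + E ^+ 2 * q ^+ 2) * a 1 ^+ 2.
Proof.
move=> ra f0; pose t := a 1; have rl := radial_lin (- t) ra (radial_pow j k E).
have cXn n : continuous (fun r : R => r ^+ n) by exact: exprn_continuous.
have ca := rad_ca ra; have cl := rad_ca rl.
have := low_estimate sH rl (h := fun=> - t * E) (@cC _ _ _) _ _ S0 hq.
rewrite !expr1n mulr1 subrr => /(_ _ erefl) le.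
have {}le := le (fun r _ => _).
have {le} h1 : II (fun r => r ^+ k.+1 * (a r + - t * r ^+ j) ^+ 2) <= q ^+ 2 * (E ^+ 2 * t ^+ 2).
  have e r : f r + - t * (E * r ^+ j) = r ^+ j * (- t * E) by rewrite f0; ring.
  apply: (le_trans (le e)).
  apply: ler_wpM2l; first exact: sqr_ge0.
  rewrite -[leRHS](@II_cst R); apply: II_le; [|exact: cC|].
    by apply: cM => //; apply: cX; exact: (rad_cb rl).
  move=> r /andP[r0 r1]; rewrite e.
  have : r ^+ k.+1 * (r ^+ j) ^+ 2 <= 1 by rewrite -exprM -exprD exprn_ile1 ?ltW.
  have -> : r ^+ k.+1 * (r ^+ j * (- t * E)) ^+ 2 = (r ^+ k.+1 * (r ^+ j) ^+ 2) * (E ^+ 2 * t ^+ 2).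
    by move: (r ^+ k.+1) (r ^+ j) => u w; ring.
  move: (r ^+ k.+1 * _) => z z1.
  by rewrite ler_piMl// mulr_ge0 ?sqr_ge0.
have c1 : continuous (fun r => 2 * (r ^+ k.+1 * (a r + - t * r ^+ j) ^+ 2)).
  by apply: cM; [exact: cC|apply: cM => //; exact: cX].
apply: (@le_trans _ _ (II (fun r => 2 * (r ^+ k.+1 * (a r + - t * r ^+ j) ^+ 2) + 2 * t ^+ 2))).
  apply: II_le; [by apply: cM => //; exact: cX|apply: cD => //; exact: cC|].
  move=> r /andP[r0 r1].
  have w0 : 0 <= r ^+ k.+1 by rewrite exprn_ge0 ?ltW.
  have : r ^+ k.+1 * (r ^+ j) ^+ 2 <= 1 by rewrite -exprM -exprD exprn_ile1 ?ltW.
  move: (r ^+ k.+1) w0 (r ^+ j) (a r) => w w0 z x h.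
  have h2 : t ^+ 2 * (w * z ^+ 2) <= t ^+ 2 by rewrite ler_piMr ?sqr_ge0.
  have h3 : 0 <= w * (x - 2 * t * z) ^+ 2 by rewrite mulr_ge0 ?sqr_ge0.
  nra.
rewrite (II_D c1 (@cC _ _ _)) II_cst II_Z; last by apply: cM => //; exact: cX.
move: h1; rewrite -/t; move: (II _) (E ^+ 2) (q ^+ 2) (t ^+ 2) => X e2 q2 t2; nra.
Qed.

Lemma cradial_low_homogeneous : (forall r, b r = 0) ->
  nsqI c <= 2 * (1 + E ^+ 2 * q ^+ 2) * normsq (c 1).
Proof.
move=> b0; rewrite nsqIE; last exact: cradial_cc.
rewrite /normsq mulrDr; apply: lerD.
  by apply: (homogeneous_low_real (proj1 rad)) => r; rewrite b0.
by apply: (homogeneous_low_real (proj2 rad)) => r; rewrite b0.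
Qed.
End low.
End theory.

Lemma cradial_sub j E c1 (c1' b1 : R -> C) c2 (c2' b2 : R -> C) :
  cradial j E c1 c1' b1 -> cradial j E c2 c2' b2 -> (forall r, b2 r = 0) ->
  cradial j E (fun r => c1 r - c2 r) (fun r => c1' r - c2' r) b1.
Proof.
move=> [h1 h2] [h3 h4] b0.
have e (f g : R -> R) : (fun r => f r + (- 1) * g r) = (fun r => f r - g r).
  by apply/funext => r; rewrite mulN1r.
have z (p : C -> R) (f : R -> R) : p 0 = 0 -> (fun r => f r + (- 1) * p (b2 r)) = f.
  by move=> p0; apply/funext => r; rewrite b0 p0 mulr0 addr0.
have {h1 h3} := radial_lin (- 1) h1 h3; rewrite (z Re)// !e => h1.
have {h2 h4} := radial_lin (- 1) h2 h4; rewrite (z Im)// !e => h2.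
have eR (u v : R -> C) : (fun r => Re (u r - v r)) = (fun r => Re (u r) - Re (v r)).
  by apply/funext => r; rewrite !cxE.
have eI (u v : R -> C) : (fun r => Im (u r - v r)) = (fun r => Im (u r) - Im (v r)).
  by apply/funext => r; rewrite !cxE.
by split; rewrite ?eR ?eI.
Qed.

Section coefficients.
Context (j : nat) (p : mpoly k.+2 C) (hp : harm j p).

Definition coef (f : V -> C) r : C := cip (fun x => f (r *: x)) (ev p).

Definition coef' (f : V -> C) r : C :=
  cip (fun x => \sum_i (x 0 i)%:C%C * partial i f (r *: x)) (ev p).

Let Hr (x : V) := Re (ev p x).
Let Hi (x : V) := Im (ev p x).

Let cscale (f : V -> C) r : cc f -> cc (fun x => f (r *: x)).
Proof. by move=> cf; apply: (cc_comp (h := fun x => r *: x) _ cf); exact: continuous_scale_rV. Qed.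

Let coef_split (g : V -> C) : cc g ->
  Re (cip g (ev p)) = SI (fun x => Re (g x) * Hr x) + 1 * SI (fun x => Im (g x) * Hi x) /\
  Im (cip g (ev p)) = SI (fun x => Im (g x) * Hr x) + (- 1) * SI (fun x => Re (g x) * Hi x).
Proof.
move=> [cR cI]; have [eR eI] := @cc_ev R k p.
have m (f h : V -> R) : continuous f -> continuous h -> continuous (fun x => f x * h x) by exact: cM.
have d0 : (0 < k.+2)%N by [].
rewrite /cip /cS /= mul1r mulN1r; split.
  rewrite -SID//; [|exact: m|exact: m]; congr SI; apply/funext => x; rewrite !cxE /Hr /Hi; ring.
rewrite -[- SI _]mulN1r -SIZ//; last exact: m.
rewrite -SID//; [|exact: m|by apply: cM; [exact: cC|exact: m]].
by congr SI; apply/funext => x; rewrite !cxE /Hr /Hi; ring.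
Qed.

Lemma rcc_coef (f : V -> C) : cc f -> rcc (coef f).
Proof.
move=> cf; have [cR cI] := cf; have [sr si] := harm_solid hp.
have eR : (fun r => Re (coef f r)) =
    (fun r => sph_coef Hr (fun x => Re (f x)) r + 1 * sph_coef Hi (fun x => Im (f x)) r).
  by apply/funext => r; have [-> _] := coef_split (cscale r cf).
have eI : (fun r => Im (coef f r)) =
    (fun r => sph_coef Hr (fun x => Im (f x)) r + (- 1) * sph_coef Hi (fun x => Re (f x)) r).
  by apply/funext => r; have [_ ->] := coef_split (cscale r cf).
by split; rewrite ?eR ?eI; apply: cD; [|apply: cM; [exact: cC|]| |apply: cM; [exact: cC|]];
  first [exact: (sph_coef_continuous sr cR)|exact: (sph_coef_continuous si cI)
        |exact: (sph_coef_continuous sr cI)|exact: (sph_coef_continuous si cR)].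
Qed.

(* The real part of a coefficient on a complex harmonic pairs the real and
   imaginary parts of psi with those of the harmonic, so it is a sum of two real
   radial solutions. *)
Lemma coef_radial (v psi : V -> C) (E : R) : Ck 1 psi -> cc (fun x => v x * psi x) ->
  schrodinger_eq v E psi (fun=> 0) ->
  cradial j E (coef psi) (coef' psi) (coef (fun x => v x * psi x)).
Proof.
move=> cpsi [cFR cFI] eqn; have [wR wI] := weak_eq_of cpsi cFR cFI eqn.
have [cR cI] := cpsi; have [sr si] := harm_solid hp.
have ccpsi : cc psi by split; [exact: CkR_continuous cR|exact: CkR_continuous cI].
have ccd i : cc (partial i psi).
  by split; [exact: CkR_continuous (CkR_D i cR)|exact: CkR_continuous (CkR_D i cI)].
have ccd' r : cc (fun x => \sum_i (x 0 i)%:C%C * partial i psi (r *: x)).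
  apply: cc_sum => i; apply: ccM; last exact: (cscale r (ccd i)).
  by split => /=; [exact: continuous_coord|exact: cC].
have RR := radial_of_weak cR cFR wR sr; have RI := radial_of_weak cI cFI wI si.
have IR := radial_of_weak cI cFI wI sr; have II' := radial_of_weak cR cFR wR si.
have hR := radial_lin 1 RR RI; have hI := radial_lin (- 1) IR II'.
have sR r (x : V) : Re (\sum_i (x 0 i)%:C%C * partial i psi (r *: x)) =
    \sum_i x 0 i * 'D_(dl i) (fun y => Re (psi y)) (r *: x).
  by rewrite Re_sum; apply: eq_bigr => i _; rewrite !cxE /= mul0r subr0.
have sI r (x : V) : Im (\sum_i (x 0 i)%:C%C * partial i psi (r *: x)) =
    \sum_i x 0 i * 'D_(dl i) (fun y => Im (psi y)) (r *: x).
  by rewrite Im_sum; apply: eq_bigr => i _; rewrite !cxE /= mul0r addr0.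
have fe (f g : R -> R) : (forall r, f r = g r) -> f = g by move=> ?; exact/funext.
split.
  move: hR; congr radial; apply: fe => r.
  - by have [-> _] := coef_split (cscale r ccpsi).
  - have [-> _] := coef_split (ccd' r); rewrite /sph_coef_deriv; congr (_ + _ * _); congr SI;
      by apply/funext => x; rewrite ?sR ?sI.
  - by have [-> _] := coef_split (cscale r (conj cFR cFI : cc (fun x => v x * psi x))).
move: hI; congr radial; apply: fe => r.
- by have [_ ->] := coef_split (cscale r ccpsi).
- have [_ ->] := coef_split (ccd' r); rewrite /sph_coef_deriv; congr (_ + _ * _); congr SI;
    by apply/funext => x; rewrite ?sR ?sI.
- by have [_ ->] := coef_split (cscale r (conj cFR cFI : cc (fun x => v x * psi x))).
Qed.
End coefficients.
End ComplexRadial.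

(** * Splitting into frequencies modulo N *)

Section Averaging.
Context {R : realType} (k : nat).
Local Notation V := 'rV[R]_k.+2.
Local Notation C := R[i].
Local Notation Re := (@complex.Re R).
Local Notation Im := (@complex.Im R).
Local Notation mu := (@lebesgue_measure R).

Lemma II_cvg_le (f : nat -> R -> R) (g : R -> R) (B : R) :
  (forall J, continuous (f J)) -> continuous g ->
  (forall J r, 0 < r < 1 -> 0 <= f J r <= g r) ->
  (forall r, 0 < r < 1 -> f J r @[J --> \oo] --> g r) ->
  (forall J, II (f J) <= B) -> II g <= B.
Proof.
move=> cf cg fg fgl fB; pose D : set R := `]0, 1[%classic.
have mD : measurable D by exact: measurable_itv.
have m (h : R -> R) : continuous h -> measurable_fun D (EFin \o h).
  by move=> ch; apply/measurable_EFinP/measurable_funTS; exact: continuous_measurable_fun.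
have e (h : R -> R) : continuous h -> (\int[mu]_(x in D) (EFin \o h) x)%E = (II h)%:E.
  move=> ch; rewrite /II /Rintegral fineK//; apply: integrable_fin_num => //.
  exact: integrable_II.
have h1 : {ae mu, forall x, D x -> (EFin \o f J) x @[J --> \oo] --> (EFin \o g) x}.
  apply: aeW => x; rewrite /D /= in_itv/= => x1; apply: cvg_EFin; first exact: nearW.
  exact: fgl.
have h2 : {ae mu, forall x J, D x -> (`|(EFin \o f J) x| <= (EFin \o g) x)%E}.
  apply: aeW => x J; rewrite /D /= in_itv/= => /(fg J) /andP[f0 f1].
  by rewrite lee_fin ger0_norm.
have [_ _] := @dominated_convergence _ _ R mu D mD (fun J => EFin \o f J) (EFin \o g) (EFin \o g)
  (fun J => m _ (cf J)) (m _ cg) h1 (integrable_II cg) h2.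
rewrite e// (_ : (fun J => _) = (fun J => (II (f J))%:E)); last by apply/funext => J; rewrite /= e.
move=> /fine_cvgP[_ c]; rewrite -(cvg_lim _ c)//; apply: limr_le; first by apply/cvg_ex; exists (II g).
exact: nearW.
Qed.

(** The origin occurs because [sphere_proj] maps it to itself. *)
Lemma SI_le01 (f g : V -> R) : continuous f -> continuous g ->
  (forall x, x = 0 \/ enorm x = 1 -> f x <= g x) -> SI f <= SI g.
Proof.
move=> cf cg fg; apply: ler_wpM2l => //.
apply: BI_le => [||x x1]; [exact: bm_sphere_proj|exact: bm_sphere_proj|apply: fg].
have [->|x0] := eqVneq x 0; first by left; rewrite /sphere_proj scaler0.
by right; exact: enorm_sphere_proj.
Qed.

Lemma cc_scale (f : V -> C) (r : R) : cc f -> cc (fun x => f (r *: x)).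
Proof. by move=> cf; apply: (cc_comp (h := fun x => r *: x) _ cf); exact: continuous_scale_rV. Qed.

Lemma Sq_continuous (f : V -> C) : cc f -> continuous (fun r : R => Sq (fun x => f (r *: x))).
Proof. by move=> cf; exact: (SI_continuous (cc_normsq cf)). Qed.

Lemma harm_av (c s : R) N (w : C) j p : c ^+ 2 + s ^+ 2 = 1 -> harm j p ->
  exists2 p', harm j p' & forall x : V, ev p' x = av c s N w (ev p) x.
Proof.
move=> cs hp.
have rr : (rotM k c s)^T *m rotM k c s = 1%:M.
  have h (x : V) : x *m ((rotM k c s)^T *m rotM k c s) = x.
    rewrite -rotM_tr mulmxA -!rotE.
    by have := @rotK R k c (- s); rewrite sqrrN opprK => /(_ cs x).
  by rewrite -[LHS]mul1mx -[RHS]mulmx1; apply/row_matrixP => i; rewrite !row_mul h mulmx1.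
have it a : exists2 q, harm j q & forall x : V, ev q x = ev p (iter a (rot c s) x).
  elim: a => [|a [q hq eq]]; first by exists p.
  exists (comp_mpoly (lin_tuple (rotM k c s)) q); first exact: harm_comp.
  by move=> x; rewrite ev_comp// eq -rotE iterSr.
have /choice[Q hQ] : forall a, exists q, harm j q /\ forall x : V, ev q x = ev p (iter a (rot c s) x).
  by move=> a; have [q] := it a; exists q.
exists (N%:R^-1 *: \sum_(0 <= a < N) w ^+ a *: Q a).
  by apply: harmZ; apply: harm_sum => a; apply: harmZ; exact: (proj1 (hQ a)).
move=> x; rewrite evZ ev_sum /av; congr (_ * _); apply: eq_bigr => a _.
by rewrite evZ (proj2 (hQ a)).
Qed.

Context (om : C) (N : nat).
Hypotheses (om1 : normsq om = 1) (c1 : 1 + Re om != 0) (po : N.-primitive_root om) (N0 : (0 < N)%N).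

(** With this sign, [freq K] extracts the part on which the rotation acts by om^(-K); multiplication
    by e^(i n theta) therefore carries the part K + n to the part K. *)
Definition freq (K : nat) (f : V -> C) : V -> C := av (Re om) (Im om) N (om ^+ K) f.

Let cis : Re om ^+ 2 + Im om ^+ 2 = 1. Proof. exact: om1. Qed.

Let omK K : normsq (om ^+ K) = 1.
Proof. by elim: K => [|K IH]; rewrite ?exprS ?normsqM ?om1 ?IH ?mulr1// /normsq /= expr1n expr0n addr0. Qed.

Lemma cc_freq K f : cc f -> cc (freq K f).
Proof. by move=> cf; exact: cc_av. Qed.

Lemma Sq_freq_le K f : cc f -> Sq (freq K f) <= Sq f.
Proof. by move=> cf; exact: Sq_av_le. Qed.

Lemma freq_scale K f r : (fun x => freq K f (r *: x)) = freq K (fun x => f (r *: x)).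
Proof. by apply/funext => x; rewrite /freq av_scale. Qed.

Lemma freqDN K f : freq (N + K) f = freq K f.
Proof. by rewrite /freq exprD (prim_expr_order po) mul1r. Qed.

Lemma freq_sum f x : f x = \sum_(0 <= K < N) freq K f x.
Proof. exact: (@av_spectral R k (Re om) (Im om) N om f x N0 po). Qed.

(* Moving the average to the harmonic reduces every estimate for a frequency
   of psi to one for psi itself, against another harmonic of the same degree. *)
Lemma freq_adjoint K j p : harm j p -> exists2 p', harm j p' &
  forall f : V -> C, cc f -> cip (freq K f) (ev p) = cip f (ev p').
Proof.
move=> hp; have cs : (Re om) ^+ 2 + (- Im om) ^+ 2 = 1 by rewrite sqrrN.
have [p' hp' ep'] := harm_av N ((om ^+ K)^*) cs hp.
exists p'; first exact: hp'.
move=> f cf; rewrite /freq (cip_av cis c1 N (om ^+ K) cf (cc_ev p)).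
by congr cip; apply/funext => x; rewrite ep'.
Qed.

(** A harmonic of degree j only has frequencies within j of 0 modulo N. The average is moved to the
    harmonic, where it becomes one for the conjugate root. *)
Lemma freq_low K j p f : harm j p -> cc f -> (j < K)%N -> (K + j < N)%N -> cip (freq K f) (ev p) = 0.
Proof.
move=> hp cf jK KN; have om0 : om != 0.
  by apply/negP => /eqP o0; move: om1; rewrite o0 /normsq /= expr0n/= addr0 => /eqP; rewrite eq_sym oner_eq0.
have omJ : om^* = om^-1.
  apply: (mulfI om0); rewrite mulfV// mulJ om1.
  by apply: complexP.
have po' : N.-primitive_root (om^*).
  rewrite omJ; have -> : om^-1 = om ^+ N.-1.
    by apply: (mulfI om0); rewrite mulfV// -exprS prednK// (prim_expr_order po).
  by rewrite prim_root_exp_coprime// coprimePn.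
have om1' : normsq (om^*) = 1 by rewrite /normsq !cxE sqrrN.
have wp : wt (om^*) j (ev p) by apply: wt_ev => //; case: hp.
rewrite /freq (cip_av cis c1 N (om ^+ K) cf (cc_ev p)).
have z := av_wt0 om1' po' wp jK KN.
rewrite (_ : av _ _ _ _ _ = (fun=> 0)); last first.
  by apply/funext => x; rewrite -(z x) ReJ ImJ rmorphXn.
rewrite /cip (_ : (fun x => _) = (fun x => 0 * f x)); last by apply/funext => x; rewrite conjC0 mulr0 mul0r.
by rewrite cSZ// mul0r.
Qed.

Lemma freqM n (v f : V -> C) K : (forall x, v (rot (Re om) (Im om) x) = om ^+ n * v x) ->
  freq K (fun x => v x * f x) = fun x => v x * freq (K + n) f x.
Proof. by move=> hv; rewrite /freq (avM N (om ^+ K) f hv) exprD. Qed.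

Section level.
Context (p : nat) (e : 'I_p -> mpoly k.+2 C) (j : nat) (he : forall i, harm j (e i)).
Hypotheses (oe : forall i l, cip (ev (e i)) (ev (e l)) = (i == l)%:R)
  (span : forall q, harm j q -> exists c : 'I_p -> C, forall x : V, enorm x = 1 ->
     ev q x = \sum_i c i * ev (e i) x).

(** The adjoint of [freq K] preserves the degree, so f may be replaced by its projection on the
    level; there Bessel's inequality and [Sq_freq_le] apply. *)
Lemma freq_contract K f : cc f ->
  \sum_i normsq (cip (freq K f) (ev (e i))) <= \sum_i normsq (cip f (ev (e i))).
Proof.
move=> cf; have ce i : cc (ev (e i)) := cc_ev (e i).
pose r := index_enum ('I_p).
have ur : uniq r := index_enum_uniq _.
have oe' : forall i l, i \in r -> l \in r -> cip (ev (e i)) (ev (e l)) = (i == l)%:R by move=> i l _ _.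
pose F := proj_on r (fun i => ev (e i)) f.
have cF : cc F by exact: (cc_proj_on r ce).
have eq i : cip (freq K f) (ev (e i)) = cip (freq K F) (ev (e i)).
  have [q hq adj] := freq_adjoint K (he i); rewrite !adj//.
  have [c ec] := span hq.
  have cs : cc (fun x => \sum_(i <- r) c i * ev (e i) x) by apply: cc_sum => l; exact: ccZ.
  rewrite (cip_eq cf cf (cc_ev q) cs (fun _ _ => erefl) ec) (cip_eq cF cF (cc_ev q) cs (fun _ _ => erefl) ec).
  rewrite !cip_sumr//; apply: eq_bigr => l _; congr (_ * _).
  by rewrite (cip_proj_on ur ce oe')// mem_index_enum.
rewrite (eq_bigr _ (fun i _ => congr1 _ (eq i))).
apply: (le_trans (bessel ur ce oe' (cc_freq K cF))).
apply: (le_trans (Sq_freq_le K cF)).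
by rewrite (Sq_proj_on ur ce oe').
Qed.
End level.
End Averaging.

(** * The frequency window *)

Section Sums.
Context {R : realType} (k : nat).
Local Notation V := 'rV[R]_k.+2.
Local Notation C := R[i].
Context (p : nat -> nat).
Implicit Types F G : forall j, 'I_(p j) -> R.

Definition DS J F : R := \sum_(0 <= j < J) \sum_(i < p j) F j i.

Lemma DS_le J F G : (forall j i, F j i <= G j i) -> DS J F <= DS J G.
Proof. by move=> FG; apply: ler_sum => j _; apply: ler_sum => i _. Qed.

Lemma DS_lin J (a b : R) F G :
  DS J (fun j i => a * F j i + b * G j i) = a * DS J F + b * DS J G.
Proof.
rewrite /DS !mulr_sumr -big_split; apply: eq_bigr => j _ /=.
by rewrite !mulr_sumr -big_split.
Qed.

Lemma DS_Z J (a : R) F : DS J (fun j i => a * F j i) = a * DS J F.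
Proof. by rewrite /DS mulr_sumr; apply: eq_bigr => j _; rewrite mulr_sumr. Qed.

Lemma DS_ge0 J F : (forall j i, 0 <= F j i) -> 0 <= DS J F.
Proof. by move=> F0; apply: sumr_ge0 => j _; apply: sumr_ge0 => i _. Qed.

Lemma II_sum (I : Type) (r : seq I) (F : I -> R -> R) : (forall i, continuous (F i)) ->
  II (fun x => \sum_(i <- r) F i x) = \sum_(i <- r) II (F i).
Proof.
move=> cF; elim: r => [|i r IH].
  by rewrite big_nil (_ : (fun x => _) = fun=> 0) ?II_cst//; apply/funext => x; rewrite big_nil.
rewrite big_cons -IH -II_D//; last by apply: continuous_sumr => l _.
by congr II; apply/funext => x; rewrite big_cons.
Qed.

Lemma continuous_DS J (F : forall j, 'I_(p j) -> R -> R) : (forall j i, continuous (F j i)) ->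
  continuous (fun x => DS J (fun j i => F j i x)).
Proof. by move=> cF; apply: continuous_sumr => j _; apply: continuous_sumr => i _; exact: cF. Qed.

Lemma II_DS J (F : forall j, 'I_(p j) -> R -> R) : (forall j i, continuous (F j i)) ->
  II (fun x => DS J (fun j i => F j i x)) = DS J (fun j i => II (F j i)).
Proof.
move=> cF; rewrite /DS II_sum => [|j]; last by apply: continuous_sumr => i _; exact: cF.
by apply: eq_bigr => j _; rewrite II_sum.
Qed.

Lemma Sq_sum_le N (f : nat -> V -> C) : (forall a, cc (f a)) ->
  Sq (fun x => \sum_(0 <= a < N) f a x) <= N%:R * \sum_(0 <= a < N) Sq (f a).
Proof.
move=> cf; have d0 : (0 < k.+2)%N by [].
have cn a : continuous (fun x => normsq (f a x)) by exact: cc_normsq.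
have e m : \sum_(0 <= a < m) Sq (f a) = SI (fun x => \sum_(0 <= a < m) normsq (f a x)).
  elim: m => [|m IH].
    rewrite big_geq// (_ : (fun x => _) = (fun x => 0 * normsq (f 0%N x))); first by rewrite SIZ// mul0r.
    by apply/funext => x; rewrite big_geq// mul0r.
  rewrite big_nat_recr//= IH -SID//; last by apply: continuous_sumr => a _.
  by congr SI; apply/funext => x; rewrite big_nat_recr.
have cs : continuous (fun x => \sum_(0 <= a < N) normsq (f a x)) by apply: continuous_sumr => a _.
rewrite e -SIZ//; apply: SI_le01; [|by apply: cM => //; exact: cC|].
  by apply: cc_normsq; exact: cc_sum.
by move=> x _; exact: normsq_sum_le.
Qed.
End Sums.

(** * Comparison of the perturbed and the free solution with equal boundary values *)

Section Comparison.
Context {R : realType} (k : nat).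
Local Notation V := 'rV[R]_k.+2.
Local Notation C := R[i].
Local Notation Re := (@complex.Re R).
Local Notation Im := (@complex.Im R).
Context (p : nat -> nat) (e : forall j, 'I_(p j) -> mpoly k.+2 C).
Hypotheses (he : forall j i, harm j (@e j i))
  (oe : forall j i l, cip (ev (@e j i)) (ev (@e j l)) = (i == l)%:R)
  (span : forall j q, harm j q -> exists c : 'I_(p j) -> C, forall x : V, enorm x = 1 ->
     ev q x = \sum_i c i * ev (@e j i) x).
Hypotheses
  (parseval_DS : forall f : V -> C, cc f ->
    DS J (fun j i => normsq (cip f (ev (@e j i)))) @[J --> \oo] --> Sq f)
  (bessel_DS : forall (f : V -> C) J, cc f -> DS J (fun j i => normsq (cip f (ev (@e j i)))) <= Sq f).
Context (E q : R) (v psi1 psi2 : V -> C) (w : R -> R) (n M : nat).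
Hypotheses (hq : (resolvent_norm (fun _ : V => 0%R : C) E <= q%:E)%E)
  (cp1 : Ck 1 psi1) (cp2 : Ck 1 psi2) (cv : forall f : V -> C, cc f -> cc (fun x => v x * f x))
  (eq1 : schrodinger_eq v E psi1 (fun=> 0)) (eq2 : schrodinger_eq (fun=> 0) E psi2 (fun=> 0))
  (bd : forall x, enorm x = 1 -> psi1 x = psi2 x)
  (vw : forall x, normsq (v x) <= w (enorm x))
  (v_in : forall x, enorm x < 1 / 4 -> v x = 0) (v_out : forall x, 1 / 3 <= enorm x -> v x = 0)
  (cw : continuous w) (w01 : forall r, 0 <= w r <= 1) (w_out : forall r, 1 / 2 <= r -> w r = 0)
  (M0 : (0 < M)%N) (nM : (M.*2 <= n)%N)
  (VE : forall j, (M <= j)%N -> 10 <= 2 * j%:R + k%:R - 1 - E)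
  (rotv : forall om : C, normsq om = 1 -> forall x, v (rot (Re om) (Im om) x) = om ^+ n * v x).

Local Notation ec j i := (ev (@e j i)).
Let F x : C := v x * psi1 x.
Let f j i : R := normsq (cip psi2 (ec j i)).

Definition wI (b : R -> C) : R := II (fun r => w r * (r ^+ k.+1 * normsq (b r))).
Definition X (h : V -> C) : R := II (fun r => w r * (r ^+ k.+1 * Sq (fun x => h (r *: x)))).
Definition flux_coef j i : C := coef' (@e j i) psi1 1 - coef' (@e j i) psi2 1.

Let cc1 : cc psi1. Proof. by split; [exact: CkR_continuous (proj1 cp1)|exact: CkR_continuous (proj2 cp1)]. Qed.
Let cc2 : cc psi2. Proof. by split; [exact: CkR_continuous (proj1 cp2)|exact: CkR_continuous (proj2 cp2)]. Qed.
Let cF : cc F. Proof. exact: cv. Qed.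
Let cXn m : continuous (fun r : R => r ^+ m). Proof. exact: exprn_continuous. Qed.

Let cip1 (h g : V -> C) : cip (fun x => h (1 *: x)) g = cip h g.
Proof. by congr cip; apply/funext => x; rewrite scale1r. Qed.

Section pair.
Context (j : nat) (pl : mpoly k.+2 C) (hp : harm j pl).
Let c1 := coef pl psi1.
Let c2 := coef pl psi2.
Let b := coef pl F.

Let coef0 (h : V -> C) r : (forall x, enorm x = 1 -> h (r *: x) = 0) -> cc h -> coef pl h r = 0.
Proof.
move=> h0 ch; have z : cc (fun _ : V => 0 : C) by exact: ccC.
rewrite /coef (cip_eq (cc_scale r ch) z (cc_ev pl) (cc_ev pl) h0 (fun _ _ => erefl)).
rewrite /cip (_ : (fun x => _) = (fun x => 0 * h x)); last by apply/funext => x; rewrite !mul0r.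
by rewrite cSZ// mul0r.
Qed.

Let rad2 : cradial k j E c2 (coef' pl psi2) (coef pl (fun x => 0 * psi2 x)).
Proof. by apply: (coef_radial hp cp2 _ eq2); apply: ccM => //; exact: ccC. Qed.

Let b2 r : coef pl (fun x => 0 * psi2 x) r = 0.
Proof. by apply: coef0 => [x _|]; [rewrite mul0r|apply: ccM => //; exact: ccC]. Qed.

Let rad : cradial k j E (fun r => c1 r - c2 r) (fun r => coef' pl psi1 r - coef' pl psi2 r) b.
Proof. exact: (cradial_sub (coef_radial hp cp1 cF eq1) rad2 b2). Qed.

Let c12 : c1 1 - c2 1 = 0.
Proof.
by rewrite /c1 /c2 /coef !cip1 (cip_eq cc1 cc2 (cc_ev pl) (cc_ev pl) bd (fun _ _ => erefl)) subrr.
Qed.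

Let b_in r : 0 <= r -> r < 1 / 4 -> b r = 0.
Proof.
move=> r0 r4; apply: coef0 => // x x1; rewrite /F v_in ?mul0r//.
by rewrite enormZ x1 mulr1 ger0_norm.
Qed.

Let b_out r : 1 / 3 <= r -> b r = 0.
Proof.
move=> r3; apply: coef0 => // x x1; rewrite /F v_out ?mul0r//.
by rewrite enormZ x1 mulr1 ger0_norm//; lra.
Qed.

Let cd : rcc (fun r => c1 r - c2 r) := cradial_cc rad.
Let rc1 : rcc c1 := rcc_coef hp cc1.
Let rc2 : rcc c2 := rcc_coef hp cc2.

Let split_le r : normsq (c1 r) <= 2 * normsq (c2 r) + 2 * normsq (c1 r - c2 r).
Proof. by have := normsqD_le (c2 r) (c1 r - c2 r); rewrite addrC subrK. Qed.

Lemma pair_high_flux : (M <= j)%N ->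
  normsq (coef' pl psi1 1 - coef' pl psi2 1) <= (2 / 5) ^+ (2 * j + k - 1) * nsqI k b.
Proof.
by move=> Mj; exact: (cradial_flux_decay rad (leq_trans M0 Mj) (VE Mj) c12 b_out).
Qed.

(** c1 is the free coefficient c2 plus the correction c1 - c2. Where w is nonzero, r < 1/2 turns the
    decay r^(2 j - 2) of the free part into (1/4)^(j-1), and coercivity gives 2 / 100 for the
    correction. The harmonic [pl] is arbitrary because [freq_adjoint] leads out of the chosen
    basis. *)
Lemma pair_high : (M <= j)%N ->
  wI c1 <= 2 * ((1 / 4) ^+ j.-1 * normsq (cip psi2 (ev pl))) + 1 / 50 * nsqI k b.
Proof.
move=> Mj; have j0 := leq_trans M0 Mj; set B := _ * normsq (cip psi2 _).
have cd' := @rcc_weight R k _ cd.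
have h := cradial_coercive rad j0 (VE Mj) c12.
have c2' : continuous (fun r : R => 2 * (r ^+ k.+1 * normsq (c1 r - c2 r))) by apply: cM => //; exact: cC.
apply: (@le_trans _ _ (II (fun r => 2 * B + 2 * (r ^+ k.+1 * normsq (c1 r - c2 r))))).
  apply: II_le; [by apply: cM => //; exact: rcc_weight|by apply: cD => //; exact: cC|].
  move=> r /andP[r0 r1]; have /andP[w0 w1] := w01 r.
  have z0 : 0 <= r ^+ k.+1 by rewrite exprn_ge0 ?ltW.
  have z1 : r ^+ k.+1 <= 1 by rewrite exprn_ile1 ?ltW.
  have B0 : 0 <= B by rewrite mulr_ge0 ?normsq_ge0 ?exprn_ge0.
  have d0 := normsq_ge0 (c1 r - c2 r); have e0 := normsq_ge0 (c2 r).
  have rhs0 : 0 <= r ^+ k.+1 * normsq (c1 r - c2 r) by exact: mulr_ge0.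
  case: (lerP (1 / 2) r) => r2; first by rewrite w_out// mul0r; lra.
  have hB : normsq (c2 r) <= B.
    have r01 : 0 <= r <= 1 by rewrite !ltW.
    have := cradial_homogeneous rad2 j0 (VE Mj) b2 r01.
    rewrite {2}/c2 /coef cip1 => hh; apply: (le_trans hh); apply: ler_wpM2r; first exact: normsq_ge0.
    rewrite -mul2n exprM; apply: lerXn2r; rewrite ?nnegrE ?sqr_ge0 ?divr_ge0//.
    have -> : (1 / 4 : R) = (1 / 2) ^+ 2 by field.
    by apply: lerXn2r; rewrite ?nnegrE ?divr_ge0 ?(ltW r0) ?(ltW r2).
  have s := split_le r.
  have t1 : r ^+ k.+1 * normsq (c1 r) <=
      2 * (r ^+ k.+1 * normsq (c2 r)) + 2 * (r ^+ k.+1 * normsq (c1 r - c2 r)).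
    apply: (le_trans (ler_wpM2l z0 s)).
    by rewrite le_eqVlt; apply/orP; left; apply/eqP; ring.
  have t2 : r ^+ k.+1 * normsq (c2 r) <= B by apply: le_trans hB; rewrite ler_piMl.
  have t3 : w r * (r ^+ k.+1 * normsq (c1 r)) <= r ^+ k.+1 * normsq (c1 r).
    by rewrite ler_piMl// mulr_ge0// normsq_ge0.
  move: t1 t2 t3.
  move: (w r * (r ^+ k.+1 * normsq (c1 r))) (r ^+ k.+1 * normsq (c1 r)) (r ^+ k.+1 * normsq (c2 r))
    (r ^+ k.+1 * normsq (c1 r - c2 r)) => x1 x2 x3 x4; lra.
rewrite (II_D (@cC _ _ _) c2') II_cst II_Z//.
by move: h; rewrite /nsqI; move: (II _) (II _) => x y; lra.
Qed.

(** The resolvent bound needs a real solid harmonic that is nonzero on the sphere: the real or the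
    imaginary part of [pl] serves, only its degree matters. *)
Lemma pair_low : 0 < Sq (ev pl) ->
  wI c1 <= 4 * (1 + E ^+ 2 * q ^+ 2) * normsq (cip psi2 (ev pl)) + 2 * q ^+ 2 * nsqI k b /\
  normsq (coef' pl psi1 1 - coef' pl psi2 1) <= 2 * (1 + E ^+ 2 * q ^+ 2) * nsqI k b.
Proof.
move=> S0; have [sr si] := harm_solid hp; have [cr ci] := @cc_ev R k pl.
have [H sH SH] : exists2 H : V -> R, solid j H & 0 < SI (fun x => H x ^+ 2).
  have e0 : Sq (ev pl) = SI (fun x => Re (ev pl x) ^+ 2) + SI (fun x => Im (ev pl x) ^+ 2).
    by rewrite -SID//; apply: cX.
  case: (ltrP 0 (SI (fun x => Re (ev pl x) ^+ 2))) => h; first by exists (fun x => Re (ev pl x)).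
  exists (fun x => Im (ev pl x)) => //.
  by apply: (lt_le_trans S0); rewrite e0 gerDr.
have [L1 L3] := cradial_low rad sH SH hq c12 b_in.
have L2 := cradial_low_homogeneous rad2 sH SH hq b2.
rewrite {2}/c2 /coef cip1 in L2.
split=> //; have cd' := @rcc_weight R k _ cd; have c2' := @rcc_weight R k _ rc2.
apply: (@le_trans _ _ (II (fun r => 2 * (r ^+ k.+1 * normsq (c2 r)) + 2 * (r ^+ k.+1 * normsq (c1 r - c2 r))))).
  have ct (h : R -> R) : continuous h -> continuous (fun r => 2 * h r) by move=> ch; apply: cM => //; exact: cC.
  apply: II_le; [by apply: cM => //; exact: rcc_weight|by apply: cD; exact: ct|].
  move=> r /andP[r0 r1]; have /andP[w0 w1] := w01 r.
  have z0 : 0 <= r ^+ k.+1 by rewrite exprn_ge0 ?ltW.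
  apply: (@le_trans _ _ (r ^+ k.+1 * normsq (c1 r))); first by rewrite ler_piMl// mulr_ge0// normsq_ge0.
  apply: (le_trans (ler_wpM2l z0 (split_le r))).
  by rewrite le_eqVlt; apply/orP; left; apply/eqP; ring.
rewrite (II_D (f := fun r => 2 * _)) ?II_Z//; [|by apply: cM => //; exact: cC|by apply: cM => //; exact: cC].
rewrite -/(nsqI k c2) -/(nsqI k (fun r => c1 r - c2 r)).
move: L1 L2; move: (nsqI k c2) (nsqI k b) (nsqI k _) (normsq _) => x1 x2 x3 x4.
by move: (q ^+ 2) (E ^+ 2) => q2 e2; nra.
Qed.
End pair.

Lemma X_continuous (h : V -> C) : cc h -> continuous (fun r => w r * (r ^+ k.+1 * Sq (fun x => h (r *: x)))).
Proof. by move=> ch; apply: cM => //; apply: cM => //; exact: Sq_continuous. Qed.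

Lemma X_ge0 (h : V -> C) : 0 <= X h.
Proof.
apply: II_ge0 => r /andP[r0 _]; have /andP[w0 _] := w01 r.
by rewrite mulr_ge0// mulr_ge0 ?Sq_ge0// exprn_ge0 ?ltW.
Qed.

(** Parseval on each sphere, then dominated convergence in r, the full sum being the dominating
    function by Bessel's inequality. *)
Lemma X_le (h : V -> C) B : cc h -> (forall J, DS J (fun j i => wI (coef (@e j i) h)) <= B) -> X h <= B.
Proof.
move=> ch hB.
have cDS J : continuous (fun r : R => DS J (fun j i => normsq (coef (@e j i) h r))).
  by apply: continuous_DS => j i; exact: (rcc_normsq (rcc_coef (@he j i) ch)).
apply: (@II_cvg_le R (fun J r => w r * (r ^+ k.+1 * DS J (fun j i => normsq (coef (@e j i) h r))))).
- by move=> J; apply: cM => //; exact: cM.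
- exact: X_continuous.
- move=> J r /andP[r0 _]; have /andP[w0 _] := w01 r.
  have z0 : 0 <= r ^+ k.+1 by rewrite exprn_ge0 ?ltW.
  rewrite !mulr_ge0//=; last by apply: DS_ge0 => j i; exact: normsq_ge0.
  by apply: ler_wpM2l => //; apply: ler_wpM2l => //; apply: bessel_DS; exact: cc_scale.
- move=> r _; apply: cvgMl_tmp; apply: cvgMl_tmp.
  by apply: parseval_DS; exact: cc_scale.
move=> J; apply: le_trans (hB J).
rewrite -II_DS; last by move=> j i; apply: cM => //; exact: (rcc_weight (rcc_coef (@he j i) ch)).
rewrite le_eqVlt; apply/orP; left; apply/eqP; congr II; apply/funext => r.
by rewrite -!DS_Z.
Qed.

Lemma nsqI_DS_le (h : V -> C) J : cc h ->
  DS J (fun j i => nsqI k (coef (@e j i) h)) <= II (fun r => r ^+ k.+1 * Sq (fun x => h (r *: x))).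
Proof.
move=> ch.
have c1 j i : continuous (fun r : R => r ^+ k.+1 * normsq (coef (@e j i) h r)).
  exact: (rcc_weight (rcc_coef (@he j i) ch)).
rewrite -(II_DS J c1); apply: II_le; [exact: continuous_DS|by apply: cM => //; exact: Sq_continuous|].
move=> r /andP[r0 _]; have z0 : 0 <= r ^+ k.+1 by rewrite exprn_ge0 ?ltW.
by rewrite DS_Z; apply: ler_wpM2l => //; apply: bessel_DS; exact: cc_scale.
Qed.

Lemma source_le_X (h : V -> C) : cc h ->
  II (fun r => r ^+ k.+1 * Sq (fun x => v (r *: x) * h (r *: x))) <= X h.
Proof.
move=> ch; have cvh := cv ch; have c1 := Sq_continuous cvh.
apply: II_le; [by apply: cM|exact: X_continuous|].
move=> r /andP[r0 r1]; have z0 : 0 <= r ^+ k.+1 by rewrite exprn_ge0 ?ltW.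
rewrite [X in _ <= X]mulrCA; apply: ler_wpM2l => //.
have c2 : continuous (fun x : V => normsq (h (r *: x))) by exact: (cc_normsq (cc_scale r ch)).
rewrite -SIZ//; apply: SI_le01.
- exact: (cc_normsq (cc_scale r cvh)).
- by apply: cM => //; exact: cC.
move=> x; rewrite normsqM => -[->|x1].
  rewrite scaler0 v_in ?enorm0 ?divr_gt0// /normsq /= expr0n/= addr0 mul0r.
  by rewrite mulr_ge0 ?normsq_ge0//; have /andP[] := w01 r.
apply: ler_wpM2r; first exact: normsq_ge0.
by have := vw (r *: x); rewrite enormZ x1 mulr1 (gtr0_norm r0).
Qed.

Let lo j : R := (j < M)%N%:R.
Let tl j : R := if (j < M)%N then 0 else (1 / 4) ^+ j.-1.
Let nF j i : R := nsqI k (coef (@e j i) F).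

Let lo_ge0 j : 0 <= lo j. Proof. exact: ler0n. Qed.
Let tl_ge0 j : 0 <= tl j.
Proof. by rewrite /tl; case: ifP => // _; rewrite exprn_ge0// divr_ge0. Qed.

Let Sq_basis j i : 0 < Sq (ec j i).
Proof.
have := cip_self (cc_ev (@e j i)); rewrite oe eqxx => /(congr1 Re) /= <-.
exact: ltr01.
Qed.

Let nF_total J : DS J (fun j i => @nF j i) <= X psi1.
Proof. by apply: (le_trans (nsqI_DS_le J cF)); exact: source_le_X. Qed.

Let cM2 : (0 < n)%N. Proof. by apply: leq_trans nM; rewrite double_gt0. Qed.

Section bounds.
Context (T A : R).
Hypotheses (hT : forall J, DS J (fun j i => tl j * @f j i) <= T)
  (hA : forall J, DS J (fun j i => lo j * @f j i) <= A).

Let T0 : 0 <= T. Proof. by have := hT 0; rewrite /DS big_geq. Qed.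

Section frequencies.
Context (om : C) (N : nat).
Hypotheses (om1 : normsq om = 1) (omR : 1 + Re om != 0) (po : N.-primitive_root om) (N0 : (0 < N)%N).
Local Notation fr K h := (freq om N K h).

Lemma freq_source K : fr K F = fun x => v x * fr (K + n) psi1 x.
Proof. exact: (freqM N psi1 K (rotv om1)). Qed.

Lemma X_freq_le K : X (fr K psi1) <= X psi1.
Proof.
have cf := cc_freq om N K cc1.
apply: II_le; [exact: X_continuous|exact: X_continuous|].
move=> r /andP[r0 _]; have /andP[w0 _] := w01 r.
have z0 : 0 <= r ^+ k.+1 by rewrite exprn_ge0 ?ltW.
apply: ler_wpM2l => //; apply: ler_wpM2l => //; rewrite freq_scale.
exact: (Sq_freq_le om1 omR N0 K (cc_scale r cc1)).
Qed.

(* Harmonics of degree < M do not see the frequency K, and those of degree >= M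
   gain r^(j - 1) for the free part and 1/100 for the correction. *)
Lemma X_freq_step K : (M <= K)%N -> (K + M <= N)%N ->
  X (fr K psi1) <= 2 * T + 1 / 50 * X (fr (K + n) psi1).
Proof.
move=> MK KN; have cf (h : V -> C) : cc h -> cc (fr K h) := fun ch => cc_freq om N K ch.
apply: X_le; first exact: cf.
move=> J; pose g j (i : 'I_(p j)) : R := normsq (cip (fr K psi2) (ec j i)).
have step j i : wI (coef (@e j i) (fr K psi1)) <= 2 * (tl j * g j i) + 1 / 50 * nsqI k (coef (@e j i) (fr K F)).
  have n0 : 0 <= 1 / 50 * nsqI k (coef (@e j i) (fr K F)) by rewrite mulr_ge0 ?divr_ge0// nsqI_ge0.
  rewrite /tl; case: ltnP => Mj.
    rewrite mul0r mulr0 add0r (_ : wI _ = 0)//.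
    have z r : coef (@e j i) (fr K psi1) r = 0.
      rewrite /coef freq_scale; apply: (freq_low om1 omR po N0 (@he j i) (cc_scale r cc1)).
        exact: leq_trans Mj MK.
      by apply: leq_trans KN; rewrite ltn_add2l.
    rewrite /wI (_ : (fun r => _) = fun=> 0) ?II_cst//; apply/funext => r.
    by rewrite z /normsq /= expr0n/= addr0 !mulr0.
  have [p' hp' adj] := freq_adjoint N om1 omR K (@he j i).
  have ce (h : V -> C) : cc h -> coef (@e j i) (fr K h) = coef p' h.
    by move=> ch; apply/funext => r; rewrite /coef freq_scale adj//; exact: cc_scale.
  by rewrite !ce// /g adj//; exact: (pair_high hp' Mj).
apply: (le_trans (DS_le J step)); rewrite DS_lin; apply: lerD.
  apply: ler_wpM2l => //; apply: le_trans (hT J).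
  apply: ler_sum => j _; rewrite -!mulr_sumr; apply: ler_wpM2l => //.
  exact: (freq_contract om1 omR N0 (@he j) (@oe j) (@span j) K cc2).
apply: ler_wpM2l; first by rewrite divr_ge0.
apply: (le_trans (nsqI_DS_le J (cf _ cF))); rewrite freq_source.
by apply: source_le_X; exact: cc_freq.
Qed.

(** The constant 3 reproduces itself because 2 T + 3 T / 50 <= 3 T; the second hypothesis keeps K, K
    + n, ..., K + i n in the window. *)
Lemma X_freq_iter i : forall K, (M <= K)%N -> (K + i * n + M <= N)%N ->
  X (fr K psi1) <= 3 * T + (1 / 50) ^+ i * X psi1.
Proof.
elim: i => [|i IH] K MK KN.
  by rewrite expr0 mul1r; apply: (le_trans (X_freq_le K)); rewrite lerDr mulr_ge0.
have h1 : X (fr K psi1) <= 2 * T + 1 / 50 * X (fr (K + n) psi1).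
  by apply: X_freq_step => //; move: KN; clear; lia.
have h2 : X (fr (K + n) psi1) <= 3 * T + (1 / 50) ^+ i * X psi1.
  by apply: IH; move: MK KN; clear; lia.
have -> : (1 / 50) ^+ i.+1 * X psi1 = 1 / 50 * ((1 / 50) ^+ i * X psi1) by rewrite exprS mulrA.
move: h1 h2; move: (_ ^+ i * X psi1) (X _) (X _) => x1 x2 x3.
by have := T0; lra.
Qed.

(* The frequencies within M of 0 modulo N. *)
Let kap a := if (a < M)%N then a else (N - M.*2 + a)%N.

(** In degrees < M only the 2 M frequencies of F within M of 0 are seen, by [freq_low]. As F = v
    psi1, each of them comes from a frequency of psi1 shifted by n >= 2 M, far enough inside the
    window for i steps. The factor 4 M^2 is (2 M)^2: Cauchy-Schwarz over 2 M terms, then 2 M equal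
    bounds. *)
Lemma low_source_freq i J : N = ((i + 4) * n)%N ->
  DS J (fun j l => lo j * @nF j l) <= 4 * M%:R ^+ 2 * (3 * T + (1 / 50) ^+ i * X psi1).
Proof.
move=> NE; have NM : (M.*2 <= N)%N.
  by rewrite NE; apply: (leq_trans nM); rewrite leq_pmull// addn4.
pose G (x : V) := \sum_(0 <= a < M.*2) fr (kap a) F x.
have cG : cc G by apply: cc_sum => a; exact: cc_freq.
have eG j l : (j < M)%N -> coef (@e j l) F = coef (@e j l) G.
  move=> jM; apply/funext => r; pose mid (x : V) := \sum_(M <= a < N - M) fr a F x.
  have FE (x : V) : F x = G x + mid x.
    rewrite (freq_sum po N0 F x) (@big_cat_nat _ _ _ M)//=; last by move: NM; clear; lia.
    rewrite (@big_cat_nat _ _ _ (N - M) M N)//=; [|by move: NM; clear; lia|exact: leq_subr].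
    rewrite /G (@big_cat_nat _ _ _ M 0 M.*2)//=; last by rewrite -addnn leq_addr.
    rewrite -/(mid x) [mid x + _]addrC addrA; congr (_ + _ + _).
      by rewrite big_nat [RHS]big_nat; apply: eq_bigr => a /andP[_ aM]; rewrite /kap aM.
    rewrite -[X in \sum_(X <= _ < N) _](_ : (M + (N - M.*2))%N = _); last by move: NM; clear; lia.
    rewrite big_addn (_ : (N - (N - M.*2))%N = M.*2); last by move: NM; clear; lia.
    rewrite big_nat [RHS]big_nat; apply: eq_bigr => a /andP[aM _].
    by rewrite /kap ltnNge aM /= addnC.
  have cmid : cc mid by apply: cc_sum => a; exact: cc_freq.
  rewrite /coef (_ : (fun x => F (r *: x)) = (fun x => G (r *: x) + mid (r *: x))); last first.
    by apply/funext => x; rewrite FE.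
  rewrite (cipDl (cc_scale r cG) (cc_scale r cmid) (cc_ev _)).
  rewrite (cip_suml (index_iota M (N - M)) (F := fun a x => fr a F (r *: x))) => [|a|]; last exact: cc_ev.
    rewrite big_nat big1 ?addr0// => a /andP[Ma aN].
    rewrite freq_scale; apply: (freq_low om1 omR po N0 (@he j l) (cc_scale r cF)).
      exact: leq_trans jM Ma.
    by move: aN jM; clear; lia.
  by apply: cc_scale; exact: cc_freq.
apply: (@le_trans _ _ (DS J (fun j l => nsqI k (coef (@e j l) G)))).
  apply: DS_le => j l; rewrite /lo /nF; case: ltnP => jM; first by rewrite mul1r eG.
  by rewrite mul0r nsqI_ge0.
apply: (le_trans (nsqI_DS_le J cG)).
pose h a (r : R) := r ^+ k.+1 * Sq (fun x => fr (kap a) F (r *: x)).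
have ch a : continuous (h a) by apply: cM => //; apply: Sq_continuous; exact: cc_freq.
have chs : continuous (fun r : R => \sum_(0 <= a < M.*2) h a r) by apply: continuous_sumr => a _.
apply: (@le_trans _ _ (II (fun r => M.*2%:R * \sum_(0 <= a < M.*2) h a r))).
  apply: II_le; [by apply: cM => //; exact: Sq_continuous|by apply: cM => //; exact: cC|].
  move=> r /andP[r0 _]; have z0 : 0 <= r ^+ k.+1 by rewrite exprn_ge0 ?ltW.
  rewrite /h -mulr_sumr [X in _ <= X]mulrCA; apply: ler_wpM2l => //.
  by apply: (Sq_sum_le M.*2 (f := fun a x => fr (kap a) F (r *: x))) => a; apply: cc_scale; exact: cc_freq.
rewrite II_Z// II_sum//.
have hX a : (a < M.*2)%N -> II (h a) <= 3 * T + (1 / 50) ^+ i * X psi1.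
  move=> aM; apply: (@le_trans _ _ (X (fr (kap a + n) psi1))).
    by rewrite /h freq_source; apply: source_le_X; exact: cc_freq.
  rewrite /kap; case: ltnP => aM2.
    by apply: X_freq_iter; move: aM aM2 nM NE; clear; lia.
  (* For the frequencies just below N the shift wraps around: modulo N the new one is n - 2 M + a,
     which is >= M since a >= M. *)
  rewrite (_ : (N - M.*2 + a + n)%N = (N + (n - M.*2 + a))%N); last by move: nM NM; clear; lia.
  by rewrite (freqDN po); apply: X_freq_iter; move: aM aM2 nM NE; clear; lia.
set Z := 3 * T + _ in hX *.
apply: (@le_trans _ _ (M.*2%:R * \sum_(0 <= a < M.*2) Z)).
  apply: ler_wpM2l => //; rewrite big_nat [leRHS]big_nat; apply: ler_sum => a /andP[_ aM]; exact: hX.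
rewrite big_const_nat iter_addr_0 subn0 -mulr_natl -muln2 natrM.
by rewrite le_eqVlt; apply/orP; left; apply/eqP; ring.
Qed.
End frequencies.

(* N = (i + 4) n leaves room for i steps of size n inside the window; i is
   arbitrary. *)
Lemma low_source J : DS J (fun j l => lo j * @nF j l) <= 12 * M%:R ^+ 2 * T.
Proof.
rewrite -subr_le0; apply: (@le0_of_pow R _ (4 * M%:R ^+ 2 * X psi1) 0%N) => [|i _].
  by rewrite mulr_ge0 ?X_ge0// mulr_ge0// sqr_ge0.
have N2 : (2 < (i + 4) * n)%N.
  apply: (@leq_trans (4 * 1)%N) => //; apply: leq_mul; first exact: leq_addl.
  exact: cM2.
have N0 : (0 < (i + 4) * n)%N by apply: leq_trans N2.
have [om po] := @prim_root_exists R _ N0.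
have [om1 omR] := prim_root_unit N2 po.
have := low_source_freq om1 omR po N0 J erefl; rewrite mulrDr => h.
have le : 4 * M%:R ^+ 2 * ((1 / 50) ^+ i * X psi1) <= 4 * M%:R ^+ 2 * X psi1 / 2 ^+ i.
  rewrite [(1 / 50) ^+ i * _]mulrC mulrA; apply: ler_wpM2l.
    by rewrite mulr_ge0 ?X_ge0// mulr_ge0// sqr_ge0.
  rewrite -exprVn; apply: lerXn2r; rewrite ?nnegrE ?divr_ge0 ?invr_ge0//.
  by lra.
move: h le; move: (DS _ _) (_ / 2 ^+ i) (4 * M%:R ^+ 2 * (_ * X psi1)) => x1 x2 x3.
by move: (M%:R ^+ 2) => m2; lra.
Qed.

Let cst : R := 1 + E ^+ 2 * q ^+ 2.
Let cst1 : 1 <= cst. Proof. by rewrite lerDl mulr_ge0 ?sqr_ge0. Qed.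

(** The high degrees return X / 50, which is absorbed: the constants 2, 4 and 2 * 12 = 24 are
    multiplied by 50/49 and rounded up to 3, 5 and 25. *)
Lemma X_bound : X psi1 <= 3 * T + 5 * cst * A + 25 * q ^+ 2 * M%:R ^+ 2 * T.
Proof.
suff : X psi1 <= 1 * ((4 * cst) * A + (2 * q ^+ 2) * (12 * M%:R ^+ 2 * T)) + 1 * (2 * T + 1 / 50 * X psi1).
  have : 0 <= cst * A.
    by apply: mulr_ge0; [exact: le_trans cst1|have := hA 0; rewrite /DS big_geq].
  have : 0 <= q ^+ 2 * M%:R ^+ 2 * T by rewrite mulr_ge0// mulr_ge0// sqr_ge0.
  have -> : 2 * q ^+ 2 * (12 * M%:R ^+ 2 * T) = 24 * (q ^+ 2 * M%:R ^+ 2 * T) by ring.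
  have -> : 25 * q ^+ 2 * M%:R ^+ 2 * T = 25 * (q ^+ 2 * M%:R ^+ 2 * T) by ring.
  have -> : 4 * cst * A = 4 * (cst * A) by ring.
  have -> : 5 * cst * A = 5 * (cst * A) by ring.
  move: (cst * A) (q ^+ 2 * M%:R ^+ 2 * T) (X psi1) => x1 x2 x3; have := T0; lra.
apply: X_le => // J.
pose F1 j (i : 'I_(p j)) : R := (4 * cst) * (lo j * @f j i) + (2 * q ^+ 2) * (lo j * @nF j i).
pose F2 j (i : 'I_(p j)) : R := 2 * (tl j * @f j i) + 1 / 50 * @nF j i.
have pt j i : wI (coef (@e j i) psi1) <= 1 * F1 j i + 1 * F2 j i.
  rewrite !mul1r /F1 /F2 /lo /tl; case: ltnP => jM.
    have [h _] := pair_low (@he j i) (@Sq_basis j i).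
    rewrite !mul1r mul0r mulr0 add0r; apply: (le_trans h); rewrite lerDl.
    by rewrite mulr_ge0 ?nsqI_ge0// divr_ge0.
  by rewrite !mul0r !mulr0 addr0 add0r; exact: (pair_high (@he j i) jM).
apply: (le_trans (DS_le J pt)); rewrite DS_lin.
have c40 : 0 <= 4 * cst by rewrite mulr_ge0// (le_trans _ cst1).
rewrite !mul1r; apply: lerD.
  rewrite /F1 DS_lin; apply: lerD; first exact: (ler_wpM2l c40 (hA J)).
  have q20 : 0 <= 2 * q ^+ 2 by rewrite mulr_ge0// sqr_ge0.
  exact: (ler_wpM2l q20 (low_source J)).
rewrite /F2 DS_lin; apply: lerD; first exact: (ler_wpM2l (ler0n R 2) (hT J)).
have p50 : 0 <= 1 / 50 :> R by rewrite divr_ge0.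
by have := ler_wpM2l p50 (nF_total J); rewrite !mul1r.
Qed.

(** Degrees < M pay the resolvent and the weight [Am] but only see the small source of [low_source];
    degrees >= M see the whole source, against the decay of the flux, which S combines with the
    weight. *)
Lemma flux_bound (Wt : nat -> R) (Am S : R) J : 0 <= Am -> 0 <= S -> (forall j, 0 <= Wt j) ->
  (forall j, (j < M)%N -> Wt j <= Am) ->
  (forall j, (M <= j)%N -> Wt j * (2 / 5) ^+ (2 * j + k - 1) <= S) ->
  DS J (fun j i => Wt j * normsq (@flux_coef j i)) <=
  24 * cst * M%:R ^+ 2 * Am * T + S * (3 * T + 5 * cst * A + 25 * q ^+ 2 * M%:R ^+ 2 * T).
Proof.
move=> Am0 S0 W0 WA WS.
have pt j i : Wt j * normsq (@flux_coef j i) <= (Am * (2 * cst)) * (lo j * @nF j i) + S * @nF j i.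
  have n0 := @nsqI_ge0 R k (coef (@e j i) F); rewrite -/(@nF j i) in n0.
  have c0 : 0 <= 2 * cst * @nF j i by rewrite mulr_ge0// mulr_ge0// (le_trans _ cst1).
  rewrite /lo; case: ltnP => jM.
    have [_ h] := pair_low (@he j i) (@Sq_basis j i).
    rewrite mul1r -[leLHS]addr0; apply: lerD; last exact: mulr_ge0.
    by rewrite -mulrA; apply: ler_pM => //; [exact: normsq_ge0|exact: WA].
  have h := pair_high_flux (@he j i) jM.
  rewrite mul0r mulr0 add0r; apply: (le_trans (ler_wpM2l (W0 j) h)).
  by rewrite mulrA; apply: ler_wpM2r => //; exact: WS.
apply: (le_trans (DS_le J pt)); rewrite DS_lin; apply: lerD.
  have c0 : 0 <= Am * (2 * cst) by rewrite mulr_ge0// mulr_ge0// (le_trans _ cst1).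
  apply: (le_trans (ler_wpM2l c0 (low_source J))).
  by rewrite le_eqVlt; apply/orP; left; apply/eqP; ring.
by apply: ler_wpM2l => //; apply: (le_trans (nF_total J)); exact: X_bound.
Qed.
End bounds.
End Comparison.

(** * The potential and the conclusion *)

Section SphereTransfer.
Context {R : realType} (k : nat).
Local Notation d := k.+2.
Local Notation leb := (@lebesgue_rV R).
Local Notation V := 'rV[R]_k.+2.
Local Notation C := R[i].
Local Notation Re := (@complex.Re R).
Local Notation Im := (@complex.Im R).
Local Notation proj := (@sphere_proj R k.+2).
Local Notation ball := (@uball R k.+2).
Implicit Types (F G : V -> R) (f g : V -> C) (x y : V).

(** Data on the sphere are arbitrary elsewhere, and [sphere_proj] sends the origin off the sphere,
    so identities on the sphere give identities off the origin only. Measurability of F follows from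
    that of G. *)
Lemma Rintegral_off0 F G : measurable_fun ball G -> (forall x, x != 0 -> F x = G x) ->
  \int[leb d]_(x in ball) F x = \int[leb d]_(x in ball) G x.
Proof.
move=> mG FG; have mb : measurable ball := @measurable_uball R d.
pose D := fun x => ind (x == 0) * (F 0 - G 0) : R.
have mD : measurable_fun setT D.
  apply: measurable_funM; last exact: measurable_cst.
  apply: measurable_boolr.
  apply: (measurable_fun_bool true); rewrite setTI (_ : _ @^-1` _ = [set 0]); first exact: measurable_rV_set0.
  by apply/seteqP; split=> x /=; [move=> /eqP|move=> ->; rewrite eqxx].
have e : F = (fun x => G x + D x).
  apply/funext => x; rewrite /D; have [->|x0] := eqVneq x 0; first by rewrite /ind mul1r addrC subrK.
  by rewrite /ind mul0r addr0 FG.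
rewrite /Rintegral; congr fine; apply: ae_eq_integral.
- exact: mb.
- by apply/measurable_EFinP; rewrite e; exact: (measurable_funD mG (measurable_funTS mD)).
- by apply/measurable_EFinP.
exists [set 0]; split; [exact: measurable_rV_set0|exact: lebesgue_rV_set0|].
by move=> x /= h; apply: contrapT => x0; apply: h => x1; congr EFin; apply: FG; exact/eqP.
Qed.

Let inner_eq f h : measurable_fun ball (fun x => Re (h (proj x))) ->
  measurable_fun ball (fun x => Im (h (proj x))) -> (forall x, usphere x -> f x = h x) ->
  sphere_integral f = sphere_integral h.
Proof.
move=> mR mI fh; rewrite /sphere_integral /cintegral.
have e x : x != 0 -> (f \o proj) x = (h \o proj) x.
  by move=> x0; rewrite /= fh//; exact: enorm_sphere_proj.
rewrite (@Rintegral_off0 (fun x => Re ((f \o proj) x)) _ mR); last by move=> x /e ->.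
by rewrite (@Rintegral_off0 (fun x => Im ((f \o proj) x)) _ mI)//; move=> x /e ->.
Qed.

Let mproj F : continuous F -> measurable_fun ball (fun x => F (proj x)).
Proof. by move=> cF; apply: measurable_funTS; have [] := bm_sphere_proj cF. Qed.

Lemma sphere_inner_cip f g f' g' : cc f' -> cc g' -> (forall x, usphere x -> f x = f' x) ->
  (forall x, usphere x -> g x = g' x) -> sphere_inner f g = cip f' g'.
Proof.
move=> cf cg ff gg; have [cR cI] := cip_cc cf cg.
rewrite /sphere_inner (@inner_eq _ (fun x => f' x * (g' x)^*)); [|exact: mproj cR|exact: mproj cI|].
  rewrite /sphere_integral /cip /cS /SI /cintegral /BI.
  have nC n : (n%:R : C) = (n%:R +i* 0)%C.
    by elim: n => [//|n IH]; rewrite !mulrSr IH; apply: complexP; rewrite cxE /= ?addr0.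
  by rewrite nC; apply: complexP; rewrite cxE /= ?mul0r ?subr0 ?addr0.
by move=> x x1; rewrite ff ?gg.
Qed.

Lemma sphere_inner_congr f g g' : L2 ball (f \o proj) -> cc g' ->
  (forall x, usphere x -> g x = g' x) -> sphere_inner f g = sphere_inner f g'.
Proof.
move=> [mR mI _] [cR cI] gg; rewrite /sphere_inner; apply: inner_eq => [||x x1]; last by rewrite gg.
  rewrite (_ : (fun x => _) = (fun x => Re (f (proj x)) * Re (g' (proj x)) + Im (f (proj x)) * Im (g' (proj x)))).
    exact: (measurable_funD (measurable_funM mR (mproj cR)) (measurable_funM mI (mproj cI))).
  by apply/funext => x; rewrite !cxE; ring.
rewrite (_ : (fun x => _) = (fun x => Im (f (proj x)) * Re (g' (proj x)) - Re (f (proj x)) * Im (g' (proj x)))).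
  exact: (measurable_funB (measurable_funM mI (mproj cR)) (measurable_funM mR (mproj cI))).
by apply/funext => x; rewrite !cxE; ring.
Qed.

Lemma resolvent_norm_ge0 (v : V -> C) (E : R) : (0 <= resolvent_norm v E)%E.
Proof.
have z0 : (fun=> 0 : C) = cplx (fun _ : V => 0).
  by apply/funext => x.
have n0 : L2norm ball (fun=> 0 : C) = 0%E.
  rewrite L2norm_bm; last by rewrite /normsq /= expr0n/= addr0; exact: bm_cst.
  by rewrite /normsq /= expr0n/= addr0 BI0 sqrtr0.
rewrite -{1}n0; apply: ereal_sup_ubound; exists (fun=> 0) => //=; exists (fun=> 0); last by rewrite n0.
split.
- by apply: L2_bm => /=; exact: bm_cst.
- rewrite z0; apply: (@H10_cplx _ _ _ 0) => [n|x x1]; first exact: CkRC.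
  by rewrite normr0 mul0r.
- move=> eta _; rewrite [X in cintegral _ X = _](_ : _ = (fun x => 0 * eta x))//.
  by apply/funext => x; rewrite !mul0r.
Qed.
End SphereTransfer.

(** * From the essential supremum of the profile to a pointwise bound *)

Section Profile.
Context {R : realType}.
Local Notation leb := (@lebesgue_rV R).
Local Notation C := R[i].
Local Notation Re := (@complex.Re R).
Local Notation Im := (@complex.Im R).

(** If F(x0) > c, then F > c on a cube of half-side t around x0, which would be a null set although
    its measure is (2 t)^d. *)
Lemma ae_le_continuous d (F : 'rV[R]_d -> R) (c : R) : continuous F ->
  {ae leb d, forall x, F x <= c} -> forall x, F x <= c.
Proof.
move=> cF aeF x0; rewrite leNgt; apply/negP => h.
have /nbhs_normP[e /= e0 he] : \forall x \near x0, c < F x by exact: (cvgr_gt (F x0) (cF x0)).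
pose t : R := e / 2; have t0 : 0 < t by rewrite divr_gt0.
pose G (x : 'rV[R]_d) : \bar R := ((\prod_(i < d) ind (`|x 0 i| <= 1))%R)%:E.
have mG : measurable_fun setT G.
  apply/measurable_EFinP; apply: measurable_prod => i _; apply: measurable_boolr.
  apply: measurable_fun_ler; last exact: measurable_cst.
  by apply: measurableT_comp => //; exact: measurable_entry.
have G0 x : (0 <= G x)%E by rewrite lee_fin; apply: prodr_ge0 => i _; exact: ind_ge0.
pose G1 x : \bar R := G (t^-1 *: x).
have mG1 : measurable_fun setT G1 by apply: (measurableT_comp mG); exact: measurable_scale_rV.
pose G2 x : \bar R := G1 (x + (- x0)).
have mG2 : measurable_fun setT G2 by apply: (measurableT_comp mG1); exact: measurable_add_rV.
have : (\int[leb d]_x G2 x = 0)%E.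
  apply/eqP; rewrite (_ : 0%E = (\int[leb d]_x (cst 0%E x))%E); last by rewrite integral0.
  apply/eqP; apply: ae_eq_integral => //.
  apply: filterS aeF => x Fx _ /=; apply/eqP; rewrite /G2 /G1 /G eqe; apply: contraT => gn0.
  suff : c < F x by rewrite ltNge Fx.
  apply: he => /=; rewrite -normrN opprB.
  apply: (@le_lt_trans _ _ t); last by rewrite /t ltr_pdivrMr// mulr2n mulrDr mulr1 ltrDl.
  apply: rV_norm_le => [|i]; first exact: ltW.
  have : ind (`|(t^-1 *: (x + - x0)) 0 i| <= 1) != 0 :> R by apply: contraNneq gn0 => h0; rewrite (bigD1 i)//= h0 mul0r.
  rewrite /ind; case: (boolP (`|(t^-1 *: (x + - x0)) 0 i| <= 1)) => [h1 _|_]; last by rewrite eqxx.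
  by move: h1; rewrite mxE normrM gtr0_norm ?invr_gt0// ler_pdivrMl// mulr1.
rewrite (@ge0_integral_translate R d (- x0) G1 mG1)//.
rewrite (@ge0_integral_scale R d t^-1 G _ mG) ?invr_gt0// integral_unit_cube -EFinM => -[] /eqP.
  by rewrite gt_eqF// mulr_gt0 ?invr_gt0 ?exprn_gt0// invr_gt0.
by move=> x; exact: G0.
Qed.

Lemma profile_le1 (phi : 'rV[R]_2 -> C) : is_profile phi -> forall y, normsq (phi y) <= 1.
Proof.
move=> [sphi _ hn] y.
have [cR cI] := sphi 0%N.
apply: (@ae_le_continuous 2 (fun y => normsq (phi y))); first by apply: cD; exact: cX.
move: hn; rewrite unlock; case: ifPn => [p0 hn|_ [] /eqP]; last by rewrite eq_sym oner_eq0.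
have h1 := lexx (1%E : \bar R); rewrite -{1}hn in h1; move/ess_sup_inf.ess_supP: h1.
apply: filterS => x /=; rewrite lee_fin modulusE ger0_norm ?sqrtr_ge0// => h.
by rewrite -(sqr_sqrtr (normsq_ge0 _)) expr_le1 ?sqrtr_ge0.
Qed.
End Profile.

(** * Support, size, rotation law and continuity of the potential *)

Section Potential.
Context {R : realType} (k : nat).
Local Notation V := 'rV[R]_k.+2.
Local Notation C := R[i].
Local Notation Re := (@complex.Re R).
Local Notation Im := (@complex.Im R).
Local Notation coord := (@Pilot.Defs.coord R _).
Context (phi : 'rV[R]_2 -> C) (m n : nat).
Hypotheses (hphi : is_profile phi) (n0 : (0 < n)%N).
Let v : V -> C := potential phi m n.
Let pr (x : V) : 'rV[R]_2 := \row_(l < 2) if l == 0 then cyl_radius x else rest_norm x.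

Let i1 : 'I_k.+2 := lift ord0 ord0.

Let phi_supp y : phi y != 0 -> enorm y < 1 / 3 /\ 1 / 4 < y 0 0.
Proof. by have [_ h _] := hphi; move=> p0; apply: h; exact: subset_closure. Qed.

Let cyl_ge0 (x : V) : 0 <= cyl_radius x. Proof. exact: sqrtr_ge0. Qed.

Let pr0 (x : V) : pr x 0 0 = cyl_radius x. Proof. by rewrite mxE. Qed.

Let enorm_pr (x : V) : enorm (pr x) = enorm x.
Proof.
rewrite /enorm !big_ord_recl big_ord0 addr0 !mxE /=; congr Num.sqrt.
rewrite /cyl_radius /rest_norm !sqr_sqrtr ?addr_ge0 ?sqr_ge0//; last by apply: sumr_ge0 => i _; exact: sqr_ge0.
rewrite coord0 coord1 addrA; congr (_ + _ + _).
rewrite [LHS]big_mkcond /= !big_ord_recl /= !add0r; apply: eq_bigr => i _.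
by rewrite /bump /=.
Qed.

Let cyl_le (x : V) : cyl_radius x <= enorm x.
Proof. by rewrite -enorm_pr -(pr0 x) (le_trans (ler_norm _))// le_coord_enorm. Qed.

Lemma potential_in (x : V) : enorm x < 1 / 4 -> v x = 0.
Proof.
move=> x4; rewrite /v /potential -/(pr x); have [->|p0] := eqVneq (phi (pr x)) 0; first by rewrite mulr0.
exfalso; have [_ h] := phi_supp p0; rewrite pr0 in h; have h2 := lt_le_trans h (cyl_le x); lra.
Qed.

Lemma potential_out (x : V) : 1 / 3 <= enorm x -> v x = 0.
Proof.
move=> x3; rewrite /v /potential -/(pr x); have [->|p0] := eqVneq (phi (pr x)) 0; first by rewrite mulr0.
exfalso; have [h _] := phi_supp p0; rewrite enorm_pr in h; lra.
Qed.

Let normsqX (z : C) l : normsq (z ^+ l) = normsq z ^+ l.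
Proof.
elim: l => [|l IH]; first by rewrite !expr0 /normsq /= expr1n expr0n addr0.
by rewrite !exprS normsqM IH.
Qed.

Lemma potential_le1 (x : V) : normsq (v x) <= 1.
Proof.
rewrite /v /potential -/(pr x) !normsqM !normsqX.
have a1 : normsq (n%:R ^- m : C) <= 1.
  rewrite -exprVn normsqX normsqV exprn_ile1// ?exprn_ge0 ?invr_ge0//.
  by rewrite exprn_ile1 ?invr_ge0// invf_le1 ?ltr0n// ler1n.
have a2 : normsq (exp_itheta x) <= 1.
  have [r0|r0] := eqVneq (cyl_radius x) 0.
    by rewrite /normsq /= r0 invr0 !mulr0 expr0n/= addr0.
  rewrite /normsq /= !expr_div_n -mulrDl -[X in X / _](_ : cyl_radius x ^+ 2 = _).
    by rewrite divff// expf_neq0.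
  by rewrite /cyl_radius sqr_sqrtr// addr_ge0 ?sqr_ge0.
rewrite -[leRHS]mulr1 ler_pM ?mulr_ge0 ?normsq_ge0 ?exprn_ge0 ?normsq_ge0 ?profile_le1//.
rewrite -[leRHS]mulr1 ler_pM ?normsq_ge0 ?exprn_ge0 ?normsq_ge0//.
by rewrite exprn_ile1 ?normsq_ge0.
Qed.

Lemma potential_rot (om : C) (x : V) : normsq om = 1 -> v (rot (Re om) (Im om) x) = om ^+ n * v x.
Proof.
move=> om1; set y := rot _ _ x.
have c0 : coord y 0 = Re om * coord x 0 - Im om * coord x 1 by rewrite /y /rot coord_row.
have c1 : coord y 1 = Im om * coord x 0 + Re om * coord x 1 by rewrite /y /rot coord_row.
have ey : cyl_radius y = cyl_radius x.
  rewrite /cyl_radius c0 c1; congr Num.sqrt.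
  have -> : (Re om * coord x 0 - Im om * coord x 1) ^+ 2 + (Im om * coord x 0 + Re om * coord x 1) ^+ 2 =
    normsq om * (coord x 0 ^+ 2 + coord x 1 ^+ 2) by rewrite /normsq; ring.
  by rewrite om1 mul1r.
have er : rest_norm y = rest_norm x.
  rewrite /rest_norm; congr Num.sqrt; apply: eq_bigr => i i2; rewrite /y mxE.
  by case: (nat_of_ord i) i2 => [|[]].
have ep : pr y = pr x by apply/rowP => i; rewrite !mxE ey er.
have ee : exp_itheta y = om * exp_itheta x.
  rewrite /exp_itheta ey c0 c1; apply: complexP; rewrite cxE /=; ring.
by rewrite /v /potential -/(pr y) -/(pr x) ep ee exprMn; ring.
Qed.

Let cc_expn (f : V -> C) l : cc f -> cc (fun x => f x ^+ l).
Proof.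
move=> cf; elim: l => [|l IH]; first exact: ccC.
rewrite (_ : (fun x => _) = (fun x => f x * f x ^+ l)); first exact: ccM.
by apply/funext => x; rewrite exprS.
Qed.

Let csqrt (f : V -> R) : continuous f -> continuous (fun x => Num.sqrt (f x)).
Proof. by move=> cf; exact: (ccomp cf (@sqrt_continuous R)). Qed.

Let ccyl : continuous (@cyl_radius R k.+2).
Proof.
rewrite (_ : @cyl_radius R k.+2 = (fun x => Num.sqrt (x 0 ord0 ^+ 2 + x 0 i1 ^+ 2))).
  by apply: csqrt; apply: cD; apply: cX; exact: continuous_coord.
by apply/funext => x; rewrite /cyl_radius coord0 coord1.
Qed.

Let crest : continuous (@rest_norm R k.+2).
Proof. by apply: csqrt; apply: continuous_sumr => i _; apply: cX; exact: continuous_coord. Qed.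

(** e^(i theta) is discontinuous where r_1 = 0. Dividing by max(r_1, 1/4) instead of r_1 makes it
    continuous and changes nothing where phi is nonzero, since r_1 > 1/4 there. *)
Lemma potential_cc (f : V -> C) : cc f -> cc (fun x => v x * f x).
Proof.
move=> cf; apply: ccM => //.
pose ma (x : V) : R := (cyl_radius x + 1 / 4 + `|cyl_radius x - 1 / 4|) / 2.
have m0 x : ma x != 0.
  by rewrite gt_eqF// /ma; have := ler_norm (- (cyl_radius x - 1 / 4)); rewrite normrN; lra.
have cm : continuous ma.
  by apply: cM; [apply: cD; [apply: cD => //; exact: cC|apply: cnorm; apply: cB => //; exact: cC]|exact: cC].
have cmV : continuous (fun x => (ma x)^-1).
  move=> x; first [exact: (cvgV (m0 x) (cm x))|exact: (cvgV _ (m0 x) (cm x))|by apply: cvgV; first [exact: cm|exact: m0|rewrite m0]].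
pose ex (x : V) : C := (x 0 ord0 * (ma x)^-1 +i* (x 0 i1 * (ma x)^-1))%C.
have cex : cc ex by split => /=; apply: cM => //; exact: continuous_coord.
have cpr : continuous pr.
  by apply: continuous_rowP => i; rewrite (_ : (fun x => _) = if i == 0 then @cyl_radius R k.+2 else @rest_norm R k.+2);
    [case: ifP|apply/funext => x; rewrite mxE; case: ifP].
have [sphi _ _] := hphi; have [cR cI] := sphi 0%N.
have cp : cc (fun x => phi (pr x)) by split; [exact: (ccomp cpr cR)|exact: (ccomp cpr cI)].
rewrite (_ : v = (fun x => n%:R ^- m * ex x ^+ n * phi (pr x))).
  by apply: ccM => //; apply: ccM; [exact: ccC|exact: cc_expn].
apply/funext => x; rewrite /v /potential -/(pr x).
have [->|p0] := eqVneq (phi (pr x)) 0; first by rewrite !mulr0.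
have [_] := phi_supp p0; rewrite pr0 => h; congr (_ * _ ^+ _ * _).
have em : ma x = cyl_radius x by rewrite /ma ger0_norm; lra.
by rewrite /exp_itheta /ex em coord0 coord1.
Qed.
End Potential.

(** (|t| - |t - 1| + 1) / 2 is t clamped to [0, 1], taken at t = 3 - 6 r. *)
Lemma cutoff_exists (R : realType) : exists w : R -> R, [/\ continuous w, forall r, 0 <= w r <= 1,
  forall r, r <= 1 / 3 -> w r = 1 & forall r, 1 / 2 <= r -> w r = 0].
Proof.
pose g (r : R) : R := 3 - 6 * r.
exists (fun r => (`|g r| - `|g r - 1| + 1) / 2).
have cr : continuous (fun r : R => r) by move=> x.
have cc (a : R) : continuous (fun _ : R => a) by exact: cC.
have cg : continuous g by apply: cB => //; exact: cM.
split.
- by apply: cM => //; apply: cD => //; apply: cB; apply: cnorm => //; exact: cB.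
- move=> r; move: (g r) => t; case: (lerP 0 t) => t0; case: (lerP 1 t) => t1.
  + by rewrite !ger0_norm; lra.
  + by rewrite ger0_norm//; lra.
  + by lra.
  + by rewrite ltr0_norm//; lra.
- by move=> r r3; rewrite !ger0_norm /g; lra.
- by move=> r r2; rewrite !ler0_norm /g; lra.
Qed.

(** Raise t <= (a / c) e^(c t / a) to the power a = 2 sigma + 2, with t = 1 + j and c = ln(5/4). The
    extra square (1 + j)^2 is meant for the factor M^2 of [low_source]. *)
Lemma weight_growth (R : realType) (sigma : R) : 0 < sigma -> exists2 B : R, 1 <= B &
  forall j, (1 + j%:R) `^ (2 * sigma) * (1 + j%:R) ^+ 2 <= B * (5 / 4) ^+ j.
Proof.
move=> s0; pose a : R := 2 * sigma + 2; have a0 : 0 < a by rewrite /a; lra.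
pose c : R := ln (5 / 4); have c0 : 0 < c by apply: ln_gt0; lra.
exists (Num.max 1 ((a / c) `^ a * (5 / 4))); first by rewrite le_max lexx.
move=> j; have j0 : 0 < 1 + j%:R :> R by rewrite ltr_pwDl.
rewrite -powR_mulrn ?(ltW j0)// -powRD; last by rewrite (gt_eqF j0) implybT.
rewrite -/a; apply: (@le_trans _ _ ((a / c) `^ a * (5 / 4) * (5 / 4) ^+ j)); last first.
  by apply: ler_wpM2r; [rewrite exprn_ge0// divr_ge0|rewrite le_max lexx orbT].
rewrite -mulrA -exprS.
have h : 1 + j%:R <= a / c * expR (c / a * (1 + j%:R)).
  rewrite -ler_pdivrMl ?divr_gt0// invf_div.
  by apply: le_trans (expR_ge1Dx _); rewrite lerDr.
have r0 : 0 <= a / c * expR (c / a * (1 + j%:R)) := le_trans (ltW j0) h.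
have ge : (1 + j%:R) `^ a <= (a / c * expR (c / a * (1 + j%:R))) `^ a.
  by apply: (ge0_ler_powR (ltW a0)); rewrite ?nnegrE; [exact: ltW|exact: r0|exact: h].
apply: (le_trans ge); rewrite powRM; [|by rewrite divr_ge0 ?ltW|exact: expR_ge0].
apply: ler_wpM2l; first exact: powR_ge0.
rewrite -expRM -[X in _ <= X]lnK ?posrE ?exprn_gt0//.
rewrite lnXn ?divr_gt0// -/c le_eqVlt; apply/orP; left; apply/eqP; congr expR.
by rewrite -[RHS]mulr_natl -addn1 natrD; field; rewrite gt_eqF.
Qed.

(** * Collecting the exponential rates *)

Section Rates.
Context {R : realType}.

(** Once M^2 is replaced by its bound, the geometric factors combine into powers of 125/256, 1/16,
    1/4 and 5/64, all at most 1/2; the first is why the weights may grow no faster than about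
    (5/4)^j. *)
Lemma rate_bound (B cst q T A : R) (M : nat) : 1 <= B -> 1 <= cst -> M%:R ^+ 2 <= B * (5 / 4) ^+ M ->
  T = 4 * B * (5 / 16) ^+ M -> A = B * (5 / 4) ^+ M ->
  24 * cst * M%:R ^+ 2 * A * T + (5 / 2 * B * (1 / 5) ^+ M) *
    (3 * T + 5 * cst * A + 25 * q ^+ 2 * M%:R ^+ 2 * T) <=
  400 * B ^+ 3 * (q ^+ 2 + cst) * (1 / 2) ^+ M.
Proof.
move=> B1 c1 hM -> ->.
have pw (x : R) : 0 <= x -> x <= 1 / 2 -> x ^+ M <= (1 / 2) ^+ M.
  by move=> x0 x2; apply: lerXn2r; rewrite ?nnegrE ?divr_ge0.
set h := (1 / 2) ^+ M; have h0 : 0 <= h by rewrite exprn_ge0// divr_ge0.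
set u := (5 / 4) ^+ M; set t := (5 / 16) ^+ M; set s := (1 / 5) ^+ M.
have u0 : 0 <= u by rewrite exprn_ge0// divr_ge0.
have t0 : 0 <= t by rewrite exprn_ge0// divr_ge0.
have s0 : 0 <= s by rewrite exprn_ge0// divr_ge0.
have uut : u * u * t <= h by rewrite /u /t -!exprMn; apply: pw; lra.
have st : s * t <= h by rewrite /s /t -!exprMn; apply: pw; lra.
have su : s * u <= h by rewrite /s /u -!exprMn; apply: pw; lra.
have sut : s * u * t <= h by rewrite /s /u /t -!exprMn; apply: pw; lra.
move: hM; rewrite -/u; move: (M%:R ^+ 2) => m hM.
have B0 : 0 <= B by lra.
have c0 : 0 <= cst by lra.
have B2 : B ^+ 2 <= B ^+ 3 by rewrite [leRHS]exprS ler_peMl// sqr_ge0.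
have B20 : 0 <= B ^+ 2 := sqr_ge0 B.
have B30 : 0 <= B ^+ 3 by rewrite exprn_ge0.
have q0 : 0 <= q ^+ 2 := sqr_ge0 q.
have t1 : (4 * B ^+ 2 * (u * t)) * m <= 4 * B ^+ 3 * h.
  have n0 : 0 <= 4 * B ^+ 2 * (u * t) by rewrite mulr_ge0 ?mulr_ge0.
  apply: (le_trans (ler_wpM2l n0 hM)).
  have -> : 4 * B ^+ 2 * (u * t) * (B * u) = (4 * B ^+ 3) * (u * u * t) by ring.
  by apply: ler_wpM2l => //; rewrite mulr_ge0.
have t4 : (10 * B ^+ 2 * (s * t)) * m <= 10 * B ^+ 3 * h.
  have n0 : 0 <= 10 * B ^+ 2 * (s * t) by rewrite mulr_ge0 ?mulr_ge0.
  apply: (le_trans (ler_wpM2l n0 hM)).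
  have -> : 10 * B ^+ 2 * (s * t) * (B * u) = (10 * B ^+ 3) * (s * u * t) by ring.
  by apply: ler_wpM2l => //; rewrite mulr_ge0.
have t2 : B ^+ 2 * (s * t) <= B ^+ 3 * h by apply: ler_pM => //; exact: mulr_ge0.
have t3 : B ^+ 2 * (s * u) <= B ^+ 3 * h by apply: ler_pM => //; exact: mulr_ge0.
have e : 24 * cst * m * (B * u) * (4 * B * t) + (5 / 2 * B * s) *
    (3 * (4 * B * t) + 5 * cst * (B * u) + 25 * q ^+ 2 * m * (4 * B * t)) =
  24 * (cst * ((4 * B ^+ 2 * (u * t)) * m)) + 30 * (B ^+ 2 * (s * t)) +
  25 / 2 * (cst * (B ^+ 2 * (s * u))) + 25 * (q ^+ 2 * ((10 * B ^+ 2 * (s * t)) * m)) by field.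
rewrite e.
have f1 : cst * (4 * B ^+ 2 * (u * t) * m) <= 4 * (cst * (B ^+ 3 * h)).
  by apply: (le_trans (ler_wpM2l c0 t1)); rewrite le_eqVlt; apply/orP; left; apply/eqP; ring.
have f4 : q ^+ 2 * (10 * B ^+ 2 * (s * t) * m) <= 10 * (q ^+ 2 * (B ^+ 3 * h)).
  by apply: (le_trans (ler_wpM2l q0 t4)); rewrite le_eqVlt; apply/orP; left; apply/eqP; ring.
have f3 := ler_wpM2l c0 t3.
have f2 : B ^+ 3 * h <= cst * (B ^+ 3 * h) by rewrite ler_peMl// mulr_ge0.
have g0 : 0 <= q ^+ 2 * (B ^+ 3 * h) by rewrite mulr_ge0// mulr_ge0.
have -> : 400 * B ^+ 3 * (q ^+ 2 + cst) * h = 400 * (q ^+ 2 * (B ^+ 3 * h)) + 400 * (cst * (B ^+ 3 * h)) by ring.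
have g1 : 0 <= B ^+ 3 * h by exact: mulr_ge0.
move: f1 f2 f3 f4 g0 g1 t2.
move: (B ^+ 3 * h) (cst * (4 * B ^+ 2 * (u * t) * m)) (cst * (B ^+ 2 * (s * u)))
  (q ^+ 2 * (10 * B ^+ 2 * (s * t) * m)) (cst * (B ^+ 3 * h)) (q ^+ 2 * (B ^+ 3 * h))
  (B ^+ 2 * (s * t)) => x7 x1 x2 x3 x4 x5 x6.
lra.
Qed.

(** The constant 30 satisfies 2 * 400 <= 30^2; besides, B^3 <= B^4 and q^2 + 1 + E^2 q^2 <= (1 + q +
    E q)^2. *)
Lemma rate_square (B q E z h : R) : 1 <= B -> 0 <= q -> 0 <= E -> h <= 2 * z ^+ 2 ->
  400 * B ^+ 3 * (q ^+ 2 + (1 + E ^+ 2 * q ^+ 2)) * h <= (30 * B ^+ 2 * (1 + q + E * q) * z) ^+ 2.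
Proof.
move=> B1 q0 E0 hz; have B0 : 0 <= B by exact: le_trans B1.
have z2 : 0 <= z ^+ 2 := sqr_ge0 z.
set c := q ^+ 2 + _.
have qc0 : 0 <= c by rewrite /c !addr_ge0 ?sqr_ge0// mulr_ge0 ?sqr_ge0.
have qc : c <= (1 + q + E * q) ^+ 2.
  have Eq0 : 0 <= E * q by exact: mulr_ge0.
  have Eqq : 0 <= E * q * q by exact: mulr_ge0.
  by rewrite /c; nra.
have B30 : 0 <= B ^+ 3 by exact: exprn_ge0.
have b34 : B ^+ 3 <= (B ^+ 2) ^+ 2 by rewrite -exprM; apply: ler_weXn2l.
have P0 : 0 <= B ^+ 3 * c by exact: mulr_ge0.
have h1 : B ^+ 3 * c * h <= B ^+ 3 * c * (2 * z ^+ 2) by exact: ler_wpM2l.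
have h2 : B ^+ 3 * c * z ^+ 2 <= (B ^+ 2) ^+ 2 * (1 + q + E * q) ^+ 2 * z ^+ 2.
  by apply: ler_wpM2r => //; exact: ler_pM.
have h0 : 0 <= B ^+ 3 * c * z ^+ 2 by exact: mulr_ge0.
have -> : (30 * B ^+ 2 * (1 + q + E * q) * z) ^+ 2 =
  900 * ((B ^+ 2) ^+ 2 * (1 + q + E * q) ^+ 2 * z ^+ 2) by ring.
have -> : 400 * B ^+ 3 * c * h = 400 * (B ^+ 3 * c * h) by ring.
move: h1; rewrite mulrCA; move: h0 h2.
by move: (B ^+ 3 * c * z ^+ 2) (B ^+ 3 * c * h) (_ * z ^+ 2) => x1 x2 x3; lra.
Qed.

Lemma half_le (n : nat) : (n%:R : R) <= 2 * (n./2)%:R + 1.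
Proof. by rewrite -natrM natr1 ler_nat -{1}(odd_double_half n) -muln2; case: (odd n); lia. Qed.

(** The factor 2 pays for the rounding of n / 2 when n is odd. *)
Lemma half_power (n : nat) : (1 / 2) ^+ n./2 <= 2 * ((2 : R) `^ (- (n%:R / 4))) ^+ 2.
Proof.
have -> : (1 / 2 : R) ^+ n./2 = 2 `^ (- (n./2)%:R) by rewrite powRN powR_mulrn// div1r exprVn.
have -> : 2 * ((2 : R) `^ (- (n%:R / 4))) ^+ 2 = 2 `^ (1 + (- (n%:R / 2))).
  rewrite powRD; last by apply/implyP => _; rewrite pnatr_eq0.
  rewrite powRr1//; congr (_ * _).
  rewrite -powR_mulrn ?powR_ge0// -powRrM; by congr powR; field.
apply: ler_powR; first by rewrite ler1n.
have := half_le n; lra.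
Qed.

Lemma sqrt_series_le (b : nat -> R) (Z : R) : 0 <= Z -> (forall j, 0 <= b j) ->
  (forall J, \sum_(0 <= j < J) b j <= Z ^+ 2) -> ((\sum_(0 <= j <oo) (b j)%:E) `^ 2^-1 <= Z%:E)%E.
Proof.
move=> Z0 b0 hb.
have S : (\sum_(0 <= j <oo) (b j)%:E <= (Z ^+ 2)%:E)%E.
  apply: lime_le; first by apply: is_cvg_nneseries => j _ _; rewrite lee_fin.
  by apply: nearW => J; rewrite sumEFin lee_fin.
have S0 : (0 <= \sum_(0 <= j <oo) (b j)%:E)%E by apply: nneseries_ge0 => j _ _; rewrite lee_fin.
have -> : Z%:E = ((Z ^+ 2)%:E `^ 2^-1)%E.
  by rewrite poweR_EFin powR12_sqrt ?sqr_ge0// sqrtr_sqr ger0_norm.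
by apply: gt0_ler_poweR => //; rewrite ?invr_ge0// in_itv/= ?leey ?andbT// lee_fin sqr_ge0.
Qed.

Lemma sqrt_series_le1 (b : nat -> R) : (forall j, 0 <= b j) ->
  ((\sum_(0 <= j <oo) (b j)%:E) `^ 2^-1 <= 1)%E -> forall J, \sum_(0 <= j < J) b j <= 1.
Proof.
move=> b0 h J; set S := (\sum_(0 <= j <oo) (b j)%:E)%E in h.
have S0 : (0 <= S)%E by apply: nneseries_ge0 => j _ _; rewrite lee_fin.
have S1 : (S <= 1)%E.
  have -> : S = ((S `^ 2^-1) `^ 2)%E by rewrite -poweRrM mulVf// poweRe1.
  have -> : (1 = 1%:E `^ 2 :> \bar R)%E by rewrite poweR_EFin powR1.
  by apply: gt0_ler_poweR => //; rewrite in_itv/= ?leey ?andbT ?poweR_ge0// lee_fin.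
rewrite -lee_fin -sumEFin; apply: le_trans S1.
by apply: nneseries_lim_ge => j _ _; rewrite lee_fin.
Qed.
End Rates.

Section BasisParseval.
Context {R : realType} (k : nat).
Local Notation V := 'rV[R]_k.+2.
Local Notation C := R[i].
Local Notation proj := (@sphere_proj R k.+2).
Local Notation ball := (@uball R k.+2).
Context (p : nat -> nat) (e : forall j, 'I_(p j) -> mpoly k.+2 C).
Hypotheses (oe : forall j i j' i', cip (ev (@e j i)) (ev (@e j' i')) = ((j == j') && (i == i' :> nat))%:R)
  (complete : forall g : V -> C, L2 ball (g \o proj) ->
     (forall j i, sphere_inner g (ev (@e j i)) = 0) -> L2norm ball (g \o proj) = 0%E).

Let T := {j : nat & 'I_(p j)}.
Let tg (j : nat) (i : 'I_(p j)) : T := Tagged (fun j => 'I_(p j)) i.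
Let lev J : seq T := [seq tg i | j <- iota 0 J, i <- enum 'I_(p j)].
Let ee (u : T) : V -> C := ev (@e (tag u) (tagged u)).

Let mem_lev J u : (u \in lev J) = (tag u < J)%N.
Proof.
apply/idP/idP => [/allpairsPdep[j [i [jJ _ ->]]]|uJ]; first by rewrite mem_iota in jJ.
by case: u uJ => j i /= jJ; apply: allpairs_f_dep; rewrite ?mem_iota// mem_enum.
Qed.

Let uniq_lev J : uniq (lev J).
Proof.
apply: allpairs_uniq_dep; [exact: iota_uniq|by move=> j _; exact: enum_uniq|].
by move=> [j i] [j' i'] _ _.
Qed.

Let oee u u' : cip (ee u) (ee u') = (u == u')%:R.
Proof.
have -> : cip (ee u) (ee u') = ((tag u == tag u') && (tagged u == tagged u' :> nat))%:R by exact: oe.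
congr (_%:R); congr nat_of_bool; apply/idP/eqP => [|->]; last by rewrite !eqxx.
case: u u' => j i [j' i'] /= /andP[/eqP jj]; move: i'; rewrite -jj => i' /eqP ii.
by congr existT; exact/val_inj.
Qed.

Let partial_DS (f : V -> C) J :
  partial_sum lev ee f J = DS J (fun j i => normsq (cip f (ev (@e j i)))).
Proof.
rewrite /partial_sum /lev big_allpairs_dep /DS /index_iota subn0; apply: eq_bigr => j _.
by rewrite big_enum.
Qed.

Lemma parseval_basis (f : V -> C) : cc f ->
  DS J (fun j i => normsq (cip f (ev (@e j i)))) @[J --> \oo] --> Sq f.
Proof.
move=> cf; rewrite (_ : (fun J => _) = partial_sum lev ee f); last first.
  by apply/funext => J; rewrite partial_DS.
apply: parseval => //.
- by move=> J J' JJ u; rewrite !mem_lev => /leq_trans; exact.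
- by move=> u; exists (tag u).+1; rewrite mem_lev.
- by move=> u; exact: cc_ev.
- by move=> g g2 gu; apply: complete => // j i; exact: (gu (tg i)).
Qed.

Lemma bessel_basis (f : V -> C) J : cc f ->
  DS J (fun j i => normsq (cip f (ev (@e j i)))) <= Sq f.
Proof.
move=> cf; rewrite -partial_DS; apply: (bessel (uniq_lev J) (fun u => cc_ev _)) => //.
by move=> u u' _ _; exact: oee.
Qed.
End BasisParseval.

Section WeightBounds.
Context {R : realType} (sigma B : R).
Hypotheses (s0 : 0 < sigma) (B1 : 1 <= B)
  (hB : forall j, (1 + j%:R) `^ (2 * sigma) * (1 + j%:R) ^+ 2 <= B * (5 / 4) ^+ j).
Let Wt (j : nat) : R := (1 + j%:R) `^ (2 * sigma).

Let j1 (j : nat) : 1 <= 1 + j%:R :> R. Proof. by rewrite lerDl. Qed.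

Lemma weight_le j : Wt j <= B * (5 / 4) ^+ j.
Proof.
apply: le_trans (hB j); rewrite ler_peMr ?powR_ge0//.
by rewrite exprn_ege1.
Qed.

Lemma weight_low j M : (j < M)%N -> Wt j <= B * (5 / 4) ^+ M.
Proof.
move=> jM; apply: (le_trans (weight_le j)); apply: ler_wpM2l; first exact: le_trans B1.
by apply: ler_weXn2l; [lra|exact: ltnW].
Qed.

Let geom (x : R) j M : 0 <= x -> x <= 1 -> (M <= j)%N -> B * x ^+ j <= B * x ^+ M.
Proof.
move=> x0 x1 Mj; apply: ler_wpM2l; first exact: le_trans B1.
exact: ler_wiXn2l.
Qed.

(** 5/16 is (1/4) (5/4), and 4 compensates the exponent j - 1. *)
Lemma weight_trace j M : (0 < M)%N -> (M <= j)%N ->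
  (1 / 4) ^+ j.-1 * Wt j <= 4 * B * (5 / 16) ^+ M.
Proof.
move=> M0 Mj; have j0 := leq_trans M0 Mj.
have e : (1 / 4 : R) ^+ j.-1 = 4 * (1 / 4) ^+ j by rewrite -[in RHS](prednK j0) exprS mulrA; field.
have p0 : 0 <= (1 / 4 : R) ^+ j.-1 by rewrite exprn_ge0// divr_ge0.
apply: (le_trans (ler_wpM2l p0 (weight_le j))); rewrite e.
have -> : 4 * (1 / 4) ^+ j * (B * (5 / 4) ^+ j) = 4 * (B * (5 / 16) ^+ j).
  rewrite (_ : (5 / 16 : R) = (1 / 4) * (5 / 4)); last by field.
  by rewrite [in RHS]exprMn; move: ((1 / 4) ^+ j) ((5 / 4) ^+ j) => x y; ring.
by rewrite -[X in _ <= X]mulrA; apply: ler_wpM2l => //; apply: geom => //; lra.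
Qed.

(** 1/5 is (5/4) (2/5)^2, and 5/2 compensates the exponent 2 j - 1, to which 2 j + k - 1 is
    lowered. *)
Lemma weight_flux j M k : (0 < M)%N -> (M <= j)%N ->
  Wt j * (2 / 5) ^+ (2 * j + k - 1) <= 5 / 2 * B * (1 / 5) ^+ M.
Proof.
move=> M0 Mj; have j0 := leq_trans M0 Mj.
have p0 n : 0 <= (2 / 5 : R) ^+ n by rewrite exprn_ge0// divr_ge0.
apply: (@le_trans _ _ (B * (5 / 4) ^+ j * (2 / 5) ^+ (2 * j).-1)).
  apply: ler_pM; rewrite ?powR_ge0//; first exact: weight_le.
  by apply: ler_wiXn2l; [lra|lra|move: j0; clear; lia].
have -> : (2 / 5 : R) ^+ (2 * j).-1 = 5 / 2 * ((2 / 5) ^+ 2) ^+ j.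
  rewrite -exprM -[in RHS](@prednK (2 * j)) ?muln_gt0// exprS mulrA.
  by rewrite (_ : 5 / 2 * (2 / 5) = 1 :> R) ?mul1r//; field.
have -> : B * (5 / 4) ^+ j * (5 / 2 * (2 / 5) ^+ 2 ^+ j) = 5 / 2 * (B * (1 / 5) ^+ j).
  rewrite (_ : (1 / 5 : R) = (5 / 4) * (2 / 5) ^+ 2); last by field.
  by rewrite [in RHS]exprMn; move: ((5 / 4) ^+ j) ((2 / 5) ^+ 2 ^+ j) => x y; ring.
by rewrite -[X in _ <= X]mulrA; apply: ler_wpM2l; [rewrite divr_ge0|apply: geom => //; lra].
Qed.

Lemma weight_sqr M : M%:R ^+ 2 <= B * (5 / 4) ^+ M.
Proof.
apply: le_trans (hB M).
have w1 : 1 <= (1 + M%:R : R) `^ (2 * sigma).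
  by rewrite -[leLHS](powRr0 (1 + M%:R)); apply: ler_powR => //; rewrite mulr_ge0 ?ltW.
apply: (@le_trans _ _ ((1 + M%:R) ^+ 2)); last by rewrite ler_peMl ?sqr_ge0.
by apply: lerXn2r; rewrite ?nnegrE ?addr_ge0// lerDr.
Qed.
End WeightBounds.

Theorem proposition2p1 (R : realType) (d : nat) (hd : (2 <= d)%N)
    (sigma : R) (hsigma : 0 < sigma) :
  exists2 C2 : R, 0 < C2 &
  forall (p : nat -> nat) (Y : forall j, 'I_(p j) -> 'rV[R]_d -> R[i])
    (phi : 'rV[R]_2 -> R[i]) (E : R) (m n : nat),
    harmonic_basis Y ->
    is_profile phi ->
    0 < E -> (0 < m)%N -> 20 * (1 + Num.sqrt E) ^+ 2 < n%:R ->
    let v0 : 'rV[R]_d -> R[i] := fun=> 0 in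
    let vnm : 'rV[R]_d -> R[i] := potential phi m n in
    ~ dirichlet_eigenvalue vnm E ->
    ~ dirichlet_eigenvalue v0 E ->
    let Q : \bar R := (resolvent_norm v0 E + resolvent_norm vnm E)%E in
    (opnorm (sobolev_norm Y (- sigma)) (sobolev_norm Y sigma)
       (dtn_difference vnm v0 E)
     <= C2%:E * (1 + Q + E%:E * Q) * (2 `^ (- (n%:R / 4)))%:E)%E.
Proof.
case: d hd => [|[|k]] // _.
have [B B1 hB] := weight_growth hsigma.
have C0 : 0 < 30 * B ^+ 2 by rewrite mulr_gt0// exprn_gt0// (lt_le_trans ltr01).
exists (30 * B ^+ 2) => //.
move=> p Y phi E m n [hY hspan hortho hcompl] hphi E0 _ hn v0 vnm _ _; cbv zeta.
have z0 : 0 < (2 : R) `^ (- (n%:R / 4)) by exact: powR_gt0.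
have r0 := resolvent_norm_ge0 v0 E; have rv := resolvent_norm_ge0 vnm E.
have Q0 : (0 <= resolvent_norm v0 E + resolvent_norm vnm E)%E by exact: adde_ge0.
have rQ : (resolvent_norm v0 E <= resolvent_norm v0 E + resolvent_norm vnm E)%E by exact: leeDl.
(* An infinite Q makes the right-hand side infinite; otherwise q is its real value, and it bounds
   the free resolvent. *)
move: (resolvent_norm v0 E + resolvent_norm vnm E)%E Q0 rQ => [q| |] // Q0 rQ; last first.
  have e : (1 + +oo + E%:E * +oo = +oo :> \bar R)%E by rewrite gt0_muley ?lte_fin.
  by rewrite e gt0_muley ?lte_fin// gt0_mulye ?lte_fin// leey.
rewrite lee_fin in Q0.
apply: ge_ereal_sup => _ [g [f [g1 [g2 [d1 d2 gE]]] fle] <-].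
set z := (2 : R) `^ _ in z0 *.
rewrite (_ : (_ * _ * _)%E = (30 * B ^+ 2 * (1 + q + E * q) * z)%:E); last first.
  by rewrite !EFinM !EFinD !EFinM.
(* The functions Y are only determined on the sphere, so they are replaced by the harmonic
   polynomials that they restrict. *)
have hP j (i : 'I_(p j)) : exists P, harm j P /\ forall x, usphere x -> Y j i x = ev P x.
  by case: (hY j i) => P [h1 h2 h3]; exists P; split.
pose e j (i : 'I_(p j)) := sval (cid (hP j i)).
have he j i : harm j (@e j i) by exact: (proj1 (svalP (cid (hP j i)))).
have eY j i x : usphere x -> Y j i x = ev (@e j i) x by exact: (proj2 (svalP (cid (hP j i)))).
have ce j i : cc (ev (@e j i)) := cc_ev _.
have oe j i j' i' : cip (ev (@e j i)) (ev (@e j' i')) = ((j == j') && (i == i' :> nat))%:R.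
  by rewrite -hortho; apply/esym; apply: sphere_inner_cip => // x x1; exact: eY.
have oe1 j (i l : 'I_(p j)) : cip (ev (@e j i)) (ev (@e j l)) = (i == l)%:R by rewrite oe eqxx.
have span j q' : harm j q' -> exists c : 'I_(p j) -> R[i], forall x : 'rV[R]_k.+2, enorm x = 1 ->
    ev q' x = \sum_i c i * ev (@e j i) x.
  move=> [h1 h2]; have [|c hc] := hspan j (ev q'); first by exists q'.
  by exists c => x x1; rewrite hc//; apply: eq_bigr => i _; rewrite eY.
have compl (g' : 'rV[R]_k.+2 -> R[i]) : L2 (@uball R k.+2) (g' \o @sphere_proj R k.+2) ->
    (forall j i, sphere_inner g' (ev (@e j i)) = 0) ->
    L2norm (@uball R k.+2) (g' \o @sphere_proj R k.+2) = 0%E.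
  move=> h1 h2; apply: hcompl => // j i; rewrite -(h2 j i).
  by apply: sphere_inner_congr => // x x1; exact: eY.
have pars := parseval_basis oe compl; have bess := bessel_basis oe.
have [psi1 [cp1 eq1 f1 g1E]] := d1; have [psi2 [cp2 eq2 f2 g2E]] := d2.
have bd x : enorm x = 1 -> psi1 x = psi2 x by move=> x1; rewrite -f1// -f2.
have n0 : (0 < n)%N.
  rewrite -(ltr_nat R); apply: le_lt_trans hn; rewrite mulr_ge0// sqr_ge0.
pose M := n./2.
have nM : (M.*2 <= n)%N by rewrite -[X in (_ <= X)%N](odd_double_half n) leq_addl.
have nM2 : (n%:R : R) <= 2 * M%:R + 1 by exact: half_le.
have hE : 20 * (1 + E) < n%:R.
  apply: le_lt_trans hn; rewrite ler_pM2l//.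
  have s0 := sqrtr_ge0 E; have s2 := sqr_sqrtr (ltW E0).
  by rewrite sqrrD expr1n mul1r s2; move: (Num.sqrt E) s0 => s s0; rewrite mulr2n; lra.
have M0 : (0 < M)%N by rewrite -(ltr_nat R); lra.
(* From 2 M + 1 >= n > 20 (1 + E) one gets 2 M - 1 - E > 18 + 19 E. *)
have VE j : (M <= j)%N -> 10 <= 2 * j%:R + k%:R - 1 - E.
  rewrite -(ler_nat R) => Mj; have k0 : 0 <= k%:R :> R by exact: ler0n.
  lra.
have [w [cw w01 w1 wout]] := cutoff_exists R.
have vin (x : 'rV[R]_k.+2) := potential_in m n hphi (x := x).
have vout (x : 'rV[R]_k.+2) := potential_out m n hphi (x := x).
have vw (x : 'rV[R]_k.+2) : normsq (vnm x) <= w (enorm x).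
  have [x3|x3] := lerP (enorm x) (1 / 3); first by rewrite w1// potential_le1.
  rewrite /vnm (vout x (ltW x3)) /normsq /= expr0n/= addr0.
  by have /andP[] := w01 (enorm x).
have cv (h : 'rV[R]_k.+2 -> R[i]) := @potential_cc R k phi m n hphi h.
have rotv om := fun (h : normsq om = 1) x => @potential_rot R k phi m n om x h.
pose Wt (j : nat) : R := (1 + j%:R) `^ (2 * sigma).
have W0 j : 0 < Wt j by apply: powR_gt0; rewrite ltr_pwDl.
pose T := 4 * B * (5 / 16) ^+ M; pose A := B * (5 / 4) ^+ M.
have B0 : 0 <= B by exact: le_trans B1.
have T0 : 0 <= T by rewrite !mulr_ge0// exprn_ge0// divr_ge0.
have A0 : 0 <= A by rewrite mulr_ge0// exprn_ge0// divr_ge0.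
pose fc j (i : 'I_(p j)) : R := normsq (cip psi2 (ev (@e j i))).
have cc1 : cc psi1 by split; [exact: CkR_continuous (proj1 cp1)|exact: CkR_continuous (proj2 cp1)].
have cc2 : cc psi2 by split; [exact: CkR_continuous (proj1 cp2)|exact: CkR_continuous (proj2 cp2)].
have mod2 (c : R[i]) : @ComplexField.Normc.normc R c ^+ 2 = normsq c.
  by rewrite modulusE sqr_sqrtr// normsq_ge0.
have hf J : DS J (fun j i => (Wt j)^-1 * @fc j i) <= 1.
  apply: (@sqrt_series_le1 R (fun j => \sum_(i < p j) (Wt j)^-1 * @fc j i)) => [j|].
    by apply: sumr_ge0 => i _; rewrite mulr_ge0 ?normsq_ge0// invr_ge0 ltW.
  move: fle; rewrite /sobolev_norm; congr (_ `^ _ <= _)%E.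
  congr (limn _); apply/funext => J'; apply: eq_bigr => j _; congr EFin.
  apply: eq_bigr => i _; rewrite mod2 mulrN powRN; congr (_ * normsq _).
  by apply: sphere_inner_cip => // x x1; exact: eY.
(* The H^(-sigma) norm of the trace is at most 1, so a sum with coefficients c is bounded by the
   supremum of c times the weight; this is where T and A come from. *)
have weighted (c : nat -> R) (D : R) J : 0 <= D -> (forall j, c j * Wt j <= D) ->
    DS J (fun j i => c j * @fc j i) <= D.
  move=> D0 hc; rewrite -[leRHS]mulr1; apply: le_trans (ler_wpM2l D0 (hf J)); rewrite -DS_Z.
  apply: DS_le => j i; rewrite mulrA; apply: ler_wpM2r; first exact: normsq_ge0.
  by rewrite ler_pdivlMr.
have hT J : DS J (fun j i => (if (j < M)%N then 0 else (1 / 4) ^+ j.-1) * @fc j i) <= T.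
  apply: weighted => // j; case: ltnP => Mj; first by rewrite mul0r.
  exact: weight_trace.
have hA J : DS J (fun j i => (j < M)%N%:R * @fc j i) <= A.
  apply: weighted => // j; case: ltnP => Mj; last by rewrite mul0r.
  by rewrite mul1r; exact: weight_low.
have FB := flux_bound he oe1 span pars bess rQ cp1 cp2 cv eq1 eq2 bd vw vin vout cw w01 wout
  M0 nM VE rotv hT hA.
pose cst : R := 1 + E ^+ 2 * q ^+ 2.
have c1 : 1 <= cst by rewrite lerDl mulr_ge0 ?sqr_ge0.
have bound J : DS J (fun j i => Wt j * normsq (@flux_coef R k p e psi1 psi2 j i)) <=
    400 * B ^+ 3 * (q ^+ 2 + cst) * (1 / 2) ^+ M.
  apply: le_trans (rate_bound q B1 c1 (weight_sqr hsigma hB M) (erefl T) (erefl A)).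
  apply: FB => // [|j|j Mj|j Mj]; [by rewrite !mulr_ge0 ?exprn_ge0 ?divr_ge0|exact: ltW| |].
    exact: weight_low.
  exact: weight_flux.
rewrite /sobolev_norm; under eq_eseriesr do under eq_bigr do rewrite mod2.
apply: sqrt_series_le => [|j|J].
- by rewrite !mulr_ge0 ?(ltW C0) ?(ltW z0)// !addr_ge0// mulr_ge0// ltW.
- by apply: sumr_ge0 => i _; rewrite mulr_ge0 ?normsq_ge0 ?powR_ge0.
have e1 (h : 'rV[R]_k.+2 -> R[i]) (x : 'rV[R]_k.+2) :
    \sum_i (x 0 i)%:C%C * partial i h (1 *: x) = \sum_i (x 0 i)%:C%C * partial i h x by rewrite scale1r.
have cflux (h : 'rV[R]_k.+2 -> R[i]) : Ck 1 h -> cc (fun x => \sum_i (x 0 i)%:C%C * partial i h (1 *: x)).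
  move=> [hR hI]; apply: cc_sum => i; apply: ccM.
    by split => /=; [exact: continuous_coord|exact: cC].
  by apply: cc_scale; split; [exact: CkR_continuous (CkR_D i hR)|exact: CkR_continuous (CkR_D i hI)].
have gc j (i : 'I_(p j)) : sphere_inner g (Y j i) = @flux_coef R k p e psi1 psi2 j i.
  have k1 := cflux _ cp1; have k2 := ccZ (- 1) (cflux _ cp2).
  rewrite (sphere_inner_cip (ccD k1 k2) (ce j i) _ (eY j i)) => [|x x1].
    by rewrite (cipDl k1 k2 (ce j i)) (cipZl _ (cflux _ cp2) (ce j i)) mulN1r.
  by rewrite gE// g1E// g2E// !e1 mulN1r.
rewrite (_ : \sum_(0 <= j < J) _ = DS J (fun j i => Wt j * normsq (@flux_coef R k p e psi1 psi2 j i))); last first.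
  by apply: eq_bigr => j _; apply: eq_bigr => i _; rewrite gc.
apply: (le_trans (bound J)); apply: rate_square => //; [exact: ltW|exact: half_power].
Qed.
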